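(* For each $n$ let $p=p_n\in(0,1)$ with $p\to0$ and $np\to\infty$ as $n\to\infty$. Let $A_n=(a_{ij})$ be the adjacency matrix of an inhomogeneous random graph with sparsity parameter $p$ and variance profile $S_n=(s_{ij})$ (see context), and let $W_n$ be the graphon associated with $S_n$. Assume that for every finite tree $T$ there is a constant $\beta_T\ge0$ such that $t(T,W_n)\to\beta_T$ as $n\to\infty$. Put $\overline A_n=A_n-\mathbb E A_n$ and for $k\ge 2$ $$X_{n,k}=\sqrt p\left(\mathrm{tr}\Big(\frac{\overline A_n}{\sqrt{np}}\Big)^k-\mathbb E\,\mathrm{tr}\Big(\frac{\overline A_n}{\sqrt{np}}\Big)^k\right).$$ Then $\{X_{n,k}\}_{k\ge2}$ converges, in the sense of finite-dimensional marginal distributions, to a centered Gaussian process $\{X_k\}_{k\ge 2}$ with covariance $$\mathrm{Cov}(X_k,X_h)=\begin{cases}\sum_{T\in\mathcal T_1^{k,h}}\beta_T&\text{if }k,h\text{ are even},\\ 0&\text{otherwise.}\end{cases}$$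
   Context: **Random graph model.** $A_n=(a_{ij})_{1\le i,j\le n}$ is a symmetric random matrix with $a_{ii}=0$, with $(a_{ij})_{i<j}$ independent, $a_{ij}\sim\mathrm{Ber}(p\,s_{ij})$, where $S_n=(s_{ij})$ is a symmetric deterministic matrix (depending on $n$) with $0\le s_{ij}\le C$ for an absolute constant $C>0$ and $\sup_{i,j}p s_{ij}\le 1$. **Graphons.** A graphon is a symmetric integrable function $W:[0,1]^2\to\mathbb R$. The graphon $W_n$ associated with $S_n$ is the step function obtained by dividing $[0,1]$ into $n$ consecutive intervals $I_1,\dots,I_n$ of length $1/n$ and setting $W_n=s_{ij}$ on $I_i\times I_j$. For a finite graph $F=(V,E)$, the homomorphism density is $t(F,W)=\int_{[0,1]^{|V|}}\prod_{ij\in E}W(x_i,x_j)\prod_{i\in V}dx_i$. **Graph class.** For even $k,h\ge2$, $\mathcal T_1^{k,h}$ is the collection of trees obtained from a rooted planar tree with $k/2$ edges and a rooted planar tree with $h/2$ edges by choosing one edge in each and identifying these two edges into one overlapping edge, in one of the two possible orientations; the result has $(k+h)/2$ vertices and $(k+h)/2-1$ edges. Elements are counted by construction: different choices give different elements of $\mathcal T_1^{k,h}$, even if the resulting trees are isomorphic. *)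

(* Defs.v *)
From HB Require Import structures.
From mathcomp Require Import all_boot all_order all_algebra finmap.
From mathcomp Require Import all_classical all_reals all_analysis.

Set Implicit Arguments.
Unset Strict Implicit.
Unset Printing Implicit Defensive.

Import Order.TTheory GRing.Theory Num.Theory.
Import numFieldNormedType.Exports.

Local Open Scope classical_set_scope.
Local Open Scope ring_scope.

Record graph := Graph { vert :> finType; adj : rel vert }.

Definition acyclic (G : graph) : Prop :=
  forall c : seq G, (2 < size c)%N -> ~~ ucycleb (@adj G) c.

Definition is_tree (G : graph) : Prop :=
  [/\ (0 < #|G|)%N, symmetric (@adj G), irreflexive (@adj G),
      forall x y : G, connect (@adj G) x y & acyclic G].

Section Graphon.
Context {R : realType}.

(* The i-th of n consecutive intervals of length 1/n; the last one is closed,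
   so that they partition [0, 1]. *)
Definition block n (i : 'I_n) : set R :=
  [set x | i%:R / n%:R <= x /\
           if i.+1 == n then x <= 1 else x < i.+1%:R / n%:R].

Definition step_graphon n (S : 'M[R]_n) (x y : R) : R :=
  \sum_(i < n) \sum_(j < n) S i j * \1_(block i) x * \1_(block j) y.

(* Integral over [0, 1]^m, as an iterated Lebesgue integral. *)
Fixpoint cube_integral m : (m.-tuple R -> R) -> R :=
  if m is m'.+1 then fun f =>
    (\int[lebesgue_measure]_(x in `[0%R, 1%R])
       cube_integral (fun s : m'.-tuple R => f [tuple of x :: s]))%R
  else fun f => f [tuple].

(* The condition i < j selects each edge of the symmetric relation adj once. *)
Definition hom_density (F : graph) (W : R -> R -> R) : R :=
  cube_integral (fun x : #|F|.-tuple R =>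
    \prod_(i < #|F|)
      \prod_(j < #|F| | (i < j)%N && adj (enum_val i : F) (enum_val j))
        W (tnth x i) (tnth x j)).

End Graphon.

(* Rooted planar trees in Ulam-Harris (Neveu) coding: a vertex is a word over
   nat, the root is the empty word, and the children of u are the words i :: u,
   ordered from left to right by i = 0, 1, ... (words are read from the vertex
   up to the root, so the parent of v is behead v). *)
Definition plane_tree (U : {fset seq nat}) : Prop :=
  [/\ [::] \in U,
      forall i u, i :: u \in U -> u \in U
    & forall i u, i.+1 :: u \in U -> i :: u \in U].

(* A rooted planar tree U with m edges, together with a chosen edge; an edge is
   given by its endpoint v farther from the root, its other endpoint being
   behead v. *)
Definition marked_plane_tree (m : nat) : set ({fset seq nat} * seq nat) :=
  [set t | [/\ plane_tree t.1, #|` t.1| = m.+1, t.2 \in t.1 & t.2 != [::]]].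

Definition gluing : Type :=
  (({fset seq nat} * seq nat) * ({fset seq nat} * seq nat) * bool)%type.
HB.instance Definition _ := Choice.on gluing.

Definition T1 (k h : nat) : set gluing :=
  (marked_plane_tree k./2 `*` marked_plane_tree h./2) `*` [set: bool].

Lemma plane_tree_word (U : {fset seq nat}) (u : seq nat) :
  plane_tree U -> u \in U ->
  (size u < #|` U|)%N /\ forall i, i \in u -> (i < #|` U|)%N.
Proof.
move=> [_ Up Ul] uU.
have sfx v w : v ++ w \in U -> w \in U.
  by elim: v => [//|i v IH]; rewrite cat_cons => /Up.
have left i v j : (j <= i)%N -> i :: v \in U -> j :: v \in U.
  elim: i j => [|i IH] j; first by rewrite leqn0 => /eqP ->.
  by rewrite leq_eqVlt => /predU1P[-> //|ji /Ul]; exact: IH.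
have inj_le n (f : nat -> seq nat) :
    (forall a b, (a < n)%N -> (b < n)%N -> f a = f b -> a = b) ->
    (forall a, (a < n)%N -> f a \in U) -> (n <= #|` U|)%N.
  move=> finj fU; rewrite -[leqLHS](size_iota 0) -(size_map f).
  apply: uniq_leq_size; last first.
    by move=> x /mapP[a]; rewrite mem_iota /= => an ->; exact: fU.
  rewrite map_inj_in_uniq ?iota_uniq // => a b.
  by rewrite !mem_iota /=; exact: finj.
split.
  apply: (inj_le _ (fun a => drop a u)) => [a b|a _].
    rewrite !ltnS => au bu /(congr1 size); rewrite !size_drop => e.
    by rewrite -(subKn au) e subKn.
  by apply: (sfx (take a u)); rewrite cat_take_drop.
move=> i iu; case/splitPr: iu uU => v w /sfx iw.
apply: (inj_le _ (fun a => a :: w)) => [a b _ _ [] //|a].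
by rewrite ltnS => /left; exact.
Qed.

Lemma finite_marked_plane_tree m : finite_set (marked_plane_tree m).
Proof.
pose word (b : {bseq m.+1 of 'I_m.+1}) : seq nat := map val b.
pose W : {fset seq nat} := [fset word b | b in {: {bseq m.+1 of 'I_m.+1}}]%fset.
apply: (@sub_finite_set _ _ ([set` fpowerset W] `*` [set` W])).
  move=> [U v] [/= Ut Um vU _].
  have UW w : w \in U -> w \in W.
    move=> wU; have [] := plane_tree_word Ut wU; rewrite Um => sw lw.
    have sb : (size [seq (inord i : 'I_m.+1) | i <- w] <= m.+1)%N.
      by rewrite size_map ltnW.
    apply/imfsetP; exists (Bseq sb) => //; rewrite /word /= -map_comp.
    by rewrite map_id_in // => i /lw iw; rewrite /= inordK.
  by split=> /=; [rewrite fpowersetE; apply/fsubsetP | exact: UW].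
exact: finite_setX.
Qed.

Lemma finite_T1 k h : finite_set (T1 k h).
Proof.
by apply: finite_setX => //; apply: finite_setX; exact: finite_marked_plane_tree.
Qed.

Section Glue.
Variable T : gluing.

Let U1 := T.1.1.1.
Let v1 := T.1.1.2.
Let U2 := T.1.2.1.
Let v2 := T.1.2.2.
Let o := T.2.

(* Embedding of the second tree in the glued one: its marked edge
   {v2, behead v2} is sent to the marked edge {v1, behead v1} of the first
   tree, with the orientation given by o. *)
Definition glue_embed (w : seq nat) : seq nat + seq nat :=
  if w == v2 then inl (if o then v1 else behead v1)
  else if w == behead v2 then inl (if o then behead v1 else v1)
  else inr w.

Definition glue_vert : {fset seq nat + seq nat} :=
  ([fset inl u | u in U1] `|` [fset glue_embed w | w in U2])%fset.

Definition glue_edge : {fset (seq nat + seq nat) * (seq nat + seq nat)} :=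
  ([fset (inl u, inl (behead u)) | u in U1 & u != [::]] `|`
   [fset (glue_embed w, glue_embed (behead w)) | w in U2 & w != [::]])%fset.

Definition glued_tree : graph :=
  @Graph glue_vert (fun x y =>
    ((val x, val y) \in glue_edge) || ((val y, val x) \in glue_edge)).

End Glue.

Section Probability.
Local Open Scope ereal_scope.
Context {R : realType} d (Om : measurableType d) (P : probability Om R).

Definition mutually_independent (I : choiceType) (D : set I)
    (X : I -> {RV P >-> R}) : Prop :=
  forall J : {fset I}, [set` J] `<=` D ->
  forall B : I -> set R, (forall i, measurable (B i)) ->
    P (\bigcap_(i in [set` J]) (X i @^-1` B i))
      = \prod_(i <- J) P (X i @^-1` B i).

Definition bernoulli_rv (X : {RV P >-> R}) (q : R) : Prop :=
  forall B : set R, measurable B ->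
    distribution P X B = bernoulli_prob q [set b : bool | B b%:R%R].

(* N(m, s^2). The library's normal_prob m s is not degenerate at s = 0. *)
Definition gaussian_law (m s : R) (B : set R) : \bar R :=
  if s == 0%R then dirac m B else normal_prob m s B.

Definition gaussian_rv (X : Om -> R) : Prop :=
  exists m s : R, forall B : set R, measurable B ->
    P (X @^-1` B) = gaussian_law m s B.

Definition gaussian_process (I : Type) (D : set I)
    (X : I -> {RV P >-> R}) : Prop :=
  forall (m : nat) (k : 'I_m -> I) (c : 'I_m -> R), (forall i, D (k i)) ->
    gaussian_rv (fun w => \sum_(i < m) c i * X (k i) w)%R.

End Probability.

(* Convergence of the finite-dimensional marginal distributions; the processes
   Y n may live on different probability spaces. *)
Definition cvg_fdd {R : realType} (I : Type) (D : set I)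
    (d : nat -> measure_display) (Om : forall n, measurableType (d n))
    (P : forall n, probability (Om n) R) (Y : forall n, I -> Om n -> R)
    (d' : measure_display) (Om' : measurableType d') (Q : probability Om' R)
    (X : I -> Om' -> R) : Prop :=
  forall (m : nat) (k : 'I_m -> I), (forall i, D (k i)) ->
  forall f : 'rV[R]_m -> R, continuous f -> (exists M : R, forall x, `|f x| <= M) ->
    ('E_(P n)[fun w => f (\row_(i < m) Y n (k i) w)])%E @[n --> \oo]
      --> ('E_Q[fun w => f (\row_(i < m) X (k i) w)])%E.

Section RandomGraph.
Context {R : realType} d (Om : measurableType d) (P : probability Om R).
Variables (n : nat) (p : R) (A : 'I_n -> 'I_n -> {RV P >-> R}).

Definition inhomogeneous_random_graph (S : 'M[R]_n) : Prop :=
  [/\ forall i w, A i i w = 0,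
      forall i j w, A i j w = A j i w,
      mutually_independent [set ij : 'I_n * 'I_n | (ij.1 < ij.2)%N]
        (fun ij => A ij.1 ij.2)
    & forall i j : 'I_n, (i < j)%N -> bernoulli_rv (A i j) (p * S i j)].

Definition centered_adj (w : Om) : 'M[R]_n :=
  \matrix_(i, j) (A i j w - fine 'E_P[A i j]%E).

Definition trace_power (k : nat) (w : Om) : R :=
  \tr (((Num.sqrt (n%:R * p))^-1 *: centered_adj w) ^+ k).

Definition linear_stat (k : nat) (w : Om) : R :=
  Num.sqrt p * (trace_power k w - fine 'E_P[trace_power k]%E).

End RandomGraph.

(* Main.v *)
(* A power [b ^+ m] of a centred Bernoulli variable [b] is an affine function of [b], so the
   expansion of [\tr (B ^+ k)], for the centred adjacency matrix [B], over closed walks turns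
   into a sum of [C_F * \prod_(e in F) b_e] over sets [F] of edges, with pairwise orthogonal
   terms. A closed walk through all the edges of [F], crossing every other edge of its trace at
   least twice, has few vertices; counting such walks shows that the terms with [1 < #|F|] are
   negligible in L2 after normalisation. What remains is a linear statistic
   [\sum_e l_e b_e] of independent variables, to which Lindeberg's argument applies.

   The coefficient [l_e] is carried by the walks that cross each edge of a tree exactly twice,
   that is, by the contours of plane trees whose vertices are labelled injectively and which
   have an edge labelled by [e]. The covariance of two linear statistics pairs two such trees
   along a common edge, and so is the sum of [t(T, W_n)] over the glued trees [T], up to [o(1)].

   The limiting process is a linear image, by Cholesky's factorisation of the limiting
   covariance, of independent normal variables on [0, 1], which are quantiles of the uniform
   variables obtained by dealing out binary digits. Convergence of the characteristic functions,
   together with bounded second moments, yields convergence in law, because a bounded continuous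
   function is uniformly close to a trigonometric polynomial up to a small multiple of
   [1 + |x|^2]. *)

Require Import Defs.
From HB Require Import structures.
From mathcomp Require Import all_boot all_order all_algebra.
From mathcomp Require Import zify.

Set Implicit Arguments.
Unset Strict Implicit.
Unset Printing Implicit Defensive.

(** * Closed walks *)

(** Only np is known to be large, at no prescribed rate, so everything is measured in powers of [s],
    where s^2 = np. Walks with e edges and v vertices weigh n^v p^e in total: s^(2e) if v = e, and n
    times that for trees, where v = e + 1. Once the edges of F are fixed, trees lose two powers of
    [s] per edge of F and other walks lose one. With the factor sqrt p this leaves a squared error p
    + 1/(np) for |F| > 1, while for |F| = 1 the trees are of order one.

    The coefficient [l_e] is of order sqrt p / s^2 = 1/(n sqrt p), so n^2 edges of variance about p
    give a total variance of order 1, and the Lindeberg sum is at most max |l_e| times that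
    variance.

    Expectations over the graph are finite sums over edge configurations ([bE]); the given
    probability spaces enter only through the law of the 0/1 configuration. Limiting variances may
    vanish, so the Gaussian laws are reached through characteristic functions, where the degenerate
    case has the same formula. Bounded second moments take the place of tightness. *)

(** If each of the a edges of a walk of length 2a is crossed at least twice, none is crossed c > 2
    times; b counts the other edges and S their crossings. *)
Lemma leading_count_aux (a b c k S : nat) : 2 * a = k -> a = (1 + b) -> 2 < c ->
  b * 2 <= S -> c + S = k -> False.
Proof. lia. Qed.

Section Walks.
Variables (V I : finType) (ed : V -> V -> I).
Hypothesis edC : forall x y, ed x y = ed y x.
Hypothesis ed_inj : forall x y x' y',
  ed x y = ed x' y' -> (x = x' /\ y = y') \/ (x = y' /\ y = x').

(** A step to a vertex outside [vis] uses an edge outside [used], because used edges only join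
    visited vertices; enlarging both sets keeps this invariant. The later comparisons of vertex
    counts with edge counts start from here, with various initial sets. *)
Lemma path_discovery (vis : {set V}) (used : {set I}) x s :
  x \in vis -> (forall a b, ed a b \in used -> b \in vis) ->
  #|[set y in s] :\: vis| <= #|[set e in pairmap ed x s] :\: used|.
Proof.
elim: s x vis used => [|z s IH] x vis used xv uv.
  by rewrite (_ : _ :\: vis = set0) ?cards0//; apply/setP => y; rewrite !inE andbF.
have [zv|zv] := boolP (z \in vis).
  have -> : [set y in z :: s] :\: vis = [set y in s] :\: vis.
    apply/setP => y; rewrite !inE; case: eqVneq => [->|//]; by rewrite zv.
  apply: leq_trans (IH z vis used zv uv) _; apply: subset_leq_card.
  by apply/subsetP => e; rewrite !inE /= => /andP[-> ->]; rewrite orbT.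
have eN : ed x z \notin used.
  by apply: contra zv; exact: uv.
have -> : [set y in z :: s] :\: vis = z |: ([set y in s] :\: (z |: vis)).
  apply/setP => y; rewrite !inE; case: eqVneq => [->|//]; by rewrite zv.
have -> : [set e in pairmap ed x (z :: s)] :\: used =
  ed x z |: ([set e in pairmap ed z s] :\: (ed x z |: used)).
  apply/setP => y; rewrite /= !inE; case: eqVneq => [->|//]; by rewrite eN.
rewrite !cardsU1 !inE !eqxx /= !add1n ltnS; apply: IH; first by rewrite !inE eqxx.
move=> a b; rewrite !inE => /orP[/eqP/ed_inj|/uv ->]; last by rewrite orbT.
by case=> -[? ?]; subst; rewrite ?eqxx // xv orbT.
Qed.

(** Appending the first vertex supplies the closing edge, so a walk of k vertices has k edges and
    rotating the walk rotates its edges. The starting point can therefore be chosen freely. *)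
Definition cedges (c : seq V) : seq I :=
  if c is x :: s then pairmap ed x (rcons s x) else [::].

Lemma size_cedges c : size (cedges c) = size c.
Proof. by case: c => [//|x s]; rewrite /cedges size_pairmap size_rcons. Qed.

Lemma cedges_rot1 c : cedges (rot 1 c) = rot 1 (cedges c).
Proof.
case: c => [//|x [|y s]] //.
rewrite /rot /= !drop0 !take0 /= !cats1.
by rewrite -!cats1 pairmap_cat /= last_cat /=.
Qed.

Lemma cedges_rot r c : r <= size c -> cedges (rot r c) = rot r (cedges c).
Proof.
elim: r => [|r IH] rc; first by rewrite !rot0.
rewrite (rotS rc) cedges_rot1 (IH (ltnW rc)) -rotS //; by rewrite size_cedges.
Qed.

Definition vset (c : seq V) : {set V} := [set x in c].
Definition eset (c : seq V) : {set I} := [set e in cedges c].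
Definition endpoints (F : {set I}) : {set V} := [set x | [exists y, ed x y \in F]].

Lemma mem_pairmap_ed x s e : e \in pairmap ed x s ->
  exists a b, [/\ a \in x :: s, b \in s & e = ed a b].
Proof.
elim: s x => [//|z s IH] x /=; rewrite inE => /orP[/eqP ->|].
  by exists x, z; rewrite !inE !eqxx.
case/IH => a [b [az bs ->]]; exists a, b; split => //; by rewrite inE ?az ?bs orbT.
Qed.

Lemma mem_cedges c e : e \in cedges c ->
  exists a b, [/\ a \in c, b \in c & e = ed a b].
Proof.
case: c => [//|x s] /mem_pairmap_ed[a [b [H1 H2 ->]]]; exists a, b; split => //.
  by move: H1; rewrite inE mem_rcons => /orP[/eqP ->|//]; rewrite inE eqxx.
by move: H2; rewrite mem_rcons.
Qed.

Lemma vset_rot r c : vset (rot r c) = vset c.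
Proof. by apply/setP => x; rewrite !inE mem_rot. Qed.

Lemma eset_rot r c : r <= size c -> eset (rot r c) = eset c.
Proof. by move=> rc; apply/setP => x; rewrite !inE cedges_rot // mem_rot. Qed.

(** Rotate the walk to start at an endpoint of [F]. With the endpoints of [F] visited and [F] used
    from the outset, every further vertex costs an edge outside [F]. *)
Lemma card_vset_endpoints c (F : {set I}) :
  F != set0 -> F \subset eset c -> #|vset c| <= #|endpoints F| + #|eset c :\: F|.
Proof.
case/set0Pn => e0 e0F /subsetP FE.
have /mem_cedges[a [b [ac _ e0E]]] : e0 \in cedges c by have := FE _ e0F; rewrite inE.
have [i s rc] := rot_to ac.
have sz : #|vset (a :: s) :\: endpoints F| <= #|eset (a :: s) :\: F|.
  have aF : a \in endpoints F by rewrite inE; apply/existsP; exists b; rewrite -e0E.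
  have -> : vset (a :: s) :\: endpoints F = [set y in rcons s a] :\: endpoints F.
    by apply/setP => y; rewrite !inE mem_rcons inE.
  apply: path_discovery => // x y xy; rewrite inE; apply/existsP; exists x.
  by rewrite edC.
case: (leqP i (size c)) => ic; last first.
  rewrite rot_oversize in rc; last exact: ltnW.
  rewrite -[#|vset c|](cardsID (endpoints F)) rc leq_add //.
  by apply: subset_leq_card; rewrite subsetIr.
rewrite -(vset_rot i) -(eset_rot ic) rc -[#|vset _|](cardsID (endpoints F)) leq_add //.
by apply: subset_leq_card; rewrite subsetIr.
Qed.

Lemma card_vset c : #|vset c| <= #|eset c|.+1.
Proof.
case: c => [|x s].
  by rewrite (_ : vset _ = set0) ?cards0 //; apply/setP => y; rewrite !inE.
have -> : #|vset (x :: s)| = #|[set y in rcons s x] :\: [set x]|.+1.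
  rewrite -add1n (_ : vset _ = x |: ([set y in rcons s x] :\ x)).
    by rewrite cardsU1 !inE eqxx.
  by apply/setP => y; rewrite !inE mem_rcons inE; case: eqVneq.
rewrite ltnS -[eset _]setD0; apply: path_discovery; first by rewrite inE.
by move=> a b; rewrite in_set0.
Qed.

(** An edge crossed once lies on a cycle. Rotate it to the front: the rest of the walk leads from
    its far end [y] back to [x] without it, and still discovers every vertex but [y]. *)
Lemma card_vset_simple c e : count_mem e (cedges c) = 1 -> #|vset c| <= #|eset c|.
Proof.
move=> c1; have eE : e \in cedges c by rewrite -has_pred1 has_count c1.
set r := index e (cedges c).
have rc : r < size c by rewrite -size_cedges index_mem.
rewrite -(vset_rot r) -(eset_rot (ltnW rc)).
have hE : cedges (rot r c) = rot r (cedges c) by exact/cedges_rot/ltnW.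
have : count_mem e (cedges (rot r c)) = 1.
  by have /permPl/permP := perm_rot r (cedges c); rewrite hE => ->.
have : ohead (cedges (rot r c)) = Some e.
  by rewrite hE /rot (drop_nth e) ?index_mem //= nth_index.
case: (rot r c) => [//|x s] {hE}.
case: s => [|y s].
  move=> /= [] <- _.
  rewrite (_ : vset _ = [set x]); last by apply/setP => z; rewrite !inE.
  rewrite cards1 card_gt0; apply/set0Pn; exists (ed x x); by rewrite !inE eqxx.
rewrite [cedges _]/= => -[xy]; rewrite xy /= eqxx add1n => -[c0].
have eN : e \notin pairmap ed y (rcons s x) by rewrite -has_pred1 has_count c0.
have -> : eset (x :: y :: s) = e |: [set f in pairmap ed y (rcons s x)].
  by apply/setP => f; rewrite !inE /= xy.
rewrite cardsU1 inE eN add1n.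
have -> : #|vset (x :: y :: s)| = #|[set z in rcons s x] :\: [set y]|.+1.
  rewrite -add1n (_ : vset _ = y |: ([set z in rcons s x] :\ y)).
    by rewrite cardsU1 !inE eqxx.
  apply/setP => z; rewrite !inE mem_rcons inE.
  by case: (eqVneq z y) => // _; rewrite orbT.
rewrite ltnS -[X in _ <= #|pred_of_set X|]setD0; apply: path_discovery; first by rewrite inE.
by move=> a b; rewrite in_set0.
Qed.

Lemma sum_count_eset c : \sum_(e in eset c) count_mem e (cedges c) = size c.
Proof.
rewrite -size_cedges.
under eq_bigr => e _ do rewrite -sum1_count big_mkcond.
rewrite exchange_big -sum1_size /= big_seq [RHS]big_seq; apply: eq_bigr => f fE.
by rewrite -big_mkcondr (big_pred1 f) // => e; rewrite !inE eq_sym andbC; case: eqVneq => [->|].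
Qed.

(** Edges of [F] are crossed at least once and the others at least twice; the multiplicities add up
    to the length. *)
Lemma double_card_eset c (F : {set I}) :
  F \subset eset c ->
  (forall e, e \in eset c -> e \notin F -> 1 < count_mem e (cedges c)) ->
  2 * #|eset c| <= size c + #|F|.
Proof.
move=> FE h; rewrite -sum_count_eset -[in leqLHS]sum1_card -[X in _ + X]sum1_card.
have -> : \sum_(e in F) 1 = \sum_(e in eset c) (e \in F).
  rewrite [RHS](bigID (mem F)) /= [X in _ = _ + X]big1 ?addn0; last first.
    by move=> e /andP[_ /negbTE ->].
  apply: esym; apply: eq_big => e; last by case/andP => _ ->.
  by rewrite andbC; case: (boolP (e \in F)) => // /(subsetP FE) ->.
rewrite big_distrr -big_split /=; apply: leq_sum => e eE.
have [eF|eF] := boolP (e \in F); last by rewrite addn0 muln1 h.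
by rewrite muln1 addn1 ltnS -has_count has_pred1; rewrite inE in eE.
Qed.

(** By [card_vset_simple] no edge of a tree-like walk is crossed exactly once. *)
Lemma double_card_eset_tree c : #|vset c| = #|eset c|.+1 -> 2 * #|eset c| <= size c.
Proof.
move=> vE; have := @double_card_eset c set0; rewrite cards0 addn0; apply.
  exact: sub0set.
move=> e eE _; have : 0 < count_mem e (cedges c).
  by rewrite -has_count has_pred1; rewrite inE in eE.
rewrite leq_eqVlt => /orP[/eqP/esym/card_vset_simple|//].
by rewrite vE ltnn.
Qed.

Lemma count_leading c e : #|vset c| = #|eset c|.+1 -> 2 * #|eset c| = size c ->
  e \in eset c -> count_mem e (cedges c) = 2.
Proof.
move=> vE sz ec.
have ge2 f : f \in eset c -> 1 < count_mem f (cedges c).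
  move=> fc; have : 0 < count_mem f (cedges c).
    by rewrite -has_count has_pred1; rewrite inE in fc.
  by rewrite leq_eqVlt => /orP[/eqP/esym/card_vset_simple|//]; rewrite vE ltnn.
apply/eqP; rewrite eqn_leq ge2 // andbT leqNgt; apply/negP => f3.
have l2 := cardsD1 e (eset c); rewrite ec /= in l2.
have := sum_count_eset c; rewrite (bigD1 e) //=.
have : \sum_(i in eset c | i != e) 2 <= \sum_(i in eset c | i != e) count_mem i (cedges c).
  by apply: leq_sum => i /andP[/ge2].
rewrite sum_nat_const.
have -> : #|[pred i in eset c | i != e]| = #|eset c :\ e|.
  by apply: eq_card => i; rewrite !inE andbC.
exact: leading_count_aux sz l2 f3.
Qed.

(** Such a walk is coded by the list of its vertices outside [V0] and by the word of positions of
    its letters in [V0] followed by that list. The decoding [f] hits every walk in question. *)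
Lemma card_walks k v (V0 : {set V}) :
  #|[set w : k.-tuple V | (V0 \subset vset w) && (#|vset w| == v)]|
    <= #|V| ^ (v - #|V0|) * v ^ k.
Proof.
case: (set_0Vmem [set w : k.-tuple V | (V0 \subset vset w) && (#|vset w| == v)])
  => [->|[w0 w0P]]; first by rewrite cards0.
(* The empty walk is treated apart, as the decoding needs a vertex [x0] for default. *)
case: k w0 w0P => [w0|k w0 _].
  rewrite inE tuple0 => /andP[_ /eqP <-]; rewrite expn0 muln1.
  rewrite (_ : #|vset _| = 0) ?sub0n ?expn0; last first.
    by apply: eq_card0 => x; rewrite !inE.
  by rewrite (leq_trans (max_card _)) // card_tuple expn0.
pose x0 := thead w0.
pose f (gh : (v - #|V0|).-tuple V * k.+1.-tuple 'I_v) : k.+1.-tuple V :=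
  [tuple of [seq nth x0 (enum V0 ++ gh.1) (val i) | i <- gh.2]].
rewrite -card_tuple -[X in _ * (X ^ _)]card_ord -card_tuple -card_prod.
rewrite -cardsT; apply: leq_trans (leq_imset_card f _).
apply: subset_leq_card; apply/subsetP => w; rewrite inE => /andP[sV /eqP vw].
have sg : size (enum (vset w :\: V0)) == v - #|V0|.
  by rewrite -cardE cardsD (setIidPr sV) vw.
pose l := enum V0 ++ enum (vset w :\: V0).
have sl : size l = v.
  rewrite size_cat -!cardE cardsD (setIidPr sV) vw subnKC // -vw.
  exact: subset_leq_card.
have wl x : x \in w -> x \in l.
  by move=> xw; rewrite mem_cat !mem_enum !inE xw andbT orbN.
have il x : x \in w -> index x l < v by move=> /wl; rewrite -index_mem sl.
have v0 : 0 < v by apply: leq_ltn_trans (il (thead w) _) => //; rewrite mem_tnth.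
case: v @f v0 vw sg sl il => // v f _ vw sg sl il.
apply/imsetP; exists (Tuple sg, [tuple of [seq inord (index x l) | x <- w]]).
  by rewrite inE.
apply: val_inj; rewrite /f /= -map_comp -[LHS]map_id.
apply/eq_in_map => x xw /=.
by rewrite inordK ?il // nth_index // wl.
Qed.

End Walks.

(** * Plane trees and walks traversing each edge twice *)

(* [CN l r] is the plane tree obtained from [r] by grafting [l], along a new edge,
   as the leftmost subtree of the root. *)
Inductive cat := CE | CN of cat & cat.

(** Words run from the vertex up to the root. Grafting a leftmost subtree appends 0 to its words
    ([rc0]) and shifts the other children of the root by raising the final letter ([inc]), which
    fixes the root. *)
Definition rc0 (u : seq nat) := rcons u 0.
Definition inc (u : seq nat) := if rev u is a :: t then rev (a.+1 :: t) else [::].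

(* Non-root words of the plane tree, and its contour started after the root. *)
Fixpoint cw c := if c is CN l r then [:: 0] :: map rc0 (cw l) ++ map inc (cw r) else [::].
Fixpoint ctr c :=
  if c is CN l r then [:: 0] :: map rc0 (ctr l) ++ [::] :: map inc (ctr r) else [::].
Definition words c := [::] :: cw c.

Lemma inc_rcons u a : inc (rcons u a) = rcons u a.+1.
Proof. by rewrite /inc rev_rcons rev_cons revK. Qed.

Lemma inc_inj : injective inc.
Proof.
move=> u v; case/lastP: u => [|u a]; case/lastP: v => [|v b]; rewrite ?inc_rcons //.
- by case: v.
- by case: u.
by move/rcons_inj => -[-> ->].
Qed.

Lemma rc0_inj : injective rc0.
Proof. by move=> u v /rcons_inj[]. Qed.

Lemma inc_rc0 u v : inc u <> rc0 v.
Proof.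
case/lastP: u => [|u a]; first by case: v.
by rewrite inc_rcons => /rcons_inj[].
Qed.

Lemma inc_eq0 u : (inc u == [::]) = (u == [::]).
Proof. by case/lastP: u => [|u a] //; rewrite inc_rcons -!size_eq0 !size_rcons. Qed.

Lemma behead_inc u : behead (inc u) = inc (behead u).
Proof.
case/lastP: u => [|u a] //; rewrite inc_rcons; case: u => [|b u] //=.
by rewrite inc_rcons.
Qed.

Lemma behead_rc0 u : u != [::] -> behead (rc0 u) = rc0 (behead u).
Proof. by case: u. Qed.

Lemma cw_neq0 c u : u \in cw c -> u != [::].
Proof.
elim: c u => [|l IHl r IHr] u //=; rewrite inE mem_cat => /orP[/eqP -> //|].
by case/orP => /mapP[v vc ->]; [rewrite /rc0; case: (v)|rewrite inc_eq0 IHr].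
Qed.

Lemma words_rc0 l r u : (rc0 u \in words (CN l r)) = (u \in words l).
Proof.
rewrite /words !inE mem_cat /= (mem_map rc0_inj).
have -> : (rc0 u == [::]) = false by case: u.
have -> : (rc0 u == [:: 0]) = (u == [::]) by case: u => [|a [|b u]] //=; rewrite eqseq_cons andbF.
rewrite (_ : rc0 u \in map inc _ = false) ?orbF //.
by apply/negP => /mapP[v _ /esym/inc_rc0].
Qed.

Lemma words_inc l r u : (inc u \in words (CN l r)) = (u \in words r).
Proof.
rewrite /words !inE mem_cat /= (mem_map inc_inj) inc_eq0.
rewrite (_ : (inc u == [:: 0]) = false); last first.
  by apply/negP => /eqP/(@inc_rc0 u [::]).
rewrite (_ : inc u \in map rc0 _ = false) //.
by apply/negP => /mapP[v _ /inc_rc0].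
Qed.

(** The empty word falls under the second case, as [inc [::]]: the root of the whole tree is the
    root of its right part. *)
Lemma word_case (P : seq nat -> Prop) :
  (forall u, P (rc0 u)) -> (forall u, P (inc u)) -> forall u, P u.
Proof.
move=> P0 Pi; case/lastP => [|u [|a]]; first exact: (Pi [::]).
  exact: (P0 u).
by rewrite -inc_rcons; exact: Pi.
Qed.

Lemma words_uniq c : uniq (words c).
Proof.
have h : uniq (cw c).
  elim: c => [//|l IHl r IHr] /=; rewrite mem_cat cat_uniq.
  rewrite (map_inj_uniq rc0_inj) (map_inj_uniq inc_inj) IHl IHr !andbT.
  apply/andP; split.
    apply/negP => /orP[] /mapP[v vc e]; last by exact: (@inc_rc0 v [::]).
    by have := cw_neq0 vc; case: v e {vc} => [//|a [|b v]].
  by rewrite /=; apply/hasPn => _ /mapP[u _ ->]; apply/negP => /mapP[v _ /inc_rc0].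
by rewrite /words /= h andbT; apply/negP => /cw_neq0.
Qed.

Lemma size_ctr c : size (ctr c) = 2 * size (cw c).
Proof.
elim: c => [//|l IHl r IHr] /=.
by rewrite !size_cat /= !size_map IHl IHr; lia.
Qed.

(** The contour comes back to the root. The default [f [::]] makes this true also for the one-vertex
    tree, whose contour is empty. *)
Lemma last_map_ctr (T : Type) (f : seq nat -> T) c : last (f [::]) (map f (ctr c)) = f [::].
Proof.
elim: c f => [//|l IHl r IHr] f /=.
rewrite map_cat last_cat /= -map_comp.
exact: (IHr (f \o inc)).
Qed.

Lemma mem_ctr c u : u \in ctr c -> u \in words c.
Proof.
elim: c u => [//|l IHl r IHr] u.
rewrite (_ : ctr (CN l r) = rc0 [::] :: map rc0 (ctr l) ++ [::] :: map inc (ctr r)) //.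
rewrite in_cons mem_cat in_cons => /orP[/eqP ->|].
  by rewrite words_rc0 mem_head.
case/orP => [/mapP[v /IHl vl ->]|/orP[/eqP ->|/mapP[v /IHr vr ->]]].
- by rewrite words_rc0.
- by rewrite mem_head.
by rewrite words_inc.
Qed.

Lemma cw_ctr c u : u \in cw c -> u \in ctr c.
Proof.
elim: c u => [//|l IHl r IHr] u.
rewrite /= !inE !mem_cat inE => /orP[->//|/orP[/mapP[v /IHl vl ->]|/mapP[v /IHr vr ->]]].
  by rewrite (map_f _ vl) orbT.
by rewrite (map_f _ vr) !orbT.
Qed.

Lemma words_ext c c' : words c =i words c' -> c = c'.
Proof.
elim: c c' => [|l IHl r IHr] [|l' r'] // h.
- by have := h [:: 0]; rewrite [RHS](words_rc0 l' r' [::]).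
- by have := h [:: 0]; rewrite [LHS](words_rc0 l r [::]).
congr CN; [apply: IHl|apply: IHr] => u.
  by rewrite -(words_rc0 l r) h words_rc0.
by rewrite -(words_inc l r) h words_inc.
Qed.

Lemma words_plane c : [/\ [::] \in words c,
    forall i u, i :: u \in words c -> u \in words c
  & forall i u, i.+1 :: u \in words c -> i :: u \in words c].
Proof.
elim: c => [|l [l0 lb ll] r [r0 rb rl]]; first by split.
split => // i u.
  case/lastP: u => [//|u [|a]]; rewrite -rcons_cons.
    by rewrite -/(rc0 (i :: u)) -/(rc0 u) !words_rc0 => /lb.
  by rewrite -!inc_rcons !words_inc => /rb.
case/lastP: u => [|u [|a]].
  case: i => [|i]; first by rewrite (words_rc0 l r [::]).
  have h a : [:: a.+1] = inc [:: a] by rewrite -[[:: a]]/(rcons [::] a) inc_rcons.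
  by rewrite (h i.+1) (h i) !words_inc => /rl.
  by rewrite -!rcons_cons -/(rc0 (i.+1 :: u)) -/(rc0 (i :: u)) !words_rc0 => /ll.
by rewrite -!rcons_cons -!inc_rcons !words_inc => /rl.
Qed.

(** Induction on a bound for the number of non-root words. If the leftmost child of the root is
    present, the preimages of the set under [rc0] and under [inc] are again trees, and neither has
    [[:: 0]] among the words to be counted. *)
Lemma plane_words (N : nat) (P : pred (seq nat)) (s : seq (seq nat)) :
  size s <= N -> (forall u, P u -> u != [::] -> u \in s) ->
  P [::] -> (forall i u, P (i :: u) -> P u) -> (forall i u, P (i.+1 :: u) -> P (i :: u)) ->
  exists c, forall u, P u = (u \in words c).
Proof.
elim: N P s => [|N IH] P s sN Ps P0 Pb Pl.
  exists CE => u; rewrite inE; case: (eqVneq u [::]) => [-> //|u0].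
  by apply/negP => /Ps/(_ u0); case: s sN {Ps}.
have [P00|P00] := boolP (P [:: 0]); last first.
  exists CE => u; rewrite inE; case: (eqVneq u [::]) => [-> //|].
  (* Climbing to a child of the root and then moving left turns any non-root word into [[:: 0]]. *)
  move=> u0; apply: contraNF P00; elim: u u0 => [//|a [|b u] IHu] _; last by move/Pb/IHu; exact.
  by elim: a => [//|a IHa] /Pl.
have s0 : [:: 0] \in s by exact: Ps.
have cnt (a : pred (seq nat)) : ~~ a [:: 0] -> count a s <= N.
  move=> a0; rewrite -ltnS; apply: leq_trans sN; rewrite -(count_predC a s) -addn1 leq_add2l.
  by rewrite -has_count; apply/hasP; exists [:: 0].
have [l Pl'] : exists c, forall u, P (rc0 u) = (u \in words c).
  (* Dropping the final letter inverts [rc0]. The default 1 discards the empty word; [[:: 0]] is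
     removed because it gives the root of the subtree, and this makes the list shorter. *)
  apply: (IH _ [seq take (size v).-1 v | v <- s & (last 1 v == 0) && (v != [:: 0])]).
  - by rewrite size_map size_filter cnt //= eqxx.
  - move=> u Pu u0; apply/mapP; exists (rc0 u).
      rewrite mem_filter /rc0 last_rcons eqxx Ps //=; last by case: (u).
      by apply/andP; split=> //; apply/eqP => /(congr1 size); rewrite size_rcons; case: (u) u0.
    by rewrite /rc0 size_rcons /= -cats1 take_size_cat.
  - by [].
  - by move=> i u /Pb.
  - by move=> i u /Pl.
have [r Pr'] : exists c, forall u, P (inc u) = (u \in words c).
  (* Lowering the final letter inverts [inc]. The default 0 discards the empty word, and the filter
     also drops the words of the left subtree. *)
  apply: (IH _ [seq rcons (take (size v).-1 v) (last 1 v).-1 | v <- s & 0 < last 0 v]).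
  - by rewrite size_map size_filter cnt.
  - move=> u Pu u0; apply/mapP; exists (inc u).
      rewrite mem_filter Ps ?inc_eq0 ?andbT //.
      by case/lastP: u u0 {Pu} => [//|u a] _; rewrite inc_rcons last_rcons.
    case/lastP: u u0 {Pu} => [//|u a] _; rewrite inc_rcons last_rcons size_rcons /=.
    by rewrite -!cats1 take_size_cat.
  - by [].
  - by move=> i u; rewrite -[u in X in _ -> X]/(behead (i :: u)) -behead_inc; case: (inc _) => [//|a v /Pb].
  - move=> i u; case/lastP: u => [|u a]; rewrite -?rcons_cons.
      by rewrite -[[:: i.+1]]/(rcons [::] i.+1) -[[:: i]]/(rcons [::] i) !inc_rcons => /Pl.
    by rewrite !inc_rcons => /Pl.
exists (CN l r); elim/word_case => u; first by rewrite words_rc0.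
by rewrite words_inc.
Qed.

Section Labelled.
Variables (V I : finType) (ed : V -> V -> I).
Hypothesis edC : forall x y, ed x y = ed y x.
Hypothesis ed_inj : forall x y x' y',
  ed x y = ed x' y' -> (x = x' /\ y = y') \/ (x = y' /\ y = x').
Implicit Types (f g : seq nat -> V).

Definition tedges f c := [seq ed (f u) (f (behead u)) | u <- cw c].
(** [cedges] closes a walk by itself, so [belast] drops the final return to the root. For [CE] the
    walk is empty, whence the condition [c <> CE] below. *)
Definition walk f c := belast (f [::]) (map f (ctr c)).

Lemma tedges_CN f l r : tedges f (CN l r) =
  ed (f [:: 0]) (f [::]) :: tedges (f \o rc0) l ++ tedges (f \o inc) r.
Proof.
rewrite /tedges /= map_cat -!map_comp; congr (_ :: (_ ++ _)).
  by apply/eq_in_map => u /cw_neq0 u0 /=; rewrite behead_rc0.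
by apply/eq_in_map => u _ /=; rewrite behead_inc.
Qed.

(** The edge above the left subtree is crossed on entering and on leaving it; the other edges come
    from the two parts by induction. *)
Lemma perm_contour f c :
  perm_eq (pairmap ed (f [::]) (map f (ctr c))) (tedges f c ++ tedges f c).
Proof.
elim: c f => [//|l IHl r IHr] f.
rewrite tedges_CN /= map_cat pairmap_cat -!map_comp /=.
have := IHl (f \o rc0) => /= hl; have := IHr (f \o inc) => /= hr.
have -> : last (f [:: 0]) [seq (f \o rc0) i | i <- ctr l] = f [:: 0].
  exact: (last_map_ctr (f \o rc0) l).
apply/permP => a; move/permP: hl => /(_ a); move/permP: hr => /(_ a).
rewrite /= !count_cat /= !count_cat -map_comp /= (edC (f [::])) /rc0 /=.
have -> : [seq f (inc x) | x <- ctr r] = [seq (f \o inc) x | x <- ctr r] by [].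
have -> : f [::] = (f \o inc) [::] by [].
move: (ed _ _) => e; move: (count a (pairmap _ _ _)) => A.
move=> ->; move: (count a (pairmap _ _ _)) => B ->; lia.
Qed.

Lemma walk_path f c : c <> CE -> exists s, walk f c = f [::] :: s /\ rcons s (f [::]) = map f (ctr c).
Proof.
case: c => [//|l r] _; rewrite /walk.
have : map f (ctr (CN l r)) != [::] by [].
case: (map f _) (last_map_ctr f (CN l r)) => [//|y s] /= h _.
exists (belast y s); split => //.
by rewrite -h -lastI.
Qed.

Lemma perm_walk f c : perm_eq (cedges ed (walk f c)) (tedges f c ++ tedges f c).
Proof.
case: c => [//|l r]; have [|s [-> sE]] := @walk_path f (CN l r) => //.
by rewrite /cedges sE; exact: perm_contour.
Qed.

Lemma size_walk f c : size (walk f c) = 2 * size (cw c).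
Proof. by rewrite /walk size_belast size_map size_ctr. Qed.

Lemma mem_walk f c x : c <> CE -> (x \in walk f c) = (x \in map f (words c)).
Proof.
move=> cN; have [s [wE sE]] := walk_path f cN.
have h y : (y \in f [::] :: s) = (y \in map f (ctr c)).
  by rewrite -sE mem_rcons.
rewrite wE h; apply/mapP/mapP => -[u uc ->]; first by exists u => //; exact: mem_ctr.
move: uc; rewrite /words inE => /orP[/eqP ->|/cw_ctr uc]; last by exists u.
have : f [::] \in map f (ctr c) by rewrite -sE mem_rcons inE eqxx.
by move/mapP.
Qed.

(** If two tree edges matched with their ends exchanged, each of [u] and [v] would be the parent of
    the other, which their lengths forbid. *)
Lemma tedges_inj f c : {in words c &, injective f} ->
  {in cw c &, injective (fun u => ed (f u) (f (behead u)))}.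
Proof.
move=> fi u v uc vc.
have w0 x : x \in cw c -> x \in words c by move=> xc; rewrite inE xc orbT.
have wb x : x \in cw c -> behead x \in words c.
  move=> xc; have := cw_neq0 xc; case: x xc => [//|a x] xc _ /=.
  by have [_ h _] := words_plane c; exact: (h a x (w0 _ xc)).
case/ed_inj => -[h1 h2]; first by apply: fi => //; exact: w0.
have e1 : u = behead v by apply: fi => //; [exact: w0|exact: wb].
have e2 : behead u = v by apply: fi => //; [exact: wb|exact: w0].
have := congr1 size e1; have := congr1 size e2; rewrite !size_behead.
by have := cw_neq0 uc; have := cw_neq0 vc; rewrite -!size_eq0; lia.
Qed.

Lemma walk_leading f c : c <> CE -> {in words c &, injective f} ->
  [/\ #|vset (walk f c)| = #|eset ed (walk f c)|.+1,
      2 * #|eset ed (walk f c)| = size (walk f c),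
      eset ed (walk f c) = [set e in tedges f c] & uniq (tedges f c)].
Proof.
move=> cN fi.
have un : uniq (tedges f c).
  rewrite map_inj_in_uniq; last exact: tedges_inj.
  by have := words_uniq c => /andP[].
have eE : eset ed (walk f c) = [set e in tedges f c].
  by apply/setP => e; rewrite !inE (perm_mem (perm_walk f c)) mem_cat orbb.
have cE : #|eset ed (walk f c)| = size (cw c).
  by rewrite eE cardsE; move/card_uniqP: un => ->; rewrite size_map.
split => //; last by rewrite cE size_walk.
rewrite cE /vset (_ : [set x in walk f c] = [set x in map f (words c)]); last first.
  by apply/setP => x; rewrite !inE mem_walk.
rewrite cardsE; have : uniq (map f (words c)) by rewrite map_inj_in_uniq ?words_uniq.
by move/card_uniqP => ->; rewrite size_map.
Qed.

Lemma cat_first (T : eqType) (x : T) (A B A' B' : seq T) :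
  x \notin A -> x \notin A' -> A ++ x :: B = A' ++ x :: B' -> A = A' /\ B = B'.
Proof.
elim: A A' => [|a A IH] [|a' A'] //=.
- by move=> _ _ [->].
- by move=> _; rewrite inE => /norP[/eqP xa _] [] /xa.
- by rewrite inE => /norP[/eqP xa _] _ [] /esym/xa.
rewrite !inE => /norP[_ h] /norP[_ h'] [-> e].
by have [-> ->] := IH _ h h' e.
Qed.

(** Under an injective labelling the first return to the label of the root marks the end of the left
    subtree. The contour thus determines where to cut, and the two parts follow by induction. *)
Lemma contour_inj f g c c' : {in words c &, injective f} -> {in words c' &, injective g} ->
  f [::] = g [::] -> map f (ctr c) = map g (ctr c') ->
  c = c' /\ {in words c, f =1 g}.
Proof.
elim: c c' f g => [|l IHl r IHr] [|l' r'] f g fi gi fg0 //=.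
  by move=> _; split => // u; rewrite inE => /eqP ->.
case=> e0; rewrite !map_cat -!map_comp /= -fg0 => e.
have nin (h : seq nat -> V) c1 c2 : {in words (CN c1 c2) &, injective h} ->
    h [::] \notin [seq (h \o rc0) i | i <- ctr c1].
  move=> hi; apply/mapP => -[u uc /= /hi]; rewrite words_rc0.
  by rewrite (mem_ctr uc) => /(_ isT isT); case: (u).
have [eA eB] := cat_first (nin _ _ _ fi) (eq_ind_r (fun z => z \notin _) (nin _ _ _ gi) fg0) e.
have [||||<- fl] := IHl l' (f \o rc0) (g \o rc0) => //.
- by move=> u v ul vl /= /fi; rewrite !words_rc0 => /(_ ul vl)/rc0_inj.
- by move=> u v ul vl /= /gi; rewrite !words_rc0 => /(_ ul vl)/rc0_inj.
rewrite -!map_comp in eB.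
have [||||<- fr] := IHr r' (f \o inc) (g \o inc) => //.
- by move=> u v ul vl /= /fi; rewrite !words_inc => /(_ ul vl)/inc_inj.
- by move=> u v ul vl /= /gi; rewrite !words_inc => /(_ ul vl)/inc_inj.
split => //; elim/word_case => u; first by rewrite words_rc0 => /fl.
by rewrite words_inc => /fr.
Qed.

(* Depth-first parsing of a walk: [vis] are the visited vertices, and [st] is the
   path from the current vertex to the root. *)
Fixpoint good (vis st rem : seq V) {struct rem} : bool :=
  if rem is z :: rem' then
    if z \in vis then
      if st is _ :: y :: st' then (z == y) && good vis (y :: st') rem' else false
    else good (z :: vis) (z :: st) rem'
  else size st == 1.

(** The walk from [x] is read until it steps back to the next vertex [y] of the stack, or to its end
    when [x] is the root; what has been read is the contour of a plane tree labelled by new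
    vertices. The second recursive call acts on a remainder produced by the first, hence the length
    bound [N]. *)
Lemma parse_good N rem vis st x : size rem <= N -> good vis (x :: st) rem ->
  {subset x :: st <= vis} ->
  exists c f rem', [/\ rem = map f (ctr c) ++ rem', f [::] = x, {in words c &, injective f},
    forall u, u \in cw c -> f u \notin vis
  & (st = [::] /\ rem' = [::]) \/ exists y st' rem'' vis',
     [/\ st = y :: st', rem' = y :: rem'', good vis' (y :: st') rem''
       & vis' =i vis ++ map f (cw c)]].
Proof.
elim: N rem vis st x => [|N IH] [|z rem] vis st x //= sN.
- move=> h _; exists CE, (fun=> x), [::]; split => //; last by left; case: st h.
  by move=> u v; rewrite !inE => /eqP -> /eqP ->.
- move=> h _; exists CE, (fun=> x), [::]; split => //; last by left; case: st h.
  by move=> u v; rewrite !inE => /eqP -> /eqP ->.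
case: ifP => zv.
  case: st => [//|y st] /andP[/eqP -> gd] _.
  exists CE, (fun=> x), (y :: rem); split => //.
    by move=> u v; rewrite !inE => /eqP -> /eqP ->.
  by right; exists y, st, rem, vis; split => //; move=> u; rewrite cats0.
move=> gd sv; have [||c1 [f1 [rem1 [rE f10 f1i f1n H]]]] := IH _ _ _ _ _ gd => //.
  by move=> u; rewrite inE => /orP[/eqP ->|/sv]; rewrite inE ?eqxx // => ->; rewrite orbT.
case: H => [[//]|[y [st' [rem2 [vis' [[yx st'E] rem1E gd2 visE]]]]]].
subst y st' rem1.
have xv : x \in vis by apply: sv; rewrite inE eqxx.
have s2 : size rem2 <= N by move: sN; rewrite rE size_cat /=; lia.
have sv2 : {subset x :: st <= vis'}.
  by move=> u /sv uv; rewrite visE mem_cat inE uv orbT.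
have [c2 [f2 [rem' [r2E f20 f2i f2n H]]]] := IH _ _ _ _ s2 gd2 sv2.
(* Words end at the root: a final 0 selects the subtree [c1], and a final [a.+1] is lowered to give
   a word of [c2]. *)
pose f u := match rev u with [::] => f2 [::] | 0 :: t => f1 (rev t)
   | a.+1 :: t => f2 (rev (a :: t)) end.
have frc u : f (rc0 u) = f1 u by rewrite /f /rc0 rev_rcons revK.
have finc u : f (inc u) = f2 u.
  case/lastP: u => [//|u a]; by rewrite inc_rcons /f rev_rcons rev_cons revK.
have f1v u : u \in words c1 -> f1 u \in vis' /\ f1 u \notin vis.
  move=> uw; split.
    rewrite visE mem_cat; move: uw; rewrite inE => /orP[/eqP ->|uc].
      by rewrite f10 inE eqxx.
    by rewrite (map_f f1 uc) orbT.
  move: uw; rewrite inE => /orP[/eqP ->|/f1n]; first by rewrite f10 zv.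
  by rewrite inE negb_or => /andP[].
have f12 u v : u \in words c1 -> v \in words c2 -> f1 u <> f2 v.
  move=> /f1v[h1 h2]; rewrite inE => /orP[/eqP ->|/f2n h3] e.
    by move: h2; rewrite e f20 xv.
  by move: h3; rewrite -e h1.
exists (CN c1 c2), f, rem'; split.
- rewrite rE r2E /= map_cat /= -!map_comp -catA /=.
  rewrite -[[:: 0]]/(rc0 [::]) frc f10; congr (_ :: _).
  have -> : [seq (f \o rc0) i | i <- ctr c1] = [seq f1 i | i <- ctr c1].
    by apply: eq_map => u; exact: frc.
  have -> : [seq (f \o inc) i | i <- ctr c2] = [seq f2 i | i <- ctr c2].
    by apply: eq_map => u; exact: finc.
  by rewrite -[X in f X :: _]/(inc [::]) finc f20.
- by rewrite -f20 -finc.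
- elim/word_case => u; elim/word_case => v; rewrite ?words_rc0 ?words_inc ?frc ?finc => uw vw.
  + by move/f1i => ->.
  + by move=> e; case: (f12 _ _ uw vw e).
  + by move=> e; case: (f12 _ _ vw uw (esym e)).
  + by move/f2i => ->.
- elim/word_case => u.
    rewrite frc => uw; have : rc0 u \in words (CN c1 c2) by rewrite inE uw orbT.
    by rewrite words_rc0 => /f1v[].
  rewrite finc => uw; have : inc u \in words (CN c1 c2) by rewrite inE uw orbT.
  rewrite words_inc inE => /orP[/eqP u0|/f2n]; first by have := cw_neq0 uw; rewrite u0.
  by rewrite visE mem_cat inE !negb_or => /andP[/andP[_ ->]].
case: H => [[-> ->]|[y [st' [rem'' [vis'' [-> -> gd3 vis''E]]]]]]; first by left.
right; exists y, st', rem'', vis''; split => // u.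
rewrite vis''E !mem_cat visE !mem_cat inE /= map_cat inE mem_cat -!map_comp.
rewrite -[[:: 0]]/(rc0 [::]) frc f10.
have -> : [seq (f \o rc0) i | i <- cw c1] = [seq f1 i | i <- cw c1].
  by apply: eq_map => v; exact: frc.
have -> : [seq (f \o inc) i | i <- cw c2] = [seq f2 i | i <- cw c2].
  by apply: eq_map => v; exact: finc.
by case: (u == z); case: (u \in vis); case: (u \in map f1 _) => //=; rewrite ?orbT.
Qed.

(** Depth-first invariant: edges on the stack are still to be crossed exactly once, used edges off
    the stack never, new edges exactly twice, and there are at most as many new edges as new
    vertices to come. A step to a visited vertex must then go back along the stack. *)
Lemma inv_good rem vis (used : {set I}) st x :
  uniq (x :: st) -> {subset x :: st <= vis} ->
  (forall a b, ed a b \in used -> b \in vis) ->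
  (forall e, e \in pairmap ed x st -> e \in used /\ count_mem e (pairmap ed x rem) = 1) ->
  (forall e, e \in used -> e \notin pairmap ed x st -> e \notin pairmap ed x rem) ->
  (forall e, e \notin used -> e \in pairmap ed x rem -> count_mem e (pairmap ed x rem) = 2) ->
  #|[set e in pairmap ed x rem] :\: used| <= #|[set y in rem] :\: [set y in vis]| ->
  good vis (x :: st) rem.
Proof.
elim: rem vis used st x => [|z rem IH] vis used st x us sv uv c1 c2 c3 le.
  by case: st us sv c1 c2 => [//|y st] _ _ c1 _; have [] := c1 (ed x y); rewrite //= inE eqxx.
have xv : x \in vis by apply: sv; rewrite inE eqxx.
rewrite [good _ _ _]/=; have [zv|zv] := boolP (z \in vis); last first.
  have eN : ed x z \notin used by apply: contra zv; exact: uv.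
  have cz : count_mem (ed x z) (pairmap ed z rem) = 1.
    have := c3 _ eN; rewrite /= inE !eqxx => /(_ isT); lia.
  have nz e : e \in used -> (ed x z == e) = false.
    by move=> eu; apply: contraNF eN => /eqP ->.
  apply: (IH _ (ed x z |: used)).
  - by rewrite /= -/(uniq (x :: st)) us andbT; apply: contra zv; exact: sv.
  - by move=> u; rewrite inE => /orP[/eqP ->|/sv]; rewrite inE ?eqxx // => ->; rewrite orbT.
  - move=> a b; rewrite !inE => /orP[/eqP/ed_inj|/uv ->]; last by rewrite orbT.
    by case=> -[? ?]; subst; rewrite ?eqxx // xv orbT.
  - move=> e; rewrite /= inE edC => /orP[/eqP ->|/c1[eu h]]; first by rewrite setU11.
    by rewrite inE eu orbT; split => //; move: h; rewrite /= nz.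
  - move=> e; rewrite in_setU1 /= inE negb_or (edC z x) => /orP[/eqP ->|eu] /andP[ne1 ne2].
      by rewrite eqxx in ne1.
    by have := c2 e eu ne2; rewrite /= inE negb_or => /andP[].
  - move=> e; rewrite !inE negb_or => /andP[ne eu] er.
    have := c3 e eu; rewrite /= inE er orbT => /(_ isT).
    by rewrite eq_sym (negbTE ne).
  - move: le.
    have -> : [set e in pairmap ed x (z :: rem)] :\: used =
       ed x z |: ([set e in pairmap ed z rem] :\: (ed x z |: used)).
      apply/setP => e; rewrite /= !inE; case: eqVneq => [->|] //=; by rewrite eN.
    have -> : [set y in z :: rem] :\: [set y in vis] = z |: ([set y in rem] :\: [set y in z :: vis]).
      apply/setP => y; rewrite !inE; case: eqVneq => [->|] //=; by rewrite zv.
    by rewrite !cardsU1 !inE !eqxx.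
set e0 := ed x z.
have e0u : e0 \in used.
  (* A new edge towards a visited vertex would be wasted, leaving fewer new edges than new vertices,
     against [path_discovery]. *)
  apply: contraT => e0u; move: le.
  have -> : [set y in z :: rem] :\: [set y in vis] = [set y in rem] :\: [set y in vis].
    by apply/setP => y; rewrite !inE; case: eqVneq => [->|//]; rewrite zv.
  have -> : [set e in pairmap ed x (z :: rem)] :\: used =
       e0 |: ([set e in pairmap ed z rem] :\: (e0 |: used)).
    apply/setP => e; rewrite /= !inE -/e0; case: eqVneq => [->|] //=; by rewrite e0u.
  rewrite cardsU1 !inE eqxx /= add1n => lt.
  have : #|[set y in rem] :\: [set y in vis]| <=
         #|[set e in pairmap ed z rem] :\: (e0 |: used)|.
    apply: path_discovery => //; first by rewrite inE.
    move=> a b; rewrite !inE => /orP[/eqP/ed_inj|/uv //].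
    by case=> -[? ?]; subst.
  by move=> h; have := leq_trans lt h; rewrite ltnn.
have e0s : e0 \in pairmap ed x st.
  by apply: contraT => /(c2 _ e0u); rewrite /= inE eqxx.
have notin y s a : x \notin y :: s -> ed x a \notin pairmap ed y s.
  move=> xs; apply: contra xs => /mem_pairmap_ed[b [b' [bs b's]]].
  by case/ed_inj => -[-> _]; rewrite // inE b's orbT.
case: st us sv c1 c2 e0s => [//|y st] us sv c1 c2 e0s.
have xys : x \notin y :: st by case/andP: us.
(* [e0] is on the stack and contains [x], which occurs only at the top; so [e0] joins [x] to the
   vertex just below. *)
have zy : z = y.
  move: e0s; rewrite /= inE (negbTE (notin _ _ _ xys)) orbF => /eqP/ed_inj[[_ ->]//|[xy _]].
  by move: xys; rewrite xy inE eqxx.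
rewrite zy eqxx /=; rewrite zy in e0 e0u e0s zv le c1 c2 c3.
have ne0 e : e \in pairmap ed y st -> (e0 == e) = false.
  by move=> es; apply: contraTF es => /eqP <-; exact: notin.
apply: (IH _ used).
- by case/andP: us.
- by move=> u us'; apply: sv; rewrite inE us' orbT.
- exact: uv.
- move=> e es; have [|eu] := c1 e; first by rewrite /= inE es orbT.
  by rewrite /= -/e0 ne0.
- move=> e eu es; have [ee|ee] := eqVneq e e0.
    have [|_] := c1 e0; first by rewrite /= inE eqxx.
    by rewrite /= -/e0 eqxx add1n => -[h]; rewrite ee -has_pred1 has_count h.
  have := c2 e eu; rewrite /= !inE -/e0 (negbTE ee) /=; exact.
- move=> e eu er; have := c3 e eu; rewrite /= inE er orbT => /(_ isT).
  by rewrite (_ : (ed x y == e) = false) //; apply: contraNF eu => /eqP <-.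
move: le; rewrite (_ : [set e in pairmap ed x (y :: rem)] :\: used =
   [set e in pairmap ed y rem] :\: used); last first.
  by apply/setP => e; rewrite /= !inE -/e0; case: eqVneq => [->|//]; rewrite e0u.
rewrite (_ : [set y0 in y :: rem] :\: [set y0 in vis] = [set y0 in rem] :\: [set y0 in vis]) //.
by apply/setP => u; rewrite !inE; case: eqVneq => [->|//]; rewrite zv.
Qed.

(** Converse of [walk_leading]. By [count_leading] each edge is crossed exactly twice, so the
    invariant of the parser holds at the start, with the stack reduced to [x]. *)
Lemma leading_walk w : w != [::] -> #|vset w| = #|eset ed w|.+1 -> 2 * #|eset ed w| = size w ->
  exists c f, [/\ c <> CE, w = walk f c & {in words c &, injective f}].
Proof.
case: w => [//|x s] _ vE sz.
have gd : good [:: x] [:: x] (rcons s x).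
  apply: (@inv_good _ _ set0) => //.
  - by move=> a b; rewrite in_set0.
  - by move=> e; rewrite in_set0.
  - move=> e _ er; apply: (count_leading ed_inj vE sz); by rewrite inE.
  rewrite setD0 -ltnS -[X in X < _]/(#|eset ed (x :: s)|) -vE.
  rewrite /vset (_ : [set y in x :: s] = x |: ([set y in rcons s x] :\: [set y in [:: x]])).
    by rewrite cardsU1 !inE eqxx.
  by apply/setP => u; rewrite !inE mem_rcons inE; case: eqVneq.
have sx : {subset [:: x] <= [:: x]} by [].
have [c [f [rem' [rE f0 fi _ H]]]] := parse_good (leqnn _) gd sx.
case: H => [[_ r0]|[y [st' [? [? []]]]]] //; subst rem'; rewrite cats0 in rE.
have cN : c <> CE by move=> cE; move: rE; rewrite cE /=; case: (s).
exists c, f; split => //.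
have [s' [wE sE]] := walk_path f cN.
rewrite wE f0; congr (_ :: _).
by move: sE; rewrite -rE f0 => /rcons_inj[->].
Qed.

End Labelled.

From mathcomp Require Import finmap.
From mathcomp Require Import all_classical all_reals all_analysis measurable_realfun.
From mathcomp Require Import ring lra.

Import Order.TTheory GRing.Theory Num.Theory.
Import numFieldNormedType.Exports.

Local Open Scope ring_scope.

(** * Functions of independent Bernoulli variables *)

Section BernoulliPowers.
Context {R : realType}.
Implicit Types q : R.

(* For a centred Bernoulli variable [b] (with values [1 - q] and [- q]) and
   [m : nat], [b ^+ m = al q m + ga q m * b]. *)
Definition ga q (m : nat) : R := (1 - q) ^+ m - (- q) ^+ m.
Definition al q (m : nat) : R := q * (1 - q) ^+ m + (1 - q) * (- q) ^+ m.

Lemma bernoulli_expr q (b : bool) m :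
  (b%:R - q) ^+ m = al q m + ga q m * (b%:R - q).
Proof. by rewrite /al /ga; case: b => /=; rewrite ?sub0r; ring. Qed.

Lemma ga0 q : ga q 0 = 0. Proof. by rewrite /ga !expr0; ring. Qed.
Lemma ga2 q : ga q 2 = 1 - 2 * q. Proof. by rewrite /ga; ring. Qed.
Lemma al0 q : al q 0 = 1. Proof. by rewrite /al !expr0; ring. Qed.
Lemma al1 q : al q 1 = 0. Proof. by rewrite /al; ring. Qed.
Lemma al2 q : al q 2 = q * (1 - q). Proof. by rewrite /al; ring. Qed.

Lemma norm_ga q m : 0 <= q <= 1 -> `|ga q m| <= 1.
Proof.
case/andP => q0 q1; case: m => [|m]; first by rewrite ga0 normr0.
have h : (1 - q) ^+ m.+1 + q ^+ m.+1 <= 1.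
  have h1 : (1 - q) ^+ m <= 1 by rewrite exprn_ile1 //; lra.
  have h2 : q ^+ m <= 1 by rewrite exprn_ile1.
  by rewrite !exprS; nra.
rewrite /ga (le_trans (ler_normB _ _)) //.
by rewrite !normrX normrN !ger0_norm //; lra.
Qed.

(** The factor q comes from the identity al q (m + 1) = q (1 - q) ga q m: a positive power of a
    centred Bernoulli variable has mean O(q). *)
Lemma norm_al q m : 0 <= q <= 1 -> (0 < m)%N -> `|al q m| <= q.
Proof.
move=> q01; case: m => // m _.
have -> : al q m.+1 = q * (1 - q) * ga q m by rewrite /al /ga !exprS; ring.
have /andP[q0 q1] := q01.
rewrite !normrM (ger0_norm q0) (ger0_norm (_ : 0 <= 1 - q)); last lra.
by have := norm_ga m q01; have := normr_ge0 (ga q m); nra.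
Qed.

End BernoulliPowers.

Section BernoulliProduct.
Context {R : realType} (I : finType) (q : I -> R).
Implicit Types (w : {ffun I -> bool}).

Definition wt e (b : bool) : R := if b then q e else 1 - q e.
Definition mass w : R := \prod_e wt e (w e).
Definition bE (F : {ffun I -> bool} -> R) : R := \sum_w mass w * F w.
Definition bet e w : R := (w e)%:R - q e.
Definition sig e : R := q e * (1 - q e).

Lemma bE_prod (g : I -> bool -> R) :
  bE (fun w => \prod_e g e (w e)) = \prod_e (q e * g e true + (1 - q e) * g e false).
Proof.
rewrite /bE /=; under eq_bigr => w _ do rewrite /mass -big_split /=.
rewrite -(bigA_distr_bigA (fun e b => wt e b * g e b)) /=.
by apply: eq_bigr => e _; rewrite big_bool.
Qed.

Lemma sum_mass : \sum_w mass w = 1.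
Proof.
transitivity (bE (fun w => \prod_e (fun _ _ => 1 : R) e (w e))).
  by rewrite /bE; apply: eq_bigr => w _; rewrite big1 ?mulr1.
have /= -> := bE_prod (fun _ _ => 1); by rewrite big1 // => e _; ring.
Qed.

Lemma bE_cst c : bE (fun=> c) = c.
Proof. by rewrite /bE -mulr_suml sum_mass mul1r. Qed.

Lemma eq_bE F G : F =1 G -> bE F = bE G.
Proof. by move=> FG; apply: eq_bigr => w _; rewrite FG. Qed.

Lemma bED F G : bE (fun w => F w + G w) = bE F + bE G.
Proof. by rewrite /bE -big_split /=; apply: eq_bigr => w _; rewrite mulrDr. Qed.

Lemma bEZ c F : bE (fun w => c * F w) = c * bE F.
Proof. by rewrite /bE mulr_sumr; apply: eq_bigr => w _; rewrite mulrCA. Qed.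

Lemma bEB F G : bE (fun w => F w - G w) = bE F - bE G.
Proof. by rewrite /bE -sumrB; apply: eq_bigr => w _; rewrite mulrBr. Qed.

Lemma bE_sum (J : Type) (r : seq J) (P : pred J) (F : J -> {ffun I -> bool} -> R) :
  bE (fun w => \sum_(j <- r | P j) F j w) = \sum_(j <- r | P j) bE (F j).
Proof.
rewrite /bE exchange_big /=; apply: eq_bigr => w _.
by rewrite mulr_sumr.
Qed.

(** [F] ignores the coordinate [e], so it is a combination of indicators of the other coordinates.
    These are products, to which [bE_prod] applies. *)
Lemma bE_indep e (g : bool -> R) (F : {ffun I -> bool} -> R) :
  (forall w w' : {ffun I -> bool}, (forall f, f != e -> w f = w' f) -> F w = F w') ->
  bE (fun w => g (w e) * F w) = bE (fun w => g (w e)) * bE F.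
Proof.
move=> Fe.
(* Indicator of agreeing with [w'] off [e]; the factor at [e] keeps only the representative [w']
   that is false there. *)
pose G w' (f : I) (b : bool) : R := if f == e then (~~ w' e)%:R else (b == w' f)%:R.
have FE w : F w = \sum_w' F w' * \prod_f G w' f (w f).
  pose w0 : {ffun I -> bool} := [ffun f => if f == e then false else w f].
  rewrite (bigD1 w0) //= (_ : \prod_f _ = 1) ?mulr1; last first.
    by apply: big1 => f _; rewrite /G !ffunE eqxx; case: eqP => //; rewrite eqxx.
  rewrite big1 ?addr0 => [|w' w'N].
    by apply: Fe => f fe; rewrite ffunE (negbTE fe).
  have [f fP] : exists f, G w' f (w f) = 0.
    have [f fP] : exists f, w' f != w0 f.
      apply/existsP; rewrite -[X in is_true X]negbK negb_exists.
      by apply: contra w'N => /forallP h; apply/eqP/ffunP => f; have := h f;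
         rewrite negbK => /eqP.
    exists f; move: fP; rewrite /G ffunE; have [->|fe] := eqVneq f e.
      by case: (w' e).
    by rewrite eq_sym => /negbTE ->.
  by rewrite (bigD1 f) //= fP mul0r mulr0.
have -> : bE F = \sum_w' F w' * bE (fun w => \prod_f G w' f (w f)).
  by rewrite (eq_bE FE) bE_sum; apply: eq_bigr => w' _; rewrite bEZ.
rewrite mulr_sumr.
transitivity (bE (fun w => \sum_w' F w' * (g (w e) * \prod_f G w' f (w f)))).
  apply: eq_bE => w; rewrite FE mulr_sumr; apply: eq_bigr => w' _; by rewrite mulrCA.
rewrite bE_sum; apply: eq_bigr => w' _; rewrite bEZ [in RHS]mulrCA; congr (_ * _).
have -> : bE (fun w => g (w e) * \prod_f G w' f (w f)) =
   bE (fun w => \prod_f ((if f == e then g (w f) else 1) * G w' f (w f))).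
  apply: eq_bE => w; rewrite big_split /=; congr (_ * _).
  by rewrite -big_mkcond big_pred1_eq.
have -> : bE (fun w => g (w e)) =
   bE (fun w => \prod_f (if f == e then g (w f) else 1)).
  by apply: eq_bE => w; rewrite -big_mkcond big_pred1_eq.
rewrite (bE_prod (fun f b => (if f == e then g b else 1) * G w' f b)).
rewrite (bE_prod (fun f b => (if f == e then g b else 1))) (bE_prod (G w')).
rewrite -big_split /=; apply: eq_bigr => f _.
by rewrite /G; case: eqP => [->|_]; ring.
Qed.

(** For two different sets, a coordinate in their symmetric difference contributes a factor of mean
    zero. *)
Lemma bE_sum_orth (c : {set I} -> R) (P : pred {set I}) :
  bE (fun w => (\sum_(F : {set I} | P F) c F * \prod_(e in F) bet e w) ^+ 2) =
  \sum_(F : {set I} | P F) c F ^+ 2 * \prod_(e in F) sig e.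
Proof.
have orth (F G : {set I}) : bE (fun w => (\prod_(e in F) bet e w) * \prod_(e in G) bet e w) =
    if F == G then \prod_(e in F) sig e else 0.
  pose g e (b : bool) : R := (if e \in F then b%:R - q e else 1) * (if e \in G then b%:R - q e else 1).
  have -> : bE (fun w => (\prod_(e in F) bet e w) * \prod_(e in G) bet e w) =
            bE (fun w => \prod_e g e (w e)).
    apply: eq_bE => w; rewrite (big_mkcond (mem F)) (big_mkcond (mem G)) -big_split.
    by apply: eq_bigr.
  rewrite bE_prod; case: eqVneq => [FG|/eqP FG].
    subst G.
    rewrite [RHS]big_mkcond; apply: eq_bigr => e _; rewrite /g /sig.
    by case: (e \in F) => /=; ring.
  have [e eP] : exists e, (e \in F) != (e \in G).
    apply/existsP; rewrite -[X in is_true X]negbK negb_exists.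
    by apply/negP => /forallP h; apply: FG; apply/setP => e; have := h e;
       rewrite negbK => /eqP.
  rewrite (bigD1 e) //= [X in X * _](_ : _ = 0) ?mul0r // /g.
  by move: eP; case: (e \in F); case: (e \in G) => //= _; ring.
under eq_bE => w do rewrite expr2 mulr_suml.
rewrite bE_sum; apply: eq_bigr => F PF.
under eq_bE => w do rewrite mulr_sumr.
rewrite bE_sum (bigD1 F) //= big1 ?addr0 => [|G /andP[_ GF]].
  transitivity (bE (fun w => c F ^+ 2 * ((\prod_(e in F) bet e w) * \prod_(e in F) bet e w))).
    by apply: eq_bE => w; ring.
  by rewrite bEZ orth eqxx.
transitivity (bE (fun w => (c F * c G) * ((\prod_(e in F) bet e w) * \prod_(e in G) bet e w))).
  by apply: eq_bE => w; ring.
by rewrite bEZ orth eq_sym (negbTE GF) mulr0.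
Qed.

(** Expanding each power as [al + ga * bet], an edge of [F] contributes its linear part and any
    other edge its mean. *)
Definition hc (l : seq I) (F : {set I}) : R :=
  \prod_e (if e \in F then ga (q e) (count_mem e l) else al (q e) (count_mem e l)).

Lemma prod_seq_count (l : seq I) (f : I -> R) :
  \prod_(e <- l) f e = \prod_e f e ^+ (count_mem e l).
Proof.
elim: l => [|x l IH]; first by rewrite big_nil big1.
rewrite big_cons IH (bigD1 x) //= [RHS](bigD1 x) //= eqxx exprD expr1 mulrA.
congr (_ * _); apply: eq_bigr => i ix; by rewrite eq_sym (negbTE ix) add0n.
Qed.

Lemma hoeffding_prod (l : seq I) w :
  \prod_(e <- l) bet e w = \sum_(F : {set I}) hc l F * \prod_(e in F) bet e w.
Proof.
rewrite prod_seq_count.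
under eq_bigr => e _ do rewrite /bet bernoulli_expr addrC.
rewrite bigA_distr; apply: eq_big => [F|F _]; first by rewrite inE.
rewrite /hc [in RHS](big_mkcond (mem F)) -big_split /=; apply: eq_bigr => e _.
by case: ifP; rewrite ?mulr1.
Qed.

(** [ga q 0 = 0] forces [F] into the walk, and [al q 1 = 0] forbids single crossings off [F]. *)
Lemma hc_neq0 l F : hc l F != 0 ->
  F \subset [set e in l] /\ forall e, e \in l -> e \notin F -> (1 < count_mem e l)%N.
Proof.
move=> /prodf_neq0 h; split.
  apply/fintype.subsetP => e eF; have := h e isT; rewrite eF inE; apply: contraR => el.
  by rewrite (count_memPn el) ga0.
move=> e el eF; have := h e isT; rewrite (negbTE eF).
have : (0 < count_mem e l)%N by rewrite -has_count has_pred1.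
by case: (count_mem e l) => [|[|m]] //; rewrite al1 eqxx.
Qed.

Hypothesis q01 : forall e, 0 <= q e <= 1.

Lemma mass_ge0 w : 0 <= mass w.
Proof.
apply: prodr_ge0 => e _; rewrite /wt; have /andP[] := q01 e.
by case: (w e) => //; lra.
Qed.

Lemma bE_le F G : (forall w, F w <= G w) -> bE F <= bE G.
Proof. by move=> FG; apply: ler_sum => w _; rewrite ler_wpM2l ?mass_ge0. Qed.

Lemma norm_bE F : `|bE F| <= bE (fun w => `|F w|).
Proof.
rewrite (le_trans (ler_norm_sum _ _ _)) //; apply: ler_sum => w _.
by rewrite normrM (ger0_norm (mass_ge0 w)).
Qed.

Lemma sig_ge0 e : 0 <= sig e.
Proof. by have /andP[? ?] := q01 e; rewrite /sig mulr_ge0 // subr_ge0. Qed.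

Lemma sig_le e : sig e <= q e.
Proof. by have /andP[? ?] := q01 e; rewrite /sig; nra. Qed.

Lemma norm_hc (c : R) l F : (forall e, q e <= c) -> 
  `|hc l F| <= c ^+ #|[set e in l] :\: F|.
Proof.
move=> qc; rewrite /hc normr_prod.
have -> : c ^+ #|[set e in l] :\: F| = \prod_e (if e \in [set e in l] :\: F then c else 1).
  by rewrite -big_mkcond /= prodr_const.
apply: ler_prod => e _; rewrite normr_ge0 /= !inE; case: ifP => eF /=.
  exact: norm_ga.
case: ifP => el; last by rewrite (count_memPn (negbT el)) al0 normr1.
by rewrite (le_trans (norm_al _ _)) // -has_count has_pred1.
Qed.

End BernoulliProduct.

(** * Taylor bounds for the cosine, the sine and the exponential *)

Section TrigBounds.
Context {R : realType}.
Implicit Types (x u : R) (f : R -> R).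

(** Mean value theorem on [0, x]. Each Taylor bound below follows from an earlier one, read as the
    sign of a derivative. *)
Lemma derivative_nneg f (df : R -> R) x : (forall y : R, is_derive y (1 : R) f (df y)) ->
  f 0 = 0 -> (forall y, 0 <= y -> 0 <= df y) -> 0 <= x -> 0 <= f x.
Proof.
move=> fd f0 df0 x0.
have [|c cx] := @MVT_segment R f df 0 x x0 (fun y _ => fd y).
  apply: continuous_subspaceT => y; apply: differentiable_continuous.
  by apply/derivable1_diffP; have := fd y => -[].
rewrite f0 !subr0 => ->; apply: mulr_ge0 => //; apply: df0.
by move: cx; rewrite in_itv /= => /andP[].
Qed.

Let sin_le x : 0 <= x -> sin x <= x.
Proof.
move=> x0; rewrite -subr_ge0.
apply: (@derivative_nneg (fun y => y - sin y) (fun y => 1 - cos y)); [| |exact: x0].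
- by rewrite sin0 subr0.
- by move=> y _; rewrite subr_ge0 cos_le1.
Qed.

Lemma cos_ge_quad x : 1 - x ^+ 2 / 2 <= cos x.
Proof.
wlog x0 : x / 0 <= x => [h|].
  have [/h//|x0] := leP 0 x; have := h (- x); rewrite cosN sqrrN; apply.
  by rewrite oppr_ge0 ltW.
rewrite -subr_ge0.
apply: (@derivative_nneg (fun y => cos y - (1 - y ^+ 2 / 2)) (fun y => y - sin y)); [| | |exact: x0].
- move=> y; apply: is_derive_eq; rewrite /GRing.scale /=; lra.
- by rewrite cos0 expr0n mul0r !subr0 subrr.
- by move=> y y0; rewrite subr_ge0 sin_le.
Qed.

Let sin_ge_cube x : 0 <= x -> x - x ^+ 3 / 6 <= sin x.
Proof.
move=> x0; rewrite -subr_ge0.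
apply: (@derivative_nneg (fun y => sin y - (y - y ^+ 3 / 6))
  (fun y => cos y - (1 - y ^+ 2 / 2))); [| | |exact: x0].
- move=> y; apply: is_derive_eq; rewrite /GRing.scale /=; lra.
- by rewrite sin0 expr0n mul0r !subr0.
- by move=> y _; rewrite subr_ge0 cos_ge_quad.
Qed.

Let one_sub_cos_le x : 0 <= x -> 1 - cos x <= x.
Proof.
move=> x0; rewrite -subr_ge0.
apply: (@derivative_nneg (fun y => y - (1 - cos y)) (fun y => 1 - sin y)); [| | |exact: x0].
- move=> y; apply: is_derive_eq; lra.
- by rewrite cos0 !subrr.
- by move=> y _; rewrite subr_ge0 sin_le1.
Qed.

Let sub_sin_le x : 0 <= x -> x - sin x <= x ^+ 2 / 2.
Proof.
move=> x0; rewrite -subr_ge0.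
apply: (@derivative_nneg (fun y => y ^+ 2 / 2 - (y - sin y)) (fun y => y - (1 - cos y))); [| | |exact: x0].
- move=> y; apply: is_derive_eq; rewrite /GRing.scale /=; lra.
- by rewrite sin0 expr0n mul0r !subrr.
- by move=> y y0; rewrite subr_ge0 one_sub_cos_le.
Qed.

Lemma norm_cos_sub_quad x : `|cos x - (1 - x ^+ 2 / 2)| <= `|x| ^+ 3.
Proof.
wlog x0 : x / 0 <= x => [h|].
  have [/h//|x0] := leP 0 x; have := h (- x); rewrite cosN sqrrN normrN; apply.
  by rewrite oppr_ge0 ltW.
rewrite (ger0_norm x0) ger0_norm ?subr_ge0 ?cos_ge_quad //.
have x3 : 0 <= x ^+ 3 by rewrite exprn_ge0.
suff : 0 <= x ^+ 3 / 6 - (cos x - (1 - x ^+ 2 / 2)) by lra.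
apply: (@derivative_nneg (fun y => y ^+ 3 / 6 - (cos y - (1 - y ^+ 2 / 2)))
  (fun y => y ^+ 2 / 2 - (y - sin y))); [| | |exact: x0].
- move=> y; apply: is_derive_eq; rewrite /GRing.scale /=; lra.
- by rewrite cos0; lra.
- by move=> y y0; rewrite subr_ge0 sub_sin_le.
Qed.

Lemma norm_sin_sub x : `|sin x - x| <= `|x| ^+ 3.
Proof.
wlog x0 : x / 0 <= x => [h|].
  have [/h//|x0] := leP 0 x; have := h (- x); rewrite sinN opprK -normrN opprD opprK (normrN x).
  by apply; rewrite oppr_ge0 ltW.
rewrite (ger0_norm x0) distrC ger0_norm ?subr_ge0 ?sin_le //.
have := sin_ge_cube x0; have : 0 <= x ^+ 3 by rewrite exprn_ge0.
lra.
Qed.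

(** From (1 + u) exp(-u) <= 1 the difference is at most u (1 - exp(-u)), and 1 - exp(-u) <= u. *)
Lemma norm_expRN_sub u : 0 <= u -> `|expR (- u) - (1 - u)| <= u ^+ 2.
Proof.
move=> u0; have h := expR_ge1Dx (- u); rewrite ger0_norm; last lra.
have h2 := expR_ge1Dx u; have h3 : expR u * expR (- u) = 1 by rewrite expRxMexpNx_1.
have h4 := expR_gt0 (- u).
have : (1 + u) * expR (- u) <= 1 by nra.
have : expR (- u) <= 1 by rewrite -expR0 ler_expR oppr_le0.
nra.
Qed.

Lemma dist_cos x u : `|cos x - cos u| <= `|x - u|.
Proof.
wlog xu : x u / x <= u => [h|].
  have [/h//|/ltW/h h1] := leP x u; by rewrite distrC (distrC x).
have [|c cx] := @MVT_segment R cos (fun y => - sin y) x u xu (fun y _ => is_derive_cos y).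
  by apply: continuous_subspaceT => y; exact: continuous_cos.
move=> e; rewrite distrC e normrM distrC (distrC x u) normrN.
by rewrite ler_piMl // ler_norml sin_le1 sin_geN1.
Qed.

End TrigBounds.

(** * Lindeberg's argument for weighted sums of centred Bernoulli variables *)

Section CharacteristicFunction.
Context {R : realType} (I : finType) (q : I -> R).
Hypothesis q01 : forall e, 0 <= q e <= 1.

Let bE_wt e (g : bool -> R) : bE q (fun w => g (w e)) = q e * g true + (1 - q e) * g false.
Proof.
transitivity (bE q (fun w => \prod_f (fun f b => if f == e then g b else 1) f (w f))).
  by apply: eq_bE => w; rewrite -big_mkcond big_pred1_eq.
have /= -> := bE_prod q (fun f b => if f == e then g b else 1).
by rewrite (bigD1 e) //= eqxx big1 ?mulr1 // => f /negbTE ->; ring.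
Qed.

(** Both sides are 1 - t^2 sig / 2 up to |t|^3 sig: for the exponential, the square of t^2 sig / 2
    is that small because |t| <= 1 and sig <= 1. *)
Let bE_cos e (t : R) : `|t| <= 1 ->
  `|bE q (fun w => cos (t * bet q e w)) - expR (- (t ^+ 2 * sig q e / 2))| <= 2 * (`|t| ^+ 3 * sig q e).
Proof.
move=> t1; have /andP[q0 q1] := q01 e.
have s0 := sig_ge0 q01 e.
have s1 : sig q e <= 1 by have := sig_le q01 e; lra.
have -> : bE q (fun w => cos (t * bet q e w)) = q e * cos (t * (1 - q e)) + (1 - q e) * cos (t * (0 - q e)).
  exact: (bE_wt e (fun b => cos (t * (b%:R - q e)))).
have h1 := norm_cos_sub_quad (t * (1 - q e)).
have h2 := norm_cos_sub_quad (t * (0 - q e)).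
have u0 : 0 <= t ^+ 2 * sig q e / 2 by rewrite mulr_ge0 // mulr_ge0 // sqr_ge0.
have h3 := norm_expRN_sub u0.
have t3 : 0 <= `|t| ^+ 3 by rewrite exprn_ge0.
have h4 : (t ^+ 2 * sig q e / 2) ^+ 2 <= `|t| ^+ 3 * sig q e.
  have -> : t ^+ 2 = `|t| ^+ 2 by rewrite real_normK ?num_real.
  have -> : (`|t| ^+ 2 * sig q e / 2) ^+ 2 = `|t| ^+ 3 * sig q e * (`|t| * sig q e / 4) by field.
  by rewrite ler_piMr ?mulr_ge0 //; have := normr_ge0 t; nra.
move: h1 h2; rewrite !normrM !exprMn sub0r normrN (ger0_norm q0) (ger0_norm (_ : 0 <= 1 - q e)); last lra.
set a := cos _; set b := cos _; set T := `|t| ^+ 3 => h1 h2.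
have -> : q e * a + (1 - q e) * b - expR (- (t ^+ 2 * sig q e / 2)) =
  q e * (a - (1 - t ^+ 2 * (1 - q e) ^+ 2 / 2)) + (1 - q e) * (b - (1 - t ^+ 2 * (- q e) ^+ 2 / 2))
  - (expR (- (t ^+ 2 * sig q e / 2)) - (1 - t ^+ 2 * sig q e / 2)).
  by rewrite /sig; field.
rewrite (le_trans (ler_normB _ _)) // (le_trans (lerD (ler_normD _ _) (lexx _))) //.
rewrite !normrM (ger0_norm q0) (ger0_norm (_ : 0 <= 1 - q e)); last lra.
have g1 : q e * `|a - (1 - t ^+ 2 * (1 - q e) ^+ 2 / 2)| <= q e * (T * (1 - q e) ^+ 3) by rewrite ler_wpM2l.
have g2 : (1 - q e) * `|b - (1 - t ^+ 2 * (- q e) ^+ 2 / 2)| <= (1 - q e) * (T * q e ^+ 3).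
  by rewrite ler_wpM2l //; lra.
have g3 : q e * (T * (1 - q e) ^+ 3) + (1 - q e) * (T * q e ^+ 3) <= T * sig q e.
  have -> : q e * (T * (1 - q e) ^+ 3) + (1 - q e) * (T * q e ^+ 3) =
     T * sig q e * ((1 - q e) ^+ 2 + q e ^+ 2) by rewrite /sig; ring.
  by rewrite ler_piMr ?mulr_ge0 //; nra.
rewrite -/T in h4; lra.
Qed.

(** The linear term has mean zero, so only the cubic remainder of the sine is left. *)
Let bE_sin e (t : R) : `|bE q (fun w => sin (t * bet q e w))| <= `|t| ^+ 3 * sig q e.
Proof.
have /andP[q0 q1] := q01 e; have s0 := sig_ge0 q01 e.
have -> : bE q (fun w => sin (t * bet q e w)) = q e * sin (t * (1 - q e)) + (1 - q e) * sin (t * (0 - q e)).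
  exact: (bE_wt e (fun b => sin (t * (b%:R - q e)))).
have h1 := norm_sin_sub (t * (1 - q e)).
have h2 := norm_sin_sub (t * (0 - q e)).
have t3 : 0 <= `|t| ^+ 3 by rewrite exprn_ge0.
move: h1 h2; rewrite !normrM !exprMn sub0r normrN (ger0_norm q0) (ger0_norm (_ : 0 <= 1 - q e)); last lra.
set a := sin _; set b := sin _; set T := `|t| ^+ 3 => h1 h2.
have -> : q e * a + (1 - q e) * b =
  q e * (a - t * (1 - q e)) + (1 - q e) * (b - t * - q e) by ring.
rewrite (le_trans (ler_normD _ _)) //.
rewrite !normrM (ger0_norm q0) (ger0_norm (_ : 0 <= 1 - q e)); last lra.
have g1 : q e * `|a - t * (1 - q e)| <= q e * (T * (1 - q e) ^+ 3) by rewrite ler_wpM2l.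
have g2 : (1 - q e) * `|b - t * - q e| <= (1 - q e) * (T * q e ^+ 3).
  by rewrite ler_wpM2l //; lra.
have g3 : q e * (T * (1 - q e) ^+ 3) + (1 - q e) * (T * q e ^+ 3) <= T * sig q e.
  have -> : q e * (T * (1 - q e) ^+ 3) + (1 - q e) * (T * q e ^+ 3) =
     T * sig q e * ((1 - q e) ^+ 2 + q e ^+ 2) by rewrite /sig; ring.
  by rewrite ler_piMr ?mulr_ge0 //; nra.
lra.
Qed.

(** Summands are replaced by Gaussian factors one at a time. The addition formula splits off one
    coordinate: its mean cosine is within twice the cubic term of the Gaussian factor, and its mean
    sine is at most once that term, whence the 3. *)
Lemma bE_cos_linear (t : I -> R) (y : R) : (forall e, `|t e| <= 1) ->
  `|bE q (fun w => cos (y + \sum_e t e * bet q e w))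
    - expR (- ((\sum_e t e ^+ 2 * sig q e) / 2)) * cos y|
  <= 3 * \sum_e `|t e| ^+ 3 * sig q e.
Proof.
move=> t1; have := enum_uniq I.
rewrite -![\sum_e _]big_enum /=.
under eq_bE => w do rewrite -big_enum /=.
elim: (enum I) y => [|e r IH] y /=.
  move=> _; rewrite !big_nil mul0r oppr0 expR0 mul1r mulr0.
  by under eq_bE do rewrite big_nil addr0; rewrite bE_cst subrr normr0.
case/andP => er ur; rewrite !big_cons.
set S := \sum_(i <- r) t i ^+ 2 * _ in IH *.
set D := \sum_(i <- r) `|t i| ^+ 3 * _ in IH *.
pose G w := y + \sum_(i <- r) t i * bet q i w.
have Gind (w w' : {ffun I -> bool}) : (forall f, f != e -> w f = w' f) -> G w = G w' :> R.
  move=> h; rewrite /G; congr (_ + _); rewrite !big_seq; apply: eq_bigr => i ir.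
  by rewrite /bet h //; apply: contra er => /eqP <-.
set c := bE q (fun w => cos (t e * bet q e w)).
set s := bE q (fun w => sin (t e * bet q e w)).
have -> : bE q (fun w => cos (y + \sum_(i <- e :: r) t i * bet q i w)) =
   c * bE q (fun w => cos (G w)) - s * bE q (fun w => sin (G w)).
  rewrite /c /s -(bE_indep q (e := e) (fun b => cos (t e * (b%:R - q e)))); last first.
    by move=> w w' /Gind ->.
  rewrite -(bE_indep q (e := e) (fun b => sin (t e * (b%:R - q e)))); last first.
    by move=> w w' /Gind ->.
  by rewrite -bEB; apply: eq_bE => w; rewrite big_cons addrCA cosD.
have sG : `|bE q (fun w => sin (G w))| <= 1.
  rewrite (le_trans (norm_bE q01 _)) // -[leRHS](bE_cst q) bE_le // => w.
  by rewrite ler_norml sin_le1 sin_geN1.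
have hc := bE_cos e (t1 e); have hs := bE_sin e (t e); rewrite -/c -/s in hc hs.
have /= IHy := IH y ur.
have -> : c * bE q (fun w => cos (G w)) - s * bE q (fun w => sin (G w)) -
   expR (- ((t e ^+ 2 * sig q e + S) / 2)) * cos y =
   c * (bE q (fun w => cos (G w)) - expR (- (S / 2)) * cos y)
   + (c - expR (- (t e ^+ 2 * sig q e / 2))) * (expR (- (S / 2)) * cos y)
   - s * bE q (fun w => sin (G w)).
  by rewrite mulrDl opprD expRD; ring.
have c1 : `|c| <= 1.
  rewrite (le_trans (norm_bE q01 _)) // -[leRHS](bE_cst q) bE_le // => w.
  by rewrite ler_norml cos_le1 cos_geN1.
have e1 : `|expR (- (S / 2)) * cos y| <= 1.
  rewrite normrM mulr_ile1 ?normr_ge0 // ?ler_norml ?cos_le1 ?cos_geN1 //.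
  rewrite (le_trans _ (expR_ge0 _)) ?oppr_le0 //= -expR0 ler_expR oppr_le0.
  by rewrite mulr_ge0 // sumr_ge0 // => i _; rewrite mulr_ge0 ?sqr_ge0 ?sig_ge0.
rewrite (le_trans (ler_normB _ _)) // (le_trans (lerD (ler_normD _ _) (lexx _))) //.
rewrite !normrM.
have g1 : `|c| * `|bE q (fun w => cos (G w)) - expR (- (S / 2)) * cos y| <= 3 * D.
  by rewrite -[leRHS]mul1r ler_pM.
have g2 : `|c - expR (- (t e ^+ 2 * sig q e / 2))| * (`|expR (- (S / 2))| * `|cos y|) <=
   2 * (`|t e| ^+ 3 * sig q e) by rewrite -[leRHS]mulr1 -normrM ler_pM.
have g3 : `|s| * `|bE q (fun w => sin (G w))| <= `|t e| ^+ 3 * sig q e.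
  by rewrite -[leRHS]mulr1 ler_pM.
lra.
Qed.

End CharacteristicFunction.

(** * Hoeffding decomposition of the trace *)

(** An unordered pair is represented with its smaller vertex first. A loop becomes (i, i), which
    will receive probability 0. *)
Definition edge n (i j : 'I_n) : 'I_n * 'I_n := if (i < j)%N then (i, j) else (j, i).

Lemma edgeC n (i j : 'I_n) : edge i j = edge j i.
Proof. by rewrite /edge; case: ltngtP => // /val_inj ->. Qed.

Lemma edge_inj n (x y x' y' : 'I_n) :
  edge x y = edge x' y' -> (x = x' /\ y = y') \/ (x = y' /\ y = x').
Proof. by rewrite /edge; case: ifP => _; case: ifP => _ [-> ->]; auto. Qed.

Lemma big_tuple_cons (R : Type) (idx : R) (op : Monoid.com_law idx) (T : finType) k
    (F : k.+1.-tuple T -> R) :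
  \big[op/idx]_(w : k.+1.-tuple T) F w =
  \big[op/idx]_(x : T) \big[op/idx]_(s : k.-tuple T) F (cons_tuple x s).
Proof.
rewrite pair_big /= (reindex (fun p : T * k.-tuple T => cons_tuple p.1 p.2)) //=.
exists (fun w => (thead w, behead_tuple w)) => [[x s] _|w _] /=.
  by congr pair; apply: val_inj.
by rewrite [RHS]tuple_eta; apply: val_inj.
Qed.

Lemma trace_expr_walks (R : realType) n (M : 'M[R]_n) (g : 'I_n * 'I_n -> R) k :
  (forall i j, M i j = g (edge i j)) ->
  \tr (M ^+ k.+1) = \sum_(w : k.+1.-tuple 'I_n) \prod_(e <- cedges (@edge n) w) g e.
Proof.
move=> Mg.
have entry m x y : (M ^+ m.+1) x y =
    \sum_(s : m.-tuple 'I_n) \prod_(e <- pairmap (@edge n) x (rcons s y)) g e.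
  elim: m x y => [|m IH] x y.
    rewrite expr1 Mg (big_pred1 [tuple]) => [|s]; first by rewrite big_seq1.
    exact/esym/eqP/tuple0.
  rewrite exprS mxE big_tuple_cons; apply: eq_bigr => z _.
  rewrite IH mulr_sumr; apply: eq_bigr => s _.
  by rewrite /= big_cons Mg.
rewrite /mxtrace big_tuple_cons; apply: eq_bigr => x _.
by rewrite entry; apply: eq_bigr.
Qed.

(** Induction step of 1 - sum r_j <= prod (1 - r_j) <= 1, used in [prod_one_sub]. *)
Lemma one_sub_step (R : realFieldType) (S x r d : R) :
  1 - x <= S -> S <= 1 -> 0 <= r -> r <= 1 -> r <= d -> 1 - (d + x) <= (1 - r) * S <= 1.
Proof. by move=> *; apply/andP; split; [nra|have [?|?] := leP 0 S; nra]. Qed.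

Lemma tree_edges_le_size (a b k : nat) : (2 * a = k)%N -> a = (1 + b)%N -> (b <= k)%N.
Proof. lia. Qed.

Lemma leading_exponents (a b v k : nat) : (2 * a = k)%N -> a = (1 + b)%N -> v = a.+1 ->
  (2 * b <= k - 2)%N /\ (v - 2 <= b)%N.
Proof. lia. Qed.

Lemma short_walk_exponents (e k : nat) : (2 * e <= k)%N -> (2 * e)%N <> k -> (0 < e)%N ->
  (2 * (e - 1) <= k - 3)%N /\ (k - 2 = (k - 3).+1)%N.
Proof. lia. Qed.

Lemma cyclic_walk_exponents (e k v : nat) : (1 < e)%N -> (2 * e <= k + 1)%N -> (v <= e)%N ->
  (2 * (e - 1) <= k - 1)%N /\ ((v - 2).+1 <= e - 1)%N.
Proof. lia. Qed.

Section Counting.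
Variables (R : realType) (n : nat).
Hypothesis n0 : (0 < n)%N.
Local Notation V := 'I_n.

Definition walk_const k : R := \sum_(v < k.+1) (v ^ k)%:R.

Lemma walk_const_ge0 k : 0 <= walk_const k.
Proof. by apply: sumr_ge0 => v _; rewrite ler0n. Qed.

Lemma card_vset_size (w : seq V) : (#|vset w| <= size w)%N.
Proof. by rewrite cardsE card_size. Qed.

(** By [card_walks] at most n^(v - |V0|) v^k walks with v vertices pass through [V0], so the weight
    cancels the choice of the free vertices. Bounding a sum over walks is thereby reduced to a
    pointwise comparison with this weight. *)
Lemma sum_walks k (V0 : {set V}) :
  \sum_(w : k.-tuple V | V0 \subset vset w) n%:R^-1 ^+ (#|vset w| - #|V0|) <= walk_const k.
Proof.
rewrite (partition_big (fun w : k.-tuple V => inord #|vset w| : 'I_k.+1) xpredT) //=.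
apply: ler_sum => v _.
have h (w : k.-tuple V) : (inord #|vset w| == v) = (#|vset w| == v :> nat).
  by rewrite -val_eqE /= inordK // ltnS -[X in (_ <= X)%N](size_tuple w) card_vset_size.
rewrite (eq_bigr (fun=> n%:R^-1 ^+ (v - #|V0|))) => [|w /andP[_]]; last first.
  by rewrite h => /eqP ->.
rewrite sumr_const -[leLHS]mulr_natl.
have nn : 0 < n%:R :> R by rewrite ltr0n.
rewrite exprVn -ler_pdivlMr ?invr_gt0 ?exprn_gt0 // invrK -natrX -natrM ler_nat.
rewrite mulnC -[X in (X ^ _ * _)%N](card_ord n).
apply: leq_trans (card_walks k v V0); rewrite subset_leq_card //.
by apply/fintype.subsetP => w; rewrite !inE unfold_in h.
Qed.

End Counting.

Section WalkBounds.
Variables (R : realType) (n : nat) (p C s : R) (q : 'I_n * 'I_n -> R).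
Hypothesis n0 : (0 < n)%N.
Hypothesis p01 : 0 < p < 1.
Hypothesis C1 : 1 <= C.
Hypothesis s1 : 1 <= s.
Hypothesis s2 : s ^+ 2 = n%:R * p.
Hypothesis q01 : forall e, 0 <= q e <= 1.
Hypothesis qC : forall e, q e <= C * p.
Local Notation V := 'I_n.
Local Notation I := ('I_n * 'I_n)%type.
Local Notation cedges := (cedges (@edge n)).
Local Notation eset := (eset (@edge n)).
Local Notation endpoints := (endpoints (@edge n)).
Local Notation hcw := (fun w F => hc q (cedges w) F).

Definition tree_like (w : seq V) := #|vset w| == #|eset w|.+1.
Definition leading (w : seq V) := tree_like w && (2 * #|eset w| == size w)%N.
Definition hoeff k (F : {set I}) : R := \sum_(w : k.-tuple V) hcw w F.

Let p0 : 0 < p. Proof. by case/andP: p01. Qed.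
Let nR : 0 < n%:R :> R. Proof. by rewrite ltr0n. Qed.
Let n1 : 1 <= n%:R :> R. Proof. by rewrite ler1n. Qed.
Let s0 : 0 < s. Proof. by rewrite (lt_le_trans ltr01). Qed.
Let Cp0 : 0 <= C * p. Proof. by rewrite mulr_ge0 ?ltW // (lt_le_trans ltr01). Qed.

(** As n >= 1 and s >= 1, exponents may be raised: n^c p^a <= (np)^a = s^(2a) <= s^b. *)
Let np_le a b c : (2 * a <= b)%N -> (c <= a)%N -> n%:R ^+ c * p ^+ a <= s ^+ b.
Proof.
move=> ab ca; rewrite (@le_trans _ _ ((n%:R * p) ^+ a)) //.
  by rewrite exprMn ler_wpM2r ?exprn_ge0 ?(ltW p0) // ler_weXn2l.
by rewrite -s2 -exprM ler_weXn2l.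
Qed.

(** A nonzero coefficient means that [F] lies on the walk and that every other edge is crossed at
    least twice, so the counts for closed walks apply. *)
Let good_facts k (w : k.-tuple V) (F : {set I}) : F != finset.set0 -> hcw w F != 0 ->
  [/\ F \subset eset w, #|eset w :\: F| = (#|eset w| - #|F|)%N,
      (#|vset w| - #|endpoints F| <= #|eset w| - #|F|)%N, (2 * #|eset w| <= k + #|F|)%N &
      endpoints F \subset vset w /\ (#|F| <= #|eset w| <= k)%N].
Proof.
move=> F0 /hc_neq0[FE h].
have cE : #|eset w :\: F| = (#|eset w| - #|F|)%N by rewrite cardsD (finset.setIidPr FE).
have h1 := card_vset_endpoints (@edgeC n) (@edge_inj n) F0 FE.
rewrite cE in h1.
have FEc := subset_leq_card FE.
split => //; last split.
- by rewrite leq_subLR.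
- rewrite -[X in (_ <= X + _)%N](size_tuple w); apply: double_card_eset => //.
  by move=> e; rewrite inE; exact: h.
- apply/fintype.subsetP => x; rewrite !inE => /existsP[y xy].
  have : edge x y \in cedges w by move/fintype.subsetP/(_ _ xy): FE; rewrite inE.
  by case/mem_cedges => a [b [aw bw /edge_inj[] [-> _]]].
- rewrite FEc /= /eset cardsE (leq_trans (card_size _)) // size_cedges.
  by rewrite size_tuple.
Qed.

Let tree_e k (w : k.-tuple V) : tree_like w -> (2 * #|eset w| <= k)%N.
Proof.
by move=> /eqP /(double_card_eset_tree (@edge_inj n)); rewrite size_tuple.
Qed.

Let nontree_v (w : seq V) : ~~ tree_like w -> (#|vset w| <= #|eset w|)%N.
Proof.
rewrite /tree_like => wt; have := card_vset (@edge_inj n) w.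
by rewrite leq_eqVlt (negbTE wt) /= ltnS.
Qed.

Let norm_hcw k (w : k.-tuple V) (F : {set I}) : F != finset.set0 -> hcw w F != 0 ->
  `|hcw w F| <= C ^+ k * p ^+ (#|eset w| - #|F|).
Proof.
move=> F0 h; have [_ cE _ _ [_ /andP[_ ek]]] := good_facts F0 h.
have := @norm_hc R _ q q01 (C * p) (cedges w) F qC; rewrite -/(eset w) cE exprMn => /le_trans; apply.
by rewrite ler_wpM2r ?exprn_ge0 ?(ltW p0) // ler_weXn2l // (leq_trans _ ek) // leq_subr.
Qed.

(* Splitting [p ^ (e - f)] against the count [n ^ (v - v(F))] of the walks through [F]. *)
Let pow_count (a b v : nat) (X : R) : 0 <= X -> n%:R ^+ v * p ^+ a <= X ->
  p ^+ a <= X * n%:R^-1 ^+ v.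
Proof. by move=> X0; rewrite exprVn ler_pdivlMr ?exprn_gt0 // mulrC. Qed.

Let sum_good k (P : pred (k.-tuple V)) (F : {set I}) (X : R) : 0 <= X ->
  (forall w, P w -> endpoints F \subset vset w /\
     `|hcw w F| <= X * n%:R^-1 ^+ (#|vset w| - #|endpoints F|)) ->
  \sum_(w | P w) `|hcw w F| <= X * walk_const R k.
Proof.
move=> X0 h; have := sum_walks R n0 k (endpoints F).
move=> /(ler_wpM2l X0); apply: le_trans; rewrite mulr_sumr.
rewrite (le_trans (ler_sum _ (fun w Pw => (h w Pw).2))) //.
rewrite [leRHS](bigID P) /= -[leLHS]addr0 lerD //.
  rewrite le_eqVlt; apply/orP; left; apply/eqP; apply: eq_bigl => w.
  by rewrite andbC; case Pw : (P w) => //=; rewrite (h w Pw).1.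
by apply: sumr_ge0 => w _; rewrite mulr_ge0 // exprn_ge0 // invr_ge0 ltW.
Qed.

Let hsum k (tr : bool) (F : {set I}) : R :=
  \sum_(w : k.-tuple V | (tree_like w == tr) && (hcw w F != 0)) `|hcw w F|.

Let Ck0 k : 0 <= C ^+ k. Proof. by rewrite exprn_ge0 // (le_trans ler01). Qed.

(** With e edges on the walk and f in [F], a tree has 2e <= k, so 2(e - f) <= k - 2f. *)
Let hsum_tree k (F : {set I}) : F != finset.set0 ->
  hsum k true F <= C ^+ k * s ^+ (k - 2 * #|F|) * walk_const R k.
Proof.
move=> F0; apply: sum_good => [|w /andP[/eqP wt h]].
  by rewrite mulr_ge0 // exprn_ge0 ?ltW.
have [_ _ vF e2 [sV /andP[fe ek]]] := good_facts F0 h; split => //.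
rewrite (le_trans (norm_hcw F0 h)) // -mulrA ler_wpM2l //.
apply: pow_count => //; first by rewrite exprn_ge0 ?ltW.
have te := tree_e wt; apply: np_le => //; clear -te fe; lia.
Qed.

(** Here the bound is 2e <= k + f, so that 2(e - f) <= k - f: one power of [s] per edge of [F]
    instead of two. *)
Let hsum_nontree k (F : {set I}) : F != finset.set0 ->
  hsum k false F <= C ^+ k * s ^+ (k - #|F|) * walk_const R k.
Proof.
move=> F0; apply: sum_good => [|w /andP[/eqP wt h]].
  by rewrite mulr_ge0 // exprn_ge0 ?ltW.
have [_ _ vF e2 [sV /andP[fe ek]]] := good_facts F0 h; split => //.
rewrite (le_trans (norm_hcw F0 h)) // -mulrA ler_wpM2l //.
apply: pow_count => //; first by rewrite exprn_ge0 ?ltW.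
apply: np_le => //; clear -e2 fe; lia.
Qed.

Let hsum_ge0 k t F : 0 <= hsum k t F.
Proof. exact: sumr_ge0. Qed.

Let hoeff_le k F : `|hoeff k F| <= hsum k true F + hsum k false F.
Proof.
rewrite (le_trans (ler_norm_sum _ _ _)) //.
rewrite (bigID (fun w : k.-tuple V => tree_like w)) /= lerD //.
  rewrite /hsum (bigID (fun w : k.-tuple V => hcw w F != 0)) /=.
  rewrite [X in _ + X]big1 ?addr0 => [|w /andP[_]]; last first.
    by rewrite negbK => /eqP ->; rewrite normr0.
  by rewrite le_eqVlt; apply/orP; left; apply/eqP/eq_bigl => w; rewrite eqb_id.
rewrite /hsum (bigID (fun w : k.-tuple V => hcw w F != 0)) /=.
rewrite [X in _ + X]big1 ?addr0 => [|w /andP[_]]; last first.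
  by rewrite negbK => /eqP ->; rewrite normr0.
by rewrite le_eqVlt; apply/orP; left; apply/eqP/eq_bigl => w; rewrite eqbF_neg.
Qed.

(** In the square one factor gets its uniform bound and the other is expanded over walks. After
    exchanging the sums, each walk meets at most 2^k sets [F], all subsets of its edges, and
    [sum_walks] with no prescribed vertex concludes. The three factors C^k come from the two
    coefficients and from (C p)^|F|. *)
Let hsum_sq k (t : bool) (X : nat -> R) : (forall f, 0 <= X f) ->
  (forall F : {set I}, F != finset.set0 -> hsum k t F <= C ^+ k * X #|F| * walk_const R k) ->
  forall Y : R, 0 <= Y ->
  (forall (w : k.-tuple V) (F : {set I}), (1 < #|F|)%N -> hcw w F != 0 -> tree_like w = t ->
     X #|F| * p ^+ #|eset w| <= Y * n%:R^-1 ^+ #|vset w|) ->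
  \sum_(F : {set I} | (1 < #|F|)%N) hsum k t F ^+ 2 * (C * p) ^+ #|F|
   <= (2 ^ k)%:R * C ^+ (3 * k) * walk_const R k ^+ 2 * Y.
Proof.
move=> X0 hX Y Y0 hY.
have W0 := walk_const_ge0 R k.
apply: (@le_trans _ _ (\sum_(F : {set I} | (1 < #|F|)%N)
  \sum_(w : k.-tuple V | (tree_like w == t) && (hcw w F != 0))
     C ^+ (3 * k) * walk_const R k * (Y * n%:R^-1 ^+ #|vset w|))).
  apply: ler_sum => F F1.
  have F0 : F != finset.set0 by rewrite -card_gt0 ltnW.
  rewrite expr2 {2}/hsum mulr_sumr mulr_suml; apply: ler_sum => w /andP[/eqP wt h].
  have [_ _ _ _ [_ /andP[fe ek]]] := good_facts F0 h.
  have -> : C ^+ (3 * k) = C ^+ k * C ^+ k * C ^+ k by rewrite -!exprD; congr (_ ^+ _); clear; lia.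
  apply: (@le_trans _ _ ((C ^+ k * X #|F| * walk_const R k) *
     (C ^+ k * p ^+ (#|eset w| - #|F|)) * (C * p) ^+ #|F|)).
    by rewrite ler_wpM2r ?exprn_ge0 // ler_pM ?hX ?norm_hcw.
  rewrite exprMn.
  have -> : C ^+ k * X #|F| * walk_const R k * (C ^+ k * p ^+ (#|eset w| - #|F|)) *
    (C ^+ #|F| * p ^+ #|F|) = C ^+ k * C ^+ k * walk_const R k * (C ^+ #|F| *
     (X #|F| * (p ^+ (#|eset w| - #|F|) * p ^+ #|F|))) by ring.
  rewrite -(exprD p) subnK //.
  have -> : C ^+ k * C ^+ k * C ^+ k * walk_const R k * (Y * n%:R^-1 ^+ #|vset w|) =
    C ^+ k * C ^+ k * walk_const R k * (C ^+ k * (Y * n%:R^-1 ^+ #|vset w|)) by ring.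
  rewrite ler_wpM2l ?mulr_ge0 //.
  have ge0 : 0 <= X #|F| * p ^+ #|eset w| by rewrite mulr_ge0 // exprn_ge0 // ltW.
  rewrite ler_pM ?hY // ?exprn_ge0 // ?(le_trans ler01) //.
  by rewrite ler_weXn2l // (leq_trans fe).
rewrite (exchange_big_dep (fun w : k.-tuple V => tree_like w == t)) /=; last first.
  by move=> F w _ /andP[].
apply: (@le_trans _ _ (\sum_(w : k.-tuple V | finset.set0 \subset vset w)
   (2 ^ k)%:R * (C ^+ (3 * k) * walk_const R k * Y) * n%:R^-1 ^+ (#|vset w| - #|@finset.set0 V|))).
  rewrite [leRHS](eq_bigl xpredT) => [|w]; last by rewrite finset.sub0set.
  rewrite [leRHS](bigID (fun w : k.-tuple V => tree_like w == t)) /= -[leLHS]addr0 lerD //; last first.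
    apply: sumr_ge0 => w _; rewrite !mulr_ge0 ?exprn_ge0 ?invr_ge0 ?ler0n //.
    by rewrite (le_trans ler01).
  apply: ler_sum => w wt; rewrite cards0 subn0 sumr_const.
  set T := C ^+ (3 * k) * walk_const R k * (Y * _).
  have T0 : 0 <= T.
    by rewrite !mulr_ge0 ?exprn_ge0 ?invr_ge0 ?ler0n // (le_trans ler01).
  rewrite [leRHS](_ : _ = (2 ^ k)%:R * T); last by rewrite /T; ring.
  rewrite -[leLHS]mulr_natl ler_wpM2r // ler_nat.
  have ek : (#|eset w| <= k)%N.
    by rewrite /eset cardsE (leq_trans (card_size _)) // size_cedges size_tuple.
  apply: leq_trans (_ : 2 ^ #|eset w| <= _)%N; last by rewrite leq_exp2l.
  rewrite -card_powerset subset_leq_card //; apply/fintype.subsetP => F.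
  by rewrite unfold_in inE => /andP[_ /andP[_ /hc_neq0[]]].
rewrite -mulr_sumr expr2.
have -> : (2 ^ k)%:R * C ^+ (3 * k) * (walk_const R k * walk_const R k) * Y =
  (2 ^ k)%:R * (C ^+ (3 * k) * walk_const R k * Y) * walk_const R k by ring.
rewrite ler_wpM2l ?sum_walks // !mulr_ge0 ?exprn_ge0 ?ler0n //.
by rewrite (le_trans ler01).
Qed.

(** Multiplied by p / s^(2k), this bound becomes p + 1/(np). For non-tree walks v <= e gives s^(2k)
    directly. Trees have v = e + 1, and the excess n is paid for by n p s^2 = s^4, which fits since
    [F] has at least two edges. *)
Lemma hoeffding_remainder k :
  \sum_(F : {set I} | (1 < #|F|)%N) hoeff k F ^+ 2 * \prod_(e in F) sig q e <=
  2 * ((2 ^ k)%:R * C ^+ (3 * k) * walk_const R k ^+ 2) * s ^+ (2 * k) * (1 + (p * (n%:R * p))^-1).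
Proof.
have sF (F : {set I}) : \prod_(e in F) sig q e <= (C * p) ^+ #|F|.
  rewrite -prodr_const; apply: ler_prod => e _; rewrite sig_ge0 //=.
  exact: le_trans (sig_le q01 e) (qC e).
have sF0 (F : {set I}) : 0 <= \prod_(e in F) sig q e.
  by apply: prodr_ge0 => e _; rewrite sig_ge0.
apply: (@le_trans _ _ (\sum_(F : {set I} | (1 < #|F|)%N)
   (2 * (hsum k true F ^+ 2 * (C * p) ^+ #|F|) + 2 * (hsum k false F ^+ 2 * (C * p) ^+ #|F|)))).
  apply: ler_sum => F _; rewrite -mulrDr -mulrDl mulrA ler_pM ?sqr_ge0 //.
  rewrite -real_normK ?num_real //.
  apply: (@le_trans _ _ ((hsum k true F + hsum k false F) ^+ 2)).
    by rewrite lerXn2r ?nnegrE ?addr_ge0.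
  by have := sqr_ge0 (hsum k true F - hsum k false F); lra.
rewrite big_split /= -!mulr_sumr.
set K := (2 ^ k)%:R * _ * _.
have h1 : \sum_(F : {set I} | (1 < #|F|)%N) hsum k true F ^+ 2 * (C * p) ^+ #|F| <=
   K * (s ^+ (2 * k) * (p * (n%:R * p))^-1).
  apply: (@hsum_sq k true (fun f => s ^+ (k - 2 * f))).
  - by move=> f; rewrite exprn_ge0 ?ltW.
  - exact: hsum_tree.
  - by rewrite mulr_ge0 ?exprn_ge0 ?invr_ge0 ?mulr_ge0 ?ltW.
  move=> w F F1 h wt.
  have F0 : F != finset.set0 by rewrite -card_gt0 ltnW.
  have [_ _ _ _ [_ /andP[fe ek]]] := good_facts F0 h.
  have te := tree_e wt; move: wt => /eqP ->.
  rewrite exprVn ler_pdivlMr ?exprn_gt0 // exprS.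
  have -> : s ^+ (k - 2 * #|F|) * p ^+ #|eset w| * (n%:R * n%:R ^+ #|eset w|) =
    n%:R * s ^+ (k - 2 * #|F|) * (n%:R * p) ^+ #|eset w| by rewrite exprMn; ring.
  rewrite -s2 -exprM ler_pdivlMr ?mulr_gt0 ?exprn_gt0 //.
  have -> : n%:R * s ^+ (k - 2 * #|F|) * s ^+ (2 * #|eset w|) * (p * s ^+ 2) =
    s ^+ (k - 2 * #|F|) * s ^+ (2 * #|eset w|) * (s ^+ 2 * (n%:R * p)) by ring.
  by rewrite -s2 -!exprD ler_weXn2l //; clear -te fe F1; lia.
have h2 : \sum_(F : {set I} | (1 < #|F|)%N) hsum k false F ^+ 2 * (C * p) ^+ #|F| <=
   K * s ^+ (2 * k).
  apply: (@hsum_sq k false (fun f => s ^+ (k - f))).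
  - by move=> f; rewrite exprn_ge0 ?ltW.
  - exact: hsum_nontree.
  - by rewrite exprn_ge0 ?ltW.
  move=> w F F1 h wt.
  have F0 : F != finset.set0 by rewrite -card_gt0 ltnW.
  have [_ _ _ e2 [_ /andP[fe ek]]] := good_facts F0 h.
  have ve := nontree_v (negbT wt).
  rewrite exprVn ler_pdivlMr ?exprn_gt0 // -mulrA [X in _ * X]mulrC.
  apply: (@le_trans _ _ (s ^+ (k - #|F|) * s ^+ (2 * #|eset w|))).
    by rewrite ler_wpM2l ?exprn_ge0 ?(ltW s0) // np_le.
  by rewrite -exprD ler_weXn2l //; clear -e2 fe; lia.
have -> : 2 * K * s ^+ (2 * k) * (1 + (p * (n%:R * p))^-1) =
  2 * (K * (s ^+ (2 * k) * (p * (n%:R * p))^-1)) + 2 * (K * s ^+ (2 * k)) by ring.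
by rewrite lerD // ler_wpM2l.
Qed.

(** Main part of [hoeff k [set e]]: only walks crossing every edge exactly twice are kept, with
    [ga q 2] replaced by 1 and [al q 2] by q. *)
Definition lead k (e : I) : R :=
  \sum_(w : k.-tuple V | leading w && (e \in eset w)) \prod_(f in eset w :\ e) q f.

Let endpoints1 (e : I) : (e.1 < e.2)%N -> #|endpoints [set e]| = 2%N.
Proof.
move=> e12; have eE : e = edge e.1 e.2 by rewrite /edge e12 -surjective_pairing.
have -> : endpoints [set e] = [set e.1; e.2].
  apply/setP => x; rewrite !inE; apply/existsP/orP.
    by move=> [y]; rewrite !inE {1}eE => /eqP /edge_inj[] [-> _]; rewrite eqxx; auto.
  move=> [/eqP ->|/eqP ->]; [exists e.2|exists e.1]; rewrite inE; last rewrite edgeC.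
    by rewrite -eE.
  by rewrite -eE.
rewrite cards2; suff -> : e.1 != e.2 by [].
by apply: contraTneq e12 => ->; rewrite ltnn.
Qed.

Let leading_e k (w : k.-tuple V) : leading w -> (2 * #|eset w| = k)%N.
Proof. by case/andP => _ /eqP; rewrite size_tuple. Qed.

Let leading_count k (w : k.-tuple V) (f : I) : leading w -> f \in eset w ->
  count_mem f (cedges w) = 2%N.
Proof.
move=> wl fw; have /andP[wt e2] := wl.
have ge2 e : e \in eset w -> (2 <= count_mem e (cedges w))%N.
  move=> ew; have : (0 < count_mem e (cedges w))%N.
    by rewrite -has_count has_pred1; rewrite inE in ew.
  rewrite leq_eqVlt => /orP[/eqP/esym/(card_vset_simple (@edge_inj n))|//].
  by case/andP: wl => /eqP ->; rewrite ltnn.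
apply/eqP; rewrite eqn_leq ge2 // andbT leqNgt; apply/negP => f3.
have l1 := leading_e wl; have l2 := cardsD1 f (eset w); rewrite fw /= in l2.
have := sum_count_eset (@edge n) w; rewrite size_tuple (bigD1 f) //=.
have : (\sum_(i in eset w | i != f) 2 <= \sum_(i in eset w | i != f) count_mem i (cedges w))%N.
  by apply: leq_sum => i /andP[/ge2].
rewrite sum_nat_const.
have -> : #|[pred i in eset w | i != f]| = #|eset w :\ f|.
  by apply: eq_card => i; rewrite !inE andbC.
exact: leading_count_aux l1 l2 f3.
Qed.

Let hc_leading k (w : k.-tuple V) (e : I) : leading w -> e \in eset w ->
  hcw w [set e] = (1 - 2 * q e) * \prod_(f in eset w :\ e) (q f * (1 - q f)).
Proof.
move=> wl ew; rewrite /hc (bigD1 e) //= set11 leading_count // ga2; congr (_ * _).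
rewrite [RHS]big_mkcond [LHS]big_mkcond /=; apply: eq_bigr => f _.
rewrite !inE; case: (eqVneq f e) => //= _.
by case: ifP => fw; [rewrite leading_count ?inE // al2|rewrite (count_memPn _) ?al0 // fw].
Qed.

Let leading_sum k (e : I) : (e.1 < e.2)%N ->
  \sum_(w : k.-tuple V | leading w && (e \in eset w)) p ^+ #|eset w :\ e| <=
  s ^+ (k - 2) * walk_const R k.
Proof.
move=> e12; have := sum_walks R n0 k (endpoints [set e]).
have S0 : 0 <= s ^+ (k - 2) by rewrite exprn_ge0 ?ltW.
move=> /(ler_wpM2l S0); apply: le_trans; rewrite mulr_sumr.
rewrite [leRHS](bigID (fun w : k.-tuple V => leading w && (e \in eset w))) /= -[leLHS]addr0 lerD //; last first.
  by apply: sumr_ge0 => w _; rewrite mulr_ge0 // exprn_ge0 // invr_ge0 ltW.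
have sub (w : k.-tuple V) : e \in eset w -> endpoints [set e] \subset vset w.
  move=> ew; apply/fintype.subsetP => x; rewrite !inE => /existsP[y].
  rewrite inE => /eqP xy; rewrite -xy inE in ew.
  by case/mem_cedges : ew => a [b [aw bw /edge_inj[] [-> _]]].
rewrite [leRHS](eq_bigl (fun w : k.-tuple V => leading w && (e \in eset w))) => [|w]; last first.
  by rewrite andbC; case: (boolP (e \in eset w)) => [/sub ->|]; rewrite ?andbT ?andbF.
apply: ler_sum => w /andP[wl ew]; rewrite (endpoints1 e12).
apply: pow_count => //; have wt := (andP wl).1; have le := leading_e wl.
have ce := cardsD1 e (eset w); rewrite ew /= in ce.
move/eqP: wt => wt; have [h1 h2] := leading_exponents le ce wt; exact: np_le.
Qed.

Let prod_one_sub (J : finType) (A : {set J}) (r : J -> R) (d : R) :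
  (forall j, 0 <= r j <= 1) -> (forall j, r j <= d) ->
  1 - #|A|%:R * d <= \prod_(j in A) (1 - r j) <= 1.
Proof.
move=> r01 rd; rewrite -sum1_card natr_sum mulr_suml.
rewrite (eq_bigr (fun=> d)) => [|j _]; last by rewrite mul1r.
have d0 : J -> 0 <= d := fun j => le_trans (proj1 (andP (r01 j))) (rd j).
elim/big_rec2 : _ => [|j S x _ /andP[h1 h2]]; first by rewrite subr0 lexx.
have /andP[r0 r1] := r01 j; have := rd j.
exact: one_sub_step.
Qed.

(** Two errors. A non-leading walk loses a factor 1/s if it is tree-like with fewer than k/2 edges,
    and a factor p if it has a cycle. On leading walks (1 - 2q) prod q (1 - q) differs from prod q
    by a relative error (k + 2) C p. The constant k + 3 adds the two. *)
Lemma hoeff_lead k (e : I) : (1 < k)%N -> (e.1 < e.2)%N ->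
  `|hoeff k [set e] - lead k e| <=
  (k.+3%:R * C ^+ k.+1 * walk_const R k) * (s ^+ (k - 2) * (p + s^-1)).
Proof.
move=> k1 e12.
have W0 := walk_const_ge0 R k.
have F0 : [set e] != finset.set0 by rewrite -card_gt0 cards1.
have hcN (w : k.-tuple V) : e \notin eset w -> hcw w [set e] = 0.
  move=> ew; apply: contraNeq ew => /hc_neq0[/fintype.subsetP h _].
  by have := h e (set11 e).
have -> : hoeff k [set e] - lead k e =
   \sum_(w : k.-tuple V | ~~ (leading w && (e \in eset w))) hcw w [set e] +
   \sum_(w : k.-tuple V | leading w && (e \in eset w))
     (hcw w [set e] - \prod_(f in eset w :\ e) q f).
  by rewrite /hoeff (bigID (fun w : k.-tuple V => leading w && (e \in eset w))) /= sumrB /lead; ring.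
have si : 0 < s^-1 by rewrite invr_gt0.
have sk : 0 <= s ^+ (k - 2) by rewrite exprn_ge0 ?ltW.
have X0 : 0 <= C ^+ k * (s ^+ (k - 2) * (p + s^-1)).
  by rewrite !mulr_ge0 // addr_ge0 ?ltW.
have b1 : `|\sum_(w : k.-tuple V | ~~ (leading w && (e \in eset w))) hcw w [set e]| <=
   C ^+ k * (s ^+ (k - 2) * (p + s^-1)) * walk_const R k.
  rewrite (le_trans (ler_norm_sum _ _ _)) //.
  rewrite (bigID (fun w : k.-tuple V => hcw w [set e] != 0)) /= [X in _ + X]big1 ?addr0; last first.
    by move=> w /andP[_]; rewrite negbK => /eqP ->; rewrite normr0.
  apply: sum_good => // w /andP[nl h].
  have [FE _ vF e2 [sV /andP[fe ek]]] := good_facts F0 h; split => //.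
  rewrite (le_trans (norm_hcw F0 h)) // -[leRHS]mulrA ler_wpM2l //.
  have ew : e \in eset w by move/fintype.subsetP: FE; apply; rewrite set11.
  rewrite ew andbT in nl; move: vF e2 fe; rewrite (endpoints1 e12) cards1 => vF e2 fe.
  apply: pow_count => //; first by rewrite mulr_ge0 // addr_ge0 ?ltW.
  have [wt|wt] := boolP (tree_like w).
    have te := tree_e wt; rewrite /leading wt /= size_tuple in nl; move/eqP: nl => nl.
    apply: (@le_trans _ _ (s ^+ (k - 3))); first by apply: np_le => //; have [] := short_walk_exponents te nl fe.
    have -> : s ^+ (k - 3) = s ^+ (k - 2) * s^-1.
      rewrite (_ : (k - 2 = (k - 3).+1)%N); last by have [] := short_walk_exponents te nl fe.
      by rewrite exprSr -mulrA divff ?mulr1 // gt_eqF.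
    by rewrite ler_wpM2l // lerDr ltW.
  have ve := nontree_v wt.
  apply: (@le_trans _ _ (s ^+ (k - 2) * p)); last by rewrite ler_wpM2l // lerDl ltW.
  (* Both ends of [e] are visited, so v <= e excludes a walk with a single edge. *)
  have [e1|e1] := leqP #|eset w| 1.
    have v2 : (2 <= #|vset w|)%N by rewrite -(endpoints1 e12) subset_leq_card.
    by exfalso; clear -e1 v2 ve; lia.
  rewrite -(ler_pM2l nR) mulrA -exprS.
  apply: (@le_trans _ _ (s ^+ (k - 1))); first by have [? ?] := cyclic_walk_exponents e1 e2 ve; apply: np_le.
  rewrite mulrCA -s2 -exprD ler_weXn2l //; clear -k1; lia.
have b2 : `|\sum_(w : k.-tuple V | leading w && (e \in eset w))
     (hcw w [set e] - \prod_(f in eset w :\ e) q f)| <=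
    (k.+2%:R * C ^+ k.+1 * p) * (s ^+ (k - 2) * walk_const R k).
  rewrite (le_trans (ler_norm_sum _ _ _)) //.
  have Y0 : 0 <= k.+2%:R * C ^+ k.+1 * p by rewrite !mulr_ge0 ?ler0n ?(ltW p0).
  apply: le_trans (ler_wpM2l Y0 (leading_sum k e12)).
  rewrite mulr_sumr; apply: ler_sum => w /andP[wl ew].
  rewrite hc_leading // big_split /= mulrCA -{2}[\prod_(f in _) q f]mulr1 -mulrBr normrM.
  have ck : (#|eset w :\ e| <= k)%N.
    have l1 := leading_e wl; have l2 := cardsD1 e (eset w); rewrite ew /= in l2; exact: tree_edges_le_size l1 l2.
  have qle : `|\prod_(f in eset w :\ e) q f| <= C ^+ k * p ^+ #|eset w :\ e|.
    rewrite normr_prod; apply: (@le_trans _ _ (\prod_(f in eset w :\ e) (C * p))).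
      apply: ler_prod => f _; rewrite normr_ge0 ger0_norm ?qC //.
      by case/andP: (q01 f).
    by rewrite prodr_const exprMn ler_wpM2r ?exprn_ge0 ?(ltW p0) // ler_weXn2l.
  have -> : k.+2%:R * C ^+ k.+1 * p * p ^+ #|eset w :\ e| =
    C ^+ k * p ^+ #|eset w :\ e| * (k.+2%:R * (C * p)) by rewrite exprS; ring.
  apply: ler_pM => //.
  have /andP[h1 h2] := prod_one_sub (eset w :\ e) q01 qC.
  have ckR : #|eset w :\ e|%:R <= k%:R :> R by rewrite ler_nat.
  have /andP[g1 g2] := q01 e; have g3 := qC e.
  have hk : #|eset w :\ e|%:R * (C * p) <= k%:R * (C * p) by rewrite ler_wpM2r.
  move: h1 h2; set x := \prod_(_ in _) _ => h1 h2.
  have g4 : k.+2%:R * (C * p) = k%:R * (C * p) + 2 * (C * p) by rewrite -addn2 natrD mulrDl.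
  rewrite ler_norml g4; apply/andP; split; last by nra.
  by nra.
rewrite (le_trans (ler_normD _ _)) //.
apply: (le_trans (lerD b1 b2)).
have CC : C ^+ k <= C ^+ k.+1 by rewrite ler_weXn2l.
have -> : k.+3%:R = 1 + k.+2%:R :> R by rewrite -nat1r.
have Ck1 := Ck0 k.+1.
have t1 : C ^+ k * (s ^+ (k - 2) * (p + s^-1)) * walk_const R k <=
  C ^+ k.+1 * (s ^+ (k - 2) * (p + s^-1)) * walk_const R k.
  by rewrite ler_wpM2r // ler_wpM2r // mulr_ge0 // addr_ge0 // ltW.
have t2 : k.+2%:R * C ^+ k.+1 * p * (s ^+ (k - 2) * walk_const R k) <=
  k.+2%:R * C ^+ k.+1 * (p + s^-1) * (s ^+ (k - 2) * walk_const R k).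
  rewrite ler_wpM2r ?mulr_ge0 // ler_wpM2l ?mulr_ge0 ?ler0n // lerDl.
  by rewrite ltW.
rewrite (le_trans (lerD t1 t2)) // le_eqVlt; apply/orP; left; apply/eqP; ring.
Qed.

End WalkBounds.

(** * Labelled plane trees *)

HB.instance Definition _ := gen_eqMixin cat.

(** Enumeration by nesting depth. A tree with m edges has depth at most m, so filtering [catsd m] by
    size misses none. *)
Fixpoint catsd d := if d is d'.+1 then
  CE :: [seq CN l r | l <- catsd d', r <- catsd d'] else [:: CE].
Definition cats m := [seq c <- catsd m | size (cw c) == m].

Lemma mem_cats m c : (c \in cats m) = (size (cw c) == m).
Proof.
rewrite mem_filter; case: eqP => //= <-.
suff h c' d : (size (cw c') <= d)%N -> c' \in catsd d by exact: h.
elim: c' d => [|l IHl r IHr] [|d] //=; rewrite ?inE ?eqxx //.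
rewrite size_cat !size_map ltnS => h; apply/orP; right; apply: allpairs_f.
  by apply: IHl; lia.
by apply: IHr; lia.
Qed.

Lemma cats_uniq m : uniq (cats m).
Proof.
apply: filter_uniq; elim: m => [//|m IH] /=; apply/andP; split.
  by apply/negP => /allpairsP[[l r] []].
by apply: allpairs_uniq => //= -[l r] [l' r'] _ _ [-> ->].
Qed.

Section Labels.
Variables (V : eqType) (m : nat).
Implicit Types (L : m.+1.-tuple V) (c : cat).

(** A labelling is stored as the tuple of labels along [words c], so that all trees with m edges
    share one index type; off [words c] a default is returned. *)
Definition lab L c u : V := nth (thead L) L (index u (words c)).

Lemma lab_inj L c : size (cw c) = m -> uniq L -> {in words c &, injective (lab L c)}.
Proof.
move=> sc uL u v uc vc /eqP; rewrite /lab nth_uniq ?size_tuple //.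
- by move/eqP => h; rewrite -(nth_index [::] uc) h nth_index.
- by move: uc; rewrite -index_mem /= sc.
- by move: vc; rewrite -index_mem /= sc.
Qed.

Lemma size_map_words (f : seq nat -> V) c : size (cw c) = m -> size (map f (words c)) == m.+1.
Proof. by move=> sc; rewrite size_map /= sc. Qed.

Definition labtuple (f : seq nat -> V) c (sc : size (cw c) = m) : m.+1.-tuple V :=
  Tuple (size_map_words f sc).

Lemma lab_labtuple f c sc : {in words c, lab (@labtuple f c sc) c =1 f}.
Proof. by move=> u uc; rewrite /lab (nth_map [::]) ?index_mem // nth_index. Qed.

Lemma labtuple_lab L c sc : @labtuple (lab L c) c sc = L.
Proof.
apply: eq_from_tnth => i; rewrite !(tnth_nth (thead L)).
have iw : (i < size (words c))%N by rewrite /= sc.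
rewrite -[tval _]/(map (lab L c) (words c)) (nth_map [::]) // /lab index_uniq //.
exact: words_uniq.
Qed.

Lemma eq_labels L L' c : size (cw c) = m -> {in words c, lab L c =1 lab L' c} -> L = L'.
Proof.
move=> sc h; rewrite -(labtuple_lab L sc) -(labtuple_lab L' sc); apply: val_inj => /=.
rewrite h ?mem_head //; congr (_ :: _); apply/eq_in_map => u uc; apply: h.
by rewrite inE uc orbT.
Qed.

End Labels.

Lemma eq_walk (V : finType) (f g : seq nat -> V) c : {in words c, f =1 g} -> walk f c = walk g c.
Proof.
move=> fg; rewrite /walk fg ?mem_head //; congr belast.
by apply/eq_in_map => u /mem_ctr; exact: fg.
Qed.

Lemma walk_inj (V : finType) (f g : seq nat -> V) c c' : c <> CE -> c' <> CE ->
  {in words c &, injective f} -> {in words c' &, injective g} ->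
  walk f c = walk g c' -> c = c' /\ {in words c, f =1 g}.
Proof.
move=> cN cN' fi gi; have [s [wE sE]] := walk_path f cN; have [s' [wE' sE']] := walk_path g cN'.
rewrite wE wE' => -[e0 es].
by apply: contour_inj => //; rewrite -sE -sE' e0 es.
Qed.

Local Open Scope ring_scope.

Section LeadingSum.
Variables (R : realType) (n : nat).
Local Notation V := 'I_n.
Local Notation eset := (eset (@edge n)).

(** Reindexing by a bijection: [leading_walk] provides the tree with its injective labelling,
    [walk_inj] their uniqueness, and [walk_leading] shows that each such pair gives a leading
    walk. *)
Lemma sum_leading m (F : seq V -> R) : (0 < m)%N ->
  \sum_(w : (2 * m).-tuple V | leading w) F w =
  \sum_(c <- cats m) \sum_(L : m.+1.-tuple V | uniq L) F (walk (lab L c) c).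
Proof.
move=> m0.
have catN c : c \in cats m -> c <> CE by move=> cm ce; move: cm m0; rewrite mem_cats ce /= => /eqP <-.
transitivity (\sum_(x <- map (@tval (2 * m) V) (seq.filter (fun w : (2 * m).-tuple V => leading w) (enum {: (2 * m).-tuple V}))) F x).
  by rewrite big_map big_filter big_enum_cond.
transitivity (\sum_(x <- [seq walk (lab L c) c | c <- cats m,
    L <- seq.filter (fun L : m.+1.-tuple V => uniq L) (enum {: m.+1.-tuple V})]) F x); last first.
  rewrite big_allpairs_dep /=; apply: eq_bigr => c _.
  by rewrite big_filter big_enum_cond.
apply: perm_big; apply: uniq_perm.
- by rewrite (map_inj_uniq val_inj) filter_uniq ?enum_uniq.
- apply: allpairs_uniq; [exact: cats_uniq|exact/filter_uniq/enum_uniq|].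
  move=> [c L] [c' L'] /=.
  move=> /allpairsP[[c1 L1] [/= cm Lu [-> ->]]] /allpairsP[[c2 L2] [/= cm' Lu' [-> ->]]].
  move: Lu Lu'; rewrite !mem_filter => /andP[Lu _] /andP[Lu' _].
  have sc : size (cw c1) = m by apply/eqP; rewrite -mem_cats.
  have sc' : size (cw c2) = m by apply/eqP; rewrite -mem_cats.
  case/(walk_inj (catN _ cm) (catN _ cm') (lab_inj sc Lu) (lab_inj sc' Lu')) => cc h.
  by subst c2; rewrite (eq_labels sc h).
move=> x; apply/mapP/allpairsP => [[w]|[[c L] /= [cm]]]; rewrite mem_filter => /andP[].
  move=> wl _ ->; case/andP: (wl) => /eqP vE /eqP sE.
  have [|c [f [cN wE fi]]] := leading_walk (@edgeC n) (@edge_inj n) _ vE sE.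
    by rewrite -size_eq0 size_tuple; lia.
  have sc : size (cw c) = m.
    by have := size_walk f c; rewrite -wE size_tuple; lia.
  exists (c, labtuple f sc); split => /=; first by rewrite mem_cats sc.
    rewrite mem_filter mem_enum andbT /= -[_ && _]/(uniq (map f (words c))).
    by rewrite map_inj_in_uniq ?words_uniq.
  by rewrite wE; apply: eq_walk => u uc; rewrite lab_labtuple.
move=> uL _ ->; have sc : size (cw c) = m by apply/eqP; rewrite -mem_cats.
have sw : size (walk (lab L c) c) == (2 * m)%N by rewrite size_walk sc.
have [h1 h2 _ _] := walk_leading (@edgeC n) (@edge_inj n) (catN _ cm) (lab_inj sc uL).
exists (Tuple sw) => //; rewrite mem_filter mem_enum andbT /leading /tree_like /=.
by rewrite h1 h2 !eqxx.
Qed.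

Variable S : 'M[R]_n.
Hypothesis Ssym : forall i j, S i j = S j i.

(* Weight of the labellings of the plane tree [c] for which the edge below [v] is [(i, j)]. *)
Definition edge_weight m c v i j : R :=
  \sum_(L : m.+1.-tuple V | (lab L c (behead v) == i) && (lab L c v == j))
    \prod_(u <- cw c | u != v) S (lab L c u) (lab L c (behead u)).

Definition total_weight m i j : R := \sum_(c <- cats m) \sum_(v <- cw c) edge_weight m c v i j.

Variables (p C : R).
Hypothesis p0 : 0 <= p.
Hypothesis SC : forall i j, 0 <= S i j <= C.
Hypothesis C1 : 1 <= C.
Hypothesis n0 : (0 < n)%N.
Let q (e : V * V) : R := if (e.1 < e.2)%N then p * S e.1 e.2 else 0.

Let q_edge i j : i != j -> q (edge i j) = p * S i j.
Proof.
move=> nij; rewrite /edge; case: (ltngtP i j) => [ij|ji|/val_inj ijE]; rewrite /q /=.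
- by rewrite ij.
- by rewrite ji Ssym.
- by rewrite ijE eqxx in nij.
Qed.

Let behead_word c u : u \in cw c -> behead u \in words c.
Proof.
move=> uc; have [_ h _] := words_plane c.
case: u uc => [|a u] uc; first by rewrite mem_head.
by apply: (h a); rewrite inE uc orbT.
Qed.

Let behead_neq (c : cat) u : u \in cw c -> behead u != u.
Proof.
move=> /cw_neq0; case: u => [//|a u] _; apply/eqP => /(congr1 size) /=; lia.
Qed.

Let cw_words c u : u \in cw c -> u \in words c.
Proof. by rewrite inE => ->; rewrite orbT. Qed.

(** The labelling being injective, at most one tree edge [v] carries the label {i, j}, in one of two
    orientations; so summing over [v] just tests whether the walk crosses it. The m - 1 other edges
    give p^(m - 1). *)
Lemma lead_labels m (i j : V) : (0 < m)%N -> (i < j)%N ->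
  lead q (2 * m) (i, j) = p ^+ m.-1 *
  \sum_(c <- cats m) \sum_(v <- cw c) \sum_(L : m.+1.-tuple V | uniq L &&
     ((lab L c (behead v), lab L c v) \in [:: (i, j); (j, i)]))
    \prod_(u <- cw c | u != v) S (lab L c u) (lab L c (behead u)).
Proof.
move=> m0 ij; rewrite /lead.
transitivity (\sum_(w : (2 * m).-tuple V | leading w)
  (if (i, j) \in eset w then \prod_(f in eset w :\ (i, j)) q f else 0)).
  by rewrite big_mkcondr.
rewrite (@sum_leading m (fun w => if (i, j) \in eset w then \prod_(f in eset w :\ (i, j)) q f else 0) m0).
rewrite mulr_sumr big_seq [RHS]big_seq; apply: eq_bigr => c cm.
have sc : size (cw c) = m by apply/eqP; rewrite -mem_cats.
have cN : c <> CE by move=> ce; move: cm m0; rewrite mem_cats ce /= => /eqP <-.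
rewrite mulr_sumr.
transitivity (\sum_(v <- cw c) \sum_(L : m.+1.-tuple V | uniq L)
   (if edge (lab L c v) (lab L c (behead v)) == (i, j) then
    p ^+ m.-1 * \prod_(u <- cw c | u != v) S (lab L c u) (lab L c (behead u)) else 0)); last first.
  apply: eq_bigr => v _; rewrite -big_mkcondr mulr_sumr; apply: eq_bigl => L.
  congr (_ && _); rewrite !inE !xpair_eqE /edge; move: (lab _ _ v) (lab _ _ (behead v)) => a b.
  case: ltngtP => [ab|ab|/val_inj ->]; rewrite xpair_eqE.
  - rewrite [(b == i) && _](_ : _ = false) /=; first by rewrite andbC.
    by apply/negP => /andP[/eqP bi /eqP aj]; move: ab ij; rewrite bi aj; lia.
  - rewrite [(b == j) && _](_ : _ = false) ?orbF //.
    by apply/negP => /andP[/eqP bi /eqP aj]; move: ab ij; rewrite bi aj; lia.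
  - by rewrite [(b == j) && _]andbC orbb.
rewrite exchange_big /=; apply: eq_bigr => L uL.
have fi := lab_inj sc uL; set f := lab L c in fi *.
have [_ _ eE un] := walk_leading (@edgeC n) (@edge_inj n) cN fi.
have ti := tedges_inj (@edge_inj n) fi.
have mt e : (e \in eset (walk f c)) = (e \in tedges (@edge n) f c) by rewrite eE inE.
rewrite mt; case: ifP => [/mapP[v vc ijE]|ijN]; last first.
  rewrite big_seq big1 // => v vc; case: eqP => // vE.
  by move: ijN; rewrite -vE (map_f (fun u => edge (f u) (f (behead u)))).
have ucw : uniq (cw c) by have := words_uniq c => /andP[].
rewrite (bigD1_seq v) //= -ijE eqxx [X in _ = _ + X]big_seq_cond [X in _ = _ + X]big1 ?addr0; last first.
  move=> u /andP[uc uv]; case: eqP => // /esym; rewrite ijE => /(ti _ _ vc uc) vu.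
  by rewrite vu eqxx in uv.
have -> : \prod_(g in eset (walk f c) :\ (i, j)) q g =
   \prod_(g <- tedges (@edge n) f c | g != (i, j)) q g.
  rewrite -[RHS]big_filter [RHS]big_uniq ?filter_uniq //; apply: eq_bigl => g.
  by rewrite in_setD1 mt mem_filter.
rewrite big_map big_seq_cond.
rewrite (eq_bigl (fun u => (u \in cw c) && (u != v))); last first.
  move=> u; have [uc|] := boolP (u \in cw c) => //=.
  rewrite ijE; congr negb; apply/eqP/eqP => [/(ti _ _ uc vc) //|-> //].
rewrite -big_seq_cond.
have -> : \prod_(u <- cw c | u != v) q (edge (f u) (f (behead u))) =
  \prod_(u <- cw c | u != v) (p * S (f u) (f (behead u))).
  rewrite big_seq_cond [RHS]big_seq_cond; apply: eq_bigr => u /andP[uc _].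
  rewrite q_edge //; apply: contra (behead_neq uc) => /eqP h.
  by apply/eqP/fi; rewrite ?behead_word ?cw_words.
rewrite big_split /= big_const_seq iter_mulr_1; congr (_ ^+ _ * _).
have := count_predC (pred1 v) (cw c); rewrite (count_uniq_mem _ ucw) vc sc add1n.
by move=> <-.
Qed.

Let prod_le c m v L : size (cw c) = m -> v \in cw c ->
  0 <= \prod_(u <- cw c | u != v) S (lab (L : m.+1.-tuple V) c u) (lab L c (behead u)) <= C ^+ m.
Proof.
move=> sc vc; apply/andP; split.
  by apply: prodr_ge0 => u _; have /andP[] := SC (lab L c u) (lab L c (behead u)).
apply: (@le_trans _ _ (\prod_(u <- cw c | u != v) C)).
  apply: ler_prod => u _; exact: SC.
rewrite big_const_seq iter_mulr_1 ler_weXn2l // -sc.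
exact: count_size.
Qed.

(** Overwriting the two prescribed coordinates by an arbitrary pair is injective in the tuple and
    the pair. *)
Lemma card_two_labels m (a b : 'I_m) (i j : V) : a != b ->
  (#|[set L : m.-tuple V | (tnth L a == i) && (tnth L b == j)]| * n ^ 2 <= n ^ m)%N.
Proof.
move=> ab; rewrite -[X in (_ * X ^ 2)%N](card_ord n) -[X in (_ <= X ^ _)%N](card_ord n).
rewrite -!card_tuple -cardsT -cardsX -cardsT.
pose f (x : m.-tuple V * 2.-tuple V) : m.-tuple V := [tuple if t == a then tnth x.2 ord0
   else if t == b then tnth x.2 ord_max else tnth x.1 t | t < m].
rewrite -(@card_in_imset _ _ f) ?subset_leq_card ?finset.subsetT //.
move=> [L t] [L' t']; rewrite !inE /= !andbT => /andP[/eqP La /eqP Lb] /andP[/eqP La' /eqP Lb'] e.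
have h x : tnth (f (L, t)) x = tnth (f (L', t')) x by rewrite e.
congr pair; apply: eq_from_tnth => x.
  have := h x; rewrite !tnth_mktuple; case: eqP => [->|_]; first by rewrite La La'.
  by case: eqP => [->|_ //]; rewrite Lb Lb'.
case: x => -[|[|//]] x.
  have := h a; rewrite !tnth_mktuple eqxx.
  by rewrite (_ : Ordinal x = ord0) //; apply: val_inj.
have := h b; rewrite !tnth_mktuple eq_sym (negbTE ab) eqxx.
by rewrite (_ : Ordinal x = ord_max) //; apply: val_inj.
Qed.

Let index_ord c m u : size (cw c) = m -> u \in words c -> (index u (words c) < m.+1)%N.
Proof. by move=> sc; rewrite -index_mem /= sc. Qed.

Let cond_tnth c m u (sc : size (cw c) = m) (uc : u \in words c) (L : m.+1.-tuple V) :
  lab L c u = tnth L (Ordinal (index_ord sc uc)).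
Proof. by rewrite (tnth_nth (thead L)). Qed.

Let nR : 0 < n%:R :> R. Proof. by rewrite ltr0n. Qed.

Let cC m : 0 <= C ^+ m. Proof. by rewrite exprn_ge0 // (le_trans ler01). Qed.

Lemma edge_weight_le m c v i j : (0 < m)%N -> size (cw c) = m -> v \in cw c ->
  0 <= edge_weight m c v i j <= C ^+ m * n%:R ^+ m.-1.
Proof.
move=> m0 sc vc; apply/andP; split.
  by apply: sumr_ge0 => L _; have /andP[] := prod_le L sc vc.
apply: (@le_trans _ _ (\sum_(L : m.+1.-tuple V | (lab L c (behead v) == i) && (lab L c v == j)) C ^+ m)).
  by apply: ler_sum => L _; have /andP[] := prod_le L sc vc.
rewrite sumr_const -[leLHS]mulr_natr ler_wpM2l // -natrX ler_nat.
have ab : Ordinal (index_ord sc (behead_word vc)) != Ordinal (index_ord sc (cw_words vc)).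
  apply: contra (behead_neq vc) => /eqP h; apply/eqP.
  have {}h : index (behead v) (words c) = index v (words c) := congr1 val h.
  by rewrite -(nth_index [::] (behead_word vc)) h nth_index ?cw_words.
have := card_two_labels i j ab.
have mE : m.+1 = (m.-1 + 2)%N by lia.
rewrite [X in (_ <= n ^ X)%N -> _]mE expnD leq_pmul2r ?expn_gt0 ?n0 //.
apply: leq_trans; apply: subset_leq_card; apply/fintype.subsetP => L.
by rewrite unfold_in inE -!cond_tnth.
Qed.

Definition weight_const m : R := \sum_(c <- cats m) \sum_(v <- cw c) C ^+ m.

Lemma weight_const_ge0 m : 0 <= weight_const m.
Proof. by apply: sumr_ge0 => c _; apply: sumr_ge0 => v _. Qed.

Lemma total_weight_le m i j : (0 < m)%N ->
  0 <= total_weight m i j <= weight_const m * n%:R ^+ m.-1.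
Proof.
move=> m0; apply/andP; split.
  rewrite /total_weight big_seq; apply: sumr_ge0 => c; rewrite mem_cats => /eqP sc.
  by rewrite big_seq; apply: sumr_ge0 => v vc; have /andP[] := edge_weight_le i j m0 sc vc.
rewrite mulr_suml; rewrite /total_weight big_seq [leRHS]big_seq; apply: ler_sum => c.
rewrite mem_cats => /eqP sc; rewrite mulr_suml big_seq [leRHS]big_seq.
by apply: ler_sum => v vc; have /andP[] := edge_weight_le i j m0 sc vc.
Qed.

(** A labelling with a repetition has at most m distinct labels, i and j among them; one free vertex
    is missing, which gains a factor 1/n. *)
Let nonuniq_count m c v i j : (0 < m)%N -> size (cw c) = m -> v \in cw c -> i != j ->
  \sum_(L : m.+1.-tuple V | ~~ uniq L && ((lab L c (behead v) == i) && (lab L c v == j))) (1 : R) <=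
  walk_const R m.+1 * (n%:R ^+ m.-1 / n%:R).
Proof.
move=> m0 sc vc ij.
have := sum_walks R n0 m.+1 [set i; j]; rewrite cards2 ij /= => h.
have X0 : 0 <= n%:R ^+ m.-1 / n%:R :> R by rewrite divr_ge0 ?exprn_ge0 ?ler0n.
apply: le_trans (ler_wpM2r X0 h); rewrite mulr_suml.
rewrite [leRHS](bigID (fun L : m.+1.-tuple V => ~~ uniq L && ((lab L c (behead v) == i) && (lab L c v == j)))) /=.
rewrite -[leLHS]addr0 lerD //; last first.
  by apply: sumr_ge0 => L _; rewrite mulr_ge0 // exprn_ge0 // invr_ge0 ltW.
have sub (L : m.+1.-tuple V) : (lab L c (behead v) == i) && (lab L c v == j) -> [set i; j] \subset vset L.
  move=> /andP[/eqP <- /eqP <-]; apply/fintype.subsetP => x; rewrite !inE => /orP[] /eqP ->.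
    by rewrite (cond_tnth sc (behead_word vc)) mem_tnth.
  by rewrite (cond_tnth sc (cw_words vc)) mem_tnth.
rewrite [leRHS](eq_bigl (fun L : m.+1.-tuple V => ~~ uniq L && ((lab L c (behead v) == i) && (lab L c v == j)))); last first.
  move=> L; rewrite andbC; case: (boolP (~~ uniq L && _)) => //= /andP[_ /sub ->] //.
apply: ler_sum => L /andP[nu /sub sL].
have v2 : (2 <= #|vset L|)%N by have := subset_leq_card sL; rewrite cards2 ij.
have vm : (#|vset L| <= m)%N.
  have h1 := card_vset_size L; rewrite size_tuple leq_eqVlt in h1.
  case/orP: h1 => [/eqP h1|//]; exfalso; move/negP: nu; apply; apply/card_uniqP.
  by move: h1; rewrite /vset cardsE => ->; rewrite size_tuple.
rewrite exprVn mulrC -mulrA -invfM -exprS ler_pdivlMr ?exprn_gt0 // mul1r.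
have aux v' m' : (2 <= v')%N -> (v' <= m')%N -> ((v' - 2).+1 <= m'.-1)%N by clear; lia.
by rewrite ler_weXn2l ?ler1n // aux.
Qed.

(** Injectivity of the labelling is dropped at relative cost 1/n. The two orientations of the edge
    {i, j} become the two total weights. *)
Lemma lead_total_weight m (i j : V) : (0 < m)%N -> (i < j)%N ->
  `|lead q (2 * m) (i, j) - p ^+ m.-1 * (total_weight m i j + total_weight m j i)| <=
  (2 * weight_const m * walk_const R m.+1) * ((n%:R * p) ^+ m.-1 / n%:R).
Proof.
move=> m0 ij; rewrite lead_labels // -mulrBr normrM (ger0_norm (exprn_ge0 _ p0)).
rewrite exprMn (mulrC (n%:R ^+ _)) -[p ^+ _ * _ / _]mulrA [leRHS]mulrCA ler_wpM2l ?exprn_ge0 //.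
rewrite /total_weight -big_split /= -sumrB.
set X := n%:R ^+ m.-1 / n%:R.
have -> : 2 * weight_const m * walk_const R m.+1 * X =
  \sum_(c <- cats m) \sum_(v <- cw c) C ^+ m * (2 * (walk_const R m.+1 * X)).
  rewrite (_ : 2 * _ * _ * _ = weight_const m * (2 * (walk_const R m.+1 * X))); last by ring.
  by rewrite mulr_suml; apply: eq_bigr => c _; rewrite mulr_suml.
rewrite (le_trans (ler_norm_sum _ _ _)) // big_seq [leRHS]big_seq; apply: ler_sum => c.
rewrite mem_cats => /eqP sc; rewrite -big_split /= -sumrB.
rewrite (le_trans (ler_norm_sum _ _ _)) // big_seq [leRHS]big_seq; apply: ler_sum => v vc.
have nij : i != j by apply: contraTneq ij => ->; rewrite ltnn.
set G := fun L : m.+1.-tuple V => \prod_(u <- cw c | u != v) S (lab L c u) (lab L c (behead u)).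
have split_uniq a b : edge_weight m c v a b =
   \sum_(L : m.+1.-tuple V | uniq L && ((lab L c (behead v) == a) && (lab L c v == b))) G L +
   \sum_(L : m.+1.-tuple V | ~~ uniq L && ((lab L c (behead v) == a) && (lab L c v == b))) G L.
  rewrite /edge_weight (bigID (fun L : m.+1.-tuple V => uniq L)) /=.
  by congr (_ + _); apply: eq_bigl => L; rewrite andbC.
have -> : \sum_(L : m.+1.-tuple V | uniq L &&
     ((lab L c (behead v), lab L c v) \in [:: (i, j); (j, i)])) G L =
   \sum_(L : m.+1.-tuple V | uniq L && ((lab L c (behead v) == i) && (lab L c v == j))) G L +
   \sum_(L : m.+1.-tuple V | uniq L && ((lab L c (behead v) == j) && (lab L c v == i))) G L.
  rewrite (bigID (fun L : m.+1.-tuple V => lab L c v == j)) /=; congr (_ + _); apply: eq_bigl => L.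
    rewrite !inE !xpair_eqE -andbA; congr (_ && _); move: (lab L c (behead v)) (lab L c v) => a b.
    case: (eqVneq b j) => [->|_]; rewrite ?andbT ?andbF //.
    by rewrite [j == i]eq_sym (negbTE nij) andbF orbF.
  rewrite !inE !xpair_eqE -andbA; congr (_ && _); move: (lab L c (behead v)) (lab L c v) => a b.
  case: (eqVneq b j) => [->|_]; rewrite ?andbT ?andbF //=.
  by rewrite [j == i]eq_sym (negbTE nij) andbF.
rewrite !split_uniq.
set A := \sum_(L | _) _; set B := \sum_(L | _) _; set D := \sum_(L | _) _; set E := \sum_(L | _) _.
have bnd a b : a != b -> 0 <= \sum_(L : m.+1.-tuple V | ~~ uniq L && ((lab L c (behead v) == a) && (lab L c v == b))) G L
   <= C ^+ m * (walk_const R m.+1 * X).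
  move=> nab; apply/andP; split.
    by apply: sumr_ge0 => L _; have /andP[] := prod_le L sc vc.
  apply: le_trans (ler_wpM2l (cC m) (nonuniq_count m0 sc vc nab)).
  by rewrite mulr_sumr; apply: ler_sum => L _; rewrite mulr1; have /andP[] := prod_le L sc vc.
have /andP[d0 d1] := bnd _ _ nij; have nji : j != i by rewrite eq_sym.
have /andP[e0 e1] := bnd _ _ nji.
rewrite -/D -/E in d0 d1 e0 e1.
rewrite (_ : A + B - (A + D + (B + E)) = - (D + E)); last by ring.
rewrite normrN ger0_norm ?addr_ge0 //; lra.
Qed.

End LeadingSum.

(** * Glued trees *)

Lemma connected_walk (T : finType) (e : rel T) (x : T) (l : seq T) :
  (forall a b, connect e a b) -> exists2 s, path e x s & {subset l <= x :: s}.
Proof.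
move=> ce; elim: l => [|y l [s ps ls]]; first by exists [::].
have /connectP[t pt yt] := ce (last x s) y.
exists (s ++ t); first by rewrite cat_path ps.
move=> z; rewrite inE => /orP[/eqP ->|/ls].
  by rewrite yt -last_cat mem_last.
by rewrite !inE mem_cat => /orP[->|->] //; rewrite orbT.
Qed.

Lemma set2_inj (T : finType) (x y x' y' : T) :
  [set x; y]%SET = [set x'; y']%SET -> (x = x' /\ y = y') \/ (x = y' /\ y = x').
Proof.
move=> h.
have hx : x \in [set x'; y']%SET by rewrite -h finset.set21.
have hy : y \in [set x'; y']%SET by rewrite -h finset.set22.
have hx' : x' \in [set x; y]%SET by rewrite h finset.set21.
have hy' : y' \in [set x; y]%SET by rewrite h finset.set22.
move: hx hy hx' hy'; rewrite !inE => /orP[] /eqP -> /orP[] /eqP ->; auto.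
  by rewrite !orbb => _ /eqP ->; left.
by rewrite !orbb => /eqP -> _; left.
Qed.

(** Deleting an edge {x, y} of a cycle keeps the graph connected. A walk through all vertices then
    discovers |G| - 1 of them and so uses as many edges, by [path_discovery]; but at most |G| - 2
    are left. *)
Lemma acyclic_card (G : graph) : symmetric (@adj G) -> irreflexive (@adj G) ->
  (forall x y : G, connect (@adj G) x y) ->
  (#|[set [set p.1; p.2]%SET | p : G * G & adj p.1 p.2]%SET| < #|G|)%N -> acyclic G.
Proof.
move=> sy irr co cardE c c2; apply/negP; case: c c2 => [|x [|y [|z s]]] // _.
set e := @adj G in sy irr co cardE *.
case/andP => cyc /= /andP[xN /andP[yN _]].
pose e' a b := e a b && ([set a; b]%SET != [set x; y]%SET).
have co' a b : connect e' a b.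
  have yx : connect e' y x.
    apply/connectP; exists (rcons (z :: s) x); last by rewrite last_rcons.
    move: cyc; rewrite /cycle rcons_path /= => /andP[/and3P[exy eyz p1] ex].
    have nset a' b' : a' != x -> b' != x -> [set a'; b']%SET != [set x; y]%SET.
      move=> ax bx; apply/eqP => /setP/(_ x); rewrite !inE eqxx /=.
      by rewrite ![x == _]eq_sym (negbTE ax) (negbTE bx).
    have xz : z != x by apply: contraNneq xN => ->; rewrite !inE eqxx orbT.
    have yx' : y != x by apply: contraNneq xN => ->; rewrite !inE eqxx.
    apply/andP; split; first by rewrite /e' eyz nset.
    rewrite rcons_path; apply/andP; split; last first.
        rewrite /e' ex /=; apply/eqP => /set2_inj[[h1 h2]|[h1 _]].
        by rewrite -h2 eqxx in yx'.
      by move: yN; rewrite -h1 mem_last.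
    have xs : x \notin s by apply: contra xN; rewrite !inE => ->; rewrite !orbT.
    elim: s z xz p1 xs {xN yN ex eyz} => [//|u s IH] z xz /= /andP[ezu p1].
    rewrite inE negb_or eq_sym => /andP[ux xs].
    by rewrite {1}/e' ezu nset //=; exact: IH.
  have sy' : symmetric e' by move=> a1 b1; rewrite /e' sy finset.setUC.
  have xy : connect e' x y by rewrite (sym_connect_sym sy').
  move: (co a b); apply: connect_sub => a1 b1 eab.
  have [|ne] := eqVneq [set a1; b1]%SET [set x; y]%SET; last first.
    by apply: connect1; rewrite /e' eab ne.
  by case/set2_inj => -[-> ->].
have [t pt tall] := connected_walk x (enum G) co'.
have ed_inj := @set2_inj G.
have := path_discovery ed_inj (vis := [set x]%SET) (used := finset.set0) (x := x) t.
rewrite inE eqxx => /(_ isT) h.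
have {h} : (#|[set v in t] :\: [set x]| <=
   #|[set f in pairmap (fun a b => [set a; b]%SET) x t] :\: finset.set0|)%N.
  by apply: h => a b; rewrite finset.in_set0.
rewrite finset.setD0.
have -> : #|([set v in t] :\: [set x])%SET| = #|G|.-1.
  rewrite (_ : [set v in t]%SET :\: _ = [set~ x]%SET) ?cardsC1 //.
  apply/setP => v; rewrite !inE; case: eqVneq => //= vx.
  by have := tall v; rewrite mem_enum in_cons (negbTE vx) => /(_ isT).
set E := [set _ | _ : _ & _]%SET in cardE.
have xyE : [set x; y]%SET \in E.
  by apply/imsetP; exists (x, y) => //; rewrite inE; case/andP: cyc.
have sub : [set f in pairmap (fun a b => [set a; b]%SET) x t]%SET \subset E :\ [set x; y]%SET.
  apply/fintype.subsetP => f; rewrite inE; clear tall.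
  have aux a : path e' a t -> f \in pairmap (fun a b => [set a; b]%SET) a t -> f \in E :\ [set x; y]%SET.
    elim: t {pt} a => [//|b t IH] a /= /andP[/andP[eab nab] pt].
    rewrite inE => /orP[/eqP ->|]; last exact: IH.
    by rewrite in_setD1 nab; apply/imsetP; exists (a, b) => //; rewrite inE.
  exact: aux.
have := subset_leq_card sub; have := cardsD1 [set x; y]%SET E; rewrite xyE /=.
move=> h1 h2 h3.
have aux a b c g : (a < g -> a = 1 + b -> c <= b -> g.-1 <= c -> False)%N by clear; lia.
exact: aux cardE h1 h2 h3.
Qed.

Section Glued.
Variables (c1 c2 : cat) (v1 v2 : seq nat) (o : bool).
Hypotheses (v1c : v1 \in cw c1) (v2c : v2 \in cw c2).
Definition fwords c : {fset seq nat} := [fset u in words c]%fset.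
Definition glue : gluing := ((fwords c1, v1), (fwords c2, v2), o).
Local Notation G := (glued_tree glue).
Local Notation emb := (glue_embed glue).

Lemma in_fwords c u : (u \in fwords c) = (u \in words c).
Proof. by apply/imfsetP/idP => [[x /= xc ->]//|uc]; exists u. Qed.

Let adjE (x y : G) : adj x y = ((val x, val y) \in glue_edge glue) || ((val y, val x) \in glue_edge glue).
Proof. by []. Qed.

Let root_in : inl [::] \in glue_vert glue.
Proof. by apply/fsetUP; left; apply/imfsetP; exists [::] => //; rewrite [_ \in _]in_fwords mem_head. Qed.

Definition g0 : G := [` root_in]%fset.
(** [insubd] makes the embeddings of both word sets total, with the root of the first tree as
    default; they are meaningful on [words c1] and [words c2]. *)
Definition e1 u : G := insubd g0 (inl u : seq nat + seq nat).
Definition e2 w : G := insubd g0 (emb w).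

Let val_e1 u : u \in words c1 -> val (e1 u) = inl u.
Proof.
move=> uc; rewrite /e1 val_insubd ifT //.
by apply/fsetUP; left; apply/imfsetP; exists u => //; rewrite [_ \in _]in_fwords.
Qed.

Let val_e2 w : w \in words c2 -> val (e2 w) = emb w.
Proof.
move=> uc; rewrite /e2 val_insubd ifT //.
by apply/fsetUP; right; apply/imfsetP; exists w => //; rewrite [_ \in _]in_fwords.
Qed.

Let behead_word c u : u \in cw c -> behead u \in words c.
Proof.
move=> uc; have [_ h _] := words_plane c.
case: u uc => [|a u] uc; first by rewrite mem_head.
by apply: (h a); rewrite inE uc orbT.
Qed.

Let cw_words c u : u \in cw c -> u \in words c.
Proof. by rewrite inE => ->; rewrite orbT. Qed.

Let behead_neq c u : u \in cw c -> (behead u == u) = false.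
Proof.
move=> /cw_neq0; case: u => [//|a u] _; apply/eqP => /(congr1 size) /=; lia.
Qed.

Let emb_v2 : emb v2 = inl (if o then v1 else behead v1).
Proof. by rewrite /glue_embed /= eqxx. Qed.

Let emb_pv2 : emb (behead v2) = inl (if o then behead v1 else v1).
Proof. by rewrite /glue_embed /= (behead_neq v2c) eqxx. Qed.

Let emb_out w : w != v2 -> w != behead v2 -> emb w = inr w.
Proof. by move=> h1 h2; rewrite /glue_embed /= (negbTE h1) (negbTE h2). Qed.

Let emb_inj : injective emb.
Proof.
move=> w w'; have nv := behead_neq v1c.
have [->|h1] := eqVneq w v2; have [->|h1'] := eqVneq w' v2 => //.
- have [->|h2'] := eqVneq w' (behead v2); last by rewrite emb_v2 emb_out.
  rewrite emb_v2 emb_pv2 => -[]; case: o => /eqP; last by rewrite nv.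
  by rewrite eq_sym nv.
- have [->|h2] := eqVneq w (behead v2); last by rewrite emb_v2 emb_out.
  rewrite emb_v2 emb_pv2 => -[]; case: o => /eqP; first by rewrite nv.
  by rewrite eq_sym nv.
have [->|h2] := eqVneq w (behead v2); have [->|h2'] := eqVneq w' (behead v2) => //.
- by rewrite emb_pv2 emb_out.
- by rewrite emb_pv2 emb_out.
by rewrite !emb_out // => -[].
Qed.

Let e1_inj : {in words c1 &, injective e1}.
Proof. by move=> u u' uc uc' /(congr1 val); rewrite !val_e1 // => -[]. Qed.

Let e2_inj : {in words c2 &, injective e2}.
Proof. by move=> u u' uc uc' /(congr1 val); rewrite !val_e2 // => /emb_inj. Qed.

Let e2_v2 : e2 v2 = e1 (if o then v1 else behead v1).
Proof.
apply: val_inj; rewrite val_e2 ?cw_words // val_e1 ?emb_v2 //.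
by case: o; rewrite ?behead_word ?cw_words.
Qed.

Let e2_pv2 : e2 (behead v2) = e1 (if o then behead v1 else v1).
Proof.
apply: val_inj; rewrite val_e2 ?behead_word // val_e1 ?emb_pv2 //.
by case: o; rewrite ?behead_word ?cw_words.
Qed.

Let e12 w u : w \in words c2 -> u \in words c1 -> e2 w = e1 u -> w = v2 \/ w = behead v2.
Proof.
move=> wc uc /(congr1 val); rewrite val_e2 // val_e1 //.
have [->|h1] := eqVneq w v2; first by left.
have [->|h2] := eqVneq w (behead v2); first by right.
by rewrite emb_out.
Qed.

Let G_case (x : G) : (exists2 u, u \in words c1 & x = e1 u) \/
   (exists2 w, w \in words c2 & [/\ w != v2, w != behead v2 & x = e2 w]).
Proof.
have /fsetUP[/imfsetP[u uc xE]|/imfsetP[w wc xE]] := valP x.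
  rewrite [_ \in _]in_fwords in uc; left; exists u => //.
  by apply: val_inj; rewrite val_e1.
rewrite [_ \in _]in_fwords in wc; have [wv|h1] := eqVneq w v2.
  left; exists (if o then v1 else behead v1); first by case: o; rewrite ?behead_word ?cw_words.
  by rewrite -e2_v2; apply: val_inj; rewrite xE wv val_e2 ?cw_words.
have [wv|h2] := eqVneq w (behead v2).
  left; exists (if o then behead v1 else v1); first by case: o; rewrite ?behead_word ?cw_words.
  by rewrite -e2_pv2; apply: val_inj; rewrite xE wv val_e2 ?behead_word.
by right; exists w => //; split => //; apply: val_inj; rewrite val_e2.
Qed.

(** Every edge once, directed from child to parent. The marked edge of the second tree is left out
    because it coincides with that of the first. *)
Definition dedges : seq (G * G) := [seq (e1 u, e1 (behead u)) | u <- cw c1] ++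
  [seq (e2 w, e2 (behead w)) | w <- cw c2 & w != v2].

(** Only [v2] and its parent are sent into the first tree, so no edge of the second tree other than
    the marked one has both ends there. *)
Let mixed u u' w : u \in words c1 -> u' \in words c1 -> w \in cw c2 -> w != v2 ->
  e2 w = e1 u -> e2 (behead w) = e1 u' -> False.
Proof.
move=> uc uc' wc wv h1 h2.
have [w1|w1] := e12 (cw_words wc) uc h1; first by rewrite w1 eqxx in wv.
have [w2|w2] := e12 (behead_word wc) uc' h2.
  have := congr1 size w2; rewrite w1 !size_behead; have := cw_neq0 v2c; rewrite -size_eq0; lia.
by have := behead_neq wc; rewrite w2 w1 eqxx.
Qed.

Let dedges_uniq : uniq dedges.
Proof.
have ucw c : uniq (cw c) by have := words_uniq c => /andP[].
rewrite cat_uniq; apply/and3P; split.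
- rewrite map_inj_in_uniq // => u u' uc uc' [h _]; apply: e1_inj => //; exact: cw_words.
- apply/hasPn => _ /mapP[w wc ->]; apply/negP => /mapP[u uc [h1 h2]].
  move: wc; rewrite mem_filter => /andP[wv wc].
  exact: (mixed (cw_words uc) (behead_word uc) wc wv h1 h2).
rewrite map_inj_in_uniq ?filter_uniq // => u u'.
rewrite !mem_filter => /andP[_ uc] /andP[_ uc'] [h _].
by apply: e2_inj => //; exact: cw_words.
Qed.

Let size_anti c u u' : u \in cw c -> u' \in cw c -> u = behead u' -> behead u = u' -> False.
Proof.
move=> uc uc' h1 h2; have := congr1 size h1; have := congr1 size h2.
rewrite !size_behead; have := cw_neq0 uc; have := cw_neq0 uc'; rewrite -!size_eq0; lia.
Qed.

Let dedges_anti x y : (x, y) \in dedges -> (y, x) \notin dedges.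
Proof.
rewrite !mem_cat => /orP[/mapP[u uc [-> ->]]|/mapP[w]]; last rewrite mem_filter => /andP[wv wc] [-> ->].
  apply/negP => /orP[/mapP[u' uc' [h1 h2]]|/mapP[w]].
    apply: (size_anti uc uc').
      exact: (e1_inj (cw_words uc) (behead_word uc') h2).
    exact: (e1_inj (behead_word uc) (cw_words uc') h1).
  rewrite mem_filter => /andP[wv wc] [h1 h2].
  exact: (mixed (behead_word uc) (cw_words uc) wc wv (esym h1) (esym h2)).
apply/negP => /orP[/mapP[u uc [h1 h2]]|/mapP[w']].
  exact: (mixed (behead_word uc) (cw_words uc) wc wv h2 h1).
rewrite mem_filter => /andP[_ wc'] [h1 h2].
apply: (size_anti wc wc').
  exact: (e2_inj (cw_words wc) (behead_word wc') h2).
exact: (e2_inj (behead_word wc) (cw_words wc') h1).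
Qed.

Let adj_e1 u : u \in cw c1 -> adj (e1 u) (e1 (behead u)).
Proof.
move=> uc; rewrite adjE (val_e1 (cw_words uc)) (val_e1 (behead_word uc)); apply/orP; left.
apply/fsetUP; left; apply/imfsetP; exists u => //.
by rewrite inE (cw_neq0 uc) andbT [_ \in _]in_fwords cw_words.
Qed.

Let adj_e2 w : w \in cw c2 -> adj (e2 w) (e2 (behead w)).
Proof.
move=> uc; rewrite adjE (val_e2 (cw_words uc)) (val_e2 (behead_word uc)); apply/orP; left.
apply/fsetUP; right; apply/imfsetP; exists w => //.
by rewrite inE (cw_neq0 uc) andbT [_ \in _]in_fwords cw_words.
Qed.

Lemma adj_dedges x y : adj x y = ((x, y) \in dedges) || ((y, x) \in dedges).
Proof.
have half (a b : G) : (val a, val b) \in glue_edge glue -> (a, b) \in dedges \/ (b, a) \in dedges.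
  case/fsetUP => /imfsetP[u]; rewrite inE => /andP[]; rewrite [_ \in _]in_fwords inE.
    move=> uc u0 [h1 h2]; rewrite (negbTE u0) /= in uc.
    left; rewrite mem_cat; apply/orP; left; apply/mapP; exists u => //.
    have -> : a = e1 u by apply: val_inj; rewrite val_e1 ?cw_words.
    by have -> : b = e1 (behead u) by apply: val_inj; rewrite val_e1 ?behead_word.
  move=> uc u0 [h1 h2]; rewrite (negbTE u0) /= in uc; move: u uc u0 h1 h2 => w uc u0 h1 h2.
  have -> : a = e2 w by apply: val_inj; rewrite val_e2 ?cw_words.
  have -> : b = e2 (behead w) by apply: val_inj; rewrite val_e2 ?behead_word.
  have [->|wv] := eqVneq w v2.
    rewrite e2_v2 e2_pv2; case: o; [left|right]; rewrite mem_cat; apply/orP; left;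
    by apply/mapP; exists v1.
  left; rewrite mem_cat; apply/orP; right; apply/mapP; exists w => //.
  by rewrite mem_filter wv.
have half2 a b : (a, b) \in dedges -> adj a b.
  rewrite mem_cat => /orP[/mapP[u uc [-> ->]]|/mapP[w]]; first exact: adj_e1.
  by rewrite mem_filter => /andP[_ wc] [-> ->]; exact: adj_e2.
apply/idP/idP; first by rewrite adjE => /orP[] /half[] ->; rewrite ?orbT.
by case/orP => /half2 //; rewrite !adjE orbC.
Qed.

Let vlist := map e1 (words c1) ++ map e2 [seq w <- words c2 | (w != v2) && (w != behead v2)].

Lemma card_glued : #|G| = (size (cw c1) + size (cw c2))%N.
Proof.
have u : uniq vlist.
  rewrite cat_uniq; apply/and3P; split.
  - by rewrite map_inj_in_uniq ?words_uniq.
  - apply/hasPn => _ /mapP[w wc ->]; apply/negP => /mapP[u uc h].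
    move: wc; rewrite mem_filter => /andP[/andP[h1 h2] wc].
    by case: (e12 wc uc h) => h3; rewrite h3 eqxx in h1 h2.
  rewrite map_inj_in_uniq ?filter_uniq ?words_uniq // => w w'.
  by rewrite !mem_filter => /andP[_ wc] /andP[_ wc']; exact: e2_inj.
have all_in : vlist =i G.
  move=> x; rewrite [RHS]inE mem_cat; apply/orP.
  case: (G_case x) => [[w wc ->]|[w wc [h1 h2 ->]]]; [left|right]; first exact: map_f.
  by apply: map_f; rewrite mem_filter h1 h2.
rewrite -(eq_card all_in); move/card_uniqP: u => ->.
rewrite size_cat !size_map size_filter /=.
have w2 := words_uniq c2.
have h := count_predC (fun w => (w != v2) && (w != behead v2)) (words c2).
have h2 : count (predC (fun w => (w != v2) && (w != behead v2))) (words c2) = 2%N.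
  rewrite (eq_count (a2 := predU (pred1 v2) (pred1 (behead v2)))); last first.
    by move=> w /=; rewrite negb_and !negbK.
  have := count_predUI (pred1 v2) (pred1 (behead v2)) (words c2).
  rewrite !count_uniq_mem // cw_words // behead_word //.
  rewrite [X in (_ + X)%N](eq_count (a2 := pred0)) ?count_pred0; last first.
    by move=> w /=; case: (w =P v2) => //= ->; rewrite eq_sym (behead_neq v2c).
  by rewrite addn0.
by move: h; rewrite h2 /=; lia.
Qed.

(** Each vertex climbs to its root and the common edge joins the two parts, so the graph is
    connected. Acyclicity follows by counting: [dedges] has one element less than there are
    vertices. *)
Lemma glued_is_tree : is_tree G.
Proof.
have sy : symmetric (@adj G) by move=> x y; rewrite !adjE orbC.
have irr : irreflexive (@adj G).
  move=> x; rewrite adj_dedges orbb; apply/negP => h.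
  by have := dedges_anti h; rewrite h.
have csy := sym_connect_sym sy.
have r1 u : u \in words c1 -> connect (@adj G) (e1 u) (e1 [::]).
  elim: u => [|a u IH] uc; first exact: connect0.
  have uc' : a :: u \in cw c1 by move: uc; rewrite inE.
  apply: connect_trans (connect1 (adj_e1 uc')) _; apply: IH; exact: behead_word uc'.
have r2 w : w \in words c2 -> connect (@adj G) (e2 w) (e2 [::]).
  elim: w => [|a u IH] uc; first exact: connect0.
  have uc' : a :: u \in cw c2 by move: uc; rewrite inE.
  apply: connect_trans (connect1 (adj_e2 uc')) _; apply: IH; exact: behead_word uc'.
have r12 : connect (@adj G) (e2 [::]) (e1 [::]).
  rewrite csy; apply: connect_trans (_ : connect _ _ (e2 v2)) (r2 _ (cw_words v2c)).
  rewrite csy e2_v2; apply: r1; by case: o; rewrite ?behead_word ?cw_words.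
have r x : connect (@adj G) x (e1 [::]).
  case: (G_case x) => [[u uc ->]|[w wc [_ _ ->]]]; first exact: r1.
  exact: connect_trans (r2 _ wc) r12.
have co x y : connect (@adj G) x y.
  by apply: connect_trans (r x) _; rewrite csy.
split => //; first by apply/card_gt0P; exists g0.
apply: acyclic_card => //.
have sub : [set [set p.1; p.2]%SET | p : G * G & adj p.1 p.2]%SET \subset
   [set [set p.1; p.2]%SET | p in dedges]%SET.
  apply/fintype.subsetP => z /imsetP[[x y] h ->].
  have {}h : adj x y by move: h; rewrite inE.
  rewrite adj_dedges in h; case/orP: h => h.
    by apply/imsetP; exists (x, y).
  by apply/imsetP; exists (y, x) => //=; rewrite finset.setUC.
apply: leq_ltn_trans (subset_leq_card sub) _.
apply: leq_ltn_trans (leq_imset_card _ _) _.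
rewrite card_glued; move/card_uniqP: dedges_uniq => ->.
rewrite size_cat !size_map ltn_add2l size_filter.
have := count_predC (fun w => w != v2) (cw c2).
move=> <-; rewrite -[X in (X < _)%N]addn0 ltn_add2l.
by rewrite -has_count; apply/hasP; exists v2 => //=; rewrite eqxx.
Qed.

Local Open Scope ring_scope.
Variables (R : realType) (V : finType) (S : V -> V -> R).
Hypothesis Ssym : forall a b, S a b = S b a.

(** [hom_density] orders the two ends of an edge by rank; [od] turns each directed edge accordingly,
    which the symmetry of [S] permits. *)
Lemma prod_adj (f : G -> V) :
  \prod_(i < #|G|) \prod_(j < #|G| | (i < j)%N && adj (enum_val i : G) (enum_val j))
     S (f (enum_val i)) (f (enum_val j)) = \prod_(p <- dedges) S (f p.1) (f p.2).
Proof.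
pose od (p : G * G) := if (enum_rank p.1 < enum_rank p.2)%N then p else (p.2, p.1).
have -> : \prod_(p <- dedges) S (f p.1) (f p.2) = \prod_(p <- map od dedges) S (f p.1) (f p.2).
  by rewrite big_map; apply: eq_bigr => p _; rewrite /od; case: ifP => //= _; rewrite Ssym.
rewrite pair_big_dep /=.
rewrite (reindex (fun p : G * G => (enum_rank p.1, enum_rank p.2))) /=; last first.
  exists (fun p => (enum_val p.1, enum_val p.2)) => -[x y] _ /=; first by rewrite !enum_rankK.
  by rewrite !enum_valK.
rewrite (eq_bigr (fun p => S (f p.1) (f p.2))) => [|p _]; last by rewrite !enum_rankK.
rewrite -big_filter; apply: perm_big; apply: uniq_perm.
- by apply: filter_uniq; rewrite /index_enum -enumT enum_uniq.
- rewrite map_inj_in_uniq // => -[x y] [x' y'] h h'; rewrite /od /=.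
  case: ifP => _; case: ifP => _ [? ?]; subst => //.
    by have := dedges_anti h; rewrite h'.
  by have := dedges_anti h; rewrite h'.
move=> [x y]; rewrite mem_filter mem_index_enum andbT.
rewrite -[X in X = _]/((enum_rank x < enum_rank y)%N && adj (enum_val (enum_rank x) : G) (enum_val (enum_rank y))).
rewrite !enum_rankK adj_dedges.
apply/andP/mapP => [[xy /orP[h|h]]|[[x' y'] h]].
- by exists (x, y) => //; rewrite /od /= xy.
- by exists (y, x) => //; rewrite /od /= ltnNge ltnW.
rewrite /od /=; case: ifP => [xy|xy] [-> ->]; first by rewrite xy h.
rewrite h orbT; split => //; rewrite ltn_neqAle leqNgt xy andbT.
apply/eqP => /val_inj/enum_rank_inj e; move: h; rewrite e => h.
by have := dedges_anti h; rewrite h.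
Qed.

Variables (n m1 m2 : nat) (M : 'M[R]_n).
Hypothesis MS : forall i j, M i j = M j i.
Hypotheses (s1 : size (cw c1) = m1) (s2 : size (cw c2) = m2).

(** A labelling of the glued tree amounts to labellings of the two trees that agree on the marked
    edge. [extend] and [restrict] are the two directions, and [compat] is the agreement. *)
Let extend (L : m1.+1.-tuple 'I_n * m2.+1.-tuple 'I_n) : {ffun G -> 'I_n} :=
  [ffun x => match val x with inl u => lab L.1 c1 u | inr w => lab L.2 c2 w end].

Let extend_e1 L u : u \in words c1 -> extend L (e1 u) = lab L.1 c1 u.
Proof. by move=> uc; rewrite ffunE val_e1. Qed.

Let compat (L : m1.+1.-tuple 'I_n * m2.+1.-tuple 'I_n) :=
  (lab L.2 c2 (behead v2) == lab L.1 c1 (if o then behead v1 else v1)) &&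
  (lab L.2 c2 v2 == lab L.1 c1 (if o then v1 else behead v1)).

Let extend_e2 L w : compat L -> w \in words c2 -> extend L (e2 w) = lab L.2 c2 w.
Proof.
move=> /andP[/eqP h1 /eqP h2] wc; rewrite ffunE val_e2 //.
have [->|n1] := eqVneq w v2; first by rewrite emb_v2 h2.
by have [->|n2] := eqVneq w (behead v2); [rewrite emb_pv2 h1|rewrite emb_out].
Qed.

Let restrict (f : {ffun G -> 'I_n}) :=
  (labtuple (fun u => f (e1 u)) s1, labtuple (fun w => f (e2 w)) s2).

Let extend_restrict f : extend (restrict f) = f.
Proof.
apply/ffunP => x; case: (G_case x) => [[u uc ->]|[w wc [h1 h2 ->]]].
  by rewrite extend_e1 // lab_labtuple.
by rewrite ffunE val_e2 // emb_out //= lab_labtuple.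
Qed.

Let restrict_extend L : (restrict (extend L) == L) = compat L.
Proof.
apply/eqP/idP => [h|h].
  have h2 w : w \in words c2 -> lab L.2 c2 w = extend L (e2 w).
    by move=> wc; rewrite -[in LHS]h lab_labtuple.
  have c1v : (if o then v1 else behead v1) \in words c1.
    by case: o; rewrite ?behead_word ?cw_words.
  have c1v' : (if o then behead v1 else v1) \in words c1.
    by case: o; rewrite ?behead_word ?cw_words.
  by rewrite /compat !h2 ?behead_word ?cw_words // e2_v2 e2_pv2 !extend_e1 ?eqxx.
case: L h => L1 L2 h; congr pair.
  apply: (eq_labels s1) => u uc; rewrite lab_labtuple //; exact: extend_e1.
apply: (eq_labels s2) => u uc; rewrite lab_labtuple //; exact: extend_e2.
Qed.

Lemma sum_fiber (I J : finType) (a b : I -> J) (F : J -> J -> R) (H : I -> R) :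
  \sum_i \sum_j F i j * (\sum_(x | (a x == i) && (b x == j)) H x) = \sum_x F (a x) (b x) * H x.
Proof.
rewrite pair_big /= (eq_bigr (fun p => \sum_x if (a x == p.1) && (b x == p.2) then F p.1 p.2 * H x else 0)).
  rewrite exchange_big /=; apply: eq_bigr => x _.
  rewrite -big_mkcond (big_pred1 (a x, b x)) // => -[i j] /=.
  by rewrite xpair_eqE ![_ == a x]eq_sym ![_ == b x]eq_sym.
by move=> p _; rewrite mulr_sumr big_mkcond.
Qed.

(** Given the labels i, j of the common edge, the two trees are labelled independently; [o] decides
    which end of the second marked edge carries i. *)
Lemma sum_glued :
  \sum_(f : {ffun G -> 'I_n}) \prod_(p <- dedges) M (f p.1) (f p.2) =
  \sum_i \sum_j M i j * edge_weight M m1 c1 v1 i j *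
    (if o then edge_weight M m2 c2 v2 i j else edge_weight M m2 c2 v2 j i).
Proof.
have ucw c : uniq (cw c) by have := words_uniq c => /andP[].
pose P1 (L : m1.+1.-tuple 'I_n) := \prod_(u <- cw c1 | u != v1) M (lab L c1 u) (lab L c1 (behead u)).
pose P2 (L : m2.+1.-tuple 'I_n) := \prod_(u <- cw c2 | u != v2) M (lab L c2 u) (lab L c2 (behead u)).
have -> : \sum_i \sum_j M i j * edge_weight M m1 c1 v1 i j *
    (if o then edge_weight M m2 c2 v2 i j else edge_weight M m2 c2 v2 j i) =
  \sum_L \sum_(L' | compat (L, L')) M (lab L c1 (behead v1)) (lab L c1 v1) * P1 L * P2 L'.
  transitivity (\sum_i \sum_j (M i j * (if o then edge_weight M m2 c2 v2 i j else edge_weight M m2 c2 v2 j i))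
       * edge_weight M m1 c1 v1 i j).
    by apply: eq_bigr => i _; apply: eq_bigr => j _; rewrite mulrAC.
  rewrite (sum_fiber _ _ (fun i j => M i j * (if o then edge_weight M m2 c2 v2 i j else edge_weight M m2 c2 v2 j i))).
  apply: eq_bigr => L _; rewrite mulrAC -/(P1 L) -mulr_sumr; congr (_ * _).
  rewrite /compat /edge_weight; case: o => /=; exact: eq_bigr.
rewrite (reindex_onto extend restrict) => [|f _]; last exact: extend_restrict.
rewrite pair_big_dep /=; apply: eq_big => [L|L]; first by rewrite restrict_extend; case: L.
rewrite restrict_extend => cL.
rewrite /dedges big_cat !big_map big_filter /=; congr (_ * _).
  rewrite (bigD1_seq v1) //= !extend_e1 ?behead_word ?cw_words // -MS; congr (_ * _).
  rewrite [LHS]big_seq_cond [RHS]big_seq_cond; apply: eq_bigr => u /andP[uc _].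
  by rewrite !extend_e1 ?behead_word ?cw_words.
rewrite [LHS]big_seq_cond [RHS]big_seq_cond; apply: eq_bigr => u /andP[uc _].
by rewrite !extend_e2 ?behead_word ?cw_words.
Qed.

End Glued.

Local Open Scope classical_set_scope.
Local Open Scope ring_scope.

(** * Homomorphism densities of step graphons *)

Lemma eq_cube_integral (R : realType) m (f g : m.-tuple R -> R) :
  (forall t : m.-tuple R, all (fun x => 0 <= x <= 1) t -> f t = g t) -> cube_integral f = cube_integral g.
Proof.
elim: m f g => [|m IH] f g fg /=; first exact: fg.
apply: eq_Rintegral => x; rewrite inE /= in_itv /= => x01.
by apply: IH => t t01; apply: fg; rewrite /= x01.
Qed.

Section Cells.
Variables (R : realType) (n : nat).
Hypothesis n0 : (0 < n)%N.
Local Notation V := 'I_n.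

Let nR : 0 < n%:R :> R. Proof. by rewrite ltr0n. Qed.

Lemma block_exists (x : R) : 0 <= x <= 1 -> exists i : V, block i x.
Proof.
move=> /andP[x0 x1].
have ex : exists i, (i.+1 == n) || (x < i.+1%:R / n%:R).
  by exists n.-1; rewrite prednK // eqxx.
case: (ex_minnP ex) => i hi imin.
have iN : (i < n)%N.
  have := imin n.-1; rewrite prednK // eqxx => /(_ isT); lia.
exists (Ordinal iN); split => /=.
  case: i hi imin iN => [|i] hi imin iN; first by rewrite mul0r.
  by rewrite leNgt; apply/negP => h; have := imin i; rewrite h orbT ltnn => /(_ isT).
by case: eqP hi.
Qed.

Lemma block_lt (i j : V) (x : R) : block i x -> block j x -> (i < j)%N -> False.
Proof.
move=> [_ +] [+ _] ij; case: eqP => [iN|_]; first by have := ltn_ord j; lia.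
move=> h1 h2; have := le_lt_trans h2 h1; rewrite ltr_pM2r ?invr_gt0 // ltr_nat; lia.
Qed.

Lemma block_inj (i j : V) (x : R) : block i x -> block j x -> i = j.
Proof.
move=> bi bj; case: (ltngtP i j) => [ij|ij|/val_inj //].
  by case: (block_lt bi bj ij).
by case: (block_lt bj bi ij).
Qed.

Definition cell (x : R) : V := odflt (Ordinal n0) [pick i : V | `[< block i x >]].

Lemma block_cell x : 0 <= x <= 1 -> block (cell x) x.
Proof.
move=> x01; rewrite /cell; case: pickP => [i /asboolP //|h].
by have [i bi] := block_exists x01; have := h i; rewrite asboolT.
Qed.

Lemma indic_block (i : V) x : 0 <= x <= 1 -> \1_(block i) x = (i == cell x)%:R :> R.
Proof.
move=> x01; rewrite indicE; congr (_%:R); congr nat_of_bool.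
apply/idP/eqP => [|->]; last by rewrite inE; exact: block_cell.
by rewrite inE => bi; exact: (block_inj bi (block_cell x01)).
Qed.

Lemma sum_cell (h : V -> R) x : 0 <= x <= 1 -> h (cell x) = \sum_(i < n) h i * \1_(block i) x.
Proof.
move=> x01; rewrite (bigD1 (cell x)) //= indic_block // eqxx mulr1 big1 ?addr0 // => i ni.
by rewrite indic_block // (negbTE ni) mulr0.
Qed.

Lemma step_graphon_cell (S : 'M[R]_n) x y : 0 <= x <= 1 -> 0 <= y <= 1 ->
  step_graphon S x y = S (cell x) (cell y).
Proof.
move=> x01 y01; rewrite /step_graphon (sum_cell (fun i => S i (cell y)) x01).
apply: eq_bigr => i _; rewrite (sum_cell (S i) y01) mulr_suml; apply: eq_bigr => j _; ring.
Qed.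

Let block_itv (i : V) : block i = [set` Interval (BLeft (i%:R / n%:R))
   (if i.+1 == n then BRight 1 else BLeft (i.+1%:R / n%:R))] :> set R.
Proof.
rewrite /block; case: eqP => _; apply/seteqP; split => x /=; rewrite in_itv /=;
  by [move=> [-> ->]|move=> /andP[]].
Qed.

Lemma measurable_block (i : V) : measurable (block i : set R).
Proof. by rewrite block_itv; exact: measurable_itv. Qed.

Lemma lebesgue_block (i : V) : lebesgue_measure (block i : set R) = (n%:R^-1)%:E.
Proof.
have lt1 : i%:R / n%:R < i.+1%:R / n%:R :> R by rewrite ltr_pM2r ?invr_gt0 // ltr_nat.
have e1 : i.+1%:R / n%:R - i%:R / n%:R = n%:R^-1 :> R.
  by rewrite -mulrBl -natrB // subSn // subnn mul1r.
rewrite block_itv lebesgue_measure_itv; case: eqP => [iN|_] /=; last first.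
  by rewrite lte_fin lt1 -EFinD e1.
have e2 : i.+1%:R / n%:R = 1 :> R by rewrite iN divff // gt_eqF.
have e3 : 1%E = (i.+1%:R / n%:R)%:E :> \bar R by rewrite e2.
by rewrite e3 lte_fin lt1 -EFinD e1.
Qed.

Lemma block_sub (i : V) : (block i : set R) `<=` `[0, 1].
Proof.
move=> x [h1 h2]; rewrite /= in_itv /=; apply/andP; split.
  by apply: le_trans h1; rewrite divr_ge0 ?ler0n.
move: h2; case: eqP => // _ /ltW /le_trans; apply.
by rewrite ler_pdivrMr // mul1r ler_nat; exact: ltn_ord.
Qed.

Lemma integral_cell (h : V -> R) :
  \int[lebesgue_measure]_(x in `[0, 1]) h (cell x) = n%:R^-1 * \sum_(i < n) h i.
Proof.
have -> : \int[lebesgue_measure]_(x in `[0, 1]) h (cell x) =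
   \int[lebesgue_measure]_(x in `[0, 1]) \sum_(i < n) h i * \1_(block i) x.
  by apply: eq_Rintegral => x; rewrite inE /= in_itv /= => /sum_cell.
rewrite /Rintegral.
have -> : (\int[lebesgue_measure]_(x in `[0%R, 1%R]) (\sum_(i < n) h i * \1_(block i) x)%R%:E =
  \int[lebesgue_measure]_(x in `[0%R, 1%R]) (\sum_(i < n) (h i)%:E * (\1_(block i) x)%:E))%E.
  by apply: eq_integral => x _; rewrite -sumEFin; apply: eq_bigr.
have mI : measurable (`[0%R, 1%R] : set R) by exact: measurable_itv.
have fI : (lebesgue_measure (`[0%R, 1%R] : set R) < +oo)%E.
  by rewrite lebesgue_measure_itv /= lte_fin ltr01 -EFinD ltry.
have int (i : V) : lebesgue_measure.-integrable `[0%R, 1%R] (EFin \o (\1_(block i) : R -> R)).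
  apply: (@measurable_bounded_integrable _ _ _ (@lebesgue_measure R) _ _ mI fI).
    by apply: measurable_realfun.measurable_indic; exact: measurable_block.
  exists 1; split => // r r1 x _ /=; rewrite ger0_norm // ltW // (le_lt_trans _ r1) //.
rewrite integral_sum //; last by move=> i; apply: integrableZl => //; exact: int.
rewrite (eq_bigr (fun i => (h i * n%:R^-1)%:E)) => [|i _].
  by rewrite sumEFin /= -mulr_suml mulrC.
rewrite integralZl //; last exact: int.
rewrite integral_indic //; last exact: measurable_block.
rewrite (setIidl (@block_sub i)); rewrite [X in (_ * X)%E](lebesgue_block i).
by rewrite -EFinM.
Qed.

Lemma cube_integral_cell m (h : m.-tuple V -> R) :
  cube_integral (fun x : m.-tuple R => h (map_tuple cell x)) = n%:R^-1 ^+ m * \sum_t h t.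
Proof.
elim: m h => [|m IH] h /=.
  rewrite expr0 mul1r (big_pred1 [tuple]) => [|t]; first by congr h; exact: val_inj.
  by apply/esym/eqP; exact: tuple0.
have -> : (fun x : R => cube_integral (fun s : m.-tuple R => h (map_tuple cell [tuple of x :: s]))) =
   (fun x => n%:R^-1 ^+ m * \sum_(t : m.-tuple V) h (cons_tuple (cell x) t)).
  apply/funext => x; rewrite -(IH (fun t => h (cons_tuple (cell x) t))).
  by congr cube_integral; apply/funext => s; congr h; exact: val_inj.
rewrite (integral_cell (fun i => n%:R^-1 ^+ m * \sum_(t : m.-tuple V) h (cons_tuple i t))).
by rewrite -mulr_sumr mulrA -exprS big_tuple_cons.
Qed.

Lemma hom_density_step (F : graph) (S : 'M[R]_n) :
  hom_density F (step_graphon S) = n%:R^-1 ^+ #|F| *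
  \sum_(f : {ffun F -> V}) \prod_(i < #|F|) \prod_(j < #|F| |
     (i < j)%N && adj (enum_val i : F) (enum_val j)) S (f (enum_val i)) (f (enum_val j)).
Proof.
pose H (t : #|F|.-tuple V) := \prod_(i < #|F|) \prod_(j < #|F| |
     (i < j)%N && adj (enum_val i : F) (enum_val j)) S (tnth t i) (tnth t j).
rewrite /hom_density (eq_cube_integral (g := fun x => H (map_tuple cell x))); last first.
  move=> t /allP t01; apply: eq_bigr => i _; apply: eq_bigr => j _.
  by rewrite !tnth_map step_graphon_cell // t01 // mem_tnth.
rewrite cube_integral_cell; congr (_ * _).
rewrite (reindex (fun f : {ffun F -> V} => [tuple f (enum_val i) | i < #|F|])) /=; last first.
  exists (fun t : #|F|.-tuple V => [ffun x => tnth t (enum_rank x)]) => [f _|t _].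
    by apply/ffunP => x; rewrite ffunE tnth_mktuple enum_rankK.
  by apply: eq_from_tnth => i; rewrite tnth_mktuple ffunE enum_valK.
by apply: eq_bigr => f _; apply: eq_bigr => i _; apply: eq_bigr => j _; rewrite !tnth_mktuple.
Qed.

End Cells.

(** * Summation over gluings and the densities of the glued trees *)

Definition marked_list m : seq ({fset seq nat} * seq nat) :=
  [seq (fwords c, v) | c <- cats m, v <- cw c].

Lemma fwords_inj : injective fwords.
Proof. by move=> c c' h; apply: words_ext => u; rewrite -!in_fwords h. Qed.

Lemma marked_list_uniq m : uniq (marked_list m).
Proof.
apply: allpairs_uniq_dep; first exact: cats_uniq.
  by move=> c _; have := words_uniq c => /andP[].
by move=> [c v] [c' v'] _ _ /= [/fwords_inj -> ->].
Qed.

Lemma mem_marked_list m t : t \in marked_list m <-> marked_plane_tree m t.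
Proof.
have sz c : #|` fwords c| = (size (cw c)).+1.
  rewrite -[RHS]/(size (words c)); apply: perm_size; apply: uniq_perm => //.
    exact: words_uniq.
  by move=> u; rewrite -in_fwords.
split.
  move=> /allpairsPdep[c [v [cm vc ->]]]; split => /=.
  - have [h1 h2 h3] := words_plane c; split; first by rewrite in_fwords.
      by move=> i u; rewrite !in_fwords; exact: h2.
    by move=> i u; rewrite !in_fwords; exact: h3.
  - by rewrite sz; move: cm; rewrite mem_cats => /eqP ->.
  - by rewrite in_fwords inE vc orbT.
  - exact: cw_neq0 vc.
case: t => U v [/= [U0 Ub Ul] Um vU v0].
have [c hc] : exists c, forall u, (u \in U) = (u \in words c).
  by apply: (@plane_words (size (enum_fset U)) (fun u => u \in U) (enum_fset U)).
have Uc : U = fwords c by apply/fsetP => u; rewrite hc in_fwords.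
apply/allpairsPdep; exists c, v; split.
- by rewrite mem_cats; move: Um; rewrite Uc sz => -[->].
- by move: vU; rewrite hc inE (negbTE v0).
- by rewrite Uc.
Qed.

Lemma sum_T1 (R : realType) m1 m2 (f : gluing -> R) :
  \sum_(T \in T1 (2 * m1) (2 * m2)) f T =
  \sum_(c1 <- cats m1) \sum_(v1 <- cw c1) \sum_(c2 <- cats m2) \sum_(v2 <- cw c2)
    \sum_(o : bool) f (glue c1 c2 v1 v2 o).
Proof.
pose s : seq gluing := [seq (x, o) | x <- [seq (a, b) | a <- marked_list m1, b <- marked_list m2],
   o <- [:: true; false]].
have us : uniq s.
  apply: allpairs_uniq => //; last by move=> [a b] [a' b'] _ _ [-> ->].
  by apply: allpairs_uniq => //; [exact: marked_list_uniq..|move=> [a b] [a' b'] _ _ [-> ->]].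
have -> : T1 (2 * m1) (2 * m2) = [set` s].
  rewrite /T1 !mul2n !doubleK; apply/seteqP; split => [[[a b] o] [[/= ha hb] _]|[[a b] o] /=].
    apply: allpairs_f; last by case: o.
    by apply: allpairs_f; apply/mem_marked_list.
  move=> /allpairsP[[x y] [/= /allpairsP[[a' b'] [/= ha hb ->]] _ [-> -> _]]].
  by split => //; split; apply/mem_marked_list.
rewrite -fsbig_seq // big_allpairs_dep big_allpairs_dep /= big_allpairs_dep.
apply: eq_bigr => c1 _; apply: eq_bigr => v1 _.
rewrite big_allpairs_dep; apply: eq_bigr => c2 _; apply: eq_bigr => v2 _.
by rewrite !big_cons big_nil addr0 big_bool.
Qed.

(** Once the labels of an edge are fixed, n^(m - 1) labellings remain, so this quotient stays
    bounded. *)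
Definition norm_weight (R : realType) n (S : 'M[R]_n) m i j : R :=
  total_weight S m i j / n%:R ^+ m.-1.

(** A glued tree has m1 + m2 vertices: n^-(m1 + m2) splits into n^-2 for the common edge and the two
    normalisations. The two orientations give the two terms of the last factor. *)
Lemma sum_T1_density (R : realType) n (S : 'M[R]_n) m1 m2 : (0 < n)%N ->
  (forall i j, S i j = S j i) -> (0 < m1)%N -> (0 < m2)%N ->
  \sum_(T \in T1 (2 * m1) (2 * m2)) hom_density (glued_tree T) (step_graphon S) =
  n%:R^-1 ^+ 2 * \sum_(i < n) \sum_(j < n) S i j * norm_weight S m1 i j *
    (norm_weight S m2 i j + norm_weight S m2 j i).
Proof.
move=> n0 SS m10 m20; rewrite sum_T1.
pose W c1 v1 c2 v2 := \sum_i \sum_j S i j * edge_weight S m1 c1 v1 i j *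
  (edge_weight S m2 c2 v2 i j + edge_weight S m2 c2 v2 j i).
transitivity (n%:R^-1 ^+ (m1 + m2) * \sum_(c1 <- cats m1) \sum_(v1 <- cw c1) \sum_(c2 <- cats m2) \sum_(v2 <- cw c2) W c1 v1 c2 v2).
  rewrite mulr_sumr big_seq [RHS]big_seq; apply: eq_bigr => c1; rewrite mem_cats => /eqP s1.
  rewrite mulr_sumr big_seq [RHS]big_seq; apply: eq_bigr => v1 v1c.
  rewrite mulr_sumr big_seq [RHS]big_seq; apply: eq_bigr => c2; rewrite mem_cats => /eqP s2.
  rewrite mulr_sumr big_seq [RHS]big_seq; apply: eq_bigr => v2 v2c.
  have dens o : hom_density (glued_tree (glue c1 c2 v1 v2 o)) (step_graphon S) = n%:R^-1 ^+ (m1 + m2) *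
      \sum_i \sum_j S i j * edge_weight S m1 c1 v1 i j *
      (if o then edge_weight S m2 c2 v2 i j else edge_weight S m2 c2 v2 j i).
    rewrite hom_density_step //; congr (_ ^+ _ * _); first by rewrite card_glued // s1 s2.
    rewrite -(sum_glued o v1c v2c SS s1 s2); apply: eq_bigr => f _.
    exact: (@prod_adj _ _ _ _ o v1c v2c R _ (fun i j => S i j) SS (fun x => f x)).
  rewrite big_bool /= !dens -mulrDr; congr (_ * _).
  rewrite /W; under [RHS]eq_bigr do under eq_bigr do rewrite mulrDr.
  under [RHS]eq_bigr do rewrite big_split /=.
  by rewrite big_split.
have nz : n%:R != 0 :> R by rewrite pnatr_eq0 -lt0n.
have -> : \sum_(i < n) \sum_(j < n) S i j * norm_weight S m1 i j *
    (norm_weight S m2 i j + norm_weight S m2 j i) =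
  n%:R^-1 ^+ (m1.-1 + m2.-1) * \sum_(i < n) \sum_(j < n) S i j * total_weight S m1 i j *
    (total_weight S m2 i j + total_weight S m2 j i).
  rewrite mulr_sumr; apply: eq_bigr => i _; rewrite mulr_sumr; apply: eq_bigr => j _.
  by rewrite /norm_weight -!exprVn exprD; ring.
rewrite mulrA -exprD; congr (_ ^+ _ * _); first by lia.
transitivity (\sum_i \sum_j \sum_(c1 <- cats m1) \sum_(v1 <- cw c1) \sum_(c2 <- cats m2) \sum_(v2 <- cw c2)
   S i j * edge_weight S m1 c1 v1 i j * (edge_weight S m2 c2 v2 i j + edge_weight S m2 c2 v2 j i)).
  rewrite /W [RHS]pair_big /=.
  under eq_bigr do under eq_bigr do under eq_bigr do under eq_bigr do rewrite pair_big /=.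
  under eq_bigr do under eq_bigr do under eq_bigr do rewrite exchange_big /=.
  under eq_bigr do under eq_bigr do rewrite exchange_big /=.
  under eq_bigr do rewrite exchange_big /=.
  by rewrite exchange_big.
apply: eq_bigr => i _; apply: eq_bigr => j _; rewrite /total_weight.
rewrite mulr_sumr mulr_suml; apply: eq_bigr => c1 _.
rewrite mulr_sumr mulr_suml; apply: eq_bigr => v1 _.
rewrite mulrDr !mulr_sumr -big_split /=; apply: eq_bigr => c2 _.
rewrite !mulr_sumr -big_split /=; apply: eq_bigr => v2 _; exact: mulrDr.
Qed.

(** * Trigonometric approximation of bounded continuous functions *)

Lemma bE_linear_sqr (R : realType) (I : finType) (q t : I -> R) :
  bE q (fun w => (\sum_e t e * bet q e w) ^+ 2) = \sum_e t e ^+ 2 * sig q e.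
Proof.
have sum1 (g : {set I} -> R) : \sum_(F : {set I} | #|F| == 1%N) g F = \sum_e g [set e]%SET.
  rewrite (eq_bigl (mem [set [set e]%SET | e in I]%SET)) => [|F].
    by rewrite big_imset //= => x y _ _; exact: set1_inj.
  by apply/cards1P/imsetP => [[x ->]|[x _ ->]]; exists x.
pose c (F : {set I}) := \sum_(e in F) t e.
transitivity (bE q (fun w => (\sum_(F : {set I} | #|F| == 1%N) c F * \prod_(e in F) bet q e w) ^+ 2)).
  by apply: eq_bE => w; rewrite sum1; congr (_ ^+ 2); apply: eq_bigr => e _; rewrite /c !big_set1.
by rewrite bE_sum_orth sum1; apply: eq_bigr => e _; rewrite /c !big_set1.
Qed.

Section SinLower.
Variable R : realType.
Implicit Types a b : R.

Lemma le_cos a b : 0 <= a -> a <= b -> b <= pi -> cos b <= cos a.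
Proof.
move=> a0 ab bp; rewrite leNgt ltr_cos ?in_itv /= -?leNgt ?a0 ?bp ?andbT //.
  exact: le_trans ab.
by rewrite (le_trans ab).
Qed.

(** With half-difference c and half-sum d, the two sides are 2 sin(c)^2 and 2 cos(d) sin(c);
    moreover |d| <= pi/2 - c, so cos d >= sin c. *)
Lemma sin_sub_ge a b : - (pi / 2) <= b -> b <= a -> a <= pi / 2 ->
  1 - cos (a - b) <= sin a - sin b.
Proof.
move=> hb ba ha; set c := (a - b) / 2; set d := (a + b) / 2.
have aE : a = d + c by rewrite /c /d; lra.
have bE : b = d - c by rewrite /c /d; lra.
have -> : sin a - sin b = 2 * (cos d * sin c) by rewrite aE bE sinD sinB; ring.
have -> : 1 - cos (a - b) = 2 * (sin c * sin c).
  have e2 : a - b = c + c by rewrite /c; lra.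
  by rewrite e2 cosD -{1}(cos2Dsin2 c); ring.
have pi0 := @pi_gt0 R.
have c0 : 0 <= c by rewrite /c; lra.
have s0 : 0 <= sin c by apply: sin_ge0_pi; rewrite /c; lra.
have cosd : cos d = cos `|d|.
  by have [?|?] := leP 0 d; [rewrite ger0_norm|rewrite ltr0_norm ?cosN].
rewrite ler_pM2l // ler_wpM2r // -cosBpihalf -cosN opprB cosd.
apply: le_cos; rewrite ?normr_ge0 //.
  by rewrite ler_norml /c /d; lra.
by rewrite /c; lra.
Qed.

(** Quantitative injectivity of the sine on [-pi/2, pi/2], which serves as a modulus of continuity
    for [asin]. *)
Lemma dist_sin_le a b (eta : R) : 0 <= eta -> eta <= pi ->
  `|a| <= pi / 2 -> `|b| <= pi / 2 -> `|sin a - sin b| <= 1 - cos eta -> `|a - b| <= eta.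
Proof.
wlog ba : a b / b <= a => [h|].
  have [/h//|/ltW/h h1] := leP b a; move=> ? ? ? ? hs; rewrite distrC.
  by apply: h1 => //; rewrite distrC.
move=> e0 ep /[!ler_norml] /andP[a1 a2] /andP[b1 b2] /andP[_ h].
have := le_trans (sin_sub_ge b1 ba a2) h; rewrite lerD2l lerN2 => cc.
have pi0 := @pi_gt0 R.
suff : a - b <= eta by move=> ?; apply/andP; split; lra.
rewrite leNgt; apply/negP => lt; have : cos (a - b) < cos eta.
  by rewrite ltr_cos // in_itv /=; apply/andP; split; lra.
by rewrite ltNge cc.
Qed.

End SinLower.

Section TrigPoly.
Variables (R : realType) (m : nat).
Implicit Types T f : 'rV[R]_m -> R.

Definition trig_mono (p : R * 'rV[R]_m * R) (x : 'rV[R]_m) : R :=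
  p.1.1 * cos (\sum_i p.1.2 0 i * x 0 i + p.2).

Definition trig_poly T := exists l, forall x, T x = \sum_(p <- l) trig_mono p x.

Lemma eq_trig T T' : (forall x, T x = T' x) -> trig_poly T -> trig_poly T'.
Proof. by move=> TT [l h]; exists l => x; rewrite -TT h. Qed.

Lemma trig_cos (t : 'rV[R]_m) s : trig_poly (fun x => cos (\sum_i t 0 i * x 0 i + s)).
Proof. by exists [:: (1, t, s)] => x; rewrite big_seq1 /trig_mono /= mul1r. Qed.

Lemma trigZ a T : trig_poly T -> trig_poly (fun x => a * T x).
Proof.
case=> l h; exists [seq (a * p.1.1, p.1.2, p.2) | p <- l] => x.
by rewrite h big_map mulr_sumr; apply: eq_bigr => p _; rewrite /trig_mono /= mulrA.
Qed.

Lemma trig_cst a : trig_poly (fun=> a).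
Proof.
apply: eq_trig (trigZ a (trig_cos 0 0)) => x.
by rewrite big1 ?addr0 ?cos0 ?mulr1 // => i _; rewrite mxE mul0r.
Qed.

Lemma trigD T T' : trig_poly T -> trig_poly T' -> trig_poly (fun x => T x + T' x).
Proof. by move=> [l h] [l' h']; exists (l ++ l') => x; rewrite big_cat /= h h'. Qed.

Lemma trig_sum (I : Type) (r : seq I) (P : pred I) (F : I -> 'rV[R]_m -> R) :
  (forall i, trig_poly (F i)) -> trig_poly (fun x => \sum_(i <- r | P i) F i x).
Proof.
move=> h; elim: r => [|i r IH].
  by apply: eq_trig (trig_cst 0) => x; rewrite big_nil.
case Pi: (P i); last by apply: eq_trig IH => x; rewrite big_cons Pi.
by apply: eq_trig (trigD (h i) IH) => x; rewrite big_cons Pi.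
Qed.

Lemma trigM T T' : trig_poly T -> trig_poly T' -> trig_poly (fun x => T x * T' x).
Proof.
move=> [l h] [l' h'].
apply: (@eq_trig (fun x => \sum_(p <- l) \sum_(p' <- l') trig_mono p x * trig_mono p' x)).
  by move=> x; rewrite h h' mulr_suml; apply: eq_bigr => p _; rewrite mulr_sumr.
apply: trig_sum => p; apply: trig_sum => p'.
apply: (@eq_trig (fun x => (p.1.1 * p'.1.1 / 2) *
   (cos (\sum_i (p.1.2 + p'.1.2) 0 i * x 0 i + (p.2 + p'.2)) +
    cos (\sum_i (p.1.2 - p'.1.2) 0 i * x 0 i + (p.2 - p'.2))))).
  move=> x; rewrite /trig_mono.
  set A := \sum_i p.1.2 0 i * x 0 i; set B := \sum_i p'.1.2 0 i * x 0 i.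
  have -> : \sum_i (p.1.2 + p'.1.2) 0 i * x 0 i = A + B.
    by rewrite -big_split /=; apply: eq_bigr => i _; rewrite mxE mulrDl.
  have -> : \sum_i (p.1.2 - p'.1.2) 0 i * x 0 i = A - B.
    by rewrite -sumrB /=; apply: eq_bigr => i _; rewrite !mxE mulrBl.
  rewrite (_ : A + B + _ = (A + p.2) + (B + p'.2)); last by ring.
  rewrite (_ : A - B + _ = (A + p.2) - (B + p'.2)); last by ring.
  by rewrite cosD cosB; field.
by apply: trigZ; apply: trigD; exact: trig_cos.
Qed.

Lemma trig_prod (I : Type) (r : seq I) (P : pred I) (F : I -> 'rV[R]_m -> R) :
  (forall i, trig_poly (F i)) -> trig_poly (fun x => \prod_(i <- r | P i) F i x).
Proof.
move=> h; elim: r => [|i r IH].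
  by apply: eq_trig (trig_cst 1) => x; rewrite big_nil.
case Pi: (P i); last by apply: eq_trig IH => x; rewrite big_cons Pi.
by apply: eq_trig (trigM (h i) IH) => x; rewrite big_cons Pi.
Qed.

Lemma trig_sin i c : trig_poly (fun x => sin (c * x 0 i)).
Proof.
apply: eq_trig (trig_cos (c *: delta_mx 0 i) (- (pi / 2))) => x.
rewrite cosBpihalf (bigD1 i) //= !mxE !eqxx mulr1 big1 ?addr0 // => j ji.
by rewrite !mxE (negbTE ji) andbF mulr0 mul0r.
Qed.

(** Each [mass] is a polynomial in the probabilities, and trigonometric polynomials form an
    algebra. *)
Lemma trig_bE (I : finType) (q : I -> 'rV[R]_m -> R) (F : {ffun I -> bool} -> R) :
  (forall e, trig_poly (q e)) -> trig_poly (fun x => bE (fun e => q e x) F).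
Proof.
move=> h; apply: trig_sum => w.
apply: (@eq_trig (fun x => F w * mass (fun e => q e x) w)) => [x|]; first by rewrite mulrC.
apply: trigZ; apply: trig_prod => e; rewrite /wt; case: (w e) => //.
apply: (@eq_trig (fun x => 1 + -1 * q e x)) => [x|]; first by ring.
by apply: trigD; [exact: trig_cst|exact: trigZ].
Qed.

(** Only [x] is confined to the box, while [z] may leave it; hence a covering argument around the
    compact box rather than uniform continuity on it. *)
Lemma uniform_continuity_box f (B eps : R) : continuous f -> 0 < eps ->
  exists2 eta, 0 < eta & forall x z : 'rV[R]_m, (forall i, `|x 0 i| <= B) ->
   (forall i, `|x 0 i - z 0 i| <= eta) -> `|f x - f z| <= eps.
Proof.
move=> fc e0.
have cK : compact [set v : 'rV[R]_m | forall i, v ord0 i \in `[(- B), B]].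
  by apply: (@rV_compact _ _ (fun=> `[(- B), B]%classic)) => _; exact: segment_compact.
have := iffLR (compact_near_coveringP _) cK.
move=> /(_ R (0^'+) (fun eta (x : 'rV[R]_m) => forall z : 'rV[R]_m, (forall i, `|x 0 i - z 0 i| <= eta) -> `|f x - f z| <= eps) _).
case.
  move=> x _; have e20 : 0 < eps / 2 by rewrite divr_gt0.
  have /cvgrPdist_lt /(_ _ e20) := fc x.
  rewrite -nbhs_ballE => -[r /= r0 hr].
  have r20 : 0 < r / 2 by rewrite divr_gt0.
  exists (ball x (r / 2), [set eta | eta < r / 2]).
    split => /=; first exact: nbhsx_ballx.
    exact: nbhs_right_lt.
  move=> [y eta] /= [xy etar] z yz.
  have h1 : `|f x - f y| < eps / 2 by apply/hr/(le_ball _ xy); lra.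
  have h2 : `|f x - f z| < eps / 2.
    apply: hr; split => // i j; rewrite (ord1 i).
    move: xy => [_ /(_ 0 j)] xy; move: (yz j) => yzj.
    rewrite /ball /= in xy *.
    have := ler_normD (x 0 j - y 0 j) (y 0 j - z 0 j); rewrite addrA subrK; lra.
  have := ler_normD (f y - f x) (f x - f z); rewrite addrA subrK (distrC (f y) (f x)).
  lra.
move=> r /= r0 h; exists (r / 2) => [|x z xB xz]; first by rewrite divr_gt0.
apply: (h (r / 2)) => //=; first by rewrite sub0r normrN gtr0_norm ?divr_gt0 //; lra.
  by rewrite divr_gt0.
by move=> i; rewrite in_itv /= -ler_norml.
Qed.

Lemma bernstein_avg (N : nat) (y : 'I_m -> R) (i : 'I_m) : (0 < N)%N ->
  bE (fun e : 'I_m * 'I_N => y e.1) (fun w => (N%:R^-1 * \sum_(l < N) (w (i, l))%:R - y i) ^+ 2) =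
  y i * (1 - y i) / N%:R.
Proof.
move=> N0; have NR : N%:R != 0 :> R by rewrite pnatr_eq0 -lt0n.
pose t (e : 'I_m * 'I_N) : R := if e.1 == i then N%:R^-1 else 0.
have sumE (g : 'I_m * 'I_N -> R) : \sum_e t e * g e = N%:R^-1 * \sum_(l < N) g (i, l).
  rewrite mulr_sumr (eq_bigr (fun e => t (e.1, e.2) * g (e.1, e.2))) => [|[] //].
  rewrite -(pair_big xpredT xpredT (fun a b => t (a, b) * g (a, b))) /= (bigD1 i) //=.
  rewrite [X in _ + X]big1 ?addr0 => [|a ai].
    by apply: eq_bigr => l _; rewrite /t eqxx.
  by rewrite big1 // => l _; rewrite /t (negbTE ai) mul0r.
transitivity (bE (fun e : 'I_m * 'I_N => y e.1) (fun w => (\sum_e t e * bet (fun e => y e.1) e w) ^+ 2)).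
  apply: eq_bE => w; congr (_ ^+ 2); rewrite sumE /bet /= sumrB sumr_const card_ord mulrBr.
  by rewrite -[y i *+ N]mulr_natr mulrCA mulVf ?mulr1.
rewrite bE_linear_sqr; transitivity (\sum_e t e * (t e * sig (fun e => y e.1) e)).
  by apply: eq_bigr => e _; rewrite mulrA -expr2.
rewrite (sumE (fun e => t e * sig (fun e => y e.1) e)) /t /sig /= eqxx sumr_const card_ord.
by rewrite -[_ *+ N]mulr_natr; field.
Qed.

(** Bernstein's method in the variables y_i = (1 + sin(x_i / La)) / 2, which are trigonometric in x.
    Means of Bernoulli variables with parameters y_i concentrate near y, and [asin] recovers x from
    y on the box |x_i| <= La. Off the box the error is at most 2M <= eps La^2, which the weight 1 +
    |x|^2 pays for. *)
Lemma trig_approx f M eps : continuous f -> (forall x, `|f x| <= M) -> 0 < eps ->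
  exists2 T, trig_poly T & forall x, `|f x - T x| <= eps * (1 + \sum_i x 0 i ^+ 2).
Proof.
move=> fc fM e0.
have M0 : 0 <= M by apply: le_trans (fM 0); exact: normr_ge0.
have pi0 := @pi_gt0 R; have pi2 := @pi_ge2 R.
pose La := 1 + 2 * M / eps.
have me0 : 0 <= 2 * M / eps by rewrite divr_ge0 ?mulr_ge0 // ltW.
have La1 : 1 <= La by rewrite /La; lra.
have La0 : 0 < La by lra.
have LaM : 2 * M <= eps * La ^+ 2.
  have h : eps * La = eps + 2 * M by rewrite /La; field; rewrite gt_eqF.
  rewrite expr2 mulrA h; nra.
have e20 : 0 < eps / 2 by rewrite divr_gt0.
have [eta0 eta00 hunif] := uniform_continuity_box (La * (pi / 2)) fc e20.
pose eta := Num.min (eta0 / La) 1.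
have eta_gt0 : 0 < eta by rewrite lt_min ltr01 divr_gt0.
have eta1 : eta <= 1 by rewrite ge_min lexx orbT.
have etaLa : eta * La <= eta0 by rewrite -ler_pdivlMr // ge_min lexx.
(* [dist_sin_le] is applied to twice the averages, hence the half. *)
pose de := (1 - cos eta) / 2.
have de0 : 0 < de.
  rewrite divr_gt0 // subr_gt0 -(cos0 R) ltr_cos // in_itv /=; apply/andP; split; lra.
(* Chebyshev's inequality: with this N the mean of the quadratic penalty in [H] is at most eps /
   4. *)
pose N := (Num.truncn (2 * M * m%:R / (de ^+ 2 * eps))).+1.
have N0 : (0 < N)%N by [].
have NR : 2 * M * m%:R / (de ^+ 2 * eps) < N%:R by rewrite /N truncnS_gt.
pose avg (w : {ffun 'I_m * 'I_N -> bool}) i : R := N%:R^-1 * \sum_(l < N) (w (i, l))%:R.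
have avg01 w i : 0 <= avg w i <= 1.
  apply/andP; split; first by rewrite mulr_ge0 ?invr_ge0 ?ler0n // sumr_ge0.
  rewrite /avg mulrC ler_pdivrMr ?ltr0n // mul1r.
  apply: (@le_trans _ _ (\sum_(l < N) 1)); last by rewrite sumr_const card_ord.
  by apply: ler_sum => l _; case: (w _).
pose z w : 'rV[R]_m := \row_i (La * asin (2 * avg w i - 1)).
pose y i (x : 'rV[R]_m) := (1 + sin (La^-1 * x 0 i)) / 2.
pose T x := bE (fun e : 'I_m * 'I_N => y e.1 x) (fun w => f (z w)).
exists T.
  apply: trig_bE => e.
  apply: (@eq_trig (fun x => 2^-1 * (1 + sin (La^-1 * x 0 e.1)))) => [x|]; first by rewrite mulrC.
  by apply: trigZ; apply: trigD; [exact: trig_cst|exact: trig_sin].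
move=> x.
have y01 e : 0 <= y e x <= 1.
  by rewrite /y; have := sin_geN1 (La^-1 * x 0 e); have := sin_le1 (La^-1 * x 0 e); move=> ? ?; apply/andP; split; lra.
have -> : f x - T x = bE (fun e : 'I_m * 'I_N => y e.1 x) (fun w => f x - f (z w)).
  by rewrite bEB bE_cst.
have q01 (e : 'I_m * 'I_N) : 0 <= y e.1 x <= 1 by [].
apply: le_trans (norm_bE q01 _) _.
have triv w : `|f x - f (z w)| <= 2 * M.
  by rewrite (le_trans (ler_normB _ _)) // mulr2n mulrDl mul1r lerD.
have sq0 : 0 <= \sum_i x 0 i ^+ 2 by apply: sumr_ge0 => i _; exact: sqr_ge0.
have [box|] := pselect (forall i, `|x 0 i| <= La); last first.
  move=> /existsNP[i /negP]; rewrite -ltNge => xi.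
  rewrite (le_trans (bE_le q01 triv)) // bE_cst (le_trans LaM) // ler_wpM2l ?(ltW e0) //.
  rewrite (bigD1 i) //= -[x 0 i ^+ 2]real_normK ?num_real //.
  have : La ^+ 2 <= `|x 0 i| ^+ 2 by rewrite ler_sqr ?nnegrE ?normr_ge0 ?ltW.
  have : 0 <= \sum_(j < m | j != i) x 0 j ^+ 2 by apply: sumr_ge0 => j _; exact: sqr_ge0.
  lra.
apply: (@le_trans _ _ eps); last by rewrite ler_peMr ?(ltW e0) //; lra.
(* If some average deviates by more than [de], the quadratic term alone exceeds 2M; otherwise
   uniform continuity gives eps / 2. *)
pose H w := eps / 2 + \sum_i (2 * M / de ^+ 2) * (avg w i - y i x) ^+ 2.
have de2 : 0 < de ^+ 2 by rewrite exprn_gt0.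
apply: (@le_trans _ _ (bE (fun e : 'I_m * 'I_N => y e.1 x) H)).
  apply: bE_le => // w; rewrite /H.
  have t0 i : 0 <= (2 * M / de ^+ 2) * (avg w i - y i x) ^+ 2.
    by rewrite mulr_ge0 ?sqr_ge0 // divr_ge0 ?mulr_ge0 // ltW.
  have [close|] := pselect (forall i, `|avg w i - y i x| <= de); last first.
    move=> /existsNP[i /negP]; rewrite -ltNge => di.
    rewrite (le_trans (triv w)) // (bigD1 i) //= -[leLHS]addr0.
    rewrite addrCA lerD //; last first.
      by rewrite addr_ge0 ?(ltW e20) //; apply: sumr_ge0 => j _; exact: t0.
    rewrite -mulrA ler_peMr ?mulr_ge0 // mulrC ler_pdivlMr // mul1r.
    by rewrite -[leRHS]real_normK ?num_real // ler_sqr ?nnegrE ?normr_ge0 ?ltW.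
  rewrite -[leLHS]addr0 lerD //; last by apply: sumr_ge0 => i _; exact: t0.
  apply: hunif => i; first by rewrite (le_trans (box i)) // ler_peMr ?(ltW La0) //; lra.
  rewrite mxE; set a := La^-1 * x 0 i; set b := asin _.
  have -> : x 0 i = La * a by rewrite /a mulVKf // gt_eqF.
  rewrite -mulrBr normrM gtr0_norm // mulrC (le_trans _ etaLa) // ler_wpM2r ?(ltW La0) //.
  have c01 : -1 <= 2 * avg w i - 1 <= 1 by have := avg01 w i; lra.
  apply: dist_sin_le; first exact: ltW.
  - lra.
  - have : `|a| <= 1 by rewrite /a normrM gtr0_norm ?invr_gt0 // mulrC ler_pdivrMr // mul1r.
    lra.
  - by rewrite ler_norml asin_geNpi2 // asin_lepi2.
  rewrite asinK ?in_itv //= distrC.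
  have := close i; rewrite /y -/a /de !ler_norml => ?; apply/andP; split; lra.
rewrite /H bED bE_cst bE_sum.
have -> : \sum_(i < m) bE (fun e : 'I_m * 'I_N => y e.1 x)
     (fun w => 2 * M / de ^+ 2 * (avg w i - y i x) ^+ 2) =
   \sum_(i < m) 2 * M / de ^+ 2 * (y i x * (1 - y i x) / N%:R).
  by apply: eq_bigr => i _; rewrite bEZ; congr (_ * _); rewrite (bernstein_avg (fun i => y i x) i N0).
have : \sum_(i < m) 2 * M / de ^+ 2 * (y i x * (1 - y i x) / N%:R) <= \sum_(i < m) 2 * M / de ^+ 2 * (4^-1 / N%:R).
  apply: ler_sum => i _; rewrite ler_wpM2l ?divr_ge0 ?mulr_ge0 ?(ltW de2) //.
  rewrite ler_wpM2r ?invr_ge0 ?ler0n //; have := sqr_ge0 (y i x - 2^-1); nra.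
rewrite sumr_const card_ord -[_ *+ m]mulr_natr.
have : 2 * M / de ^+ 2 * (4^-1 / N%:R) * m%:R <= eps / 4.
  have Nr0 : 0 < N%:R :> R by rewrite ltr0n.
  rewrite (_ : 2 * M / de ^+ 2 * (4^-1 / N%:R) * m%:R = (2 * M * m%:R / (de ^+ 2 * eps) / N%:R) * (eps / 4)).
    rewrite ler_piMl ?divr_ge0 ?(ltW e0) // ler_pdivrMr // mul1r ltW //.
  by field; rewrite !gt_eqF.
lra.
Qed.

End TrigPoly.

(** * Convergence in law from characteristic functions *)

Lemma cvg_sum (R : realType) (T : Type) (F : set_system T) (FF : Filter F) (I : Type) (r : seq I) (P : pred I)
    (u : I -> T -> R) (l : I -> R) : (forall i, u i x @[x --> F] --> l i) ->
  \sum_(i <- r | P i) u i x @[x --> F] --> \sum_(i <- r | P i) l i.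
Proof. by move=> h; apply: cvg_big => //; exact: add_continuous. Qed.

Section Mean.
Variables (R : realType) (m : nat).
Local Notation fn := ('rV[R]_m -> R).

(* The expectation [E] of a random vector with second moments, seen as a functional on the test functions [A]. *)
Record mean (A : fn -> Prop) (E : fn -> R) : Prop := Mean {
  mean_closed : forall a f g, A f -> A g -> A (fun x => f x + a * g x);
  mean_linear : forall a f g, A f -> A g -> E (fun x => f x + a * g x) = E f + a * E g;
  mean_le : forall f g, A f -> A g -> (forall x, f x <= g x) -> E f <= E g;
  mean_cos : forall t s, A (fun x => cos (\sum_i t i * x 0 i + s));
  mean_sqr : forall i, A (fun x => x 0 i ^+ 2);
  mean_one : E (fun=> 1) = 1 }.

Section OneMean.
Variables (A : fn -> Prop) (E : fn -> R).
Hypothesis ME : mean A E.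

Let ext (f g : fn) : (forall x, f x = g x) -> f = g. Proof. by move=> h; exact/funext. Qed.

Lemma mean_A1 : A (fun=> 1).
Proof.
rewrite (_ : (fun=> 1) = fun x : 'rV[R]_m => cos (\sum_i (fun=> 0 : R) i * x 0 i + 0)); first exact: (mean_cos ME).
by apply: ext => x; rewrite big1 ?addr0 ?cos0 // => i _; rewrite mul0r.
Qed.

Lemma mean_AZ a f : A f -> A (fun x => a * f x).
Proof.
move=> Af; have A0 : A (fun=> 0).
  rewrite (_ : (fun=> 0) = fun x : 'rV[R]_m => 1 + -1 * 1); first by apply: (mean_closed ME); exact: mean_A1.
  by apply: ext => x; ring.
by rewrite (_ : (fun _ => _) = fun x => 0 + a * f x); [exact: (mean_closed ME)|apply: ext => x; rewrite add0r].
Qed.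

Lemma mean_E0 : E (fun=> 0) = 0.
Proof.
rewrite (_ : (fun=> 0) = fun x : 'rV[R]_m => 1 + -1 * 1); last by apply: ext => x; ring.
by rewrite (mean_linear ME) ?mean_one //; [ring|exact: mean_A1..].
Qed.

Lemma mean_EZ a f : A f -> E (fun x => a * f x) = a * E f.
Proof.
move=> Af; rewrite (_ : (fun _ => _) = fun x => 0 + a * f x); last by apply: ext => x; rewrite add0r.
rewrite (mean_linear ME) // ?mean_E0 ?add0r //.
by rewrite (_ : (fun=> 0) = fun x => 0 * f x); [exact: mean_AZ|apply: ext => x; rewrite mul0r].
Qed.

Lemma mean_sum (I : Type) (r : seq I) (a : I -> R) (F : I -> fn) :
  (forall i, A (F i)) -> A (fun x => \sum_(i <- r) a i * F i x) /\
    E (fun x => \sum_(i <- r) a i * F i x) = \sum_(i <- r) a i * E (F i).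
Proof.
move=> AF; elim: r => [|i r [IA IE]].
  rewrite (_ : (fun _ => _) = fun x => 0 * 1); last by apply: ext => x; rewrite big_nil mul0r.
  by split; [exact/mean_AZ/mean_A1|rewrite mean_EZ ?mul0r ?big_nil //; exact: mean_A1].
rewrite (_ : (fun _ => _) = fun x => \sum_(i <- r) a i * F i x + a i * F i x); last first.
  by apply: ext => x; rewrite big_cons addrC.
by split; [exact: (mean_closed ME)|rewrite (mean_linear ME) // IE big_cons addrC].
Qed.

Lemma mean_trig T : trig_poly T -> A T.
Proof.
case=> l h.
rewrite (_ : T = fun x => \sum_(p <- l) p.1.1 * cos (\sum_i p.1.2 0 i * x 0 i + p.2)).
  by apply: (proj1 (mean_sum l (fun p => p.1.1) _)) => p; exact: (mean_cos ME).
exact: ext.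
Qed.

(** Monotonicity applied to f <= T + eps (1 + |x|^2), and to the same inequality with f and T
    exchanged. *)
Lemma mean_near f T eps K : A f -> A T -> 0 <= eps ->
  (forall x, `|f x - T x| <= eps * (1 + \sum_i x 0 i ^+ 2)) ->
  (forall i, E (fun x => x 0 i ^+ 2) <= K) -> `|E f - E T| <= eps * (1 + m%:R * K).
Proof.
move=> Af AT e0 fT sK.
have [As Es] := mean_sum (index_enum 'I_m) (fun=> 1) (fun i => mean_sqr ME i).
pose q (x : 'rV[R]_m) : R := \sum_(i < m) 1 * x 0 i ^+ 2.
have Aq : A (fun x => 1 + 1 * q x) by apply: (mean_closed ME) => //; exact: mean_A1.
have Eq : E (fun x => 1 + 1 * q x) <= 1 + m%:R * K.
  rewrite (mean_linear ME) ?(mean_one ME) //; last exact: mean_A1.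
  rewrite lerD2l mul1r Es -[m in leRHS]card_ord mulrC mulr_natr -sumr_const.
  by apply: ler_sum => i _; rewrite mul1r.
have main f' T' : A f' -> A T' -> (forall x, f' x <= T' x + eps * (1 + \sum_i x 0 i ^+ 2)) ->
    E f' <= E T' + eps * (1 + m%:R * K).
  move=> Af' AT' h; apply: le_trans (_ : E (fun x => T' x + eps * (1 + 1 * q x)) <= _).
    apply: (mean_le ME) => //; first exact: (mean_closed ME).
    by move=> x; rewrite mul1r /q; under [X in _ <= _ + _ * (_ + X)]eq_bigr do rewrite mul1r.
  by rewrite (mean_linear ME) // lerD2l ler_wpM2l.
rewrite ler_norml; apply/andP; split.
  have := main T f AT Af; have h x := fT x; move=> /(_ _) h1.
  suff : E T <= E f + eps * (1 + m%:R * K) by lra.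
  by apply: h1 => x; have := h x; rewrite ler_norml => /andP[]; lra.
suff : E f <= E T + eps * (1 + m%:R * K) by lra.
by apply: main => // x; have := fT x; rewrite ler_norml => /andP[]; lra.
Qed.

End OneMean.

(** Continuity theorem for characteristic functions. By linearity [cc] gives convergence on
    trigonometric polynomials, and the bound [K] on second moments controls the error of
    [trig_approx] uniformly in n. *)
Theorem mean_continuity (An : nat -> fn -> Prop) (En : nat -> fn -> R) (A : fn -> Prop) (E : fn -> R) (K : R) (f : fn) :
  (forall n, mean (An n) (En n)) -> mean A E ->
  (\forall n \near \oo, forall i, En n (fun x => x 0 i ^+ 2) <= K) ->
  (forall i, E (fun x => x 0 i ^+ 2) <= K) ->
  (forall t s, En n (fun x => cos (\sum_i t i * x 0 i + s)) @[n --> \oo] -->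
     E (fun x => cos (\sum_i t i * x 0 i + s))) ->
  continuous f -> (exists M, forall x, `|f x| <= M) -> (forall n, An n f) -> A f ->
  En n f @[n --> \oo] --> E f.
Proof.
move=> Mn ME Kn KE cc fc [M fM] Anf Af.
apply/cvgrPdist_le => eps e0.
pose K' := 1 + m%:R * `|K|; have K'1 : 1 <= K' by rewrite lerDl mulr_ge0 ?ler0n.
have K'K : 1 + m%:R * K <= K' by rewrite lerD2l ler_wpM2l ?ler0n // ler_norm.
pose d := eps / (3 * K').
have d0 : 0 < d by rewrite divr_gt0 // mulr_gt0 //; lra.
have dK : d * (1 + m%:R * K) <= eps / 3.
  apply: le_trans (ler_wpM2l (ltW d0) K'K) _.
  rewrite /d le_eqVlt; apply/orP; left; apply/eqP; field; lra.
have [T tT hT] := trig_approx fc fM d0.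
have AT := mean_trig ME tT; have AnT n := mean_trig (Mn n) tT.
have cT : En n T @[n --> \oo] --> E T.
  case: tT => l hl.
  rewrite (_ : T = fun x => \sum_(p <- l) p.1.1 * cos (\sum_i p.1.2 0 i * x 0 i + p.2)); last first.
    exact/funext.
  have [_ ->] := mean_sum ME l (fun p => p.1.1) (fun p => mean_cos ME (fun i => p.1.2 0 i) p.2).
  rewrite (_ : (fun n => En n _) = fun n => \sum_(p <- l) p.1.1 * En n (fun x => cos (\sum_i p.1.2 0 i * x 0 i + p.2))).
    apply: cvg_sum => p; apply: cvgMr; exact: cc.
  apply/funext => n.
  by have [_ ->] := mean_sum (Mn n) l (fun p => p.1.1) (fun p => mean_cos (Mn n) (fun i => p.1.2 0 i) p.2).
have e30 : 0 < eps / 3 by rewrite divr_gt0.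
move/cvgrPdist_le : cT => /(_ _ e30) cT.
near=> n.
have h1 : `|En n f - En n T| <= eps / 3.
  by apply: le_trans (mean_near (Mn n) (Anf n) (AnT n) (ltW d0) hT _) dK; near: n.
have h2 := le_trans (mean_near ME Af AT (ltW d0) hT KE) dK.
have h3 : `|E T - En n T| <= eps / 3 by near: n.
rewrite (_ : E f - En n f = (E f - E T) + (E T - En n T) - (En n f - En n T)); last by ring.
rewrite (le_trans (ler_normB _ _)) //; have := ler_normD (E f - E T) (E T - En n T); lra.
Unshelve. all: by end_near.
Qed.

End Mean.

Lemma law_unique (R : realType) (m1 m2 : {measure set R -> \bar R}) : m1 setT = 1%E ->
  (forall a : R, m1 `]a, +oo[%classic = m2 `]a, +oo[%classic) -> forall B, measurable B -> m1 B = m2 B.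
Proof.
move=> m11 h B mB.
apply: (@measure_unique _ R _ (@RGenOInfty.G R) (fun k => `](- k%:R), +oo[%classic) _ _ _ _ m1 m2) => //.
- exact: RGenOInfty.measurableE.
- move=> _ _ [x [->]] [y [->]]; exists (Num.max x y).
  apply/seteqP; split => z /=; rewrite !in_itv /= !andbT gt_max.
    by move=> [-> ->].
  by move=> /andP[].
- by move=> k; exists (- k%:R).
- rewrite -subTset => x _; exists (Num.truncn `|x|).+1 => //=; rewrite in_itv /= andbT.
  rewrite ltrNl (le_lt_trans _ (truncnS_gt _)) //; rewrite -normrN; exact: ler_norm.
- by move=> A [x [->]].
- move=> k; rewrite (@le_lt_trans _ _ (m1 setT)) ?m11 ?ltry // -m11.
  by apply: le_measure; rewrite ?inE.
Qed.

Section Prob.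
Context {R : realType} d {T : measurableType d} (P : probability T R).

Lemma prob_bounded_integrable (g : T -> R) M : measurable_fun setT g ->
  (forall w, `|g w| <= M) -> P.-integrable setT (EFin \o g).
Proof.
move=> mg gM; apply: measurable_bounded_integrable => //.
  by rewrite [X in (X < _)%E](probability_setT P) ltry.
by exists M; split; [exact: num_real|move=> x Mx w _; exact: le_trans (gM w) (ltW Mx)].
Qed.

Lemma Rintegral_prob_cst (c : R) : (\int[P]_w c)%R = c.
Proof. by rewrite Rintegral_cst // [X in fine X](probability_setT P) mulr1. Qed.

Lemma expectation_Rintegral (g : T -> R) : P.-integrable setT (EFin \o g) ->
  ('E_P[g] = (\int[P]_w g w)%:E)%E.
Proof.
by move=> ig; rewrite unlock /Rintegral fineK //; exact: integrable_fin_num.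
Qed.

Lemma Rintegral_cvg (g_ : nat -> T -> R) (g h : T -> R) :
  (forall n, measurable_fun setT (g_ n)) -> (forall w, g_ n w @[n --> \oo] --> g w) ->
  P.-integrable setT (EFin \o h) -> (forall n w, `|g_ n w| <= h w) ->
  P.-integrable setT (EFin \o g) /\ (\int[P]_w g_ n w)%R @[n --> \oo] --> (\int[P]_w g w)%R.
Proof.
move=> mg gg ih gh.
have mg_ n : measurable_fun setT (EFin \o g_ n) by exact/measurable_EFinP.
have gg' w : setT w -> (EFin \o g_ n) w @[n --> \oo] --> (EFin \o g) w.
  by move=> _; apply: cvg_EFin; [exact: nearW|exact: gg].
have gh' n w : setT w -> (`|(EFin \o g_ n) w| <= (EFin \o h) w)%E by move=> _; rewrite lee_fin.
have mg' : measurable_fun setT g by apply: measurable_fun_cvg mg _ => x _; exact: gg.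
have [||//||ig _ c] := @dominated_convergence _ _ _ P _ measurableT _ (EFin \o g) (EFin \o h) mg_.
- exact/measurable_EFinP.
- exact: aeW.
- by apply: aeW => w n Tw; exact: gh'.
split => //; apply: fine_cvg; rewrite fineK; last exact: integrable_fin_num.
exact: c.
Qed.

Lemma measurable_cos_comp (g : T -> R) : measurable_fun setT g -> measurable_fun setT (fun w => cos (g w)).
Proof. by move=> mg; apply: measurableT_comp mg; apply: continuous_measurable_fun; exact: continuous_cos. Qed.

Section RandomVector.
Variables (m : nat) (X : 'I_m -> T -> R).
Hypothesis mX : forall i, measurable_fun setT (X i).
Local Notation row w := (\row_i X i w).

Lemma measurable_linear (t : 'I_m -> R) s : measurable_fun setT (fun w => \sum_i t i * X i w + s).
Proof.
apply: measurable_funD; last exact: measurable_cst.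
by apply: measurable_sum => i; apply: measurable_funM; [exact: measurable_cst|exact: mX].
Qed.

Lemma measurable_trig f : trig_poly f -> measurable_fun setT (fun w => f (row w)).
Proof.
case=> l h; rewrite (_ : (fun _ => _) = fun w => \sum_(p <- l) p.1.1 * cos (\sum_i p.1.2 0 i * X i w + p.2)).
  apply: measurable_sum => p; apply: measurable_funM; first exact: measurable_cst.
  exact/measurable_cos_comp/measurable_linear.
apply/funext => w; rewrite h; apply: eq_bigr => p _; rewrite /trig_mono.
by congr (_ * cos (_ + _)); apply: eq_bigr => i _; rewrite mxE.
Qed.

(** A pointwise limit of trigonometric polynomials, so that measurability of the coordinates is
    enough. *)
Lemma measurable_cont_bounded (f : 'rV[R]_m -> R) M : continuous f -> (forall x, `|f x| <= M) ->
  measurable_fun setT (fun w => f (row w)).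
Proof.
move=> fc fM.
have /choice[Tk hT] k : exists Tk, trig_poly Tk /\ forall x, `|f x - Tk x| <= k.+1%:R^-1 * (1 + \sum_i x 0 i ^+ 2).
  have k0 : 0 < k.+1%:R^-1 :> R by rewrite invr_gt0 ltr0n.
  by have [Tk h1 h2] := trig_approx fc fM k0; exists Tk.
apply: (measurable_fun_cvg (h := fun k w => Tk k (row w))) => [k|w _].
  by apply: measurable_trig; case: (hT k).
set B := 1 + \sum_i (row w) 0 i ^+ 2.
apply/cvgrPdist_le => eps e0.
have c0 : k.+1%:R^-1 * B @[k --> \oo] --> 0.
  rewrite -[X in _ --> X](mul0r B); apply: cvgMl; exact: cvg_harmonic.
move/cvgrPdist_le : c0 => /(_ _ e0) c0; near=> k.
apply: le_trans (proj2 (hT k) (row w)) _.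
have : `|0 - k.+1%:R^-1 * B| <= eps by near: k.
by rewrite sub0r normrN; apply: le_trans; exact: ler_norm.
Unshelve. all: by end_near.
Qed.

Hypothesis X2 : forall i, P.-integrable setT (fun w => (X i w ^+ 2)%:E).

Definition test_fun (f : 'rV[R]_m -> R) := P.-integrable setT (fun w => (f (row w))%:E).
Definition Emean (f : 'rV[R]_m -> R) : R := \int[P]_w f (row w).

Lemma test_cont_bounded (f : 'rV[R]_m -> R) M : continuous f -> (forall x, `|f x| <= M) -> test_fun f.
Proof.
by move=> fc fM; apply: (prob_bounded_integrable (M := M)) => [|w]; [exact: measurable_cont_bounded fM|].
Qed.

Lemma mean_RV : mean test_fun Emean.
Proof.
split.
- move=> a f g If Ig; exact: (integrableD measurableT If (integrableZl measurableT a Ig)).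
- move=> a f g If Ig; rewrite /Emean RintegralD //; last exact: (integrableZl measurableT a Ig).
  by rewrite RintegralZl.
- by move=> f g If Ig fg; apply: le_Rintegral => // w _; exact: fg.
- move=> t s; apply: (prob_bounded_integrable (M := 1)) => [|w]; last exact: cos_max.
  rewrite (_ : (fun _ => _) = fun w => cos (\sum_i t i * X i w + s)).
    exact/measurable_cos_comp/measurable_linear.
  by apply/funext => w; congr (cos (_ + _)); apply: eq_bigr => i _; rewrite mxE.
- move=> i; rewrite /test_fun (_ : (fun _ => _) = fun w => (X i w ^+ 2)%:E) //.
  by apply/funext => w; rewrite mxE.
exact: Rintegral_prob_cst.
Qed.

End RandomVector.

End Prob.

(** The base exp(-(x - a + |x - a|)) is 1 for x <= a and less than 1 for x > a, so these continuous
    functions increase with k to the indicator of ]a, +oo[. *)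
Definition ramp (R : realType) (a : R) (k : nat) (x : R) : R :=
  1 - expR (- (x - a + `|x - a|)) ^+ k.

Lemma ramp_bound (R : realType) (a x : R) k : `|ramp a k x| <= 1.
Proof.
have h : 0 <= x - a + `|x - a|.
  by have := ler_norm (- (x - a)); rewrite normrN; lra.
have h1 : expR (- (x - a + `|x - a|)) <= 1 by rewrite -expR0 ler_expR; lra.
have h0 := expR_gt0 (- (x - a + `|x - a|)).
have := exprn_ile1 k (ltW h0) h1; have := exprn_ge0 k (ltW h0).
by rewrite /ramp ler_norml; move=> ? ?; apply/andP; split; lra.
Qed.

Lemma ramp_continuous (R : realType) (a : R) k : continuous (ramp a k).
Proof.
move=> x; apply: cvgB; first exact: cvg_cst.
apply: (cvg_comp (fun y : R => expR (- (y - a + `|y - a|))) (fun y : R => y ^+ k)); last exact: exprn_continuous.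
apply: (cvg_comp (fun y : R => - (y - a + `|y - a|)) expR); last exact: continuous_expR.
apply: cvgN; apply: cvgD; first by apply: cvgB; [exact: cvg_id|exact: cvg_cst].
apply: cvg_norm; apply: cvgB; [exact: cvg_id|exact: cvg_cst].
Qed.

Lemma ramp_cvg (R : realType) (a x : R) : ramp a k x @[k --> \oo] --> (\1_(`]a, +oo[) x : R).
Proof.
rewrite indicE; have [xa|xa] := leP x a.
  rewrite memNset; last by rewrite /= in_itv /= andbT ltNge xa.
  rewrite (_ : (fun _ => _) = fun=> 0); first exact: cvg_cst.
  apply/funext => k; rewrite /ramp ler0_norm; last lra.
  by rewrite subrr oppr0 expR0 expr1n subrr.
rewrite mem_set; last by rewrite /= in_itv /= xa.
rewrite -[X in _ --> X](subr0 (1 : R)); apply: cvgB; first exact: cvg_cst.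
apply: cvg_expr; rewrite ger0_norm ?expR_ge0 // -expR0 ltr_expR gtr0_norm; lra.
Qed.

(** [mean_continuity] on a constant sequence identifies integrals of bounded continuous functions;
    the ramps carry this to half-lines, and [law_unique] to Borel sets. *)
Lemma char_law_unique (R : realType) d1 d2 (T1 : measurableType d1) (T2 : measurableType d2)
    (P1 : probability T1 R) (P2 : probability T2 R) (X1 : {RV P1 >-> R}) (X2 : {RV P2 >-> R}) :
  P1.-integrable setT (fun w => (X1 w ^+ 2)%:E) -> P2.-integrable setT (fun w => (X2 w ^+ 2)%:E) ->
  (forall t s, (\int[P1]_w cos (t * X1 w + s) = \int[P2]_w cos (t * X2 w + s))%R) ->
  forall B : set R, measurable B -> P1 (X1 @^-1` B) = P2 (X2 @^-1` B).
Proof.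
move=> I1 I2 h B mB.
rewrite -[LHS]/(distribution P1 X1 B) -[RHS]/(distribution P2 X2 B); apply: (@law_unique R (distribution P1 X1) (distribution P2 X2)) => // [|a].
  exact: probability_setT.
have mX1 := measurable_funPT X1; have mX2 := measurable_funPT X2.
have M1 := mean_RV (X := fun _ : 'I_1 => X1) (fun=> mX1) (fun=> I1).
have M2 := mean_RV (X := fun _ : 'I_1 => X2) (fun=> mX2) (fun=> I2).
have step k : (\int[P1]_w ramp a k (X1 w) = \int[P2]_w ramp a k (X2 w))%R.
  pose f (x : 'rV[R]_1) := ramp a k (x 0 0).
  have fc : continuous f.
    move=> x; apply: (@continuous_comp _ _ _ (fun x : 'rV[R]_1 => x 0 0)); first exact: coord_continuous.
    exact: ramp_continuous.
  have fb x : `|f x| <= 1 by exact: ramp_bound.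
  pose K := Num.max (Emean P1 (fun _ : 'I_1 => X1) (fun x => x 0 0 ^+ 2)) (Emean P2 (fun _ : 'I_1 => X2) (fun x => x 0 0 ^+ 2)).
  have E1 : (\int[P1]_w ramp a k (X1 w))%R = Emean P1 (fun _ : 'I_1 => X1) f.
    by rewrite /Emean /f; congr Rintegral; apply/funext => w; rewrite mxE.
  have E2 : (\int[P2]_w ramp a k (X2 w))%R = Emean P2 (fun _ : 'I_1 => X2) f.
    by rewrite /Emean /f; congr Rintegral; apply/funext => w; rewrite mxE.
  rewrite E1 E2.
  have K1 i : Emean P1 (fun _ : 'I_1 => X1) (fun x => x 0 i ^+ 2) <= K.
    by rewrite (ord1 i) /K le_max lexx.
  have K2 i : Emean P2 (fun _ : 'I_1 => X2) (fun x => x 0 i ^+ 2) <= K.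
    by rewrite (ord1 i) /K le_max lexx orbT.
  have cc (t : 'I_1 -> R) s : Emean P1 (fun _ : 'I_1 => X1) (fun x => cos (\sum_i t i * x 0 i + s)) @[_ --> \oo] -->
      Emean P2 (fun _ : 'I_1 => X2) (fun x => cos (\sum_i t i * x 0 i + s)).
    rewrite /Emean.
    have hh d (T : measurableType d) (P : probability T R) (X : T -> R) :
        (\int[P]_w cos (\sum_(i < 1) t i * (\row_(_ < 1) X w) 0 i + s))%R = (\int[P]_w cos (t 0 * X w + s))%R.
      by congr Rintegral; apply/funext => w; rewrite big_ord1 mxE.
    rewrite !hh h; exact: cvg_cst.
  have T1f : test_fun P1 (fun _ : 'I_1 => X1) f by apply: test_cont_bounded fb.
  have T2f : test_fun P2 (fun _ : 'I_1 => X2) f by apply: test_cont_bounded fb.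
  have fbd : exists M, forall x, `|f x| <= M by exists 1.
  have c := mean_continuity (fun _ : nat => M1) M2 (nearW _ (fun=> K1)) K2 cc fc fbd (fun=> T1f) T2f.
  exact: (cvg_unique (@Rhausdorff R) (cvg_cst _) (c _)).
have lim d (T : measurableType d) (P : probability T R) (X : {RV P >-> R}) :
    (\int[P]_w ramp a k (X w))%R @[k --> \oo] --> fine (distribution P X `]a, +oo[%classic).
  have -> : fine (distribution P X `]a, +oo[%classic) = (\int[P]_w \1_(`]a, +oo[) (X w))%R.
    rewrite /Rintegral; congr fine.
    rewrite (_ : (fun w => (\1_(`]a, +oo[) (X w))%:E) = fun w => (\1_(X @^-1` `]a, +oo[) w)%:E); last first.
      by apply/funext => w.
    rewrite integral_indic // ?setIT //.
    by rewrite -[X in measurable X]setTI; apply: measurable_funPT.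
  have mX := measurable_funPT X.
  apply: (proj2 (Rintegral_cvg (h := fun=> 1) _ _ _ _)).
  - by move=> k; apply: measurableT_comp mX; apply: continuous_measurable_fun; exact: ramp_continuous.
  - by move=> w; exact: ramp_cvg.
  - exact: finite_measure_integrable_cst.
  - by move=> k w; exact: ramp_bound.
rewrite -[LHS]fineK ?fin_num_measure // -[RHS]fineK ?fin_num_measure //; congr EFin.
apply: cvg_unique (lim _ _ P1 X1) _ => //.
rewrite (_ : (fun k => _) = fun k => (\int[P2]_w ramp a k (X2 w))%R); last exact/funext.
exact: lim.
Qed.

(** * The characteristic function of the normal law *)

Lemma gauss_slope (R : realType) (c e x sg : R) : sg != 0 ->
  c * (e * - (x ^+ 2 * 0 + (sg ^+ 2 *+ 2)^-1 * (x * 1 + x * 1))) = - (x / sg ^+ 2) * (c * e).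
Proof. by move=> sg0; rewrite -mulr_natr; field. Qed.

Section NormalChar.
Variables (R : realType) (sg : R).
Hypothesis sg0 : sg != 0.
Local Notation mu := (@lebesgue_measure R).
Local Notation p := (normal_pdf 0 sg).

Let pE x : p x = normal_peak sg * expR (- (x ^+ 2 / (sg ^+ 2 *+ 2))).
Proof. by rewrite normal_pdfE // /normal_fun subr0 mulNr. Qed.

Lemma integral_normal_prob (f : R -> \bar R) : measurable_fun setT f ->
  (\int[normal_prob 0 sg]_x `|f x| < +oo)%E ->
  (\int[normal_prob 0 sg]_x f x = \int[mu]_x (f x * (p x)%:E))%E.
Proof.
move=> mf finf.
rewrite -(Radon_Nikodym_change_of_variables (normal_prob_dominates 0 sg)) //=; last first.
  by apply/integrableP; split.
have dom := normal_prob_dominates 0 sg.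
apply: ae_eq_integral => //.
- exact: emeasurable_funM.
- apply: emeasurable_funM => //; apply/measurable_EFinP; exact: measurable_normal_pdf.
apply: ae_eqe_mul2l => /=; rewrite Radon_NikodymE //=.
case: cid => /= h [h1 h2 h3]; apply: integral_ae_eq => //=.
- by apply/measurable_EFinP; exact: measurable_normal_pdf.
- by move=> E _ mE; rewrite -h3.
Qed.

Let s2 := Num.sqrt 2 * sg.

(** A normal density of twice the variance absorbs the quadratic factor: with u = x^2 / (4 sg^2) the
    claim becomes 1 + 4 sg^2 u <= (1 + 4 sg^2) exp(u), which follows from 1 + u <= exp(u). *)
Let p_bound x : (1 + x ^+ 2) * p x <= (1 + 4 * sg ^+ 2) * (normal_peak sg / normal_peak s2) * normal_pdf 0 s2 x.
Proof.
have s20 : s2 != 0 by rewrite mulf_neq0 // gt_eqF // sqrtr_gt0.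
have h0 : 0 < sg ^+ 2 by rewrite exprn_even_gt0.
have e2 : s2 ^+ 2 = 2 * sg ^+ 2 by rewrite exprMn sqr_sqrtr.
rewrite (normal_pdfE _ s20) /normal_fun subr0 pE e2.
set u := x ^+ 2 / (4 * sg ^+ 2).
have u0 : 0 <= u by rewrite divr_ge0 ?sqr_ge0 // mulr_ge0 // ltW.
have -> : - (x ^+ 2 / (sg ^+ 2 *+ 2)) = - u + - u by rewrite /u -mulr_natr; field.
have -> : - x ^+ 2 / ((2 * sg ^+ 2) *+ 2) = - u by rewrite /u -mulr_natr; field.
rewrite expRD.
have pk := normal_peak_gt0 sg0; have pk2 := normal_peak_gt0 s20.
rewrite [leRHS](_ : _ = (1 + 4 * sg ^+ 2) * normal_peak sg * expR (- u)); last by field; rewrite gt_eqF.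
rewrite [leLHS](_ : _ = ((1 + x ^+ 2) * expR (- u)) * normal_peak sg * expR (- u)); last by ring.
rewrite ler_wpM2r ?expR_ge0 // ler_wpM2r ?(ltW pk) //.
have e1 := expR_ge1Dx u.
have ee : expR (- u) * expR u = 1 by rewrite -expRD addNr expR0.
have xu : x ^+ 2 = 4 * sg ^+ 2 * u by rewrite /u; field.
have step : 1 + x ^+ 2 <= (1 + 4 * sg ^+ 2) * expR u.
  rewrite xu; set a := 4 * sg ^+ 2; have a0 : 0 <= a by rewrite mulr_ge0 // ltW.
  nra.
by rewrite (le_trans (ler_wpM2r (expR_ge0 _) step)) // -mulrA [expR u * _]mulrC ee mulr1.
Qed.

Lemma integrable_sqr_normal_pdf : mu.-integrable setT (fun x => ((1 + x ^+ 2) * p x)%:E).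
Proof.
apply: (@le_integrable _ _ _ mu setT measurableT _ (fun x => ((1 + 4 * sg ^+ 2) * (normal_peak sg / normal_peak s2) * normal_pdf 0 s2 x)%:E)).
- apply/measurable_EFinP; apply: measurable_funM; last exact: measurable_normal_pdf.
  by apply: continuous_measurable_fun => x; apply: cvgD; [exact: cvg_cst|exact: exprn_continuous].
- move=> x _ /=; rewrite lee_fin ger0_norm.
    by rewrite (le_trans (p_bound x)) // ler_norm.
  by rewrite mulr_ge0 ?normal_pdf_ge0 // addr_ge0 // sqr_ge0.
- exact: (integrableZl measurableT _ (integrable_normal_pdf 0 s2)).
Qed.

Lemma integrable_normal_dom (f : R -> R) C : measurable_fun setT f -> 0 <= C ->
  (forall x, `|f x| <= C * (1 + x ^+ 2)) -> mu.-integrable setT (fun x => (f x * p x)%:E).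
Proof.
move=> mf C0 fC.
apply: (@le_integrable _ _ _ mu setT measurableT _ (fun x => (C * ((1 + x ^+ 2) * p x))%:E)).
- by apply/measurable_EFinP; apply: measurable_funM => //; exact: measurable_normal_pdf.
- move=> x _ /=; rewrite lee_fin normrM (ger0_norm (normal_pdf_ge0 _ _ _)).
  by rewrite (le_trans _ (ler_norm _)) // mulrA ler_wpM2r ?normal_pdf_ge0.
- exact: (integrableZl measurableT C integrable_sqr_normal_pdf).
Qed.

(** Primitive for the integration by parts; it tends to 0 at infinity, so the integral of its
    derivative vanishes. *)
Let bump t s x := sin (t * x + s) * p x.

Let p_derive (x : R) : is_derive x 1 p (- (x / sg ^+ 2) * p x).
Proof.
have -> : p = fun x => normal_peak sg * expR (- (x ^+ 2 / (sg ^+ 2 *+ 2))) by apply/funext => y; exact: pE.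
apply: is_derive_eq; rewrite /GRing.scale /=.
exact: gauss_slope.
Qed.

Let bump_derive t s (x : R) : is_derive x 1 (bump t s) (t * (cos (t * x + s) * p x) - sg ^- 2 * (x * sin (t * x + s) * p x)).
Proof.
have pd := p_derive x.
apply: is_derive_eq; rewrite /GRing.scale /=.
by rewrite !mulr1 ?addr0 ?mul1r; field.
Qed.

Let bump_continuous t s : continuous (bump t s).
Proof.
move=> x; apply: differentiable_continuous; apply/derivable1_diffP.
by case: (bump_derive t s x).
Qed.

Let phase_continuous t s : continuous (fun x : R => t * x + s).
Proof. by move=> x; apply: cvgD; [apply: cvgM; [exact: cvg_cst|exact: cvg_id]|exact: cvg_cst]. Qed.

Let bump'_continuous (t s : R) :
  continuous (fun x : R => t * (cos (t * x + s) * p x) - sg ^- 2 * (x * sin (t * x + s) * p x)).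
Proof.
move=> x; have pc : {for x, continuous p} by exact: continuous_normal_pdf.
have cc : {for x, continuous (fun x => cos (t * x + s))}.
  by apply: continuous_comp; [exact: phase_continuous|exact: continuous_cos].
have sc : {for x, continuous (fun x => sin (t * x + s))}.
  by apply: continuous_comp; [exact: phase_continuous|exact: continuous_sin].
apply: cvgB; apply: cvgM; first exact: cvg_cst.
- by apply: cvgM; [exact: cc|exact: pc].
- exact: cvg_cst.
- by apply: cvgM; [apply: cvgM; [exact: cvg_id|exact: sc]|exact: pc].
Qed.

Let bump_integral t s (n : nat) : (0 < n)%N ->
  (\int[mu]_(x in `[(- n%:R)%R, n%:R]) (t * (cos (t * x + s) * p x) - sg ^- 2 * (x * sin (t * x + s) * p x)))%R =
  bump t s n%:R - bump t s (- n%:R).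
Proof.
move=> n0; have nR : 0 < n%:R :> R by rewrite ltr0n.
rewrite /Rintegral (@continuous_FTC2 _ _ (bump t s)) //=.
- by lra.
- apply: continuous_subspaceT => x; exact: bump'_continuous.
- split=> [x _||].
  + by case: (bump_derive t s x).
  + apply: cvg_at_right_filter; exact: bump_continuous.
  + apply: cvg_at_left_filter; exact: bump_continuous.
- by move=> x _; rewrite derive1E; case: (bump_derive t s x).
Qed.

Let C (t s : R) := \int[mu]_x (cos (t * x + s) * p x).
Let D (t s : R) := \int[mu]_x (x * sin (t * x + s) * p x).

Let measurable_phase (g : R -> R) (t s : R) : continuous g -> measurable_fun setT (fun x : R => g (t * x + s)).
Proof.
move=> cg; apply: continuous_measurable_fun => x; apply: continuous_comp; [exact: phase_continuous|exact: cg].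
Qed.

Let int_cos t s : mu.-integrable setT (fun x => (cos (t * x + s) * p x)%:E).
Proof.
apply: (@integrable_normal_dom _ 1) => // [|x]; first exact: (measurable_phase _ _ (@continuous_cos R)).
by rewrite mul1r (le_trans (cos_max _)) // lerDl sqr_ge0.
Qed.

Let norm_xsin (x y : R) : `|x * sin y| <= 1 + x ^+ 2.
Proof.
rewrite normrM; apply: (@le_trans _ _ (`|x| * 1)); first by rewrite ler_wpM2l // sin_max.
rewrite mulr1 -[x ^+ 2]real_normK ?num_real //; have := sqr_ge0 (`|x| - 2^-1); nra.
Qed.

Let int_xsin t s : mu.-integrable setT (fun x => (x * sin (t * x + s) * p x)%:E).
Proof.
apply: (@integrable_normal_dom _ 1) => // [|x]; last by rewrite mul1r norm_xsin.
by apply: measurable_funM => //; exact: (measurable_phase _ _ (@continuous_sin R)).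
Qed.

Let bump_small t s x n : x ^+ 2 = n%:R ^+ 2 ->
  `|bump t s x| <= (1 + 4 * sg ^+ 2) * normal_peak sg * n.+1%:R^-1.
Proof.
move=> xn.
have s20 : s2 != 0 by rewrite mulf_neq0 // gt_eqF // sqrtr_gt0.
have pk := normal_peak_gt0 sg0; have pk2 := normal_peak_gt0 s20.
rewrite normrM (ger0_norm (normal_pdf_ge0 _ _ _)).
apply: (@le_trans _ _ (1 * p x)); first by rewrite ler_wpM2r ?sin_max ?normal_pdf_ge0.
rewrite mul1r ler_pdivlMr ?ltr0n // mulrC.
apply: (@le_trans _ _ ((1 + x ^+ 2) * p x)).
  rewrite ler_wpM2r ?normal_pdf_ge0 // xn -natrX -[X in _ <= X + _]/(1%:R) -natrD ler_nat; nia.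
apply: le_trans (p_bound x) _.
have a0 : 0 <= 1 + 4 * sg ^+ 2 by rewrite addr_ge0 // mulr_ge0 // sqr_ge0.
rewrite -mulrA ler_wpM2l // -[leRHS](divfK (lt0r_neq0 pk2)).
rewrite ler_wpM2l ?divr_ge0 ?(ltW pk) ?(ltW pk2) //.
exact: normal_pdf_ub.
Qed.

Let integral_exhaust (g : R -> R) : mu.-integrable setT (EFin \o g) ->
  (\int[mu]_(x in `[(- n%:R)%R, n%:R]) g x) @[n --> \oo] --> \int[mu]_x g x.
Proof.
move=> ig; apply: fine_cvg; rewrite fineK; last exact: integrable_fin_num.
have mg : measurable_fun setT (EFin \o g) by exact: measurable_int ig.
rewrite (_ : (fun n => _) = fun n : nat => (\int[mu]_x (((EFin \o g) \_ `[(- n%:R)%R, n%:R]) x))%E); last first.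
  by apply/funext => n; rewrite -integral_mkcond.
have H1 n : measurable_fun setT ((EFin \o g) \_ `[(- n%:R)%R, n%:R]).
  by apply/(measurable_restrictT _ _).1 => //; exact: measurable_funTS.
have H3 : {ae mu, forall x, setT x -> ((EFin \o g) \_ `[(- n%:R)%R, n%:R]) x @[n --> \oo] --> (EFin \o g) x}.
  apply: aeW => x _; apply: cvg_near_cst; near=> n; rewrite patchE mem_set //= in_itv /= -ler_norml.
  by near: n; exact: nbhs_infty_ger.
have H5 : {ae mu, forall x n, setT x -> (`|((EFin \o g) \_ `[(- n%:R)%R, n%:R]) x| <= (abse \o (EFin \o g)) x)%E}.
  by apply: aeW => x n _ /=; rewrite patchE; case: ifP => // _; rewrite abse0.
have [_ _ c] := @dominated_convergence _ _ _ mu _ measurableT _ _ _ H1 mg H3 (integrable_abse ig) H5.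
exact: c.
Unshelve. all: by end_near.
Qed.

Let by_parts t s : D t s = sg ^+ 2 * t * C t s.
Proof.
pose g x := t * (cos (t * x + s) * p x) - sg ^- 2 * (x * sin (t * x + s) * p x).
have ig1 := integrableZl measurableT t (int_cos t s).
have ig2 := integrableZl measurableT (sg ^- 2) (int_xsin t s).
have ig : mu.-integrable setT (EFin \o g) by exact: (integrableB measurableT ig1 ig2).
have gE : \int[mu]_x g x = t * C t s - sg ^- 2 * D t s.
  rewrite (@RintegralB _ _ _ mu setT (fun x => t * (cos (t * x + s) * p x)) (fun x => sg ^- 2 * (x * sin (t * x + s) * p x)) measurableT ig1 ig2).
  by rewrite !RintegralZl //; [exact: int_xsin|exact: int_cos].
suff g0 : \int[mu]_x g x = 0.
  have h0 : sg ^+ 2 != 0 by rewrite expf_neq0.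
  by move: gE; rewrite g0 => /esym/eqP; rewrite subr_eq0 -mulrA => /eqP ->; rewrite mulrA mulfV // mul1r.
have := integral_exhaust ig.
suff c0 : (\int[mu]_(x in `[(- n%:R)%R, n%:R]) g x) @[n --> \oo] --> (0 : R).
  by move=> c; exact: (cvg_unique (@Rhausdorff R) c c0).
pose K := (1 + 4 * sg ^+ 2) * normal_peak sg.
have harm : 2 * (K * n.+1%:R^-1) @[n --> \oo] --> (0 : R).
  rewrite -[X in _ --> X](mulr0 2); apply: cvgM; first exact: cvg_cst.
  by rewrite -[X in _ --> X](mulr0 K); apply: cvgM; [exact: cvg_cst|exact: cvg_harmonic].
apply/norm_cvg0P; apply: (@squeeze_cvgr _ _ _ _ (fun=> 0) (fun n => 2 * (K * n.+1%:R^-1))) harm => //; last exact: cvg_cst.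
near=> n; rewrite normr_ge0 /= bump_integral; last by near: n; exists 1%N.
rewrite (le_trans (ler_normB _ _)) //.
have b1 : _ <= K * n.+1%:R^-1 := @bump_small t s n%:R n erefl.
have b2 : _ <= K * n.+1%:R^-1 := @bump_small t s (- n%:R) n (sqrrN _).
by rewrite mulr2n mulrDl mul1r lerD.
Unshelve. all: by end_near.
Qed.

Let C_derive (t s : R) : is_derive t 1 (fun t => C t s) (- D t s).
Proof.
pose f (t x : R) := cos (t * x + s) * p x.
have fd (u x : R) : is_derive u 1 (f ^~ x) (- (x * sin (u * x + s) * p x)).
  by apply: is_derive_eq; rewrite /GRing.scale /=; ring.
have It : `]t - 1, t + 1[%classic t by rewrite /= in_itv /=; apply/andP; split; lra.
pose G x := (1 + x ^+ 2) * p x.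
have G0 x : 0 <= G x by rewrite mulr_ge0 ?normal_pdf_ge0 // addr_ge0 // sqr_ge0.
have GB : mu.-integrable setT (EFin \o G) by exact: integrable_sqr_normal_pdf.
have d1 u x : partial1of2 f u x = - (x * sin (u * x + s) * p x).
  by rewrite partial1of2E; case: (fd u x).
have H1 : forall u, `]t - 1, t + 1[%classic u -> mu.-integrable setT (EFin \o f u) by move=> u _; exact: int_cos.
have H2 : forall u x, `]t - 1, t + 1[%classic u -> setT x -> derivable (f ^~ x) u 1.
  by move=> u x _ _; case: (fd u x).
have H3 : forall u x, `]t - 1, t + 1[%classic u -> setT x -> `|partial1of2 f u x| <= G x.
  move=> u x _ _; rewrite d1 normrN normrM (ger0_norm (normal_pdf_ge0 _ _ _)).
  by rewrite ler_wpM2r ?normal_pdf_ge0 ?norm_xsin.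
apply: DeriveDef.
  exact: (derivable_under_integral measurableT It H1 H2 G0 GB H3).
rewrite -derive1E (differentiation_under_integral measurableT It H1 H2 G0 GB H3).
rewrite -mulN1r /D -RintegralZl //; last exact: int_xsin.
by congr Rintegral; apply/funext => x; rewrite d1 mulN1r.
Qed.

(** [C_derive] and [by_parts] give C' = - sg^2 t C in t, so exp(sg^2 t^2 / 2) C is constant, equal
    to cos s at t = 0. *)
Lemma normal_char_density t s :
  \int[mu]_x (cos (t * x + s) * p x) = expR (- (sg ^+ 2 * t ^+ 2 / 2)) * cos s.
Proof.
pose H (t : R) := expR (sg ^+ 2 * t ^+ 2 / 2) * C t s.
have Hd (u : R) : is_derive u 1 H 0.
  have := C_derive u s => cd.
  apply: is_derive_eq; by rewrite /GRing.scale /= by_parts; field.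
have := @is_derive_0_is_cst R H t 0 Hd; rewrite /H expr0n /= mulr0 mul0r expR0 mul1r => h.
have C0 : C 0 s = cos s.
  rewrite /C (_ : (fun x => _) = fun x => cos s * p x); last by apply/funext => x; rewrite mul0r add0r.
  by rewrite RintegralZl ?/Rintegral ?integral_normal_pdf ?mulr1 //; exact: integrable_normal_pdf.
by rewrite -/(C t s) -C0 -h mulrA -expRD addNr expR0 mul1r.
Qed.

Lemma normal_char t s :
  \int[normal_prob 0 sg]_x cos (t * x + s) = expR (- (sg ^+ 2 * t ^+ 2 / 2)) * cos s.
Proof.
rewrite -normal_char_density /Rintegral integral_normal_prob //.
- by apply/measurable_EFinP; exact: (measurable_phase _ _ (@continuous_cos R)).
- have ic : (normal_prob 0 sg).-integrable setT (EFin \o (fun x => cos (t * x + s))).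
    apply: (@prob_bounded_integrable _ _ _ (normal_prob 0 sg) _ 1) => [|x]; last exact: cos_max.
    exact: (measurable_phase _ _ (@continuous_cos R)).
  by case/integrableP: ic.
Qed.

End NormalChar.

(** * Independent normal variables on the unit interval *)

Section Quantile.
Context {R : realType} d (T : measurableType d) (m : probability T R) (Z : {RV m >-> R}).

Let F (x : R) : R := fine (cdf Z x).

Let F_le (x y : R) : x <= y -> F x <= F y.
Proof. by move=> xy; rewrite fine_le ?fin_num_measure // cdf_nondecreasing. Qed.

Definition quantile (u : R) : R := if 0 < u < 1 then sup [set x | F x < u] else 0.

Let has_sup_quantile u : 0 < u < 1 -> has_sup [set x | F x < u].
Proof.
move=> /andP[u0 u1]; split.
  have c : F x @[x --> -oo] --> (0 : R) by apply: fine_cvg; exact: cvg_cdfNy0.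
  move/cvgrPdist_lt : c => /(_ _ u0) [M [_ h]]; exists (M - 1) => /=.
  have hM : M - 1 < M by rewrite ltrBlDr ltrDl.
  by have := h _ hM; rewrite sub0r normrN => /(le_lt_trans (ler_norm _)).
have c : F x @[x --> +oo] --> (1 : R) by apply: fine_cvg; exact: cvg_cdfy1.
have u10 : 0 < 1 - u by rewrite subr_gt0.
move/cvgrPdist_lt : c => /(_ _ u10) [M [_ h]]; exists (M + 1) => x /= Fx.
rewrite leNgt; apply/negP => xM.
have Mx : M < x by apply: lt_trans xM; rewrite ltrDl.
have := h x Mx; rewrite ltNge => /negP; apply.
by apply: le_trans (ler_norm _); rewrite lerD2l lerN2 ltW.
Qed.

Lemma quantile_le u x : 0 < u < 1 -> (quantile u <= x) = (u <= F x).
Proof.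
move=> u01; have hs := has_sup_quantile u01; rewrite /quantile u01.
apply/idP/idP => [qx|ux].
  have rc : F y @[y --> x^'+] --> F x.
    by apply: fine_cvg; rewrite fineK ?fin_num_measure //; exact: cdf_right_continuous.
  rewrite leNgt; apply/negP => Fx; have e0 : 0 < u - F x by rewrite subr_gt0.
  move/cvgrPdist_lt : rc => /(_ _ e0) rc.
  have [y []] : exists y, x < y /\ F y < u.
    near (x^'+) => y; exists y; split; first by near: y; exact: nbhs_right_gt.
    have : `|F x - F y| < u - F x by near: y.
    by rewrite distrC => /(le_lt_trans (ler_norm _)); lra.
  move=> xy Fy; have := ub_le_sup (proj2 hs) Fy; lra.
apply: ge_sup; first exact: (proj1 hs).
move=> y /= Fy; rewrite leNgt; apply/negP => xy.
by have := le_trans ux (F_le (ltW xy)); rewrite leNgt Fy.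
Unshelve. all: by end_near.
Qed.

(** Binary fractions approach their limit from below, so left-continuity suffices. At u = 0 the
    sequence is constant; u = 1 is excluded, as [quantile] takes its default value there. *)
Lemma quantile_left_cvg (u : R) (u_ : nat -> R) : 0 <= u < 1 -> (forall n, 0 <= u_ n <= u) ->
  u_ n @[n --> \oo] --> u -> quantile (u_ n) @[n --> \oo] --> quantile u.
Proof.
move=> /andP[u0 u1] u_u uc.
have [uE|une] := eqVneq u 0.
  rewrite (_ : (fun n => _) = fun=> quantile u); first exact: cvg_cst.
  apply/funext => n; congr quantile; apply/eqP; have := u_u n.
  by rewrite uE eq_le andbC.
have u0' : 0 < u by rewrite lt_neqAle eq_sym une.
have u01 : 0 < u < 1 by rewrite u0'.
apply/cvgrPdist_le => eps e0.
have [x /= Fx xQ] := sup_adherent e0 (has_sup_quantile u01).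
have xQ' : quantile u - eps < x by rewrite /quantile u01.
have Fx0 : 0 <= F x by rewrite fine_ge0 // cdf_ge0.
have d0 : 0 < u - F x by rewrite subr_gt0.
move/cvgrPdist_lt : uc => /(_ _ d0) uc; near=> n.
have un1 : `|u - u_ n| < u - F x by near: n.
have /andP[un0 unu] := u_u n.
have Fun : F x < u_ n by move: un1; rewrite ger0_norm ?subr_ge0 //; lra.
have un01 : 0 < u_ n < 1 by rewrite (le_lt_trans Fx0 Fun) (le_lt_trans unu u1).
have le1 : quantile (u_ n) <= quantile u.
  by rewrite quantile_le // (le_trans unu) // -quantile_le.
have le2 : x <= quantile (u_ n).
  rewrite leNgt; apply/negP => /ltW; rewrite quantile_le // => h.
  by move: Fun; rewrite ltNge h.
rewrite ger0_norm ?subr_ge0 //; lra.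
Unshelve. all: by end_near.
Qed.

Lemma measurable_quantile : measurable_fun setT quantile.
Proof.
apply: (measurability (@RGenOInfty.G R)); first exact: RGenOInfty.measurableE.
move=> _ [_ [x ->] <-]; rewrite setTI.
have -> : quantile @^-1` `]x, +oo[ = (`]0, 1[ `&` `]F x, +oo[) `|`
    (if x < 0 then ~` `]0%R, 1%R[%classic else set0).
  apply/seteqP; split => u /=; rewrite !in_itv /= !andbT.
    move=> xq; have [u01|u01] := boolP (0 < u < 1); [left|right].
      by split => //; rewrite ltNge -quantile_le // -ltNge.
    by move: xq; rewrite /quantile (negbTE u01) => ->; rewrite /= in_itv /=; exact/negP.
  case=> [[u01]|]; first by rewrite ltNge -quantile_le // -ltNge.
  by case: ifP => // x0; rewrite /= in_itv /= => /negP /negbTE u01; rewrite /quantile u01.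
apply: measurableU; first by apply: measurableI; exact: measurable_itv.
by case: ifP => // _; apply: measurableC; exact: measurable_itv.
Qed.

End Quantile.

Section Uniform.
Variable R : realType.
Local Notation P := (uniform_prob (@ltr01 R)).

(** [cell] is meaningful on [0, 1] only, whereas the uniform law lives on the real line; clamping
    changes nothing almost surely. *)
Definition clamp (x : R) : R := Num.max 0 (Num.min x 1).

Lemma clamp01 x : 0 <= clamp x <= 1.
Proof. by rewrite /clamp le_max lexx /= ge_max ler01 /= ge_min lexx orbT. Qed.

Lemma clamp_id x : 0 <= x <= 1 -> clamp x = x.
Proof. by move=> /andP[x0 x1]; rewrite /clamp (min_idPl x1) (max_idPr x0). Qed.

Lemma measurable_clamp : measurable_fun setT clamp.
Proof.
apply: measurable_maxr; first exact: measurable_cst.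
by apply: measurable_minr; [exact: measurable_id|exact: measurable_cst].
Qed.

Lemma integral_uniform_bounded (f : R -> R) M : measurable_fun setT f -> (forall x, `|f x| <= M) ->
  \int[P]_x f x = \int[lebesgue_measure]_(x in `[0, 1]) f x.
Proof.
move=> mf fM.
have IP := prob_bounded_integrable P mf fM.
have IM : P.-integrable setT (EFin \o (fun=> M)) by exact: finite_measure_integrable_cst.
have mI : measurable (`[0%R, 1%R] : set R) by exact: measurable_itv.
have l1 : lebesgue_measure (`[0%R, 1%R]%classic : set R) = 1%E.
  by rewrite lebesgue_measure_itv /= lte_fin ltr01 oppr0 adde0.
have IL (g : R -> R) N : measurable_fun setT g -> (forall x, `|g x| <= N) ->
    lebesgue_measure.-integrable `[0%R, 1%R] (EFin \o g).
  move=> mg gN; apply: (@measurable_bounded_integrable _ _ _ (@lebesgue_measure R) _ _ mI).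
  - by rewrite [X in (X < _)%E]l1 ltry.
  - exact: measurable_funTS.
  - by exists N; split; [exact: num_real|move=> x Nx w _; exact: le_trans (gN w) (ltW Nx)].
(* Adding [M] makes the integrand nonnegative, as [integral_uniform] requires. *)
have h : \int[P]_x (f x + M) = \int[lebesgue_measure]_(x in `[0, 1]) (f x + M).
  rewrite /Rintegral integral_uniform.
  - by rewrite subr0 invr1 mul1e.
  - by apply/measurable_EFinP; apply: measurable_funD => //; exact: measurable_cst.
  - by move=> x; rewrite lee_fin; have := fM x; rewrite ler_norml; lra.
move: h; rewrite RintegralD // RintegralD //; last 2 first.
- exact: IL mf fM.
- by apply: (IL (fun=> M) `|M|) => // x; exact: lexx.
rewrite !Rintegral_cst // [X in fine X](probability_setT P) [X in _ = _ + _ * fine X]l1.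
exact: addIr.
Qed.

Lemma integral_uniform_cell n (n0 : (0 < n)%N) (h : 'I_n -> R) :
  measurable_fun setT (fun x => h (cell n0 (clamp x))) /\
  \int[P]_x h (cell n0 (clamp x)) = n%:R^-1 * \sum_i h i.
Proof.
have hE : (fun x => h (cell n0 (clamp x))) = fun x => \sum_(i < n) h i * \1_(block i) (clamp x).
  by apply/funext => x; rewrite (sum_cell n0 h (clamp01 x)).
have mh : measurable_fun setT (fun x => h (cell n0 (clamp x))).
  rewrite hE; apply: measurable_sum => i; apply: measurable_funM; first exact: measurable_cst.
  apply: measurableT_comp; last exact: measurable_clamp.
  apply: measurable_indic; exact: measurable_block.
split => //.
rewrite (integral_uniform_bounded (M := \sum_i `|h i|)) //; last first.
  by move=> x; rewrite (bigD1 (cell n0 (clamp x))) //= lerDl sumr_ge0.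
rewrite -(integral_cell n0 h); apply: eq_Rintegral => x; rewrite inE /= in_itv /= => x01.
by rewrite clamp_id.
Qed.

End Uniform.

Lemma Rintegral_cvg_ae (R : realType) d (T : measurableType d) (P : probability T R)
    (g_ : nat -> T -> R) (g : T -> R) M :
  (forall n, measurable_fun setT (g_ n)) -> measurable_fun setT g ->
  {ae P, forall w, g_ n w @[n --> \oo] --> g w} -> (forall n w, `|g_ n w| <= M) ->
  (\int[P]_w g_ n w)%R @[n --> \oo] --> (\int[P]_w g w)%R.
Proof.
move=> mg_ mg gg gM.
have H1 n : measurable_fun setT (EFin \o g_ n) by exact/measurable_EFinP.
have H2 : measurable_fun setT (EFin \o g) by exact/measurable_EFinP.
have H3 : {ae P, forall w, setT w -> (EFin \o g_ n) w @[n --> \oo] --> (EFin \o g) w}.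
  move: gg => [N [mN N0 sub]]; exists N; split => //; apply: subset_trans sub => w /= h h'.
  by apply: h => _; apply: cvg_EFin; [exact: nearW|exact: h'].
have H4 : P.-integrable setT (EFin \o (fun=> M)) by exact: finite_measure_integrable_cst.
have H5 : {ae P, forall w n, setT w -> (`|(EFin \o g_ n) w| <= (EFin \o (fun=> M)) w)%E}.
  by apply: aeW => w n _; rewrite lee_fin.
have [ig _ c] := @dominated_convergence _ _ _ P _ measurableT _ _ _ H1 H2 H3 H4 H5.
by apply: fine_cvg; rewrite fineK; [exact: c|exact: integrable_fin_num].
Qed.

Lemma cell_divn (R : realType) (a b : nat) (a0 : (0 < a)%N) (ab0 : (0 < a * b)%N) (y : R) : 0 <= y <= 1 ->
  cell a0 y = (cell ab0 y %/ b)%N :> nat.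
Proof.
move=> y01; have := block_cell ab0 y01; have := block_cell a0 y01.
set c := cell ab0 y; set c' := cell a0 y => hc' [c1 c2].
have b0 : (0 < b)%N by have := ab0; rewrite muln_gt0 => /andP[].
have ca : (c %/ b < a)%N by rewrite ltn_divLR.
suff : block (Ordinal ca) y by move=> /(block_inj a0 hc') ->.
have aR : 0 < a%:R :> R by rewrite ltr0n.
have bR : 0 < b%:R :> R by rewrite ltr0n.
have ce := divn_eq c b; have cm := ltn_pmod c b0.
have abR : 0 < (a * b)%:R^-1 :> R by rewrite invr_gt0 ltr0n.
have sc (x : nat) : x%:R / a%:R = (x * b)%:R / (a * b)%:R :> R.
  by rewrite !natrM; field; rewrite !gt_eqF.
split => /=.
  by apply: le_trans c1; rewrite sc ler_pM2r // ler_nat; lia.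
move: c2; case: eqP => [cab|cab y1].
  have -> : (c %/ b).+1 == a by apply/eqP; nia.
  by [].
have lt : y < (c %/ b).+1%:R / a%:R.
  by apply: lt_le_trans y1 _; rewrite sc ler_pM2r // ler_nat; nia.
by case: eqP => // _; have /andP[] := y01.
Qed.

Lemma digits_inj M c c' : (c < 2 ^ M)%N -> (c' < 2 ^ M)%N ->
  (forall i, (i < M)%N -> odd (c %/ 2 ^ i) = odd (c' %/ 2 ^ i)) -> c = c'.
Proof.
elim: M c c' => [|M IH] c c'; first by rewrite expn0; lia.
rewrite !expnS => cM cM' h.
have h0 := h 0%N isT; rewrite expn0 !divn1 in h0.
have : c./2 = c'./2.
  apply: IH; [lia|lia|] => i iM.
  by rewrite -!divn2 -!divnMA -!expnS; apply: h.
by move=> hh; have := odd_double_half c; have := odd_double_half c'; rewrite h0 hh; lia.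
Qed.

Section Bits.
Variable R : realType.
Local Notation P := (uniform_prob (@ltr01 R)).
Local Notation half := (fun=> 2^-1 : R).

Let pow2 i : (0 < 2 ^ i)%N. Proof. by rewrite expn_gt0. Qed.

(** Parity of the dyadic cell of level i + 1, that is, the binary digit of weight 2^-(i + 1). *)
Definition bit i (x : R) : bool := odd (cell (pow2 i.+1) (clamp x)).

Lemma bitE M i x : (i < M)%N -> bit i x = odd (cell (pow2 M) (clamp x) %/ 2 ^ (M - i.+1)).
Proof.
move=> iM; have e : (2 ^ M = 2 ^ i.+1 * 2 ^ (M - i.+1))%N by rewrite -expnD subnKC.
have ab0 : (0 < 2 ^ i.+1 * 2 ^ (M - i.+1))%N by rewrite -e.
rewrite /bit (cell_divn (pow2 i.+1) ab0 (clamp01 x)); congr (odd (_ %/ _)).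
by move: (pow2 M) ab0; rewrite e => p1 p2; rewrite (bool_irrelevance p1 p2).
Qed.

(** The first M bits are the digits of the cell of level M, and [dig] is a bijection from cells to
    bit vectors, so all vectors are equally likely. *)
Lemma bits_uniform M (h : {ffun 'I_M -> bool} -> R) :
  measurable_fun setT (fun x => h [ffun i : 'I_M => bit i x]) /\
  \int[P]_x h [ffun i : 'I_M => bit i x] = bE half h.
Proof.
pose dig (c : 'I_(2 ^ M)) : {ffun 'I_M -> bool} := [ffun i : 'I_M => odd (c %/ 2 ^ (M - i.+1))].
have digE x : [ffun i : 'I_M => bit i x] = dig (cell (pow2 M) (clamp x)).
  by apply/ffunP => i; rewrite !ffunE (bitE _ (ltn_ord i)).
have dinj : injective dig.
  move=> c c' e; apply: val_inj; apply: (digits_inj (ltn_ord c) (ltn_ord c')) => i iM.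
  have i' : (M - i.+1 < M)%N by lia.
  have := congr1 (fun f : {ffun 'I_M -> bool} => f (Ordinal i')) e; rewrite !ffunE /=.
  by rewrite (_ : (M - (M - i.+1).+1)%N = i); last by lia.
have dbij : bijective dig by apply: inj_card_bij => //; rewrite card_ffun card_bool !card_ord.
have [mh hE] := integral_uniform_cell (pow2 M) (fun c => h (dig c)).
split.
  by apply: eq_measurable_fun mh => x _; rewrite digE.
under eq_Rintegral do rewrite digE; rewrite hE /bE (reindex dig); last exact: onW_bij.
rewrite mulr_sumr; apply: eq_bigr => c _; congr (_ * _).
rewrite /mass (eq_bigr (fun=> 2^-1)) => [|i _]; last by rewrite /wt; case: (dig c i) => //; field.
by rewrite prodr_const card_ord natrX exprVn.
Qed.

End Bits.

Section Blocks.
Variable R : realType.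
Local Notation P := (uniform_prob (@ltr01 R)).
Local Notation half := (fun=> 2^-1 : R).

(* The bits are dealt out into infinitely many sequences; the [j]-th one is read as a binary fraction. *)
Definition slot (j i : nat) : nat := choice.pickle (j, i).
Definition fraction (b : nat -> bool) j K : R := \sum_(i < K) (b (slot j i))%:R * 2^-1 ^+ i.+1.

Lemma slot_inj j i j' i' : slot j i = slot j' i' -> j = j' /\ i = i'.
Proof. by move/(pcan_inj choice.pickleK) => []. Qed.

Definition ext M (w : {ffun 'I_M -> bool}) k : bool := oapp w false (insub k).

Lemma bE_half (I : finType) (e : I) (g : bool -> R) :
  bE half (fun w : {ffun I -> bool} => g (w e)) = (g true + g false) / 2.
Proof.
transitivity (bE half (fun w : {ffun I -> bool} => \prod_f (fun f b => if f == e then g b else 1) f (w f))).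
  apply: eq_bE => w; rewrite (bigD1 e) //= eqxx big1 ?mulr1 // => f fe.
  by rewrite (negbTE fe).
have /= -> := bE_prod half (fun (f : I) b => if f == e then g b else 1).
rewrite (bigD1 e) //= eqxx big1 => [|f fe]; last by rewrite (negbTE fe); field.
by field.
Qed.

Lemma sum_ord_double n (f : nat -> R) : \sum_(c < 2 * n) f c = \sum_(c < n) (f (2 * c)%N + f (2 * c).+1).
Proof.
elim: n => [|n IH]; first by rewrite muln0 !big_ord0.
by rewrite mulnS !big_ord_recr /= IH addrA.
Qed.

(** The K bits of sequence [j] are integrated out one by one: the fraction is uniform on the grid of
    step 2^-K and independent of the other bits seen by [G]. The last bit sends c / 2^K to 2c / 2^(K
    + 1) or (2c + 1) / 2^(K + 1). *)
Lemma bE_fraction M (G : R -> {ffun 'I_M -> bool} -> R) j K :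
  (forall i, (i < K)%N -> (slot j i < M)%N) ->
  (forall i v (w w' : {ffun 'I_M -> bool}), (i < K)%N -> (forall f : 'I_M, val f != slot j i -> w f = w' f) -> G v w = G v w') ->
  bE half (fun w => G (fraction (ext w) j K) w) =
  (2 ^ K)%:R^-1 * \sum_(c < 2 ^ K) bE half (G (c%:R / (2 ^ K)%:R)).
Proof.
elim: K G => [|K IH] G sM GI.
  rewrite expn0 invr1 mul1r big_ord1 mul0r; apply: eq_bE => w.
  by rewrite /fraction big_ord0.
pose e : 'I_M := Ordinal (sM K (leqnn _)).
pose r : R := 2^-1 ^+ K.+1.
have fr w : fraction (ext w) j K.+1 = fraction (ext w) j K + (w e)%:R * r.
  rewrite /fraction big_ord_recr /=; congr (_ + _%:R * _).
  by rewrite /ext insubT ?sM //= => h; congr (nat_of_bool (w _)); exact: val_inj.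
have feq (w w' : {ffun 'I_M -> bool}) : (forall f, f != e -> w f = w' f) -> fraction (ext w) j K = fraction (ext w') j K.
  move=> ww; apply: eq_bigr => i _; congr (_%:R * _); congr nat_of_bool.
  rewrite /ext; case: insubP => //= f _ fE; apply: ww; apply/eqP => fe.
  by move: fE; rewrite fe /= => /slot_inj[_]; have := ltn_ord i; lia.
have Ge v (w w' : {ffun 'I_M -> bool}) : (forall f, f != e -> w f = w' f) -> G v w = G v w'.
  by move=> ww; apply: (GI K) => // f fn; apply: ww; apply: contra fn => /eqP ->.
transitivity (bE half (fun w => (w e)%:R * G (fraction (ext w) j K + r) w) +
   bE half (fun w => (~~ w e)%:R * G (fraction (ext w) j K) w)).
  rewrite -bED; apply: eq_bE => w; rewrite fr; case: (w e) => /=.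
    by rewrite !mul1r mul0r addr0.
  by rewrite mul1r !mul0r addr0 add0r.
rewrite (@bE_indep _ _ half e (fun b => b%:R)); last first.
  by move=> w w' ww; rewrite (feq _ _ ww); exact: Ge.
rewrite (@bE_indep _ _ half e (fun b => (~~ b)%:R)); last first.
  by move=> w w' ww; rewrite (feq _ _ ww); exact: Ge.
rewrite (bE_half e (fun b => b%:R)) (bE_half e (fun b => (~~ b)%:R)) /= addr0 add0r mul1r.
have sM' i : (i < K)%N -> (slot j i < M)%N by move=> iK; have := sM i; apply; lia.
rewrite (IH (fun v w => G (v + r) w)) //; last by move=> i v w w' iK; apply: GI; lia.
rewrite (IH G) //; last by move=> i v w w' iK; apply: GI; lia.
rewrite expnS (sum_ord_double _ (fun c => bE half (G (c%:R / (2 * 2 ^ K)%:R)))) big_split /= -mulrDr.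
have p0 : (2 ^ K)%:R != 0 :> R by rewrite pnatr_eq0 expn_eq0.
rewrite -mulrDr natrM invfM -!mulrA; congr (_ * (_ * _)); rewrite addrC; congr (_ + _); apply: eq_bigr => c _.
  apply: eq_bE => w /=; congr (G _ w); rewrite /r -[(2 * c).+1]addn1 natrD natrM exprVn exprS -natrX.
  by field.
by apply: eq_bE => w; congr (G _ w); rewrite natrM; field.
Qed.

End Blocks.

Section QuantileLaw.
Context {R : realType} d (T : measurableType d) (m : probability T R) (Z : {RV m >-> R}).
Local Notation P := (uniform_prob (@ltr01 R)).
Local Notation Q := (quantile Z).

Let mQc : measurable_fun setT (fun x => Q (clamp x)).
Proof. by apply: measurableT_comp; [exact: measurable_quantile|exact: measurable_clamp]. Qed.

Definition rv_of d' (T' : measurableType d') (P' : probability T' R) (f : T' -> R)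
  (mf : measurable_fun setT f) : {RV P' >-> R} := mfun_Sub (mem_set mf).

Let Qc : {RV P >-> R} := rv_of P mQc.

(** By [quantile_le] the quantile at u exceeds a exactly when F(a) < u, an interval of length 1 -
    F(a). *)
Lemma quantile_law (B : set R) : measurable B -> distribution P Qc B = distribution m Z B.
Proof.
apply: (@law_unique R (distribution P Qc) (distribution m Z)) => [|a]; first exact: probability_setT.
have c0 := cdf_ge0 Z a; have c1 := cdf_le1 Z a.
set F := fine (cdf Z a).
have FE : cdf Z a = F%:E by rewrite fineK // fin_num_measure.
have F0 : 0 <= F by rewrite -lee_fin -FE.
have F1 : F <= 1 by rewrite -lee_fin -FE.
rewrite [RHS](_ : _ = (1 - F)%:E); last first.
  rewrite -setCitvl [LHS](@probability_setC _ _ _ (distribution m Z)) ?EFinB -?FE //; exact: measurable_itv.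
pose A := Qc @^-1` `]a, +oo[.
have mA : measurable A by rewrite -[A]setTI; apply: measurable_funPT => //; exact: measurable_itv.
rewrite -[LHS]/(P A) -[LHS]fineK; last by rewrite fin_num_measure.
congr EFin.
have -> : fine (P A) = \int[P]_x \1_A x.
  by rewrite /Rintegral integral_indic // setIT.
have m1 : measurable_fun setT (\1_A : R -> R) by exact: measurable_indic.
have b1 (x : R) : `|\1_A x : R| <= 1 by rewrite indicE; case: (_ \in _); rewrite ?normr1 ?normr0.
rewrite (integral_uniform_bounded m1 b1).
have mI : measurable (`]0%R, 1%R[ : set R) by exact: measurable_itv.
have int1 (I : set R) : measurable I -> I `<=` `[0, 1] -> lebesgue_measure.-integrable I (EFin \o (\1_A : R -> R)).
  move=> mI' I01; apply: (@measurable_bounded_integrable _ _ _ (@lebesgue_measure R) _ _ mI').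
  - apply: (@le_lt_trans _ _ (lebesgue_measure (`[0%R, 1%R]%classic : set R))); last first.
      by rewrite lebesgue_measure_itv /= lte_fin ltr01 oppr0 adde0 ltry.
    by apply: le_measure; rewrite ?inE.
  - exact: measurable_funTS.
  - by exists 1; split => // r r1 x _; exact: le_trans (b1 x) (ltW r1).
rewrite -Rintegral_itv_obnd_cbnd; last first.
  by apply: int1; [exact: measurable_itv|apply: subset_itvr; rewrite bnd_simp].
rewrite -Rintegral_itv_bndo_bndc; last first.
  by apply: int1; [exact: measurable_itv|apply: subset_itv; rewrite bnd_simp].
rewrite /Rintegral integral_indic //.
have -> : A `&` `]0, 1[ = `]F, 1[%classic.
  apply/seteqP; split => x /=; rewrite /A /= !in_itv /= ?andbT.
    move=> [xa x01]; move: xa; rewrite clamp_id; last by case/andP: x01 => /ltW -> /ltW ->.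
    by rewrite ltNge quantile_le // -ltNge => ->; case/andP: x01.
  move=> /andP[Fx x1]; have x01 : 0 < x < 1 by rewrite (le_lt_trans F0 Fx).
  by split => //; rewrite clamp_id ?ltW ?(le_lt_trans F0 Fx) // ltNge quantile_le // -ltNge.
rewrite [X in fine X](lebesgue_measure_itv `]F, 1[) /= lte_fin; case: ltP => [//|h] /=.
by apply/eqP; rewrite eq_sym subr_eq0 eq_le h F1.
Qed.

Lemma integral_quantile (g : R -> R) M : measurable_fun setT g -> (forall x, `|g x| <= M) ->
  \int[P]_x g (Q (clamp x)) = \int[m]_w g (Z w).
Proof.
move=> mg gM.
have mg' : measurable_fun setT (EFin \o g) by exact/measurable_EFinP.
have I1 : P.-integrable setT ((EFin \o g) \o Qc).
  by apply: (@prob_bounded_integrable _ _ _ P _ M) => //; exact: measurableT_comp.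
have I2 : m.-integrable setT ((EFin \o g) \o Z).
  by apply: (@prob_bounded_integrable _ _ _ m _ M) => //; exact: measurableT_comp.
rewrite /Rintegral; congr fine.
rewrite -[LHS]/(\int[P]_x ((EFin \o g) \o Qc) x)%E -[RHS]/(\int[m]_x ((EFin \o g) \o Z) x)%E.
rewrite -!integral_distribution //; apply: eq_measure_integral => B mB _.
exact: quantile_law.
Qed.

End QuantileLaw.

Section Iid.
Variable R : realType.
Local Notation P := (uniform_prob (@ltr01 R)).
Local Notation N01 := (normal_prob (0 : R) 1).
Local Notation half := (fun=> 2^-1 : R).

Let Z : {RV N01 >-> R} := rv_of N01 (@measurable_id _ R setT).
Local Notation Q := (quantile Z).

Definition unif j K (x : R) : R := fraction R (fun k => bit k x) j K.

Let slots N K : exists M, forall j i, (j < N)%N -> (i < K)%N -> (slot j i < M)%N.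
Proof.
exists (\max_(p : 'I_N * 'I_K) slot p.1 p.2).+1 => j i jN iK; rewrite ltnS.
exact: (leq_bigmax (Ordinal jN, Ordinal iK)).
Qed.

Lemma unif_ext M j K x : (forall i, (i < K)%N -> (slot j i < M)%N) ->
  unif j K x = fraction R (ext [ffun i : 'I_M => bit i x]) j K.
Proof.
move=> h; apply: eq_bigr => i _; congr (_%:R * _); congr nat_of_bool.
by rewrite /ext insubT ?h //= => h'; rewrite ffunE.
Qed.

Lemma measurable_unif j K : measurable_fun setT (unif j K).
Proof.
have [M hM] := slots j.+1 K.
have := proj1 (bits_uniform (M := M) (fun w => fraction R (ext w) j K)).
by apply: eq_measurable_fun => x _; apply/esym/unif_ext => i iK; exact: hM.
Qed.

(** Characteristic function of N approximate normal variables built on K bits each; K tends to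
    infinity at fixed N. *)
Definition partial (a : nat -> R) N K s : R :=
  \int[P]_x cos (\sum_(j < N) a j * Q (unif j K x) + s).

Lemma partialS a N K s : partial a N.+1 K s =
  (2 ^ K)%:R^-1 * \sum_(c < 2 ^ K) partial a N K (a N * Q (c%:R / (2 ^ K)%:R) + s).
Proof.
have [M hM] := slots N.+1 K.
pose X n (w : {ffun 'I_M -> bool}) := \sum_(j < n) a j * Q (fraction R (ext w) j K).
have pE n t : (n <= N.+1)%N -> partial a n K t = bE half (fun w => cos (X n w + t)).
  move=> nN; rewrite -(proj2 (bits_uniform _)); apply: eq_Rintegral => x _.
  congr (cos (_ + _)); apply: eq_bigr => j _; congr (_ * Q _); apply: unif_ext => i iK.
  by apply: hM => //; exact: leq_trans (ltn_ord j) nN.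
rewrite pE //.
pose G v (w : {ffun 'I_M -> bool}) := cos (X N w + (a N * Q v + s)).
transitivity (bE half (fun w => G (fraction R (ext w) N K) w)).
  by apply: eq_bE => w; rewrite /G /X big_ord_recr /= addrA.
rewrite bE_fraction.
- congr (_ * _); apply: eq_bigr => c _; rewrite pE //.
- by move=> i iK; exact: hM.
move=> i v w w' iK ww; congr (cos (_ + _)); apply: eq_bigr => j _; congr (_ * Q _).
apply: eq_bigr => k _; congr (_%:R * _); congr nat_of_bool.
rewrite /ext; case: insubP => //= f _ fE; apply: ww; apply/eqP => h.
have /slot_inj[jN _] : slot j k = slot N i by rewrite -fE -h.
by have := ltn_ord j; rewrite jN ltnn.
Qed.

Lemma measurable_partial (a : nat -> R) N K s : measurable_fun setT (fun x : R => cos (\sum_(j < N) a j * Q (unif j K x) + s)).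
Proof.
apply: measurable_cos_comp; apply: measurable_funD; last exact: measurable_cst.
apply: measurable_sum => j; apply: measurable_funM; first exact: measurable_cst.
by apply: measurableT_comp; [exact: measurable_quantile|exact: measurable_unif].
Qed.

(** Takes a phase out of the integral, so that the average over the grid in [partialS] factors. *)
Lemma partial_add a N K s v : partial a N K (v + s) =
  cos v * partial a N K s + sin v * partial a N K (s + pi / 2).
Proof.
have ip t : P.-integrable setT (EFin \o (fun x : R => cos (\sum_(j < N) a j * Q (unif j K x) + t))).
  by apply: (@prob_bounded_integrable _ _ _ P _ 1); [exact: measurable_partial|move=> x; exact: cos_max].
have i1 := integrableZl measurableT (cos v) (ip s).
have i2 := integrableZl measurableT (sin v) (ip (s + pi / 2)).
rewrite /partial -!RintegralZl //.
rewrite -RintegralD //.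
apply: eq_Rintegral => x _; set y := \sum_(j < N) _.
rewrite (_ : y + (v + s) = v + (y + s)); last by ring.
by rewrite (addrA y s) cosDpihalf cosD; ring.
Qed.

Lemma null_clamp1 : P (`[1, +oo[%classic) = 0%E.
Proof.
rewrite /uniform_prob integral_uniform_pdf (_ : _ `&` _ = [set 1]).
  by rewrite integral_set1.
apply/seteqP; split => x /=; rewrite !in_itv /= ?andbT.
  by move=> [x1 /andP[_ x1']]; apply/eqP; rewrite eq_le x1 x1'.
by move=> ->; rewrite lexx ler01.
Qed.

Lemma cvg_pow2 : (2 ^ K)%:R^-1 @[K --> \oo] --> (0 : R).
Proof.
rewrite (_ : (fun K => _) = fun K => (2^-1 : R) ^+ K); last by apply/funext => K; rewrite natrX exprVn.
by apply: cvg_expr; rewrite ger0_norm ?invr_ge0 // invf_lt1 // ltr1n.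
Qed.

(** The average is the integral of the function evaluated at left ends of dyadic cells. These tend
    to the clamped point from the left, so [quantile_left_cvg] and dominated convergence apply off
    the null set where that point is 1. *)
Lemma grid_cvg a s : (2 ^ K)%:R^-1 * (\sum_(c < 2 ^ K) cos (a * Q (c%:R / (2 ^ K)%:R) + s)) @[K --> \oo] -->
  expR (- (a ^+ 2 / 2)) * cos s.
Proof.
have pow2 i : (0 < 2 ^ i)%N by rewrite expn_gt0.
pose g (x : R) := cos (a * x + s).
have mg : measurable_fun setT g.
  apply: measurable_cos_comp; apply: measurable_funD; last exact: measurable_cst.
  by apply: measurable_funM; [exact: measurable_cst|exact: measurable_id].
have gM x : `|g x| <= 1 by exact: cos_max.
have -> : expR (- (a ^+ 2 / 2)) * cos s = \int[P]_x g (Q (clamp x)).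
  rewrite (integral_quantile Z mg gM) /g.
  have := normal_char (sg := 1) (oner_neq0 R) a s; rewrite expr1n mul1r => <-.
  by apply: eq_Rintegral.
have gc : continuous g.
  move=> z; apply: continuous_comp; last exact: continuous_cos.
  by apply: cvgD; [apply: cvgM; [exact: cvg_cst|exact: cvg_id]|exact: cvg_cst].
pose gK K (x : R) := g (Q ((cell (pow2 K) (clamp x))%:R / (2 ^ K)%:R)).
have hE K := integral_uniform_cell (pow2 K) (fun c => g (Q (c%:R / (2 ^ K)%:R))).
rewrite (_ : (fun K => _) = fun K => \int[P]_x gK K x); last first.
  by apply/funext => K; rewrite (proj2 (hE K)).
apply: (@Rintegral_cvg_ae _ _ _ _ _ _ 1).
- by move=> K; exact: (proj1 (hE K)).
- apply: measurableT_comp mg _.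
  by apply: measurableT_comp; [exact: measurable_quantile|exact: measurable_clamp].
- exists `[1, +oo[%classic; split; [exact: measurable_itv|exact: null_clamp1|].
  move=> x /= h; rewrite in_itv /= andbT leNgt; apply/negP => x1; apply: h.
  have y1 : 0 <= clamp x < 1.
    have /andP[-> _] := clamp01 x; rewrite /= /clamp gt_max ltr01 /=.
    by rewrite gt_min x1.
  pose c K : R := (cell (pow2 K) (clamp x))%:R / (2 ^ K)%:R.
  apply: (cvg_comp (fun K => Q (c K)) g); last exact: gc.
  have cy K : c K <= clamp x by have [] := block_cell (pow2 K) (clamp01 x).
  have yc K : clamp x <= c K + (2 ^ K)%:R^-1.
    have [_] := block_cell (pow2 K) (clamp01 x).
    have -> : c K + (2 ^ K)%:R^-1 = (cell (pow2 K) (clamp x)).+1%:R / (2 ^ K)%:R.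
      by rewrite -natr1 mulrDl mul1r.
    case: eqP => [e h|_ /ltW //]; rewrite e divff //.
  apply: quantile_left_cvg => // [K|]; first by rewrite cy andbT divr_ge0.
  apply: (@squeeze_cvgr _ _ _ _ (fun K => clamp x - (2 ^ K)%:R^-1) (fun=> clamp x)).
  - by apply: nearW => K; rewrite cy andbT lerBlDr.
  - by rewrite -[X in _ --> X](subr0 (clamp x)); apply: cvgB; [exact: cvg_cst|exact: cvg_pow2].
  - exact: cvg_cst.
- by move=> K x; exact: gM.
Qed.

Lemma partial_cvg a N s : partial a N K s @[K --> \oo] -->
  expR (- ((\sum_(j < N) a j ^+ 2) / 2)) * cos s.
Proof.
elim: N s => [|N IH] s.
  rewrite big_ord0 mul0r oppr0 expR0 mul1r (_ : (fun K => _) = fun=> cos s); first exact: cvg_cst.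
  apply/funext => K; rewrite /partial -[RHS](Rintegral_prob_cst P); apply: eq_Rintegral => x _.
  by rewrite big_ord0 add0r.
pose A K t := (2 ^ K)%:R^-1 * (\sum_(c < 2 ^ K) cos (a N * Q (c%:R / (2 ^ K)%:R) + t)).
have -> : (fun K => partial a N.+1 K s) = fun K => A K 0 * partial a N K s + A K (- (pi / 2)) * partial a N K (s + pi / 2).
  apply/funext => K; rewrite partialS /A -!mulrA -mulrDr; congr (_ * _).
  rewrite !mulr_suml -big_split /=; apply: eq_bigr => c _.
  by rewrite [LHS]partial_add addr0 cosBpihalf.
have c1 : A K 0 @[K --> \oo] --> expR (- (a N ^+ 2 / 2)).
  by have := @grid_cvg (a N) 0; rewrite cos0 mulr1.
have c2 : A K (- (pi / 2)) @[K --> \oo] --> (0 : R).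
  by have := @grid_cvg (a N) (- (pi / 2)); rewrite cosN cos_pihalf mulr0.
have -> : expR (- ((\sum_(j < N.+1) a j ^+ 2) / 2)) * cos s =
    expR (- (a N ^+ 2 / 2)) * (expR (- ((\sum_(j < N) a j ^+ 2) / 2)) * cos s) +
    0 * (expR (- ((\sum_(j < N) a j ^+ 2) / 2)) * cos (s + pi / 2)).
  by rewrite big_ord_recr /= mulrDl opprD expRD; ring.
exact: (cvgD (cvgM c1 (IH s)) (cvgM c2 (IH (s + pi / 2)))).
Qed.

Lemma unif_bound j K x : 0 <= unif j K x <= 1 - 2^-1 ^+ K.
Proof.
rewrite /unif /fraction; apply/andP; split.
  by apply: sumr_ge0 => i _; rewrite mulr_ge0 ?ler0n // exprn_ge0 // invr_ge0.
elim: K => [|K IH]; first by rewrite big_ord0 expr0 subrr.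
rewrite big_ord_recr /=; set b := (bit _ x)%:R.
have b1 : b <= 1 :> R by rewrite /b; case: (bit _ _).
have p0 : 0 <= (2^-1 : R) ^+ K.+1 by rewrite exprn_ge0 // invr_ge0.
have pE : (2^-1 : R) ^+ K = 2 * 2^-1 ^+ K.+1 by rewrite exprS mulrA divff ?mul1r.
have : b * 2^-1 ^+ K.+1 <= 1 * 2^-1 ^+ K.+1 by rewrite ler_wpM2r.
rewrite pE in IH; lra.
Qed.

Lemma unif_nondecreasing j x : nondecreasing_seq (fun K => unif j K x).
Proof.
apply/nondecreasing_seqP => K; rewrite /unif /fraction big_ord_recr /= lerDl.
by rewrite mulr_ge0 ?ler0n // exprn_ge0 // invr_ge0.
Qed.

Definition unif_lim j x : R := limn (fun K => unif j K x).

Lemma unif_cvg j x : unif j K x @[K --> \oo] --> unif_lim j x.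
Proof.
apply: nondecreasing_is_cvgn; first exact: unif_nondecreasing.
exists 1 => _ [K _ <-]; have /andP[_ h] := unif_bound j K x; apply: le_trans h _.
by rewrite gerBl exprn_ge0 // invr_ge0.
Qed.

Lemma unif_le j K x : unif j K x <= unif_lim j x.
Proof.
apply: nondecreasing_cvgn_le; first exact: unif_nondecreasing.
exact: unif_cvg.
Qed.

Lemma unif_gap j K x : unif_lim j x <= unif j K x + 2^-1 ^+ K.
Proof.
have p0 L : 0 <= (2^-1 : R) ^+ L by rewrite exprn_ge0 // invr_ge0.
apply: limr_le; first exact: unif_cvg.
near=> L; have KL : (K <= L)%N by near: L; exact: nbhs_infty_ge.
suff : unif j L x <= unif j K x + (2^-1 ^+ K - 2^-1 ^+ L) by have := p0 L; lra.
rewrite -(subnKC KL); elim: (L - K)%N => [|r IH]; first by rewrite addn0 subrr addr0.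
rewrite addnS; apply: (@le_trans _ _ (unif j (K + r) x + 2^-1 ^+ (K + r).+1)).
  rewrite /unif /fraction big_ord_recr /= lerD2l ler_piMl //.
  by case: (bit _ _).
have pE : (2^-1 : R) ^+ (K + r) = 2 * 2^-1 ^+ (K + r).+1 by rewrite exprS mulrA divff ?mul1r.
rewrite pE in IH; lra.
Unshelve. all: by end_near.
Qed.

Lemma measurable_unif_lim j : measurable_fun setT (unif_lim j).
Proof. by apply: measurable_fun_cvg (measurable_unif j) _ => x _; exact: unif_cvg. Qed.

(** The value 1 - 2^-K is reached only when all K bits are 1: one grid point out of 2^K. *)
Lemma unif_top j K : \int[P]_x ((1 - 2^-1 ^+ K <= unif j K x)%R%:R : R) <= (2 ^ K)%:R^-1.
Proof.
have [M hM] := slots j.+1 K.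
pose G (v : R) (w : {ffun 'I_M -> bool}) : R := (1 - 2^-1 ^+ K <= v)%R%:R.
have sM i : (i < K)%N -> (slot j i < M)%N by exact: hM.
have -> : \int[P]_x ((1 - 2^-1 ^+ K <= unif j K x)%R%:R : R) = bE half (fun w => G (fraction R (ext w) j K) w).
  by rewrite -(proj2 (bits_uniform _)); apply: eq_Rintegral => x _; rewrite (unif_ext _ sM).
rewrite bE_fraction //.
have p0 : 0 < (2 ^ K)%:R :> R by rewrite ltr0n expn_gt0.
rewrite ler_piMr ?invr_ge0 ?(ltW p0) //.
have lastK : ((2 ^ K).-1 < 2 ^ K)%N by rewrite prednK ?expn_gt0.
have Gc v : bE half (G v) = (1 - 2^-1 ^+ K <= v)%R%:R by exact: bE_cst.
rewrite (bigD1 (Ordinal lastK)) //= big1 ?addr0.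
  by rewrite Gc; case: (1 - _ <= _)%R.
move=> c cl; rewrite Gc; case: leP => // h; exfalso; move/negP: cl; apply; apply/eqP/val_inj => /=.
have := ltn_ord c; have : ((2 ^ K).-1 <= c)%N; last by lia.
rewrite -(ler_nat R) -subn1 natrB ?expn_gt0 //.
move: h; rewrite ler_pdivlMr // mulrBl mul1r exprVn -natrX mulVf ?gt_eqF //.
Qed.

(** A limit of at least 1 forces every truncation to be maximal, which has probability at most 2^-K
    for each K. This secures the condition u < 1 of [quantile_left_cvg]. *)
Lemma unif_lim_lt1 j : {ae P, forall x, unif_lim j x < 1}.
Proof.
pose A := unif_lim j @^-1` `[1, +oo[%classic.
have mA : measurable A.
  by rewrite -[A]setTI; apply: measurable_unif_lim => //; exact: measurable_itv.
exists A; split => //; last first.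
  by move=> x /= h; rewrite /A /= in_itv /= andbT leNgt; exact/negP.
have PA : P A = (\int[P]_x (\1_A x : R))%:E.
  by rewrite /Rintegral integral_indic // setIT fineK // fin_num_measure.
have i0 : 0 <= \int[P]_x (\1_A x : R) by apply: Rintegral_ge0 => x _; rewrite indicE.
have ub K : \int[P]_x (\1_A x : R) <= (2 ^ K)%:R^-1.
  apply: le_trans (unif_top j K); apply: le_Rintegral => //.
  - apply: (@prob_bounded_integrable _ _ _ P _ 1); first exact: measurable_indic.
    by move=> x; rewrite indicE; case: (_ \in _); rewrite ?normr1 ?normr0.
  - apply: (@prob_bounded_integrable _ _ _ P _ 1) => [|x]; last by case: (1 - _ <= _)%R; rewrite ?normr1 ?normr0.
    rewrite (_ : (fun x => _) = \1_(unif j K @^-1` `[1 - 2^-1 ^+ K, +oo[%classic)).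
      apply: measurable_indic; rewrite -[X in measurable X]setTI.
      by apply: measurable_unif => //; exact: measurable_itv.
    apply/funext => x; rewrite indicE; congr (_%:R); congr nat_of_bool.
    by apply/idP/idP; rewrite inE /= in_itv /= andbT.
  move=> x _; rewrite indicE; case: (boolP (_ \in _)); last by rewrite ler0n.
  rewrite inE /A /= in_itv /= andbT => u1; have := unif_gap j K x => gap.
  by rewrite (_ : (1 - _ <= _) = true) //; apply/idP; lra.
rewrite PA; congr EFin; apply/eqP; rewrite eq_le i0 andbT.
by apply: (cvgr_to_ge cvg_pow2); apply: nearW => K; exact: ub.
Qed.

Definition iid_normal j x : R := Q (unif_lim j x).

Lemma measurable_iid j : measurable_fun setT (iid_normal j).
Proof.
apply: measurableT_comp; first exact: measurable_quantile.
exact: measurable_unif_lim.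
Qed.

Lemma iid_char (a : nat -> R) N s : \int[P]_x cos (\sum_(j < N) a j * iid_normal j x + s) =
  expR (- ((\sum_(j < N) a j ^+ 2) / 2)) * cos s.
Proof.
suff c : partial a N K s @[K --> \oo] --> \int[P]_x cos (\sum_(j < N) a j * iid_normal j x + s).
  exact: (cvg_unique (@Rhausdorff R) c (@partial_cvg a N s)).
apply: (@Rintegral_cvg_ae _ _ _ _ _ _ 1).
- by move=> K; exact: measurable_partial.
- apply: measurable_cos_comp; apply: measurable_funD; last exact: measurable_cst.
  apply: measurable_sum => j; apply: measurable_funM; first exact: measurable_cst.
  exact: measurable_iid.
- have : {ae P, forall x, forall j : 'I_N, unif_lim j x < 1}.
    have : {ae P, forall x, forall j, unif_lim j x < 1} by apply/ae_foralln => j; exact: unif_lim_lt1.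
    by move=> [N0 [mN PN sub]]; exists N0; split => //; apply: subset_trans sub => x /= h h'; apply: h => j.
  move=> [N0 [mN PN sub]]; exists N0; split => //; apply: subset_trans sub => x /= ncv h; apply: ncv.
  apply: (cvg_comp _ (fun y => cos y)); last exact: continuous_cos.
  apply: cvgD; last exact: cvg_cst.
  apply: cvg_sum => j; apply: cvgM; first exact: cvg_cst.
  apply: quantile_left_cvg.
  - rewrite h andbT; apply: le_trans (unif_le j 0 x); by have /andP[] := unif_bound j 0 x.
  - by move=> K; rewrite unif_le andbT; have /andP[] := unif_bound j K x.
  - exact: unif_cvg.
- by move=> K x; exact: cos_max.
Qed.

End Iid.

(** * Gaussian processes with a given covariance *)

Section Kernel.
Variable R : realType.
Implicit Types (K : nat -> nat -> R) (c : nat -> R).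

Definition qform N c K : R := \sum_(k < N) \sum_(h < N) c k * c h * K k h.

Definition psd K := (forall k h, K k h = K h k) /\ forall N c, 0 <= qform N c K.

Lemma sum_delta N r (g : nat -> R) : (r < N)%N -> \sum_(k < N) (k == r :> nat)%:R * g k = g r.
Proof.
move=> rN; rewrite (bigD1 (Ordinal rN)) //= eqxx mul1r big1 ?addr0 // => k kr.
by rewrite (_ : (k == r :> nat) = false) ?mul0r //; apply: contraNF kr => /eqP h; apply/eqP/val_inj.
Qed.

Lemma qform_sub N r t c K : (forall k h, K k h = K h k) -> (r < N)%N ->
  qform N (fun k => c k - t * (k == r)%:R) K =
  qform N c K - 2 * t * (\sum_(k < N) c k * K k r) + t ^+ 2 * K r r.
Proof.
move=> Ks rN; rewrite /qform.
pose b := \sum_(k < N) c k * K k r.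
have e1 (k : 'I_N) : \sum_(h < N) (c k - t * (k == r :> nat)%:R) * (c h - t * (h == r :> nat)%:R) * K k h =
   \sum_(h < N) c k * c h * K k h - t * (c k * K k r) - (k == r :> nat)%:R * (t * \sum_(h < N) c h * K k h)
     + (k == r :> nat)%:R * (t ^+ 2 * K k r).
  have d1 := sum_delta (fun h => c k * K k h) rN.
  have d2 := sum_delta (fun h => (k == r :> nat)%:R * (t ^+ 2 * K k h)) rN.
  rewrite -d2 -d1 !mulr_sumr -!sumrB -big_split /=; apply: eq_bigr => h _; ring.
rewrite (eq_bigr _ (fun k _ => e1 k)) big_split /= !sumrB.
rewrite (sum_delta (fun k => t * \sum_(h < N) c h * K k h) rN) (sum_delta (fun k => t ^+ 2 * K k r) rN).
rewrite -mulr_sumr.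
have -> : \sum_(h < N) c h * K r h = \sum_(k < N) c k * K k r by apply: eq_bigr => k _; rewrite Ks.
ring.
Qed.

Lemma sum_extend N M (g : nat -> R) : (N <= M)%N -> (forall k, (N <= k)%N -> g k = 0) ->
  \sum_(k < M) g k = \sum_(k < N) g k.
Proof.
move=> NM g0; rewrite -!(big_mkord xpredT g) [LHS](big_cat_nat (n := N)) //=.
by rewrite [X in _ + X]big_nat_cond [X in _ + X]big1 ?addr0 // => k /andP[/andP[h _] _]; exact: g0.
Qed.

Lemma qform_extend N M c K : (N <= M)%N -> qform M (fun k => if (k < N)%N then c k else 0) K = qform N c K.
Proof.
move=> NM; rewrite /qform.
rewrite (sum_extend (g := fun k => \sum_(h < M) (if (k < N)%N then c k else 0) * (if (h < N)%N then c h else 0) * K k h) NM); last first.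
  by move=> k kN; rewrite ltnNge kN /= big1 // => h _; rewrite !mul0r.
apply: eq_bigr => k _.
rewrite (sum_extend (g := fun h => (if (k < N)%N then c k else 0) * (if (h < N)%N then c h else 0) * K k h) NM).
  by apply: eq_bigr => h _; rewrite !ltn_ord.
by move=> h hN; rewrite [(h < N)%N]ltnNge hN /= mulr0 mul0r.
Qed.

(** Schur complement of the pivot [r]. By the convention x / 0 = 0 it is [K] itself when the pivot
    vanishes. *)
Definition schur K r k h : R := K k h - K k r * K h r / K r r.

Lemma qform_schur N r c K : qform N c (schur K r) = qform N c K - (\sum_(k < N) c k * K k r) ^+ 2 / K r r.
Proof.
rewrite /qform expr2 !mulr_suml -sumrB; apply: eq_bigr => k _.
rewrite mulr_sumr mulr_suml -sumrB; apply: eq_bigr => h _; rewrite /schur; ring.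
Qed.

(** For a nonzero pivot the form of the complement at c is the minimum over t of the form of [K] at
    c - t e_r, attained at t = b / K r r. Padding c with zeros up to M brings the index r into
    range. *)
Lemma psd_schur K r : psd K -> psd (schur K r).
Proof.
move=> [Ks Kp]; split=> [k h|N c]; first by rewrite /schur Ks [K k r * _]mulrC.
have [a0|a0] := eqVneq (K r r) 0.
  by rewrite qform_schur a0 invr0 mulr0 subr0.
pose M := (N + r.+1)%N; pose c' k : R := if (k < N)%N then c k else 0.
have NM : (N <= M)%N by rewrite leq_addr.
have rM : (r < M)%N by rewrite /M addnS ltnS leq_addl.
rewrite -(qform_extend c _ NM) -/c' qform_schur.
set b := \sum_(k < M) _.
have := Kp M (fun k => c' k - b / K r r * (k == r)%:R).
rewrite qform_sub // -/b; congr (_ <= _); by field.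
Qed.

Lemma psd_diag K r : psd K -> 0 <= K r r.
Proof.
move=> [Ks Kp].
have := Kp r.+1 (fun k => 0 - -1 * (k == r)%:R).
rewrite (@qform_sub _ _ _ (fun=> 0)) //; congr (_ <= _).
rewrite /qform !big1 => [||k _]; first by ring.
- by move=> k _; rewrite mul0r.
- by rewrite big1 // => h _; rewrite !mul0r.
Qed.

(** At e_r + s e_k the form equals 2 s K k r + s^2 K k k, which is negative for the chosen s if K k
    r is nonzero. The +1 in the denominator guards against K k k = 0. *)
Lemma psd_null K r k : psd K -> K r r = 0 -> K k r = 0.
Proof.
move=> [Ks Kp] a0; apply/eqP; apply/negP => /negP nz.
pose M := (k + r).+1; pose s := - K k r / (K k k + 1).
have kM : (k < M)%N by rewrite ltnS leq_addr.
have rM : (r < M)%N by rewrite ltnS leq_addl.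
have Kk := psd_diag k (conj Ks Kp).
have := Kp M (fun j => (0 - (-1) * (j == r)%:R) - (- s) * (j == k)%:R).
rewrite (@qform_sub _ _ _ (fun j => 0 - (-1) * (j == r)%:R)) //.
rewrite (@qform_sub _ _ _ (fun=> 0)) // a0.
have -> : qform M (fun=> 0) K = 0.
  by rewrite /qform big1 // => i _; rewrite big1 // => h _; rewrite !mul0r.
rewrite big1 => [|i _]; last by rewrite mul0r.
have -> : \sum_(i < M) (0 - -1 * (i == r :> nat)%:R) * K i k = K k r.
  rewrite Ks -(sum_delta (fun i => K i k) rM); apply: eq_bigr => i _; ring.
apply/negP; rewrite -ltNge.
have x0 : 0 < K k k + 1 by rewrite ltr_wpDl.
have -> : 0 - 2 * -1 * 0 + (-1) ^+ 2 * 0 - 2 * - s * K k r + (- s) ^+ 2 * K k k =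
   - (K k r ^+ 2 * (K k k + 2)) / (K k k + 1) ^+ 2.
  by rewrite /s; field; rewrite gt_eqF.
rewrite mulNr oppr_lt0 divr_gt0 ?exprn_gt0 // mulr_gt0 ?ltr_wpDl //.
by rewrite exprn_even_gt0.
Qed.

Fixpoint residual K r := if r is r'.+1 then schur (residual K r') r' else K.

Lemma psd_residual K r : psd K -> psd (residual K r).
Proof. by move=> Kp; elim: r => //= r IH; exact: psd_schur. Qed.

Lemma residual0 K r k h : psd K -> (k < r)%N -> residual K r k h = 0.
Proof.
move=> Kp; elim: r h => // r IH h; rewrite ltnS leq_eqVlt => /predU1P[->|kr] /=; rewrite /schur.
  have Pr := psd_residual r Kp; have [a0|a0] := eqVneq (residual K r r r) 0.
    by rewrite a0 mul0r mul0r subr0 Pr.1 psd_null.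
  by rewrite [residual K r h r]Pr.1 mulrAC divff // mul1r subrr.
by rewrite !IH // !mul0r subr0.
Qed.

(** If the pivot is 0 the column is 0, consistently with [psd_null], which makes the column of the
    residual vanish. *)
Definition chol K k r : R := residual K r k r / Num.sqrt (residual K r r r).

Lemma chol0 K k r : psd K -> (k < r)%N -> chol K k r = 0.
Proof. by move=> Kp kr; rewrite /chol residual0 // mul0r. Qed.

Lemma cholesky_partial K k h N : psd K ->
  K k h = \sum_(r < N) chol K k r * chol K h r + residual K N k h.
Proof.
move=> Kp; elim: N => [|N IH]; first by rewrite big_ord0 add0r.
rewrite big_ord_recr /= IH -addrA; congr (_ + _).
have Pr := psd_residual N Kp.
rewrite /schur /chol mulrACA -invfM -expr2 sqr_sqrtr ?psd_diag // addrC subrK.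
by [].
Qed.

Lemma cholesky K k h N : psd K -> (k < N)%N -> K k h = \sum_(r < N) chol K k r * chol K h r.
Proof. by move=> Kp kN; rewrite (cholesky_partial k h N Kp) residual0 // addr0. Qed.

End Kernel.

Lemma cvg_dist_le (R : realType) (u : nat -> R) (l M : R) :
  (forall n, `|u n - l| <= M / n.+1%:R) -> u n @[n --> \oo] --> l.
Proof.
move=> h; rewrite (_ : u = (u \- cst l) \+ cst l); last by apply/funext => n /=; rewrite subrK.
rewrite -[X in _ --> X]add0r; apply: cvgD; last exact: cvg_cst.
apply/norm_cvg0P; apply: (squeeze_cvgr (f := cst 0) (h := fun n => M * n.+1%:R^-1)).
- by apply: nearW => n; rewrite normr_ge0 h.
- exact: cvg_cst.
- by rewrite -[X in _ --> X](mulr0 M); apply: cvgM; [exact: cvg_cst|exact: cvg_harmonic].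
Qed.

Section Moments.
Context {R : realType} d {T : measurableType d} (P : probability T R).
Variables (f : T -> R) (v : R).
Hypothesis mf : measurable_fun setT f.
Hypothesis v0 : 0 <= v.
Hypothesis charf : forall t s, \int[P]_w cos (t * f w + s) = expR (- (v * t ^+ 2 / 2)) * cos s.

(** Second difference quotient of the characteristic function at 0: at most f^2, tending to f^2, and
    with an explicit integral. *)
Let sq n w : R := 2 * n.+1%:R ^+ 2 * (1 - cos (n.+1%:R^-1 * f w + 0)).

Let nz n : n.+1%:R != 0 :> R. Proof. by rewrite pnatr_eq0. Qed.

Let sqE n : \int[P]_w sq n w = 2 * n.+1%:R ^+ 2 * (1 - expR (- (v * n.+1%:R^-1 ^+ 2 / 2))).
Proof.
have mc : measurable_fun setT (fun w => cos (n.+1%:R^-1 * f w + 0)).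
  by apply: measurable_cos_comp; apply: measurable_funD => //; exact: measurable_funM.
have ic := @prob_bounded_integrable _ _ _ P _ 1 mc (fun w => cos_max _).
have i1 : P.-integrable setT (EFin \o cst 1).
  by apply: (@prob_bounded_integrable _ _ _ P _ 1) => // w; rewrite normr1.
rewrite RintegralZl //; last exact: (integrableB measurableT i1 ic).
by rewrite RintegralB // Rintegral_prob_cst charf cos0 mulr1.
Qed.

Let sq_ge0 n w : 0 <= sq n w.
Proof.
by rewrite mulr_ge0 ?mulr_ge0 ?exprn_ge0 // subr_ge0 cos_le1.
Qed.

Let sq_le n w : sq n w <= f w ^+ 2.
Proof.
have := cos_ge_quad (n.+1%:R^-1 * f w + 0); rewrite addr0 /sq addr0 => h.
have -> : f w ^+ 2 = 2 * n.+1%:R ^+ 2 * ((n.+1%:R^-1 * f w) ^+ 2 / 2).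
  by move: n.+1%:R (nz n) => x x0; field.
by rewrite ler_wpM2l ?mulr_ge0 ?exprn_ge0 // lerBlDr addrC -lerBlDr.
Qed.

Let sq_cvg w : sq n w @[n --> \oo] --> f w ^+ 2.
Proof.
apply: (@cvg_dist_le _ _ _ (2 * `|f w| ^+ 3)) => n.
have -> : sq n w - f w ^+ 2 = - (2 * n.+1%:R ^+ 2) * (cos (n.+1%:R^-1 * f w) - (1 - (n.+1%:R^-1 * f w) ^+ 2 / 2)).
  by rewrite /sq addr0; move: n.+1%:R (nz n) (cos _) => x x0 c; field.
rewrite normrM normrN (ger0_norm (x := 2 * _)) ?mulr_ge0 ?exprn_ge0 //.
rewrite (le_trans (ler_wpM2l _ (norm_cos_sub_quad _))) ?mulr_ge0 ?exprn_ge0 //.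
rewrite normrM (ger0_norm (x := _^-1)) ?invr_ge0 // exprMn.
by rewrite le_eqVlt; apply/orP; left; apply/eqP; move: n.+1%:R (nz n) => x x0; field.
Qed.

Let msq n : measurable_fun setT (sq n).
Proof.
apply: measurable_funM => //; apply: measurable_funB => //.
by apply: measurable_cos_comp; apply: measurable_funD => //; apply: measurable_funM.
Qed.

Let sq_int_cvg : \int[P]_w sq n w @[n --> \oo] --> v.
Proof.
apply: (@cvg_dist_le _ _ _ (v ^+ 2 / 2)) => n; rewrite sqE.
set u := v * _ / 2.
have u0 : 0 <= u by rewrite divr_ge0 ?mulr_ge0 ?exprn_ge0 ?invr_ge0.
have -> : 2 * n.+1%:R ^+ 2 * (1 - expR (- u)) - v = - (2 * n.+1%:R ^+ 2) * (expR (- u) - (1 - u)).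
  by rewrite (_ : v = 2 * n.+1%:R ^+ 2 * u); [ring|rewrite /u; move: n.+1%:R (nz n) => x x0; field].
rewrite normrM normrN (ger0_norm (x := 2 * _)) ?mulr_ge0 ?exprn_ge0 //.
rewrite (le_trans (ler_wpM2l _ (norm_expRN_sub u0))) ?mulr_ge0 ?exprn_ge0 //.
have -> : 2 * n.+1%:R ^+ 2 * u ^+ 2 = v ^+ 2 / 2 * (n.+1%:R^-1) ^+ 2 :> R.
  by rewrite /u; move: n.+1%:R (nz n) => x x0; field.
rewrite ler_wpM2l ?divr_ge0 ?exprn_ge0 // expr2 ler_piMr ?invr_ge0 //.
by rewrite invf_le1 ?ltr0n // ler1n.
Qed.

(** Fatou's lemma along [sq], whose integrals converge to v. *)
Lemma char_integrable_sqr : P.-integrable setT (fun w => (f w ^+ 2)%:E).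
Proof.
have msq2 : measurable_fun setT (fun w => (f w ^+ 2)%:E).
  by apply/measurable_EFinP; exact: measurable_funX.
apply/integrableP; split => //.
have e w : `|(f w ^+ 2)%:E|%E = limn_einf (fun n => (sq n w)%:E).
  rewrite /= ger0_norm ?sqr_ge0 //; symmetry.
  have c : (sq n w)%:E @[n --> \oo] --> (f w ^+ 2)%:E.
    by apply: cvg_EFin; [exact: nearW|exact: sq_cvg].
  rewrite is_cvg_limn_einfE; first exact/cvg_lim.
  by apply/cvg_ex; exists (f w ^+ 2)%:E.
rewrite (eq_integral (fun w => limn_einf (fun n => (sq n w)%:E))) => [|w _]; last exact: e.
have isq n : P.-integrable setT (EFin \o sq n).
  apply: (@prob_bounded_integrable _ _ _ P _ (2 * n.+1%:R ^+ 2 * 2)) => // w.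
  rewrite ger0_norm // ler_wpM2l ?mulr_ge0 ?exprn_ge0 //.
  by have := cos_geN1 (n.+1%:R^-1 * f w + 0); lra.
have sqi n : (\int[P]_w (sq n w)%:E)%E = (\int[P]_w sq n w)%:E.
  by rewrite /Rintegral fineK //; exact: (integrable_fin_num measurableT (isq n)).
apply: (@le_lt_trans _ _ (limn_einf (fun n => \int[P]_w (sq n w)%:E)%E)).
  apply: (fatou P measurableT (f := fun n w => (sq n w)%:E)) => n.
    exact/measurable_EFinP.
  by move=> w _; rewrite lee_fin.
have c : (\int[P]_w (sq n w)%:E)%E @[n --> \oo] --> v%:E.
  by under eq_fun do rewrite sqi; apply: cvg_EFin; [exact: nearW|exact: sq_int_cvg].
rewrite is_cvg_limn_einfE; last by apply/cvg_ex; exists v%:E.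
by rewrite (cvg_lim _ c) // ltry.
Qed.

Lemma char_sqr : \int[P]_w (f w ^+ 2) = v.
Proof.
have sqn n w : `|sq n w| <= f w ^+ 2 by rewrite ger0_norm.
have [_ c] := Rintegral_cvg msq sq_cvg char_integrable_sqr sqn.
exact: (cvg_unique (@Rhausdorff R) c sq_int_cvg).
Qed.

Lemma char_integrable : P.-integrable setT (EFin \o f).
Proof.
have i1 := @prob_bounded_integrable _ _ _ P (cst 1) 1 (measurable_cst _) (fun w => ltac:(by rewrite normr1)).
apply: (le_integrable measurableT _ _ (integrableD measurableT i1 char_integrable_sqr)).
  exact/measurable_EFinP.
move=> w _ /=; rewrite lee_fin (ger0_norm (x := 1 + _)) ?addr_ge0 ?sqr_ge0 //.
rewrite -(ger0_norm (sqr_ge0 (f w))) normrX; have := sqr_ge0 (`|f w| - 1); have := normr_ge0 (f w); nra.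
Qed.

(** With N = n + 1, the function N sin(f / N) tends to f, is dominated by |f|, and has mean 0 by
    [charf] at the phase -pi/2. *)
Lemma char_mean0 : \int[P]_w f w = 0.
Proof.
pose g n w : R := n.+1%:R * cos (n.+1%:R^-1 * f w + - (pi / 2)).
have mg n : measurable_fun setT (g n).
  by apply: measurable_funM => //; apply: measurable_cos_comp; apply: measurable_funD => //; exact: measurable_funM.
have gc w : g n w @[n --> \oo] --> f w.
  apply: (@cvg_dist_le _ _ _ (`|f w| ^+ 3)) => n; rewrite /g cosBpihalf.
  have -> : n.+1%:R * sin (n.+1%:R^-1 * f w) - f w = n.+1%:R * (sin (n.+1%:R^-1 * f w) - n.+1%:R^-1 * f w).
    by move: n.+1%:R (nz n) (sin _) => x x0 c; field.
  rewrite normrM (ger0_norm (x := n.+1%:R)) // (le_trans (ler_wpM2l _ (norm_sin_sub _))) //.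
  rewrite normrM (ger0_norm (x := _^-1)) ?invr_ge0 // exprMn.
  have -> : n.+1%:R * (n.+1%:R^-1 ^+ 3 * `|f w| ^+ 3) = `|f w| ^+ 3 / n.+1%:R * n.+1%:R^-1 :> R.
    by move: n.+1%:R (nz n) => x x0; field.
  by rewrite ler_piMr ?divr_ge0 ?exprn_ge0 // invf_le1 ?ltr0n // ler1n.
have gb n w : `|g n w| <= `|f w|.
  rewrite /g normrM (ger0_norm (x := n.+1%:R)) // -[leRHS](mulKf (nz n)) mulrCA ler_wpM2l //.
  rewrite cosBpihalf.
  have := dist_cos (n.+1%:R^-1 * f w + - (pi / 2)) (0 + - (pi / 2)).
  rewrite !cosBpihalf sin0 subr0 add0r opprK subrK normrM (ger0_norm (x := _^-1)) ?invr_ge0 //.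
have ia : P.-integrable setT (EFin \o (fun w => `|f w|)) by exact: integrable_norm char_integrable.
have [_ c] := Rintegral_cvg mg gc ia gb.
apply: (cvg_unique (@Rhausdorff R) c); rewrite (_ : (fun n => _) = cst 0); first exact: cvg_cst.
apply/funext => n; rewrite /g RintegralZl //.
  by rewrite charf cosN cos_pihalf !mulr0.
apply: (@prob_bounded_integrable _ _ _ P _ 1) => [|w]; last exact: cos_max.
by apply: measurable_cos_comp; apply: measurable_funD => //; exact: measurable_funM.
Qed.

End Moments.

Section GaussianLaw.
Context {R : realType} d {T : measurableType d} (P : probability T R).

(** By [char_law_unique] the law is that of a constant if v = 0, and otherwise the normal law of
    deviation sqrt v. *)
Lemma char_gaussian (f : T -> R) (v : R) : measurable_fun setT f -> 0 <= v ->
  (forall t s, \int[P]_w cos (t * f w + s) = expR (- (v * t ^+ 2 / 2)) * cos s) -> gaussian_rv P f.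
Proof.
move=> mf v0 charf; have i2 := char_integrable_sqr mf v0 charf.
exists 0, (Num.sqrt v) => B mB; rewrite /gaussian_law.
have [sv0|sv0] := eqVneq (Num.sqrt v) 0.
  have v00 : v = 0 by apply/eqP; rewrite eq_le v0 -sqrtr_eq0 sv0 eqxx.
  pose Z : {RV P >-> R} := rv_of P (@measurable_cst _ _ _ _ setT (0 : R)).
  have i20 : P.-integrable setT (fun w => (Z w ^+ 2)%:E).
    apply: (@prob_bounded_integrable _ _ _ P (fun=> 0 ^+ 2) 0) => // w.
    by rewrite expr0n normr0.
  rewrite (@char_law_unique R _ _ _ _ P P (rv_of P mf) Z i2 i20) //.
    rewrite diracE preimage_cst; case: ifPn => _ ; rewrite ?measure0 //.
    exact: probability_setT.
  move=> t s; rewrite charf v00 mul0r mul0r oppr0 expR0 mul1r.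
  by rewrite /= mulr0 add0r Rintegral_prob_cst.
pose N : probability (measurableTypeR R) R := normal_prob 0 (Num.sqrt v).
pose Z : {RV N >-> R} := rv_of N (@measurable_id _ (measurableTypeR R) setT).
have cN t s : \int[N]_w cos (t * Z w + s) = expR (- (v * t ^+ 2 / 2)) * cos s.
  by rewrite normal_char // sqr_sqrtr.
have mZ : measurable_fun setT (Z : _ -> R) by exact: measurable_id.
apply: (char_law_unique (X1 := rv_of P mf) (X2 := Z) i2 (char_integrable_sqr mZ v0 cN)) => //.
by move=> t s; rewrite cN charf.
Qed.

End GaussianLaw.

Section GaussianProcess.
Variables (R : realType) (K : nat -> nat -> R).
Hypothesis Kp : psd K.
Local Notation P := (uniform_prob (@ltr01 R)).

(** The Cholesky factor is lower triangular, so the first k + 1 normal variables determine X k,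
    whatever range of indices is considered. *)
Let X k x : R := \sum_(r < k.+1) chol K k r * iid_normal r x.

Let mX k : measurable_fun setT (X k).
Proof.
apply: measurable_sum => r; apply: measurable_funM => //; exact: measurable_iid.
Qed.

Definition gaussian_family k : {RV P >-> R} := rv_of P (mX k).

Lemma gaussian_family_char m (k : 'I_m -> nat) (c : 'I_m -> R) (s : R) :
  \int[P]_x cos (\sum_(i < m) c i * gaussian_family (k i) x + s) =
  expR (- ((\sum_(i < m) \sum_(j < m) c i * c j * K (k i) (k j)) / 2)) * cos s.
Proof.
pose N := (\max_(i < m) k i).+1.
have kN i : (k i < N)%N by rewrite ltnS; exact: (leq_bigmax i).
pose a r : R := \sum_(i < m) c i * chol K (k i) r.
have -> : (fun x => cos (\sum_(i < m) c i * gaussian_family (k i) x + s)) =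
    fun x => cos (\sum_(r < N) a r * iid_normal r x + s).
  apply/funext => x; congr (cos (_ + s)).
  under [RHS]eq_bigr do rewrite mulr_suml.
  rewrite exchange_big /=; apply: eq_bigr => i _.
  have -> : X (k i) x = \sum_(r < N) chol K (k i) r * iid_normal r x.
    symmetry; apply: (sum_extend (g := fun r => chol K (k i) r * iid_normal r x) (kN i)).
    by move=> r kr; rewrite chol0 // mul0r.
  by rewrite mulr_sumr; apply: eq_bigr => r _; rewrite mulrA.
rewrite iid_char; congr (expR (- (_ / 2)) * _).
under eq_bigr do rewrite expr2 mulr_suml.
rewrite exchange_big /=; apply: eq_bigr => i _.
under eq_bigr do rewrite mulr_sumr.
rewrite exchange_big /=; apply: eq_bigr => j _.
rewrite (cholesky (k j) Kp (kN i)) mulr_sumr; apply: eq_bigr => r _; ring.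
Qed.

Let comb_char m (k : 'I_m -> nat) (c : 'I_m -> R) (t s : R) :
  \int[P]_x cos (t * (\sum_(i < m) c i * gaussian_family (k i) x) + s) =
  expR (- ((\sum_(i < m) \sum_(j < m) c i * c j * K (k i) (k j)) * t ^+ 2 / 2)) * cos s.
Proof.
have -> : (fun x => cos (t * (\sum_(i < m) c i * gaussian_family (k i) x) + s)) =
    fun x => cos (\sum_(i < m) (t * c i) * gaussian_family (k i) x + s).
  by apply/funext => x; rewrite mulr_sumr; under eq_bigr do rewrite mulrA.
rewrite gaussian_family_char; congr (expR (- (_ / 2)) * _).
rewrite mulr_suml; apply: eq_bigr => i _; rewrite mulr_suml; apply: eq_bigr => j _; ring.
Qed.

Let comb_ge0 m (k : 'I_m -> nat) (c : 'I_m -> R) :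
  0 <= \sum_(i < m) \sum_(j < m) c i * c j * K (k i) (k j).
Proof.
pose N := (\max_(i < m) k i).+1.
have kN i : (k i < N)%N by rewrite ltnS; exact: (leq_bigmax i).
rewrite (_ : \sum_i _ = \sum_(r < N) (\sum_(i < m) c i * chol K (k i) r) ^+ 2); last first.
  under [RHS]eq_bigr do rewrite expr2 mulr_suml.
  rewrite [RHS]exchange_big /=; apply: eq_bigr => i _.
  under [RHS]eq_bigr do rewrite mulr_sumr.
  rewrite [RHS]exchange_big /=; apply: eq_bigr => j _.
  rewrite (cholesky (k j) Kp (kN i)) mulr_sumr; apply: eq_bigr => r _; ring.
by apply: sumr_ge0 => r _; exact: sqr_ge0.
Qed.

Let mcomb m (k : 'I_m -> nat) (c : 'I_m -> R) :
  measurable_fun setT (fun x => \sum_(i < m) c i * gaussian_family (k i) x).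
Proof. by apply: measurable_sum => i; apply: measurable_funM => //; exact: mX. Qed.

Lemma gaussian_family_process (D : set nat) : gaussian_process D gaussian_family.
Proof.
move=> m k c _; apply: char_gaussian; [exact: mcomb|exact: (comb_ge0 k c)|exact: comb_char].
Qed.

Let one_char k (t s : R) : \int[P]_x cos (t * gaussian_family k x + s) = expR (- (K k k * t ^+ 2 / 2)) * cos s.
Proof.
have := @comb_char 1 (fun=> k) (fun=> 1) t s.
rewrite !big_ord1 !mul1r => <-; congr Rintegral; apply/funext => x.
by rewrite big_ord1 mul1r.
Qed.

Lemma gaussian_family_sqr_integrable k : P.-integrable setT (fun w => (gaussian_family k w ^+ 2)%:E).
Proof. exact: (@char_integrable_sqr _ _ _ P (gaussian_family k) (K k k) (mX k) (psd_diag k Kp) (one_char k)). Qed.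

Lemma gaussian_family_sqr k : \int[P]_w (gaussian_family k w ^+ 2) = K k k.
Proof. exact: (@char_sqr _ _ _ P (gaussian_family k) (K k k) (mX k) (psd_diag k Kp) (one_char k)). Qed.

Lemma gaussian_family_integrable k : P.-integrable setT (EFin \o gaussian_family k).
Proof. exact: (@char_integrable _ _ _ P (gaussian_family k) (K k k) (mX k) (psd_diag k Kp) (one_char k)). Qed.

Lemma gaussian_family_mean k : ('E_P[gaussian_family k] = 0)%E.
Proof.
rewrite expectation_Rintegral; last exact: gaussian_family_integrable.
congr EFin; exact: (@char_mean0 _ _ _ P (gaussian_family k) (K k k) (mX k) (psd_diag k Kp) (one_char k)).
Qed.

(** Polarisation: the product is expressed by the squares of the sum and of both variables, whose
    integrals [char_sqr] provides. *)
Lemma gaussian_family_cov k h : covariance P (gaussian_family k) (gaussian_family h) = (K k h)%:E.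
Proof.
pose kh (i : 'I_2) := if i == ord0 then k else h.
pose Z x := \sum_(i < 2) 1 * gaussian_family (kh i) x.
have e x : gaussian_family k x * gaussian_family h x =
    2^-1 * (Z x ^+ 2 - gaussian_family k x ^+ 2 - gaussian_family h x ^+ 2).
  by rewrite /Z big_ord_recl big_ord1 /= !mul1r; by field.
have i3 : P.-integrable setT (fun x => (Z x ^+ 2)%:E).
  exact: (@char_integrable_sqr _ _ _ P Z _ (mcomb kh (fun=> 1)) (comb_ge0 kh (fun=> 1)) (comb_char kh (fun=> 1))).
have v3 := @char_sqr _ _ _ P Z _ (mcomb kh (fun=> 1)) (comb_ge0 kh (fun=> 1)) (comb_char kh (fun=> 1)).
have ik := gaussian_family_sqr_integrable k.
have ih := gaussian_family_sqr_integrable h.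
have i4 := integrableB measurableT (integrableB measurableT i3 ik) ih.
have ip : P.-integrable setT (EFin \o (fun x => gaussian_family k x * gaussian_family h x)).
  have -> : EFin \o (fun x => gaussian_family k x * gaussian_family h x) = fun x => ((2^-1)%:E *
      ((Z x ^+ 2)%:E - (gaussian_family k x ^+ 2)%:E - (gaussian_family h x ^+ 2)%:E))%E.
    by apply/funext => x /=; rewrite e.
  exact: (integrableZl measurableT 2^-1 i4).
rewrite unlock (_ : (_ * _)%R = fun x => gaussian_family k x * gaussian_family h x); last first.
  by apply/funext => x; rewrite !gaussian_family_mean /= /GRing.mul /= !subr0.
rewrite expectation_Rintegral //; congr EFin.
under eq_Rintegral do rewrite e.
rewrite RintegralZl // ?RintegralB // ?v3 ?gaussian_family_sqr //; last exact: (integrableB measurableT i3 ik).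
rewrite !big_ord_recl !big_ord0 /= Kp.1; by field.
Qed.

End GaussianProcess.

(** * Linearisation of the trace *)

Section BernoulliMean.
Context {R : realType} (I : finType) (q : I -> R).

Lemma bE_prod_bet (F : {set I}) : F != finset.set0 -> bE q (fun w => \prod_(e in F) bet q e w) = 0.
Proof.
case/set0Pn => e eF.
transitivity (bE q (fun w => \prod_e (fun e b => if e \in F then b%:R - q e else 1) e (w e))).
  by apply: eq_bE => w; rewrite big_mkcond.
have /= -> := bE_prod q (fun e b => if e \in F then b%:R - q e else 1).
by rewrite (bigD1 e) //= eF [X in X * _](_ : _ = 0) ?mul0r //; ring.
Qed.

End BernoulliMean.

Section FiniteGraph.
Variables (R : realType) (n : nat) (p C s : R) (S : 'M[R]_n).
Hypothesis n0 : (0 < n)%N.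
Hypothesis p01 : 0 < p < 1.
Hypothesis C1 : 1 <= C.
Hypothesis s1 : 1 <= s.
Hypothesis s2 : s ^+ 2 = n%:R * p.
Hypothesis Ssym : forall i j, S i j = S j i.
Hypothesis SC : forall i j, 0 <= S i j <= C.
Hypothesis pS : forall i j, p * S i j <= 1.
Local Notation V := 'I_n.
Local Notation I := ('I_n * 'I_n)%type.

(** Configurations are indexed by all ordered pairs; those that are not edges get probability 0,
    hence variance 0. *)
Definition edge_prob (e : I) : R := if (e.1 < e.2)%N then p * S e.1 e.2 else 0.
Local Notation q := edge_prob.

Let p0 : 0 < p. Proof. by case/andP: p01. Qed.
Let p1 : p < 1. Proof. by case/andP: p01. Qed.
Let s0 : 0 < s. Proof. by apply: lt_le_trans s1. Qed.
Let nR : 0 < n%:R :> R. Proof. by rewrite ltr0n. Qed.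
Let C0 : 0 <= C. Proof. by apply: le_trans C1. Qed.

Lemma edge_prob01 e : 0 <= q e <= 1.
Proof.
rewrite /q; case: ifP => _; last by rewrite lexx ler01.
by rewrite pS andbT mulr_ge0 ?(ltW p0) //; have /andP[] := SC e.1 e.2.
Qed.

Lemma edge_prob_le e : q e <= C * p.
Proof.
rewrite /q; case: ifP => _; last by rewrite mulr_ge0 // ltW.
by rewrite mulrC ler_wpM2r ?(ltW p0) //; have /andP[] := SC e.1 e.2.
Qed.

Definition noise (w : {ffun I -> bool}) : 'M[R]_n := \matrix_(i, j) bet q (edge i j) w.

Definition fluct k w : R :=
  Num.sqrt p / s ^+ k * (\tr (noise w ^+ k) - bE q (fun w => \tr (noise w ^+ k))).

Definition lin k (e : I) : R :=
  if (e.1 < e.2)%N then Num.sqrt p / s ^+ k * hoeff q k [set e] else 0.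

(** Limit of the coefficient [lin] up to the factor sqrt p / s^2. For odd k no walk of length k
    crosses each edge exactly twice. *)
Definition limit_weight k i j : R :=
  if odd k then 0 else norm_weight S k./2 i j + norm_weight S k./2 j i.

(** The term p accounts for cycles and for factors 1 - q, 1/s for walks with too few edges, and 1/n
    for repeated labels and for the diagonal. *)
Definition eps : R := p + s^-1 + n%:R^-1.

Lemma eps_le3 : eps <= 3.
Proof.
have h1 : s^-1 <= 1 by rewrite invf_le1.
have h2 : n%:R^-1 <= 1 :> R by rewrite invf_le1 // ler1n.
have := lerD (lerD (ltW p1) h1) h2; rewrite -/eps => h; apply: le_trans h _; lra.
Qed.

Lemma trace_hoeff k w : (0 < k)%N ->
  \tr (noise w ^+ k) = \sum_(F : {set I}) hoeff q k F * \prod_(e in F) bet q e w.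
Proof.
case: k => // k _; rewrite (@trace_expr_walks R n _ (fun e => bet q e w)); last by move=> i j; rewrite mxE.
under eq_bigr do rewrite hoeffding_prod.
by rewrite exchange_big /=; apply: eq_bigr => F _; rewrite /hoeff mulr_suml.
Qed.

Definition edge_singletons : {set {set I}} :=
  imset (fun e : I => [set e]%SET) (mem [set e : I | (e.1 < e.2)%N]%SET).

Definition remainder_const k : R := 2 * ((2 ^ k)%:R * C ^+ (3 * k) * walk_const R k ^+ 2).

Lemma fluct_remainder k w : (0 < k)%N ->
  fluct k w - \sum_e lin k e * bet q e w =
  \sum_(F : {set I} | (F != finset.set0) && (F \notin edge_singletons))
    (Num.sqrt p / s ^+ k * hoeff q k F) * \prod_(e in F) bet q e w.
Proof.
move=> k0; rewrite /fluct.
have -> : bE q (fun w => \tr (noise w ^+ k)) = hoeff q k finset.set0.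
  under eq_bE do rewrite trace_hoeff //.
  rewrite bE_sum (bigD1 finset.set0) //= bEZ.
  under eq_bE do rewrite big_set0.
  rewrite bE_cst mulr1 big1 ?addr0 // => F F0.
  by rewrite bEZ bE_prod_bet // mulr0.
rewrite trace_hoeff // (bigD1 finset.set0) //= big_set0 mulr1 addrAC subrr add0r mulr_sumr.
rewrite (eq_bigr (fun F : {set I} => Num.sqrt p / s ^+ k * hoeff q k F * \prod_(e in F) bet q e w)) => [|F _]; last exact: mulrA.
rewrite (bigID (fun F => F \in edge_singletons)) /=.
suff -> : \sum_e lin k e * bet q e w = \sum_(F : {set I} | (F != finset.set0) && (F \in edge_singletons))
    (Num.sqrt p / s ^+ k * hoeff q k F) * \prod_(e in F) bet q e w by rewrite addrAC subrr add0r.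
rewrite (eq_bigl (fun F => F \in edge_singletons)) => [|F]; last first.
  rewrite andb_idl // => /imsetP[e _ ->]; by rewrite -card_gt0 cards1.
rewrite big_imset => [|e f _ _ /set1_inj //] /=.
rewrite [RHS](eq_bigl (fun e : I => (e.1 < e.2)%N)) => [|e]; last by rewrite inE.
rewrite [RHS]big_mkcond; apply: eq_bigr => e _; rewrite /lin.
by case: ifP; rewrite ?mul0r // big_set1.
Qed.

(** By orthogonality the error is a sum over sets outside [edge_singletons]: those with |F| > 1,
    covered by [hoeffding_remainder], and single pairs that are not edges, of variance 0. The
    squared prefactor is p / s^(2k). *)
Lemma fluct_lin k : (0 < k)%N ->
  bE q (fun w => (fluct k w - \sum_e lin k e * bet q e w) ^+ 2) <=
  remainder_const k * (p + (n%:R * p)^-1).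
Proof.
move=> k0; under eq_bE do rewrite fluct_remainder //.
rewrite bE_sum_orth.
have c0 : 0 <= (Num.sqrt p / s ^+ k) ^+ 2 by exact: sqr_ge0.
have cE : (Num.sqrt p / s ^+ k) ^+ 2 = p / s ^+ (2 * k).
  by rewrite expr_div_n sqr_sqrtr ?ltW // mulnC exprM.
apply: (@le_trans _ _ ((Num.sqrt p / s ^+ k) ^+ 2 *
   \sum_(F : {set I} | (1 < #|F|)%N) hoeff q k F ^+ 2 * \prod_(e in F) sig q e)).
  rewrite mulr_sumr big_mkcond [leRHS]big_mkcond; apply: ler_sum => F _.
  case: ifP => [/andP[F0 FS]|_]; last first.
    case: ifP => // _; rewrite mulr_ge0 // mulr_ge0 ?sqr_ge0 //.
    by apply: prodr_ge0 => e _; apply: sig_ge0; exact: edge_prob01.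
  case: ifP => [_|F1]; first by rewrite exprMn -mulrA.
  have /cards1P[e Fe] : #|F| == 1%N by rewrite eqn_leq card_gt0 F0 andbT leqNgt F1.
  rewrite Fe big_set1 /sig (_ : q e = 0) ?mul0r ?mulr0 //.
  rewrite /q; case: ifP => // e12; case/negP: FS; rewrite Fe; apply/imsetP; exists e => //.
  by rewrite inE.
have := @hoeffding_remainder R n p C s q n0 p01 C1 s1 s2 edge_prob01 edge_prob_le k.
move=> /(ler_wpM2l c0) h; apply: le_trans h _; rewrite cE -/(remainder_const k).
have np0 : n%:R * p != 0 by rewrite mulf_neq0 ?gt_eqF.
have sk0 : s ^+ (2 * k) != 0 by rewrite expf_neq0 // gt_eqF.
move: (s ^+ _) sk0 (remainder_const k) => sk sk0 K.
rewrite le_eqVlt; apply/orP; left; apply/eqP; field.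
by move: np0; rewrite mulf_eq0 negb_or => /andP[-> ->]; rewrite sk0.
Qed.

Definition lin_const k : R := k.+3%:R * C ^+ k.+1 * walk_const R k +
   2 * weight_const C k./2 * walk_const R k./2.+1.

Lemma lin_const_ge0 k : 0 <= lin_const k.
Proof. by rewrite addr_ge0 ?mulr_ge0 ?exprn_ge0 ?walk_const_ge0 ?weight_const_ge0. Qed.

(** [hoeff_lead] followed by [lead_total_weight]; after division by s^k both errors carry the factor
    sqrt p / s^2. *)
Lemma lin_limit k (e : I) : (1 < k)%N -> (e.1 < e.2)%N ->
  `|lin k e - Num.sqrt p / s ^+ 2 * limit_weight k e.1 e.2| <=
  Num.sqrt p / s ^+ 2 * (lin_const k * eps).
Proof.
move=> k1 e12; rewrite /lin e12.
have k2 : (k = 2 + (k - 2))%N by rewrite subnKC.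
have c0 : 0 <= Num.sqrt p / s ^+ k by rewrite divr_ge0 ?sqrtr_ge0 ?exprn_ge0 // ltW.
have sk : s ^+ k = s ^+ 2 * s ^+ (k - 2) by rewrite -exprD -k2.
have h1 := hoeff_lead n0 p01 C1 s1 s2 edge_prob01 edge_prob_le k1 e12.
have h2 : `|lead q k e - s ^+ (k - 2) * limit_weight k e.1 e.2| <=
    2 * weight_const C k./2 * walk_const R k./2.+1 * s ^+ (k - 2) / n%:R.
  rewrite /limit_weight; case: ifP => ok.
    rewrite mulr0 subr0 /lead big_pred0 ?normr0 => [|w].
      by rewrite !mulr_ge0 ?invr_ge0 ?exprn_ge0 ?walk_const_ge0 ?weight_const_ge0 // ltW.
    apply/negP => /andP[/andP[_ /eqP sw] _]; move: ok.
    by rewrite -(size_tuple w) -sw oddM.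
  have kE : k = (2 * k./2)%N by rewrite mul2n -[LHS]odd_double_half ok.
  have m0 : (0 < k./2)%N by rewrite half_gt0.
  have := lead_total_weight Ssym (ltW p0) SC C1 n0 m0 e12.
  rewrite -surjective_pairing -kE -/q.
  have sE : s ^+ (k - 2) = (n%:R * p) ^+ (k./2).-1.
    rewrite -s2 -exprM; congr (_ ^+ _); rewrite {1}kE.
    by case: (k./2) m0 => // m _; rewrite mulnS addKn.
  rewrite sE /norm_weight -mulrDl mulrA [_ ^+ _ * _]mulrC.
  rewrite [(n%:R * p) ^+ _ * _]mulrC.
  suff -> : (total_weight S k./2 e.1 e.2 + total_weight S k./2 e.2 e.1) / n%:R ^+ (k./2).-1 * (n%:R * p) ^+ (k./2).-1 =
    (total_weight S k./2 e.1 e.2 + total_weight S k./2 e.2 e.1) * p ^+ k./2.-1 by [].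
  rewrite exprMn; have : n%:R ^+ (k./2).-1 != 0 :> R by rewrite expf_neq0 // gt_eqF.
  by move: (_ ^+ _) (_ + _) (p ^+ _) => a b c a0; field.
have si : 0 <= s^-1 by rewrite invr_ge0 ltW.
have ni : 0 <= n%:R^-1 :> R by rewrite invr_ge0 ltW.
set A := k.+3%:R * C ^+ k.+1 * walk_const R k; set B := 2 * weight_const C k./2 * walk_const R k./2.+1.
have A0 : 0 <= A by rewrite !mulr_ge0 ?exprn_ge0 ?walk_const_ge0.
have B0 : 0 <= B by rewrite !mulr_ge0 ?walk_const_ge0 ?weight_const_ge0.
have sk0 : 0 < s ^+ (k - 2) by rewrite exprn_gt0.
have s20 : 0 < s ^+ 2 by rewrite exprn_gt0.
rewrite -/A in h1; rewrite -/B in h2.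
have -> : Num.sqrt p / s ^+ k * hoeff q k [set e]%SET - Num.sqrt p / s ^+ 2 * limit_weight k e.1 e.2 =
   Num.sqrt p / s ^+ 2 / s ^+ (k - 2) * ((hoeff q k [set e]%SET - lead q k e) +
     (lead q k e - s ^+ (k - 2) * limit_weight k e.1 e.2)).
  rewrite sk; move: (s ^+ (k - 2)) (s ^+ 2) sk0 s20 => x y x0 y0; field.
  by rewrite !gt_eqF.
have c20 : 0 <= Num.sqrt p / s ^+ 2 / s ^+ (k - 2) by rewrite !divr_ge0 ?sqrtr_ge0 // ltW.
rewrite normrM (ger0_norm c20) (le_trans (ler_wpM2l c20 (ler_normD _ _))) //.
rewrite (le_trans (ler_wpM2l c20 (lerD h1 h2))) //.
have -> : Num.sqrt p / s ^+ 2 / s ^+ (k - 2) * (A * (s ^+ (k - 2) * (p + s^-1)) + B * s ^+ (k - 2) / n%:R) =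
   Num.sqrt p / s ^+ 2 * (A * (p + s^-1) + B / n%:R).
  move: (s ^+ (k - 2)) (s ^+ 2) sk0 s20 (p + s^-1) n%:R^-1 => x y x0 y0 u v; field.
  by rewrite !gt_eqF.
rewrite ler_wpM2l ?divr_ge0 ?sqrtr_ge0 ?(ltW s20) //.
rewrite /lin_const -/A -/B /eps mulrDl mulrDr [B * (_ + _)]mulrDr.
have := mulr_ge0 A0 ni; have := mulr_ge0 B0 (addr_ge0 (ltW p0) si); lra.
Qed.

Definition weight_bound k : R := 2 * weight_const C k./2.

Lemma limit_weight_bound k i j : (1 < k)%N -> 0 <= limit_weight k i j <= weight_bound k.
Proof.
move=> k1; rewrite /limit_weight /weight_bound.
have W0 := weight_const_ge0 C1 k./2.
case: ifP => _; first by rewrite lexx mulr_ge0.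
have m0 : (0 < k./2)%N by rewrite half_gt0.
have nm : 0 < n%:R ^+ (k./2).-1 :> R by rewrite exprn_gt0.
have h x y : 0 <= norm_weight S k./2 x y <= weight_const C k./2.
  have /andP[h1 h2] := total_weight_le (ltW p0) SC C1 n0 x y m0.
  by rewrite divr_ge0 ?(ltW nm) //= ler_pdivrMr.
by have := h i j; have := h j i; lra.
Qed.

Lemma limit_weightC k i j : limit_weight k i j = limit_weight k j i.
Proof. by rewrite /limit_weight addrC. Qed.

(** Ordered pairs count each edge twice, hence the 1/2. *)
Definition kernel_n k h : R :=
  n%:R^-1 ^+ 2 / 2 * \sum_(i < n) \sum_(j < n) S i j * limit_weight k i j * limit_weight h i j.

Lemma sum_offdiag (f : I -> R) : (forall i j, f (i, j) = f (j, i)) ->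
  \sum_e f e = 2 * (\sum_(e : I | (e.1 < e.2)%N) f e) + \sum_(e : I | e.1 == e.2) f e.
Proof.
move=> fs; rewrite (bigID (fun e : I => e.1 == e.2)) /= addrC; congr (_ + _).
rewrite (bigID (fun e : I => (e.1 < e.2)%N)) /= mulr_natl mulr2n; congr (_ + _).
  apply: eq_bigl => -[i j] /=; case: ltngtP => [ij||//]; rewrite ?andbF // andbT.
  by apply/eqP => ijE; rewrite ijE ltnn in ij.
rewrite (reindex_inj (h := fun e : I => (e.2, e.1))) /=; last by move=> [i j] [i' j'] [-> ->].
apply: eq_big => [[i j]|[i j] _] //=.
case: (ltngtP i j) => [ij|ij|/val_inj ->]; rewrite ?andbF ?eqxx ?andbT //.
by apply/eqP => ijE; rewrite ijE ltnn in ij.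
Qed.

Definition cov_const k h : R :=
  let G := weight_bound in let D := lin_const in
  C ^+ 2 * (G k + 3 * D k) * (G h + 3 * D h) + C * (G k * D h + G h * D k + 3 * D k * D h) + C * G k * G h.

(** Here g, g' are limit weights, u, u' their errors, x an entry of S and d the parameter p; x (1 -
    d x) is the variance of an edge divided by p. The bound e <= 3 keeps the estimate linear in e
    despite the product u u'. *)
Lemma perturbed_product (x d g g' G G' u u' D D' e : R) :
  0 <= x <= C -> 0 <= d <= e -> e <= 3 -> 0 <= g <= G -> 0 <= g' <= G' ->
  `|u| <= D * e -> `|u'| <= D' * e -> 0 <= D -> 0 <= D' ->
  `|x * (1 - d * x) * ((g + u) * (g' + u')) - x * g * g'| <=
    (C ^+ 2 * (G + 3 * D) * (G' + 3 * D') + C * (G * D' + G' * D + 3 * D * D')) * e.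
Proof.
move=> /andP[x0 xC] /andP[d0 de] e3 /andP[g0 gG] /andP[g0' gG'] uD uD' D0 D0'.
have e0 : 0 <= e by apply: le_trans de.
have b (a A v B : R) : 0 <= a <= A -> `|v| <= B * e -> 0 <= B -> `|a + v| <= A + 3 * B.
  move=> /andP[a0 aA] vB B0; rewrite (le_trans (ler_normD _ _)) // (ger0_norm a0) lerD //.
  by rewrite (le_trans vB) // mulrC ler_wpM2r.
have b1 : `|g + u| <= G + 3 * D by apply: b; rewrite ?g0.
have b2 : `|g' + u'| <= G' + 3 * D' by apply: b; rewrite ?g0'.
have -> : x * (1 - d * x) * ((g + u) * (g' + u')) - x * g * g' =
   - (d * x ^+ 2 * ((g + u) * (g' + u'))) + x * (g * u' + g' * u + u * u') by ring.
rewrite (le_trans (ler_normD _ _)) // normrN [leRHS]mulrDl lerD //.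
  have dx0 : 0 <= d * x ^+ 2 by rewrite mulr_ge0 ?exprn_ge0.
  rewrite normrM (ger0_norm dx0) normrM.
  have -> : C ^+ 2 * (G + 3 * D) * (G' + 3 * D') * e = (e * C ^+ 2) * ((G + 3 * D) * (G' + 3 * D')) by ring.
  by apply: ler_pM; rewrite ?mulr_ge0 // ler_pM ?exprn_ge0 // lerXn2r ?nnegrE.
rewrite normrM (ger0_norm x0) -mulrA ler_pM //.
rewrite (le_trans (ler_normD _ _)) // mulrDl lerD //.
  rewrite (le_trans (ler_normD _ _)) // mulrDl !normrM (ger0_norm g0) (ger0_norm g0') lerD //.
    by rewrite -mulrA ler_pM.
  by rewrite -mulrA ler_pM.
rewrite normrM (le_trans (ler_pM (normr_ge0 _) (normr_ge0 _) uD uD')) //.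
have -> : D * e * (D' * e) = D * D' * e * e by ring.
have -> : 3 * D * D' * e = D * D' * e * 3 by ring.
by rewrite ler_wpM2l ?mulr_ge0.
Qed.

(** With a = sqrt p / s^2 one has a^2 p = n^-2, so each of at most n^2 edges contributes an error of
    order eps / n^2. The diagonal, present in [kernel_n] only, costs 1/n. *)
Lemma cov_lin k h : (1 < k)%N -> (1 < h)%N ->
  `|\sum_e lin k e * lin h e * sig q e - kernel_n k h| <= cov_const k h * eps.
Proof.
move=> k1 h1; pose nu : R := n%:R^-1 ^+ 2; pose a := Num.sqrt p / s ^+ 2.
have s20 : 0 < s ^+ 2 by rewrite exprn_gt0.
have a0 : 0 < a by rewrite divr_gt0 // sqrtr_gt0.
have nu0 : 0 <= nu by exact: sqr_ge0.
have aE : a ^+ 2 * p = nu.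
  rewrite /a expr_div_n sqr_sqrtr ?(ltW p0) // s2 /nu; field.
  by rewrite !gt_eqF.
have si : 0 < s^-1 by rewrite invr_gt0.
have ni : 0 < n%:R^-1 :> R by rewrite invr_gt0.
have eps_p : 0 <= p <= eps by rewrite (ltW p0) /eps -addrA lerDl addr_ge0 ?ltW.
have eps_n : n%:R^-1 <= eps by rewrite /eps lerDr addr_ge0 ?ltW.
have eps3 := eps_le3.
pose f (e : I) := S e.1 e.2 * limit_weight k e.1 e.2 * limit_weight h e.1 e.2.
have kE : kernel_n k h = nu * (\sum_(e : I | (e.1 < e.2)%N) f e) + nu / 2 * \sum_(e : I | e.1 == e.2) f e.
  rewrite /kernel_n pair_big /= -/nu (sum_offdiag (f := f)); first by field.
  by move=> i j; rewrite /f /= Ssym ![limit_weight _ j i]limit_weightC.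
have -> : \sum_e lin k e * lin h e * sig q e =
    \sum_(e : I | (e.1 < e.2)%N) lin k e * lin h e * sig q e.
  rewrite [RHS]big_mkcond; apply: eq_bigr => e _; case: ifP => // e12.
  by rewrite /lin e12 !mul0r.
rewrite kE mulr_sumr opprD addrA -sumrB.
rewrite (le_trans (ler_normB _ _)) // /cov_const mulrDl lerD //.
  pose M := (C ^+ 2 * (weight_bound k + 3 * lin_const k) * (weight_bound h + 3 * lin_const h) +
     C * (weight_bound k * lin_const h + weight_bound h * lin_const k + 3 * lin_const k * lin_const h)) * eps.
  rewrite -/M (le_trans (ler_norm_sum _ _ _)) //.
  have M0 : 0 <= M.
    rewrite /M; have := lin_const_ge0 k; have := lin_const_ge0 h.
    have := weight_const_ge0 C1 k./2; have := weight_const_ge0 C1 h./2; rewrite /weight_bound => *.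
    apply: mulr_ge0; last by apply: le_trans (ltW ni) eps_n.
    by repeat (first [done | apply: addr_ge0 | apply: mulr_ge0]).
  apply: (@le_trans _ _ (\sum_(e : I) nu * M)); last first.
    rewrite sumr_const card_prod card_ord -[leLHS]mulr_natl natrM /nu mulrA.
    by rewrite -expr2 -exprMn divff ?expr1n ?mul1r // gt_eqF.
  rewrite big_mkcond; apply: ler_sum => e _; case: ifP => e12; last by rewrite mulr_ge0.
  pose u k' := lin k' e / a - limit_weight k' e.1 e.2.
  have uE k' : lin k' e = a * (limit_weight k' e.1 e.2 + u k').
    by rewrite /u addrC subrK mulrC divfK // gt_eqF.
  have uD k' : (1 < k')%N -> `|u k'| <= lin_const k' * eps.
    move=> k1'; have := lin_limit k1' e12; rewrite -/a uE -mulrBr addrAC subrr add0r normrM (gtr0_norm a0).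
    by rewrite ler_pM2l.
  have qE : q e = p * S e.1 e.2 by rewrite /q e12.
  rewrite (uE k) (uE h) /sig qE /f.
  have -> : a * (limit_weight k e.1 e.2 + u k) * (a * (limit_weight h e.1 e.2 + u h)) *
       (p * S e.1 e.2 * (1 - p * S e.1 e.2)) - nu * (S e.1 e.2 * limit_weight k e.1 e.2 * limit_weight h e.1 e.2) =
     nu * (S e.1 e.2 * (1 - p * S e.1 e.2) * ((limit_weight k e.1 e.2 + u k) * (limit_weight h e.1 e.2 + u h)) -
        S e.1 e.2 * limit_weight k e.1 e.2 * limit_weight h e.1 e.2) by rewrite -aE; ring.
  rewrite normrM (ger0_norm nu0) ler_wpM2l //.
  by apply: perturbed_product => //; rewrite ?limit_weight_bound ?uD ?lin_const_ge0.
have G0 k' : 0 <= weight_bound k' by rewrite mulr_ge0 // weight_const_ge0.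
rewrite normrM ger0_norm ?divr_ge0 //.
apply: (@le_trans _ _ (nu / 2 * (n%:R * (C * weight_bound k * weight_bound h)))).
  rewrite ler_wpM2l ?divr_ge0 // (le_trans (ler_norm_sum _ _ _)) //.
  have -> : n%:R * (C * weight_bound k * weight_bound h) =
     \sum_(e : I | e.1 == e.2) (C * weight_bound k * weight_bound h).
    rewrite -(pair_big_dep xpredT (fun i j : V => i == j) (fun _ _ => C * weight_bound k * weight_bound h)) /=.
    rewrite (eq_bigr (fun=> C * weight_bound k * weight_bound h)) => [|i _]; last first.
      by rewrite (eq_bigl (pred1 i)) ?big_pred1_eq // => j; rewrite eq_sym.
    by rewrite sumr_const card_ord mulr_natl.
  apply: ler_sum => e _; rewrite /f; have /andP[x0 x1] := SC e.1 e.2.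
  have /andP[y0 y1] := limit_weight_bound e.1 e.2 k1; have /andP[z0 z1] := limit_weight_bound e.1 e.2 h1.
  by rewrite ger0_norm ?mulr_ge0 // !ler_pM ?mulr_ge0.
have -> : nu / 2 * (n%:R * (C * weight_bound k * weight_bound h)) =
   C * weight_bound k * weight_bound h * (n%:R^-1 / 2).
  by rewrite /nu; field; rewrite gt_eqF.
apply: ler_wpM2l; first by rewrite mulr_ge0 // mulr_ge0.
by rewrite (le_trans _ eps_n) // ler_piMr ?(ltW ni) // invf_le1 ?ler1n.
Qed.

(** The uniform smallness of coefficients that Lindeberg's argument asks for. *)
Lemma norm_lin k e : (1 < k)%N -> `|lin k e| <= (weight_bound k + 3 * lin_const k) / s ^+ 2.
Proof.
move=> k1; have s20 : 0 < s ^+ 2 by rewrite exprn_gt0.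
have G0 : 0 <= weight_bound k by rewrite mulr_ge0 // weight_const_ge0.
have D0 := lin_const_ge0 k.
case: (boolP (e.1 < e.2)%N) => e12; last first.
  by rewrite /lin (negbTE e12) normr0 divr_ge0 ?(ltW s20) // addr_ge0 // mulr_ge0.
have := lin_limit k1 e12; have /andP[g0 g1] := limit_weight_bound e.1 e.2 k1.
have sp1 : Num.sqrt p <= 1 by rewrite -sqrtr1 ler_wsqrtr // ltW.
have sp0 := sqrtr_ge0 p.
have eps3 := eps_le3.
move=> h; have -> : lin k e = (lin k e - Num.sqrt p / s ^+ 2 * limit_weight k e.1 e.2) +
  Num.sqrt p / s ^+ 2 * limit_weight k e.1 e.2 by ring.
rewrite (le_trans (ler_normD _ _)) // (le_trans (lerD h (lexx _))) //.
have a0 : 0 <= Num.sqrt p / s ^+ 2 by rewrite divr_ge0 // ltW.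
rewrite normrM (ger0_norm a0) (ger0_norm g0) -mulrDr mulrAC.
rewrite ler_pM2r ?invr_gt0 // -[leRHS]mul1r ler_pM //.
  rewrite addr_ge0 // mulr_ge0 // /eps addr_ge0 ?invr_ge0 // ?addr_ge0 ?invr_ge0 //; exact: ltW.
by rewrite addrC lerD // mulrC ler_wpM2r.
Qed.

End FiniteGraph.

(** * Reduction to the product space *)

Lemma measurable_mxpow (R : realType) d (T : measurableType d) n (M : T -> 'M[R]_n) k :
  (forall i j, measurable_fun setT (fun w => M w i j)) ->
  forall i j, measurable_fun setT (fun w => (M w ^+ k) i j).
Proof.
move=> mM; elim: k => [|k IH] i j.
  under eq_fun do rewrite expr0; exact: measurable_cst.
under eq_fun do rewrite exprS mxE.
by apply: measurable_sum => l; apply: measurable_funM.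
Qed.

Lemma scalemx_expr (R : comPzRingType) n (a : R) (M : 'M[R]_n) k : (a *: M) ^+ k = a ^+ k *: M ^+ k.
Proof.
elim: k => [|k IH]; first by rewrite !expr0 scale1r.
rewrite !exprS IH -[LHS]/((a *: M) *m (a ^+ k *: M ^+ k)) -scalemxAl -scalemxAr scalerA.
by [].
Qed.

Section Reduction.
Context {R : realType} d {Om : measurableType d} (P : probability Om R).
Variables (n : nat) (p : R) (S : 'M[R]_n) (A : 'I_n -> 'I_n -> {RV P >-> R}).
Hypothesis hA : inhomogeneous_random_graph p A S.
Hypothesis q01 : forall e, 0 <= edge_prob p S e <= 1.
Local Notation I := ('I_n * 'I_n)%type.
Local Notation q := (edge_prob p S).

Definition config (w : Om) : {ffun I -> bool} := [ffun e : I => (e.1 < e.2)%N && (A e.1 e.2 w == 1)].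

Let bern (e : I) (B : set R) : (e.1 < e.2)%N -> measurable B ->
  P (A e.1 e.2 @^-1` B) = (q e * `[< B 1 >]%:R + (1 - q e) * `[< B 0 >]%:R)%:E.
Proof.
case: hA => _ _ _ hb e12 mB; have := hb _ _ e12 B mB.
rewrite /distribution /pushforward => ->.
have qE : p * S e.1 e.2 = q e by rewrite /edge_prob e12.
by rewrite qE bernoulli_probE; last exact: q01.
Qed.

(** False is coded by the complement of {1}, not by {0}, so the cylinders partition the space before
    the entries are known to be almost surely 0 or 1. *)
Let cyl (c : {ffun I -> bool}) (e : I) : set R := if c e then [set 1] else ~` [set 1].

Let mcyl c e : measurable (cyl c e).
Proof. by rewrite /cyl; case: ifP => _ //; exact: measurableC. Qed.

Let prob_cyl c (e : I) : (e.1 < e.2)%N -> P (A e.1 e.2 @^-1` cyl c e) = (wt q e (c e))%:E.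
Proof.
move=> e12; rewrite bern // /cyl /wt.
case: (c e); first by rewrite asboolT // asboolF ?mulr1 ?mulr0 ?addr0 //= => /esym/eqP; rewrite oner_eq0.
rewrite asboolF /=; last exact.
by rewrite asboolT ?mulr1 ?mulr0 ?add0r //= => /esym/eqP; rewrite oner_eq0.
Qed.

Let edges : {fset I} := [fset e : I | (e.1 < e.2)%N]%fset.

Let config_cyl (c : {ffun I -> bool}) : (forall e : I, ~~ (e.1 < e.2)%N -> c e = false) ->
  config @^-1` [set c] = \bigcap_(e in [set` edges]) (A e.1 e.2 @^-1` cyl c e).
Proof.
move=> c0; apply/seteqP; split => w /=.
  move=> <- e; rewrite /= /edges !inE /= => e12; rewrite /cyl ffunE e12 /=.
  by case: eqP.
move=> h; apply/ffunP => e; rewrite ffunE.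
case: (boolP (e.1 < e.2)%N) => [e12|/c0 -> //].
have := h e; rewrite /= /edges !inE /= => /(_ e12); rewrite /cyl; case: (c e) => /=.
  by move=> ->; rewrite eqxx.
by move/eqP/negbTE.
Qed.

Let config_none (c : {ffun I -> bool}) (e : I) : ~~ (e.1 < e.2)%N -> c e -> config @^-1` [set c] = set0.
Proof.
move=> e12 ce; apply/seteqP; split => w //= wc; move: ce.
by rewrite -wc ffunE (negbTE e12).
Qed.

Let measurable_config c : measurable (config @^-1` [set c]).
Proof.
case: (boolP [forall e : I, ~~ (e.1 < e.2)%N ==> ~~ c e]) => [/forallP h|].
  rewrite config_cyl => [|e e12]; last by apply/negbTE; have := h e; rewrite e12.
  apply: fin_bigcap_measurable => // e _; exact: measurable_funPTI.
rewrite negb_forall => /existsP[e]; rewrite negb_imply negbK => /andP[e12 ce].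
by rewrite (config_none e12 ce).
Qed.

Lemma config_law c : P (config @^-1` [set c]) = (mass q c)%:E.
Proof.
case: (boolP [forall e : I, ~~ (e.1 < e.2)%N ==> ~~ c e]) => [/forallP h|].
  rewrite config_cyl => [|e e12]; last by apply/negbTE; have := h e; rewrite e12.
  case: hA => _ _ ind _; rewrite ind //; last by move=> e; rewrite /= /edges !inE.
  have -> : mass q c = \prod_(e : I | (e.1 < e.2)%N) wt q e (c e).
    rewrite /mass (bigID (fun e : I => (e.1 < e.2)%N)) /= [X in _ * X]big1 ?mulr1 // => e e12.
    have := h e; rewrite e12 /= => /negbTE ce.
    by rewrite /wt ce /edge_prob (negbTE e12) subr0.
  rewrite (eq_big_seq (fun e => (wt q e (c e))%:E)) => [|e]; last first.
    by rewrite /edges !inE => e12; exact: prob_cyl.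
  rewrite prodEFin; congr EFin; rewrite big_uniq ?fset_uniq //=.
  by apply: eq_bigl => e; rewrite /edges !inE.
rewrite negb_forall => /existsP[e]; rewrite negb_imply negbK => /andP[e12 ce].
rewrite (config_none e12 ce) measure0 /mass (bigD1 e) //= /wt ce /edge_prob (negbTE e12) mul0r //.
Qed.

Definition faithful w := forall e : I, (e.1 < e.2)%N -> A e.1 e.2 w = (config w e)%:R.

Lemma faithful_ae : {ae P, forall w, faithful w}.
Proof.
apply: filter_forall => e.
case: (boolP (e.1 < e.2)%N) => e12; last by apply: nearW => w.
exists (A e.1 e.2 @^-1` ~` [set 0; 1]); split.
- by apply: measurable_funPTI; apply: measurableC; apply: measurableU.
- rewrite bern //; last by apply: measurableC; apply: measurableU.
  rewrite !asboolF ?mulr0 ?addr0 //= => h; apply: h; [by left|by right].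
- move=> w /= h h01; apply: h => _; rewrite ffunE e12 /=.
  by case: h01 => ->; rewrite ?eqxx // eq_sym oner_eq0.
Qed.

(** [F] is almost surely equal to a simple function on the finite partition by configurations, whose
    probabilities are given by [config_law]. *)
Lemma expectation_config (F : Om -> R) (G : {ffun I -> bool} -> R) : measurable_fun setT F ->
  (forall w, faithful w -> F w = G (config w)) -> ('E_P[F] = (bE q G)%:E)%E.
Proof.
move=> mF FG.
have mD c := measurable_config c.
have i1 c : P.-integrable setT (fun w => (G c)%:E * (\1_(config @^-1` [set c]) w)%:E)%E.
  by apply: integrableZl => //; exact: integrable_indic.
pose H w := (\sum_c (G c)%:E * (\1_(config @^-1` [set c]) w)%:E)%E.
have HE w : H w = (G (config w))%:E.
  rewrite /H (bigD1 (config w)) //= indicE mem_set // mule1 big1 ?adde0 // => c cw.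
  by rewrite indicE memNset ?mule0 //= => wc; rewrite wc eqxx in cw.
have mH : measurable_fun setT H.
  by apply: emeasurable_sum => c; case/integrableP: (i1 c).
rewrite unlock (ae_eq_integral H) //.
- rewrite /H integral_sum // /bE -sumEFin; apply: eq_bigr => c _.
  rewrite integralZl //; last exact: integrable_indic.
  rewrite integral_indic // setIT mulrC EFinM; congr (_ * _)%E; exact: config_law.
- exact/measurable_EFinP.
- by apply: filterS faithful_ae => w fw _; rewrite HE /= FG.
Qed.

Let edgeE (w : Om) (i j : 'I_n) : i != j -> faithful w -> A i j w = (config w (edge i j))%:R.
Proof.
move=> ij fw; case: hA => _ As _ _; rewrite /edge.
case: (ltngtP i j) => [lij|lji|/val_inj ijE]; last by rewrite ijE eqxx in ij.
  by rewrite (fw (i, j)).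
by rewrite As (fw (j, i)).
Qed.

Let edge_diag (i : 'I_n) : edge i i = (i, i). Proof. by rewrite /edge ltnn. Qed.

Lemma expectation_adj i j : ('E_P[A i j] = (q (edge i j))%:E)%E.
Proof.
have [->|ij] := eqVneq i j.
  have -> : (A j j : Om -> R) = cst 0 by apply/funext => w; case: hA => ->.
  by rewrite expectation_cst edge_diag /edge_prob ltnn.
rewrite (@expectation_config _ (fun c => (c (edge i j))%:R)) //; last by move=> w; exact: edgeE.
congr EFin; have := bE_prod_bet q (F := [set edge i j]%SET).
under eq_bE do rewrite big_set1.
rewrite -card_gt0 cards1 => /(_ isT) h.
rewrite -[RHS]add0r -h -[X in _ = _ + X](bE_cst q) -bED; apply: eq_bE => w.
by rewrite /bet subrK.
Qed.

Lemma centered_adj_noise w : faithful w -> centered_adj A w = noise p S (config w).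
Proof.
move=> fw; apply/matrixP => i j; rewrite !mxE expectation_adj /= /bet; congr (_ - _).
have [->|ij] := eqVneq i j; last exact: edgeE.
by case: hA => -> _ _ _; rewrite edge_diag ffunE ltnn.
Qed.

Let s := Num.sqrt (n%:R * p).

Let mcent i j : measurable_fun setT (fun w => centered_adj A w i j).
Proof. by under eq_fun do rewrite mxE; apply: measurable_funB. Qed.

Lemma measurable_trace_power k : measurable_fun setT (trace_power p A k).
Proof.
rewrite /trace_power /mxtrace; apply: measurable_sum => i.
apply: measurable_mxpow => {i} i j; under eq_fun do rewrite mxE.
by apply: measurable_funM => //; exact: mcent.
Qed.

Lemma trace_power_noise k w : faithful w -> trace_power p A k w = s ^- k * \tr (noise p S (config w) ^+ k).
Proof. by move=> fw; rewrite /trace_power centered_adj_noise // scalemx_expr mxtraceZ exprVn. Qed.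

Lemma linear_stat_fluct k w : faithful w -> linear_stat p A k w = fluct p s S k (config w).
Proof.
move=> fw; rewrite /linear_stat /fluct trace_power_noise //.
have e := @expectation_config _ (fun c => s ^- k * \tr (noise p S c ^+ k)) (measurable_trace_power k)
  (fun w => @trace_power_noise k w).
rewrite [X in fine X]e /=.
by rewrite bEZ; ring.
Qed.

Lemma measurable_linear_stat k : measurable_fun setT (linear_stat p A k).
Proof.
by apply: measurable_funM => //; apply: measurable_funB => //; exact: measurable_trace_power.
Qed.

Lemma expectation_linear_stat m (k : 'I_m -> nat) (f : 'rV[R]_m -> R) (M : R) : continuous f ->
  (forall x, `|f x| <= M) ->
  ('E_P[fun w => f (\row_i linear_stat p A (k i) w)] = (bE q (fun c => f (\row_i fluct p s S (k i) c)))%:E)%E.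
Proof.
move=> fc fM; apply: expectation_config.
  by apply: (measurable_cont_bounded _ fc fM) => i; exact: measurable_linear_stat.
by move=> w fw; congr f; apply/rowP => i; rewrite !mxE linear_stat_fluct.
Qed.

End Reduction.

(** * The central limit theorem *)

Section Limits.
Variable R : realType.
Variables (p : nat -> R) (S : forall n, 'M[R]_n) (C : R) (K : nat -> nat -> R).
Hypothesis hp : forall n, 0 < p n < 1.
Hypothesis hp0 : p n @[n --> \oo] --> (0 : R).
Hypothesis hnp : n%:R * p n @[n --> \oo] --> +oo.
Hypothesis C1 : 1 <= C.
Hypothesis Ssym : forall n i j, S n i j = S n j i.
Hypothesis SC : forall n i j, 0 <= S n i j <= C.
Hypothesis pS : forall n i j, p n * S n i j <= 1.
Hypothesis KE : forall k h, (1 < k)%N -> (1 < h)%N -> kernel_n (S n) k h @[n --> \oo] --> K k h.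

Let s n : R := Num.sqrt (n%:R * p n).
Local Notation q n := (edge_prob (p n) (S n)).
Let q01 n e : 0 <= q n e <= 1. Proof. exact: edge_prob01 (hp n) (@SC n) (@pS n) e. Qed.

Let p0 n : 0 < p n. Proof. by case/andP: (hp n). Qed.

Let s2 n : s n ^+ 2 = n%:R * p n.
Proof. by rewrite sqr_sqrtr // mulr_ge0 // ltW. Qed.

Let large : \forall n \near \oo, (0 < n)%N /\ 1 <= s n.
Proof.
near=> n; have h : 1 <= n%:R * p n by near: n; move/cvgryPge: hnp; apply.
split; last by rewrite -sqrtr1 ler_wsqrtr.
by rewrite lt0n; apply: contraTneq h => ->; rewrite mul0r -ltNge.
Unshelve. all: by end_near.
Qed.

Let inv_np : (n%:R * p n)^-1 @[n --> \oo] --> (0 : R).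
Proof.
apply/gtr0_cvgV0; last exact: hnp.
near=> n; rewrite mulr_gt0 // ltr0n.
by near: n; exact: nbhs_infty_gt.
Unshelve. all: by end_near.
Qed.

Let inv_s : (s n)^-1 @[n --> \oo] --> (0 : R).
Proof.
rewrite -[Z in _ --> Z](@sqrtr0 R); apply: cvg_trans; last exact: (cvg_comp _ _ inv_np (@sqrt_continuous R 0)).
by apply: near_eq_cvg; apply: nearW => n /=; rewrite sqrtrV // mulr_ge0 // ltW.
Qed.

Let inv_n : (n%:R^-1 : R) @[n --> \oo] --> (0 : R).
Proof.
rewrite -[Z in _ --> Z](mul0r 0); apply: cvg_trans; last exact: (cvgM hp0 inv_np).
apply: near_eq_cvg; apply: nearW => n /=.
by rewrite invfM mulrA [p n * _]mulrC mulfK // gt_eqF.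
Qed.

Let eps_cvg : eps n (p n) (s n) @[n --> \oo] --> (0 : R).
Proof.
have := cvgD (cvgD hp0 inv_s) inv_n; rewrite !addr0; exact.
Qed.

Let cov n k h : R := \sum_e lin (p n) (s n) (S n) k e * lin (p n) (s n) (S n) h e * sig (q n) e.

Lemma cov_cvg k h : (1 < k)%N -> (1 < h)%N -> cov n k h @[n --> \oo] --> K k h.
Proof.
move=> k1 h1; rewrite (_ : (fun n => cov n k h) = (fun n => cov n k h - kernel_n (S n) k h) \+ (fun n => kernel_n (S n) k h)); last first.
  by apply/funext => n /=; rewrite subrK.
rewrite -[Z in _ --> Z]add0r; apply: cvgD; last exact: KE.
apply/norm_cvg0P; apply: (squeeze_cvgr (f := cst 0) (h := fun n => cov_const C k h * eps n (p n) (s n))).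
- near=> n; rewrite normr_ge0 /=.
  have [n0 s1] : (0 < n)%N /\ 1 <= s n by near: n.
  exact: (cov_lin n0 (hp n) C1 s1 (s2 n) (@Ssym n) (@SC n) (@pS n) k1 h1).
- exact: cvg_cst.
- by rewrite -[Z in _ --> Z](mulr0 (cov_const C k h)); apply: cvgMr.
Unshelve. all: by end_near.
Qed.

Let err n : R := p n + (n%:R * p n)^-1.

Let err_cvg : err n @[n --> \oo] --> (0 : R).
Proof. by have := cvgD hp0 inv_np; rewrite addr0; exact. Qed.

Let err_gt0 n : 0 < err n.
Proof. by rewrite ltr_wpDr // invr_ge0 mulr_ge0 // ltW. Qed.

Local Notation L n k w := (\sum_e lin (p n) (s n) (S n) k e * bet (q n) e w).
Local Notation X n k w := (fluct (p n) (s n) (S n) k w).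

Let dist_L : forall k, (1 < k)%N -> \forall n \near \oo,
  bE (q n) (fun w => (X n k w - L n k w) ^+ 2) <= remainder_const C k * err n.
Proof.
move=> k k1; near=> n.
have [n0 s1] : (0 < n)%N /\ 1 <= s n by near: n.
exact: (fluct_lin n0 (hp n) C1 s1 (s2 n) (@SC n) (@pS n) (ltnW k1)).
Unshelve. all: by end_near.
Qed.

(** From X^2 <= 2 (X - L)^2 + 2 L^2, where the mean of the right side is bounded by a quantity
    tending to 2 K k k. *)
Lemma fluct_sqr k : (1 < k)%N -> \forall n \near \oo, bE (q n) (fun w => X n k w ^+ 2) <= 2 * K k k + 3.
Proof.
move=> k1.
have c1 : 2 * (remainder_const C k * err n) + 2 * cov n k k @[n --> \oo] --> 2 * (remainder_const C k * 0) + 2 * K k k.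
  apply: cvgD; apply: cvgMr; last exact: cov_cvg.
  by apply: cvgMr; exact: err_cvg.
near=> n.
have h1 : bE (q n) (fun w => (X n k w - L n k w) ^+ 2) <= remainder_const C k * err n by near: n; exact: dist_L.
apply: (@le_trans _ _ (2 * (remainder_const C k * err n) + 2 * cov n k k)); last first.
  near: n; apply: (cvgr_le _ c1); lra.
apply: (@le_trans _ _ (bE (q n) (fun w => 2 * (X n k w - L n k w) ^+ 2 + 2 * L n k w ^+ 2))).
  apply: (bE_le (@q01 n)) => w; have := sqr_ge0 (X n k w - 2 * L n k w); nra.
rewrite bED !bEZ; apply: lerD; rewrite ler_pM2l //.
rewrite bE_linear_sqr le_eqVlt; apply/orP; left; apply/eqP.
by apply: eq_bigr => e _; rewrite expr2.
Unshelve. all: by end_near.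
Qed.

(** [X] is replaced by its linear part [L], [bE_cos_linear] compares [L] with a Gaussian of variance
    [v n], and [v n] converges by [cov_cvg]. The cubic error is at most 3 B v, where [B] bounds the
    coefficients and tends to 0 like 1 / s^2. *)
Lemma fluct_clt m (k : 'I_m -> nat) (t : 'I_m -> R) (y : R) : (forall i, (1 < k i)%N) ->
  bE (q n) (fun w => cos (\sum_i t i * X n (k i) w + y)) @[n --> \oo] -->
  expR (- ((\sum_i \sum_j t i * t j * K (k i) (k j)) / 2)) * cos y.
Proof.
move=> k1.
pose v n : R := \sum_i \sum_j t i * t j * cov n (k i) (k j).
pose r n : R := Num.sqrt (err n).
pose M i : R := weight_bound C (k i) + 3 * lin_const C (k i).
pose B n : R := (\sum_i `|t i| * M i) / s n ^+ 2.
have vc : v n @[n --> \oo] --> \sum_i \sum_j t i * t j * K (k i) (k j).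
  by apply: cvg_sum => i; apply: cvg_sum => j; apply: cvgMr; exact: cov_cvg.
have rc : r n @[n --> \oo] --> (0 : R).
  rewrite -[Z in _ --> Z](@sqrtr0 R); exact: (cvg_comp _ _ err_cvg (@sqrt_continuous R 0)).
have Bc : B n @[n --> \oo] --> (0 : R).
  rewrite -[Z in _ --> Z](mulr0 (\sum_i `|t i| * M i)); apply: cvgMr.
  by under eq_fun do rewrite s2.
have ec : expR (- (v n / 2)) * cos y @[n --> \oo] --> expR (- ((\sum_i \sum_j t i * t j * K (k i) (k j)) / 2)) * cos y.
  apply: cvgMl; apply: (cvg_comp (fun n => - (v n / 2)) expR); last exact: continuous_expR.
  by apply: cvgN; apply: cvgMl.
rewrite -[Z in _ --> Z]add0r.
pose F n := bE (q n) (fun w => cos (\sum_i t i * X n (k i) w + y)).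
rewrite (_ : (fun n => bE _ _) = (fun n => F n - expR (- (v n / 2)) * cos y) \+ (fun n => expR (- (v n / 2)) * cos y)); last first.
  by apply/funext => n /=; rewrite subrK.
apply: cvgD ec; apply/norm_cvg0P.
pose U n : R := \sum_i `|t i| * ((1 + remainder_const C (k i)) * r n) + 3 * (B n * v n).
apply: (squeeze_cvgr (f := cst 0) (h := U)); last first.
- have -> : 0 = \sum_i `|t i| * ((1 + remainder_const C (k i)) * 0) + 3 * (0 * \sum_i \sum_j t i * t j * K (k i) (k j)) :> R.
    by rewrite mul0r mulr0 addr0 big1 // => i _; rewrite !mulr0.
  apply: cvgD; first by apply: cvg_sum => i; apply: cvgMr; apply: cvgMr.
  by apply: cvgMr; apply: cvgM.
- exact: cvg_cst.
near=> n; rewrite normr_ge0 /=.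
have [n0 s1] : (0 < n)%N /\ 1 <= s n by near: n.
have B1 : B n <= 1 by near: n; apply: (cvgr_le _ Bc); exact: ltr01.
have dL : forall i, bE (q n) (fun w => (X n (k i) w - L n (k i) w) ^+ 2) <= remainder_const C (k i) * err n.
  by near: n; apply: filter_forall => i; exact: dist_L.
pose tl e := \sum_i t i * lin (p n) (s n) (S n) (k i) e.
have tlB e : `|tl e| <= B n.
  rewrite (le_trans (ler_norm_sum _ _ _)) // /B mulr_suml; apply: ler_sum => i _.
  rewrite normrM -mulrA ler_wpM2l //.
  exact: (norm_lin n0 (hp n) C1 s1 (s2 n) (@Ssym n) (@SC n) (@pS n) e (k1 i)).
have vE : v n = \sum_e tl e ^+ 2 * sig (q n) e.
  rewrite /v /tl; under [RHS]eq_bigr => e _ do rewrite expr2 mulr_suml mulr_suml.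
  rewrite [RHS]exchange_big /=; apply: eq_bigr => i _.
  under [RHS]eq_bigr => e _ do rewrite mulr_sumr mulr_suml.
  rewrite [RHS]exchange_big /=; apply: eq_bigr => j _.
  rewrite /cov mulr_sumr; apply: eq_bigr => e _; ring.
have LE w : \sum_i t i * L n (k i) w = \sum_e tl e * bet (q n) e w.
  under [RHS]eq_bigr => e _ do rewrite mulr_suml.
  rewrite [RHS]exchange_big /=; apply: eq_bigr => i _.
  by rewrite mulr_sumr; apply: eq_bigr => e _; rewrite mulrA.
pose F' := bE (q n) (fun w => cos (y + \sum_e tl e * bet (q n) e w)).
have h1 : `|F' - expR (- (v n / 2)) * cos y| <= 3 * (B n * v n).
  rewrite vE /F'; apply: (le_trans (bE_cos_linear (@q01 n) y _)).
    by move=> e; apply: le_trans (tlB e) B1.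
  rewrite ler_pM2l // mulr_sumr; apply: ler_sum => e _.
  rewrite mulrA ler_wpM2r ?sig_ge0 // ?q01 // exprS (_ : `|tl e| ^+ 2 = tl e ^+ 2).
    by rewrite ler_wpM2r ?sqr_ge0.
  by rewrite -normrX ger0_norm ?sqr_ge0.
have r0 : 0 < r n by rewrite sqrtr_gt0.
have rr : r n ^+ 2 = err n by rewrite sqr_sqrtr // ltW.
(* Pointwise |x| <= r + x^2 / r with r^2 = err, so a mean square of order err contributes order
   r. *)
have h2 : `|F n - F'| <= \sum_i `|t i| * ((1 + remainder_const C (k i)) * r n).
  rewrite /F /F' -bEB (le_trans (norm_bE (@q01 n) _)) //.
  apply: (@le_trans _ _ (bE (q n) (fun w => \sum_i `|t i| * (r n + (r n)^-1 * (X n (k i) w - L n (k i) w) ^+ 2)))).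
    apply: (bE_le (@q01 n)) => w; rewrite (le_trans (dist_cos _ _)) // -LE.
    have -> : \sum_i t i * X n (k i) w + y - (y + \sum_i t i * L n (k i) w) = \sum_i t i * (X n (k i) w - L n (k i) w).
      by rewrite opprD addrA addrK -sumrB; apply: eq_bigr => i _; rewrite mulrBr.
    rewrite (le_trans (ler_norm_sum _ _ _)) //; apply: ler_sum => i _.
    rewrite normrM ler_wpM2l //; set x := _ - _.
    rewrite -(ler_pM2l r0) mulrDr mulVKf ?gt_eqF // -(ger0_norm (sqr_ge0 x)) normrX.
    have := sqr_ge0 (`|x| - r n); have := normr_ge0 x; nra.
  rewrite bE_sum; apply: ler_sum => i _; rewrite bEZ ler_wpM2l // bED bEZ bE_cst mulrDl mul1r lerD2l.
  rewrite -(ler_pM2l r0) mulVKf ?gt_eqF // mulrCA -expr2 rr; exact: dL.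
rewrite -(subrKA F') (le_trans (ler_normD _ _)) //; exact: lerD.
Unshelve. all: by end_near.
Qed.

End Limits.

(** * The limiting covariance *)

Lemma T1_is_tree m1 m2 (T : gluing) : T1 (2 * m1) (2 * m2) T -> is_tree (glued_tree T).
Proof.
case: T => [[t1 t2] o] [/= [+ +] _]; rewrite !mul2n !doubleK.
move=> /mem_marked_list /allpairsPdep[c1 [v1 [_ v1c ->]]] /mem_marked_list /allpairsPdep[c2 [v2 [_ v2c ->]]].
exact: (glued_is_tree o v1c v2c).
Qed.

Lemma kernel_n_odd (R : realType) n (S : 'M[R]_n) k h : odd k || odd h -> kernel_n S k h = 0.
Proof.
move=> o; rewrite /kernel_n big1 ?mulr0 // => i _; rewrite big1 // => j _.
by rewrite /limit_weight; case/orP: o => ->; rewrite ?mulr0 ?mul0r.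
Qed.

(** Write a', b' for a, b with i and j exchanged. As S is symmetric, half the sum of S (a + a') (b +
    b') is the sum of S a (b + b'). *)
Lemma kernel_n_T1 (R : realType) n (S : 'M[R]_n) k h : (0 < n)%N -> (forall i j, S i j = S j i) ->
  (1 < k)%N -> (1 < h)%N -> ~~ odd k -> ~~ odd h ->
  kernel_n S k h = \sum_(T \in T1 k h) hom_density (glued_tree T) (step_graphon S).
Proof.
move=> n0 Ssym k1 h1 ok oh.
have e2 j : ~~ odd j -> j = (2 * j./2)%N by move=> oj; rewrite mul2n -[LHS]odd_double_half (negbTE oj).
rewrite (e2 _ ok) (e2 _ oh) sum_T1_density ?half_gt0 //.
rewrite -(e2 _ ok) -(e2 _ oh) /kernel_n -mulrA; congr (_ * _).
rewrite /limit_weight (negbTE ok) (negbTE oh).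
set a := norm_weight S k./2; set b := norm_weight S h./2.
pose f i j := S i j * a i j * (b i j + b j i).
have -> : \sum_(i < n) \sum_(j < n) S i j * (a i j + a j i) * (b i j + b j i) =
   \sum_(i < n) \sum_(j < n) f i j + \sum_(i < n) \sum_(j < n) f j i.
  rewrite -big_split; apply: eq_bigr => i _; rewrite -big_split; apply: eq_bigr => j _.
  by rewrite /f /= (Ssym j i); ring.
by rewrite [X in _ + X]exchange_big /=; field.
Qed.

Section Main.
Variables (R : realType) (S : forall n, 'M[R]_n) (beta : graph -> R).
Hypothesis Ssym : forall n i j, S n i j = S n j i.
Hypothesis hbeta : forall T : graph, is_tree T ->
  hom_density T (step_graphon (S n)) @[n --> \oo] --> beta T.

(** Extended by 0 to indices below 2, to be a kernel on all of [nat] as [gaussian_family]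
    expects. *)
Definition limit_kernel k h : R :=
  if (1 < k)%N && (1 < h)%N && (~~ odd k && ~~ odd h) then \sum_(T \in T1 k h) beta (glued_tree T) else 0.

Lemma kernel_n_cvg k h : (1 < k)%N -> (1 < h)%N ->
  kernel_n (S n) k h @[n --> \oo] --> limit_kernel k h.
Proof.
move=> k1 h1; rewrite /limit_kernel k1 h1 /=.
case: (boolP (~~ odd k && ~~ odd h)) => [/andP[ok oh]|]; last first.
  rewrite negb_and !negbK => o; under eq_fun do rewrite kernel_n_odd //; exact: cvg_cst.
have tree T : T1 k h T -> is_tree (glued_tree T).
  have e2 j : ~~ odd j -> j = (2 * j./2)%N by move=> oj; rewrite mul2n -[LHS]odd_double_half (negbTE oj).
  by rewrite (e2 _ ok) (e2 _ oh); exact: T1_is_tree.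
(* [cvg_sum] asks for convergence at every gluing; the guard provides it where the glued graph is
   not a tree. *)
pose f n T := if `[< is_tree (glued_tree T) >] then hom_density (glued_tree T) (step_graphon (S n)) else 0.
pose l T := if `[< is_tree (glued_tree T) >] then beta (glued_tree T) else 0.
have -> : \sum_(T \in T1 k h) beta (glued_tree T) = \sum_(T <- fset_set (T1 k h)) l T.
  rewrite -fsbig_finite; last exact: finite_T1.
  by apply: eq_fsbigr => T; rewrite inE => /tree tT; rewrite /l asboolT.
apply: cvg_trans (_ : (fun n => \sum_(T <- fset_set (T1 k h)) f n T) @ \oo --> _).
  apply: near_eq_cvg; near=> n.
  have n0 : (0 < n)%N by near: n; exact: nbhs_infty_gt.
  rewrite (kernel_n_T1 n0 (@Ssym n)) // -fsbig_finite; last exact: finite_T1.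
  by apply: eq_fsbigr => T; rewrite inE => /tree tT; rewrite /f asboolT.
apply: cvg_sum => T; rewrite /f /l; case: asboolP => tT; [exact: hbeta|exact: cvg_cst].
Unshelve. all: by end_near.
Qed.

(** For each n the form is a sum, with weights [S n i j >= 0], of squares of linear forms in c;
    nonnegativity passes to the limit. *)
Lemma limit_kernel_psd : (forall n i j, 0 <= S n i j) -> psd limit_kernel.
Proof.
move=> S0.
pose Kn n k h := if (1 < k)%N && (1 < h)%N then kernel_n (S n) k h else 0.
have KnE k h : Kn n k h @[n --> \oo] --> limit_kernel k h.
  rewrite /Kn; case: (boolP ((1 < k)%N && (1 < h)%N)) => [/andP[k1 h1]|kh]; first exact: kernel_n_cvg.
  by rewrite /limit_kernel (negbTE kh) /=; exact: cvg_cst.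
split=> [k h|N c].
  apply: (cvg_unique (@Rhausdorff R) (KnE k h)).
  rewrite (_ : (fun n => Kn n k h) = fun n => Kn n h k); first exact: KnE.
  apply/funext => n; rewrite /Kn andbC; case: ifP => // _; congr (_ * _).
  by apply: eq_bigr => i _; apply: eq_bigr => j _; rewrite mulrAC.
have c1 : qform N c (Kn n) @[n --> \oo] --> qform N c limit_kernel.
  by apply: cvg_sum => k; apply: cvg_sum => h; apply: cvgMr.
rewrite -(cvg_lim (@Rhausdorff R) c1); apply: limr_ge; first by apply/cvg_ex; exists (qform N c limit_kernel).
apply: nearW => n; pose g (k : nat) i j := if (1 < k)%N then limit_weight (S n) k i j else 0.
have -> : qform N c (Kn n) = n%:R^-1 ^+ 2 / 2 * \sum_(i < n) \sum_(j < n) S n i j * (\sum_(k < N) c k * g k i j) ^+ 2.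
  have KE k h : Kn n k h = n%:R^-1 ^+ 2 / 2 * \sum_(i < n) \sum_(j < n) S n i j * g k i j * g h i j.
    rewrite /Kn /g; case: ifP => [/andP[-> ->] //|kh].
    rewrite big1 ?mulr0 // => i _; rewrite big1 // => j _.
    by case: ifP kh => k1; case: ifP => h1 kh; rewrite ?mulr0 ?mul0r.
  rewrite /qform; under eq_bigr do under eq_bigr do rewrite KE mulrCA mulr_sumr.
  under eq_bigr do rewrite -mulr_sumr; rewrite -mulr_sumr; congr (_ * _).
  under eq_bigr do rewrite exchange_big /=.
  rewrite exchange_big /=; apply: eq_bigr => i _.
  under eq_bigr do under eq_bigr do rewrite mulr_sumr.
  under eq_bigr do rewrite exchange_big /=.
  rewrite exchange_big /=; apply: eq_bigr => j _.
  rewrite expr2 !mulr_suml mulr_sumr; apply: eq_bigr => k _.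
  rewrite !mulr_sumr; apply: eq_bigr => h _; ring.
rewrite mulr_ge0 ?divr_ge0 ?sqr_ge0 //; apply: sumr_ge0 => i _; apply: sumr_ge0 => j _.
by rewrite mulr_ge0 ?sqr_ge0.
Qed.

End Main.

Theorem theorem3p9 (R : realType)
    (p : nat -> R) (hp : forall n, 0 < p n < 1)
    (hp0 : p n @[n --> \oo] --> (0 : R))
    (hnp : n%:R * p n @[n --> \oo] --> +oo)
    (S : forall n, 'M[R]_n) (C : R) (hC : 0 < C)
    (hSsym : forall n i j, S n i j = S n j i)
    (hSC : forall n i j, 0 <= S n i j <= C)
    (hpS : forall n i j, p n * S n i j <= 1)
    (d : nat -> measure_display) (Om : forall n, measurableType (d n))
    (P : forall n, probability (Om n) R)
    (A : forall n, 'I_n -> 'I_n -> {RV (P n) >-> R})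
    (hA : forall n, inhomogeneous_random_graph (p n) (@A n) (S n))
    (beta : graph -> R)
    (hbeta : forall T : graph, is_tree T ->
       0 <= beta T /\
       hom_density T (step_graphon (S n)) @[n --> \oo] --> beta T) :
  exists (d' : measure_display) (Om' : measurableType d')
         (Q : probability Om' R) (X : nat -> {RV Q >-> R}),
    [/\ gaussian_process [set k | (2 <= k)%N] X,
        forall k, (2 <= k)%N -> ('E_Q[X k] = 0)%E,
        forall k h, (2 <= k)%N -> (2 <= h)%N ->
          covariance Q (X k) (X h) =
            (if ~~ odd k && ~~ odd h
             then \sum_(T \in T1 k h) beta (glued_tree T) else 0)%:E
      & cvg_fdd [set k | (2 <= k)%N] P
          (fun n k => linear_stat (p n) (@A n) k) Q (fun k => X k)].
Proof.
pose K := limit_kernel beta.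
have hb T : is_tree T -> hom_density T (step_graphon (S n)) @[n --> \oo] --> beta T by case/hbeta.
have Kp : psd K.
  by apply: (limit_kernel_psd hSsym hb) => n i j; case/andP: (hSC n i j).
have KE k h : (1 < k)%N -> (1 < h)%N -> kernel_n (S n) k h @[n --> \oo] --> K k h by exact: kernel_n_cvg.
(* The walk estimates are stated for a constant that is at least 1. *)
pose C' := Num.max 1 C.
have C1 : 1 <= C' by rewrite le_max lexx.
have SC' n i j : 0 <= S n i j <= C'.
  by case/andP: (hSC n i j) => -> h /=; rewrite (le_trans h) // le_max lexx orbT.
exists _, _, (uniform_prob (@ltr01 R)), (gaussian_family K); split.
- exact: gaussian_family_process.
- by move=> k _; exact: gaussian_family_mean.
- by move=> k h k1 h1; rewrite gaussian_family_cov // /K /limit_kernel k1 h1.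
move=> m k k1 f fc [M fM].
have q01 n e : 0 <= edge_prob (p n) (S n) e <= 1 by exact: (edge_prob01 (hp n) (@hSC n) (@hpS n)).
pose s n : R := Num.sqrt (n%:R * p n).
pose En n (g : 'rV[R]_m -> R) : R := bE (edge_prob (p n) (S n)) (fun c => g (\row_i fluct (p n) (s n) (S n) (k i) c)).
have -> : (fun n => 'E_(P n)[fun w => f (\row_i linear_stat (p n) (@A n) (k i) w)])%E = (fun n => (En n f)%:E).
  by apply/funext => n; rewrite (expectation_linear_stat (hA n) (@q01 n) k fc fM).
have mX i : measurable_fun setT (gaussian_family K (k i)) by exact: measurable_funP.
have X2 i := gaussian_family_sqr_integrable Kp (k i).
have tf : test_fun (uniform_prob (@ltr01 R)) (fun i => gaussian_family K (k i)) f.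
  exact: (@test_cont_bounded _ _ _ _ _ _ mX _ _ fc fM).
have K0 i : 0 <= K (k i) (k i) by exact: psd_diag.
have Kle i : 2 * K (k i) (k i) + 3 <= \sum_i (2 * K (k i) (k i) + 3).
  rewrite (bigD1 i) //= lerDl sumr_ge0 // => j _; have := K0 j; lra.
have -> : ('E_(uniform_prob (@ltr01 R))[fun w => f (\row_i gaussian_family K (k i) w)%R])%E =
    (Emean (uniform_prob (@ltr01 R)) (fun i => gaussian_family K (k i)) f)%:E by exact: expectation_Rintegral.
apply: cvg_EFin; first exact: nearW.
apply: (@mean_continuity R m (fun _ _ => True) En _ _ (\sum_i (2 * K (k i) (k i) + 3)) f _ (mean_RV mX X2)) => //.
- move=> n; split => //.
  + by move=> a g h _ _; rewrite /En bED bEZ.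
  + by move=> g h _ _ gh; apply: bE_le.
  + exact: bE_cst.
- apply: filter_forall => i.
  have := fluct_sqr hp hp0 hnp C1 hSsym SC' hpS KE (k1 i); apply: filterS => n h.
  by apply: le_trans (Kle i); rewrite /En; under eq_bE do rewrite mxE.
- move=> i; apply: le_trans (Kle i); rewrite /Emean.
  under eq_Rintegral do rewrite mxE.
  by rewrite gaussian_family_sqr //; have := K0 i; lra.
- move=> t y; rewrite /Emean.
  under eq_Rintegral do under eq_bigr do rewrite mxE.
  rewrite gaussian_family_char //.
  have := @fluct_clt _ _ _ _ _ hp hp0 hnp C1 hSsym SC' hpS KE m k t y k1; apply: cvg_trans.
  apply: near_eq_cvg; apply: nearW => n; rewrite /En.
  by apply: eq_bE => w; congr (cos (_ + _)); apply: eq_bigr => i _; rewrite mxE.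
- by exists M.
Qed.
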